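(* Let $f$ and $h$ be distributionally integrable on $[a,b]$ and suppose that $\{g_n\}_{n=1}^\infty$ is a sequence of distributionally integrable functions on $[a,b]$ that satisfies, for every $n$, $$f(x)\ge g_n(x)\ge h(x)\quad\text{almost everywhere.}$$ If $g_n\to g$ almost everywhere, then $g$ is distributionally integrable over $[a,b]$ and $$\lim_{n\to\infty}(\mathfrak{dist})\int_a^bg_n(x)\,dx=(\mathfrak{dist})\int_a^bg(x)\,dx .$$
   Context: Distributions are real. Notation: $\overline{\mathbb R}=\mathbb R\cup\{-\infty,\infty\}$; $\mathcal E'[a,b]$ is the space of distributions on $\mathbb R$ with support contained in $[a,b]$; $\langle \mathsf g(x+ty),\phi(y)\rangle:=|t|^{-1}\langle \mathsf g(y),\phi((y-x)/t)\rangle$ for $t\ne0$. Point values. For $\mathsf g\in\mathcal D'(\mathbb R)$, the distributional (Łojasiewicz) point value $\mathsf g(x_0)$ exists and equals $\gamma\in\mathbb R$ if $\lim_{\varepsilon\to0}\langle \mathsf g(x_0+\varepsilon y),\phi(y)\rangle=\gamma\int_{-\infty}^\infty\phi(y)\,dy$ for every $\phi\in\mathcal D(\mathbb R)$. A Łojasiewicz distribution is one having a point value at every point of $\mathbb R$. Test classes. $\mathcal T_0$: functions $\phi\in C^\infty(\mathbb R)$, $\phi\ge0$, $\int\phi=1$, such that for some $\alpha<-1$, $\phi^{(m)}(x)=O(|x|^{\alpha-m})$ as $|x|\to\infty$ for all $m\ge0$. $\mathcal T_1$: those $\phi\in\mathcal T_0$ with $x\phi'(x)\le0$ for all $x$.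 For $\mathsf g\in\mathcal E'(\mathbb R)$, $\phi\in\mathcal T_0$: $\mathsf g^{+}_{\phi,0}(x)=\limsup_{t\to0^+}\langle \mathsf g(x+ty),\phi(y)\rangle$ and $\mathsf g^{-}_{\phi,0}(x)=\liminf_{t\to0^+}\langle \mathsf g(x+ty),\phi(y)\rangle$. Integral. Let $f:[a,b]\to\overline{\mathbb R}$. A major distributional pair $(\mathsf u,\mathsf U)$ for $f$ consists of $\mathsf u\in\mathcal E'[a,b]$ and a Łojasiewicz distribution $\mathsf U$ with $\mathsf U'=\mathsf u$, $\mathsf U(a)=0$, such that there exist a countable set $E$ and a Lebesgue null set $Z$ with $\mathsf u^-_{\phi,0}(x)\ge f(x)$ for all $x\in[a,b]\setminus Z$, $\phi\in\mathcal T_0$, and $\mathsf u^-_{\phi,0}(x)>-\infty$ for all $x\in[a,b]\setminus E$, $\phi\in\mathcal T_1$. A minor distributional pair $(\mathsf v,\mathsf V)$ for $f$ consists of $\mathsf v\in\mathcal E'[a,b]$ and a Łojasiewicz distribution $\mathsf V$ with $\mathsf V'=\mathsf v$, $\mathsf V(a)=0$, such that there exist a countable set $E$ and a null set $Z$ with $\mathsf v^+_{\phi,0}(x)\le f(x)$ for all $x\in[a,b]\setminus Z$, $\phi\in\mathcal T_0$, and $\mathsf v^+_{\phi,0}(x)<\infty$ for all $x\in[a,b]\setminus E$, $\phi\in\mathcal T_1$. The function $f$ is distributionally integrable over $[a,b]$ if it has both major and minor pairs and $\sup\mathsf V(b)=\inf\mathsf U(b)$ (sup over minor pairs, inf over major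 pairs); the common value is $(\mathfrak{dist})\int_a^bf(x)\,dx$. Integrability and the integral do not change if $f$ is modified on a null set; integrable functions are finite almost everywhere. *)

(* Defs.v *)
From mathcomp Require Import all_boot all_order all_algebra.
From mathcomp Require Import all_classical all_reals all_analysis.
Set Implicit Arguments.
Unset Strict Implicit.
Unset Printing Implicit Defensive.
Import Order.TTheory GRing.Theory Num.Theory.
Import numFieldNormedType.Exports.
Local Open Scope ring_scope.
Local Open Scope classical_set_scope.

Section Distributions.
Context {R : realType}.
Local Notation mu := (@lebesgue_measure R).
Implicit Types (phi psi : R -> R) (K : set R).

Definition smooth phi := forall (n : nat) (x : R), derivable (derive1n n phi) x 1.

Definition supp phi : set R := closure [set x | phi x != 0].

Definition test_function phi := smooth phi /\ compact (supp phi).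

Definition seminorm (N : nat) K phi : R :=
  \sum_(k < N.+1) sup [set `|derive1n k phi x| | x in K].

(* D'(R) and E'(R) are the continuous duals of the real test functions and of
   C^oo(R).  An element is represented by a functional on all of R -> R; its
   values outside the relevant class of functions are irrelevant. *)
Record schwartz_distribution := SchwartzDistribution {
  dist_fun :> (R -> R) -> R;
  dist_linear : forall (c : R) phi psi,
    test_function phi -> test_function psi ->
    dist_fun (fun x => c * phi x + psi x) = c * dist_fun phi + dist_fun psi;
  dist_continuous : forall K, compact K -> exists (C : R) (N : nat),
    forall phi, test_function phi -> supp phi `<=` K ->
      `|dist_fun phi| <= C * seminorm N K phi }.

Record compact_distribution := CompactDistribution {
  cdist_fun :> (R -> R) -> R;
  cdist_linear : forall (c : R) phi psi,
    smooth phi -> smooth psi ->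
    cdist_fun (fun x => c * phi x + psi x) = c * cdist_fun phi + cdist_fun psi;
  cdist_continuous : exists K (C : R) (N : nat), compact K /\
    forall phi, smooth phi -> `|cdist_fun phi| <= C * seminorm N K phi }.

Definition supported_in (u : compact_distribution) K :=
  forall phi, test_function phi -> supp phi `&` K = set0 -> u phi = 0.

Definition has_derivative (U : schwartz_distribution) (u : compact_distribution) :=
  forall phi, test_function phi -> u phi = - U (derive1 phi).

(* <T(x + t y), phi(y)>, for t <> 0 *)
Definition dilated_pairing (T : (R -> R) -> R) (x t : R) phi : R :=
  `|t|^-1 * T (fun y => phi ((y - x) / t)).

Definition has_point_value (U : schwartz_distribution) (x0 gamma : R) :=
  forall phi, test_function phi ->
    dilated_pairing U x0 e phi @[e --> 0^'] -->
      gamma * (\int[mu]_y phi y)%R.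

Definition Lojasiewicz (U : schwartz_distribution) :=
  forall x : R, exists gamma : R, has_point_value U x gamma.

Definition T0 phi :=
  [/\ smooth phi, forall x, 0 <= phi x,
      (\int[mu]_x (phi x)%:E = 1)%E &
      exists2 alpha : R, alpha < -1 &
        forall m : nat, exists C M : R, forall x : R, M < `|x| ->
          `|derive1n m phi x| <= C * `|x| `^ (alpha - m%:R)].

Definition T1 phi := T0 phi /\ forall x, x * derive1 phi x <= 0.

Definition upper_value (u : compact_distribution) phi (x : R) : \bar R :=
  limf_esup (fun t : R => (dilated_pairing u x t phi)%:E) 0^'+.

Definition lower_value (u : compact_distribution) phi (x : R) : \bar R :=
  limf_einf (fun t : R => (dilated_pairing u x t phi)%:E) 0^'+.

(* In everything below, functions on [a, b] are represented by functions on R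
   whose values outside [a, b] are not used. *)
Definition major_pair (a b : R) (f : R -> \bar R)
    (u : compact_distribution) (U : schwartz_distribution) :=
  [/\ supported_in u `[a, b], Lojasiewicz U, has_derivative U u,
      has_point_value U a 0 &
      exists E Z : set R, [/\ countable E, mu.-negligible Z,
        forall x phi, x \in `[a, b] -> ~ Z x -> T0 phi ->
          (f x <= lower_value u phi x)%E &
        forall x phi, x \in `[a, b] -> ~ E x -> T1 phi ->
          (-oo < lower_value u phi x)%E]].

Definition minor_pair (a b : R) (f : R -> \bar R)
    (v : compact_distribution) (V : schwartz_distribution) :=
  [/\ supported_in v `[a, b], Lojasiewicz V, has_derivative V v,
      has_point_value V a 0 &
      exists E Z : set R, [/\ countable E, mu.-negligible Z,
        forall x phi, x \in `[a, b] -> ~ Z x -> T0 phi ->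
          (upper_value v phi x <= f x)%E &
        forall x phi, x \in `[a, b] -> ~ E x -> T1 phi ->
          (upper_value v phi x < +oo)%E]].

Definition major_values (a b : R) (f : R -> \bar R) : set R :=
  [set y | exists u U, major_pair a b f u U /\ has_point_value U b y].

Definition minor_values (a b : R) (f : R -> \bar R) : set R :=
  [set y | exists v V, minor_pair a b f v V /\ has_point_value V b y].

(* The supremum and infimum are taken in \bar R, because sup and inf in R take
   a default value on unbounded sets. *)
Definition dist_integrable (a b : R) (f : R -> \bar R) :=
  [/\ exists u U, major_pair a b f u U,
      exists v V, minor_pair a b f v V &
      ereal_sup (EFin @` minor_values a b f) =
      ereal_inf (EFin @` major_values a b f)].

(* For integrable f the extended real below is finite. *)
Definition dist_integral (a b : R) (f : R -> \bar R) : R :=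
  fine (ereal_sup (EFin @` minor_values a b f)).

End Distributions.
Arguments schwartz_distribution R : clear implicits.
Arguments compact_distribution R : clear implicits.

(* Main.v *)
Require Import Defs.
From HB Require Import structures.
From mathcomp Require Import all_boot all_order all_algebra.
From mathcomp Require Import all_classical all_reals all_analysis.
From mathcomp Require Import measurable_realfun.
From mathcomp Require Import ring lra.
Import Order.TTheory GRing.Theory Num.Theory.
Import numFieldNormedType.Exports.
Local Open Scope ring_scope.
Local Open Scope classical_set_scope.
Set Implicit Arguments.
Unset Strict Implicit.
Unset Printing Implicit Defensive.

(** Two facts reduce the claim to Lebesgue's dominated convergence theorem. If p <= q are
    distributionally integrable, then q - p is Lebesgue integrable ([dist_integrable_diff]); and
    adding a Lebesgue integrable function k to a distributionally integrable one keeps it integrable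
    and adds the Lebesgue integral of k ([dist_integrable_add]). The functions g_n - h lie between 0
    and the Lebesgue integrable f - h, so dominated convergence applies to them, and adding h back
    gives the result.

    The core is [pair_le]: if (u, U) is a major pair for q and (v, V) a minor pair for p, then w = u
    - v is a positive functional. Positivity is read off the Poisson extension F(x, t) of w to the
    upper half-plane ([pext], up to the factor pi). Since the Poisson kernel lies in T1, the pair
    conditions say that F has lower limit at least 0 as t -> 0+ over almost every x in [a, b], and
    is bounded below for small t over all but countably many x. Since primitives have point values,
    t F(x, t) -> 0 over every x ([pext_dil_vanishing]). Adding a small multiple of a measure with
    infinite density on the null set and atoms on the countable set makes F nonnegative for small t
    over every point of [a, b] ([nonneg_of_extension]).

    It remains that bounds F(x, t) >= - C t, with C and the range of t depending on x, force
    positivity ([locally_pos_everywhere]). By Baire, the bound is uniform on a portion of the set of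
    points near which positivity fails. Over the complementary gaps a minimum principle on
    rectangles ([pext_strip]) carries the bound from the sides to the inside. At the corners the
    growth of F is controlled by uniform boundedness of dilations ([dil_vanishing_bounded]), a
    dyadic decomposition ([dyadic_bound]) and a harmonic barrier ([pext_corner]). A uniform bound
    then gives positivity by approximating test functions by their Poisson integrals
    ([pos_on_of_pext]).

    Once w is positive, Fatou's lemma shows that the lower boundary limit of F has integral at most
    w(1) ([integral_pdensity_le]), and w(1) = U(b) - V(b) ([point_value_total]). Pairs with small
    gaps for p and for q then squeeze q - p between integrable functions. Conversely, an integrable
    k gets a majorant of almost the same integral that dominates continuous approximations of k
    ([vitali_majorant]); adding its density to a major pair perturbs the pair by k ([major_add]). *)

(** * Calculus of smooth functions on the line *)

Section Smooth.
Context {R : realType}.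
Implicit Types (f g phi psi : R -> R) (x y t h : R).

(* [smooth] wrapped in an inductive type, so that comparing two smoothness
   statements does not unfold the functions involved again and again. *)
Inductive Cinf f : Prop := CinfI of smooth f.

Lemma CinfE f : Cinf f -> smooth f. Proof. by case. Qed.

(** The error in the difference quotient is at most [B * |h|]. This criterion is used where no
    differentiation rule applies: at the flat point of [pexp], for limits of sequences, under a
    functional and under an integral. *)
Lemma is_derive_quad f x l (B e : R) : 0 < e ->
  (forall h, `|h| < e -> `|f (x + h) - f x - h * l| <= B * h ^+ 2) ->
  is_derive x 1 f l.
Proof.
move=> e0 H.
have cvgl : h^-1 *: (f (h *: 1 + x) - f x) @[h --> 0^'] --> l.
  apply/cvgrPdist_le => eps eps0; near=> h.
  have h0 : h != 0 by near: h; exact: nbhs_dnbhs_neq.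
  have he : `|h| < e.
    near: h; apply: dnbhs0_lt; exact: e0.
  have hB : (`|B| + 1) * `|h| <= eps.
    rewrite -ler_pdivlMl ?ltr_wpDl//.
    near: h; apply: dnbhs0_le; rewrite mulr_gt0// invr_gt0 ltr_wpDl//.
  have := H _ he.
  rewrite /= scaler1 (addrC h) -[_ *: _]/(h^-1 * _) => Hh.
  rewrite distrC -(ler_pM2l (x := `|h|)) ?normr_gt0// -normrM mulrBr mulVKf//.
  apply: (le_trans Hh); apply: le_trans (ler_wpM2l (normr_ge0 h) hB).
  have -> : `|h| * ((`|B| + 1) * `|h|) = (`|B| + 1) * h ^+ 2.
    by rewrite -(@real_normK _ h) ?num_real//; ring.
  by rewrite ler_wpM2r ?sqr_ge0// (le_trans (ler_norm _))// lerDl.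
apply: DeriveDef; last by apply/cvg_lim => //; exact: cvgl.
by apply/cvg_ex; exists l.
Unshelve. all: end_near. Qed.

Lemma derivable_is_derive f x : derivable f x 1 -> is_derive x 1 f (derive1 f x).
Proof. by move=> /derivableP; rewrite derive1E. Qed.

Lemma is_derive_derive1 f x l : is_derive x 1 f l -> derive1 f x = l.
Proof. by move=> [_ <-]; rewrite derive1E. Qed.

Lemma is_deriveDr f g x a b : is_derive x 1 f a -> is_derive x 1 g b ->
  is_derive x 1 (fun y => f y + g y) (a + b).
Proof. by move=> ? ?; exact: (@is_deriveD _ _ _ f g). Qed.

Lemma is_deriveBr f g x a b : is_derive x 1 f a -> is_derive x 1 g b ->
  is_derive x 1 (fun y => f y - g y) (a - b).
Proof. by move=> ? ?; exact: (@is_deriveB _ _ _ f g). Qed.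

Lemma is_deriveNr f x a : is_derive x 1 f a -> is_derive x 1 (fun y => - f y) (- a).
Proof. by move=> ?; exact: (@is_deriveN _ _ _ f). Qed.

Lemma is_deriveMr f g x a b : is_derive x 1 f a -> is_derive x 1 g b ->
  is_derive x 1 (fun y => f y * g y) (f x * b + g x * a).
Proof. by move=> ? ?; exact: (@is_deriveM _ _ f g). Qed.

Lemma is_deriveZr c f x a : is_derive x 1 f a -> is_derive x 1 (fun y => c * f y) (c * a).
Proof. by move=> ?; exact: (@is_deriveZ _ _ _ f c). Qed.

Lemma is_derive_cstr c x : is_derive x 1 (fun=> c : R) 0.
Proof. exact: is_derive_cst. Qed.

Lemma is_derive_idr x : is_derive x 1 (fun y : R => y) 1.
Proof. exact: is_derive_id. Qed.

Lemma is_derive_linr c f g x a b : is_derive x 1 f a -> is_derive x 1 g b ->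
  is_derive x 1 (fun y => c * f y + g y) (c * a + b).
Proof. by move=> ? ?; apply: is_deriveDr => //; exact: is_deriveZr. Qed.

Lemma smooth_is_derive n f x : Cinf f ->
  is_derive x 1 (derive1n n f) (derive1n n.+1 f x).
Proof. by move=> [sf]; rewrite derive1nS; exact: derivable_is_derive (sf n x). Qed.

Lemma smooth_is_derive0 f x : Cinf f -> is_derive x 1 f (derive1 f x).
Proof. by move=> /(smooth_is_derive 0 x). Qed.

Lemma smooth_continuous f : Cinf f -> continuous f.
Proof.
by move=> [sf] x; apply: differentiable_continuous; apply/derivable1_diffP; exact: (sf 0%N).
Qed.

Lemma smooth_derive1n n f : Cinf f -> Cinf (derive1n n f).
Proof. by move=> [sf]; split=> m x; rewrite /derive1n -iterD; exact: sf. Qed.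

Lemma smooth_derive1 f : Cinf f -> Cinf (derive1 f).
Proof. exact: (@smooth_derive1n 1). Qed.

Lemma derive1n_comp m n f : derive1n m (derive1n n f) = derive1n (m + n) f.
Proof. by rewrite /derive1n iterD. Qed.

(** A chain in which each function is the derivative of the previous one exhibits all iterated
    derivatives at once; explicit derivative formulas below are proved by naming such a chain. *)
Lemma smooth_family (F : nat -> R -> R) :
  (forall k x, is_derive x 1 (F k) (F k.+1 x)) ->
  Cinf (F 0%N) /\ forall k, derive1n k (F 0%N) = F k.
Proof.
move=> H.
have E k : derive1n k (F 0%N) = F k.
  elim: k => // k IH; rewrite derive1nS IH.
  by apply/funext => x; apply: is_derive_derive1.
by split => //; split => k x; rewrite E; have [] := H k x.
Qed.

(** Differentiability to finite order, recursive on the first derivative, so that closure under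
    products, composition and inverses goes by induction on the order; [ndiffP] returns to
    [Cinf]. *)
Fixpoint ndiff (n : nat) f : Prop :=
  (forall x, derivable f x 1) /\ if n is m.+1 then ndiff m (derive1 f) else True.

Lemma ndiffS n f : ndiff n.+1 f -> ndiff n f.
Proof. by elim: n f => [|n IH] f [H1 H2]; split => //; exact: IH. Qed.

Lemma ndiffP f : Cinf f <-> forall n, ndiff n f.
Proof.
split=> [sf n|H].
  elim: n f sf => [|n IH] f sf /=; split => //; try by case: sf => sf; exact: (sf 0%N).
  exact/IH/smooth_derive1.
split=> n x.
elim: n f H => [|n IH] f H; first by case: (H 0%N).
by rewrite derive1Sn; apply: IH => m; case: (H m.+1).
Qed.

Lemma ndiff_ext n f g : (forall x, f x = g x) -> ndiff n f -> ndiff n g.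
Proof. by move=> /funext ->. Qed.

Lemma is_derive_ndiff n f g : (forall x, is_derive x 1 f (g x)) -> ndiff n g ->
  ndiff n.+1 f.
Proof.
move=> H; split; first by move=> x; have [] := H x.
suff -> : derive1 f = g by [].
by apply/funext => x; apply: is_derive_derive1.
Qed.

Lemma ndiff_is_derive n f x : ndiff n f -> is_derive x 1 f (derive1 f x).
Proof. by move=> H; apply: derivable_is_derive; case: n H => [|n] []. Qed.

Lemma ndiff_lin n c f g : ndiff n f -> ndiff n g -> ndiff n (fun x => c * f x + g x).
Proof.
elim: n f g => [|n IH] f g Hf Hg.
  split=> // x.
  by have [] := is_derive_linr c (ndiff_is_derive x Hf) (ndiff_is_derive x Hg).
apply: (@is_derive_ndiff _ _ (fun x => c * derive1 f x + derive1 g x)) => [x|].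
  exact: is_derive_linr (ndiff_is_derive x Hf) (ndiff_is_derive x Hg).
by apply: IH; [case: Hf|case: Hg].
Qed.

Lemma ndiff_cst n (c : R) : ndiff n (fun=> c).
Proof.
elim: n c => [|n IH] c; first by split => // x; exact: derivable_cst.
by apply: (@is_derive_ndiff _ _ (fun=> 0)).
Qed.

Lemma ndiffM n f g : ndiff n f -> ndiff n g -> ndiff n (fun x => f x * g x).
Proof.
elim: n f g => [|n IH] f g Hf Hg.
  by split=> // x; have [] := is_deriveMr (ndiff_is_derive x Hf) (ndiff_is_derive x Hg).
(* The factor 1 puts the product rule in the shape that [ndiff_lin] expects. *)
apply: (@is_derive_ndiff _ _ (fun x => 1 * (f x * derive1 g x) + g x * derive1 f x)) => [x|].
  rewrite mul1r; exact: is_deriveMr (ndiff_is_derive x Hf) (ndiff_is_derive x Hg).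
by apply: ndiff_lin; apply: IH; try exact: ndiffS; [case: Hg|case: Hf].
Qed.

Lemma ndiff_comp n f g : ndiff n f -> ndiff n g -> ndiff n (fun x => f (g x)).
Proof.
elim: n f g => [|n IH] f g Hf Hg.
  split=> // x; have a := ndiff_is_derive (g x) Hf; have b := ndiff_is_derive x Hg.
  by have [] := is_derive1_comp a b.
apply: (@is_derive_ndiff _ _ (fun x => derive1 f (g x) * derive1 g x)) => [x|].
  have a := ndiff_is_derive (g x) Hf; have b := ndiff_is_derive x Hg.
  exact: is_derive1_comp.
by apply: ndiffM; [apply: IH; [case: Hf|exact: ndiffS]|case: Hg].
Qed.

Lemma ndiffV n f : (forall x, f x != 0) -> ndiff n f -> ndiff n (fun x => (f x)^-1).
Proof.
move=> f0; elim: n f f0 => [|n IH] f f0 Hf.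
  by split=> // x; have a := ndiff_is_derive x Hf; have [] := is_deriveV (f0 x) a.
apply: (@is_derive_ndiff _ _ (fun x => - 1 * (((f x)^-1 * (f x)^-1) * derive1 f x) + 0)) => [x|].
  have a := ndiff_is_derive x Hf.
  have b := is_deriveV (f0 x) a; apply: (is_derive_eq b).
  by rewrite -[_ *: _]/(_ * _) addr0 -exprVn expr2 mulN1r mulNr.
apply: ndiff_lin; last exact: ndiff_cst.
have HV := IH _ f0 (ndiffS Hf).
by apply: ndiffM; [exact: ndiffM|case: Hf].
Qed.

Lemma smooth_lin c f g : Cinf f -> Cinf g -> Cinf (fun x => c * f x + g x).
Proof. by move=> /ndiffP sf /ndiffP sg; apply/ndiffP => n; exact: ndiff_lin. Qed.

Lemma smooth_cst (c : R) : Cinf (fun=> c : R).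
Proof. by apply/ndiffP => n; exact: ndiff_cst. Qed.

Lemma smooth_id : Cinf (fun x : R => x).
Proof.
apply/ndiffP => -[|n]; first by split => // x; exact: derivable_id.
by apply: (@is_derive_ndiff _ _ (fun=> 1)); last exact: ndiff_cst.
Qed.

Lemma smoothM f g : Cinf f -> Cinf g -> Cinf (fun x => f x * g x).
Proof. by move=> /ndiffP sf /ndiffP sg; apply/ndiffP => n; exact: ndiffM. Qed.

Lemma smooth_comp f g : Cinf f -> Cinf g -> Cinf (fun x => f (g x)).
Proof. by move=> /ndiffP sf /ndiffP sg; apply/ndiffP => n; exact: ndiff_comp. Qed.

Lemma smoothV f : (forall x, f x != 0) -> Cinf f -> Cinf (fun x => (f x)^-1).
Proof. by move=> f0 /ndiffP sf; apply/ndiffP => n; exact: ndiffV. Qed.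

Lemma smoothZ c f : Cinf f -> Cinf (fun x => c * f x).
Proof. by move=> sf; apply: smoothM => //; exact: smooth_cst. Qed.

Lemma smoothD f g : Cinf f -> Cinf g -> Cinf (fun x => f x + g x).
Proof.
move=> sf sg; have := smooth_lin 1 sf sg.
by congr Cinf; apply/funext => x; rewrite mul1r.
Qed.

Lemma smoothB f g : Cinf f -> Cinf g -> Cinf (fun x => f x - g x).
Proof.
move=> sf sg; have := smooth_lin (-1) sg sf.
by congr Cinf; apply/funext => x; rewrite mulN1r addrC.
Qed.

Lemma smooth_affine f (c t : R) : Cinf f -> Cinf (fun x => f ((x - c) / t)).
Proof.
move=> sf; apply: smooth_comp => //; apply: smoothM; last exact: smooth_cst.
by apply: smoothB; [exact: smooth_id|exact: smooth_cst].
Qed.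

Lemma derive1n_lin n c f g : Cinf f -> Cinf g ->
  derive1n n (fun x => c * f x + g x) = fun x => c * derive1n n f x + derive1n n g x.
Proof.
move=> sf sg; pose F k x := c * derive1n k f x + derive1n k g x.
have [//|_ ->//] := @smooth_family F.
move=> k x; exact: is_derive_linr (smooth_is_derive k x sf) (smooth_is_derive k x sg).
Qed.

Lemma derive1nD n f g : Cinf f -> Cinf g ->
  derive1n n (fun x => f x + g x) = fun x => derive1n n f x + derive1n n g x.
Proof.
move=> sf sg; have := derive1n_lin n 1 sf sg.
by under eq_fun do rewrite mul1r; under [X in _ = X -> _]eq_fun do rewrite mul1r.
Qed.

Lemma derive1n_cst n (c : R) : derive1n n.+1 (fun=> c) = fun=> 0 :> R.
Proof.
pose F k (x : R) : R := if k is 0%N then c else 0.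
have H k x : is_derive x 1 (F k) (F k.+1 x) by case: k => [|k] /=; exact: is_derive_cst.
by have [_ E] := smooth_family H; exact: E n.+1.
Qed.

Lemma derive1nZ n c f : Cinf f ->
  derive1n n (fun x => c * f x) = fun x => c * derive1n n f x.
Proof.
move=> sf; pose F k x := c * derive1n k f x.
have [//|_ ->//] := @smooth_family F.
by move=> k x; exact: is_deriveZr (smooth_is_derive k x sf).
Qed.

Lemma derive1nB n f g : Cinf f -> Cinf g ->
  derive1n n (fun x => f x - g x) = fun x => derive1n n f x - derive1n n g x.
Proof.
move=> sf sg; have := derive1n_lin n (-1) sg sf.
by under eq_fun do rewrite mulN1r addrC; under [X in _ = X -> _]eq_fun do rewrite mulN1r addrC.
Qed.

Lemma is_derive_affine f (c t x l : R) : is_derive ((x - c) / t) 1 f l ->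
  is_derive x 1 (fun x => f ((x - c) / t)) (t^-1 * l).
Proof.
move=> H.
have : is_derive x 1 (fun x => t^-1 * x + - (t^-1 * c)) (t^-1).
  have a := is_deriveDr (is_deriveZr t^-1 (is_derive_idr x)) (is_derive_cstr (- (t^-1 * c)) x).
  apply: (is_derive_eq a).
  by rewrite mulr1 addr0.
have E : (fun x => t^-1 * x + - (t^-1 * c)) = (fun x => (x - c) / t).
  by apply/funext => z; rewrite mulrBl ![_ / t]mulrC.
rewrite E => H2; rewrite mulrC.
exact: (@is_derive1_comp _ f (fun x => (x - c) / t)).
Qed.

Lemma derive1n_affine n f (c t : R) : Cinf f ->
  derive1n n (fun x => f ((x - c) / t)) = fun x => t^-1 ^+ n * derive1n n f ((x - c) / t).
Proof.
move=> sf; pose F k x := t^-1 ^+ k * derive1n k f ((x - c) / t).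
have H k x : is_derive x 1 (F k) (F k.+1 x).
  have b := is_derive_affine (smooth_is_derive k ((x - c) / t) sf).
  apply: (is_derive_eq (is_deriveZr (t^-1 ^+ k) b)).
  by rewrite /F exprSr mulrA.
have [_ E] := smooth_family H.
rewrite -[RHS]/(F n) -E; congr (derive1n n _).
by apply/funext => x; rewrite /F mul1r.
Qed.

Lemma derive1n_eq_near (f g : R -> R) (x : R) n : (\forall y \near x, f y = g y) ->
  \forall y \near x, derive1n n f y = derive1n n g y.
Proof.
elim: n => // n IH /IH H; near=> y.
have Hy : \forall z \near y, derive1n n f z = derive1n n g z.
  by near: y; exact: (nbhs_interior H).
rewrite !derive1nS !derive1E; apply: near_eq_derive => //.
Unshelve. all: end_near. Qed.

Lemma derive1n_eq_nearx (f g : R -> R) (x : R) n : (\forall y \near x, f y = g y) ->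
  derive1n n f x = derive1n n g x.
Proof. by move=> /(derive1n_eq_near n)/nbhs_singleton. Qed.

(** A crude Leibniz rule: each differentiation of the product doubles the number of terms, whence
    [2 ^+ n]. The weights [r ^+ k], with 1/r the length scale of the functions, simply multiply. *)
Lemma derive1nM_bound n f g x (A B r : R) : Cinf f -> Cinf g -> 0 <= r ->
  (forall k, (k <= n)%N -> `|derive1n k f x| <= A * r ^+ k) ->
  (forall k, (k <= n)%N -> `|derive1n k g x| <= B * r ^+ k) ->
  `|derive1n n (fun y => f y * g y) x| <= 2 ^+ n * (A * B) * r ^+ n.
Proof.
elim: n f g A B => [|n IH] f g A B sf sg r0 Hf Hg.
  rewrite !expr0 mulr1 mul1r /= normrM.
  by have := Hf 0%N isT; have := Hg 0%N isT; rewrite !mulr1 => ? ?; rewrite ler_pM.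
have A0 : 0 <= A by have := Hf 0%N isT; rewrite mulr1; apply: le_trans.
have B0 : 0 <= B by have := Hg 0%N isT; rewrite mulr1; apply: le_trans.
have -> : derive1n n.+1 (fun y => f y * g y) x =
  derive1n n (fun y => f y * derive1 g y) x + derive1n n (fun y => derive1 f y * g y) x.
  rewrite derive1Sn.
  have -> : derive1 (fun y => f y * g y) = fun y => f y * derive1 g y + derive1 f y * g y.
    apply/funext => y; apply: is_derive_derive1.
    have a := smooth_is_derive0 y sf; have b := smooth_is_derive0 y sg.
    by rewrite [derive1 f y * _]mulrC; exact: is_deriveMr.
  by rewrite derive1nD//; apply: smoothM => //; exact: smooth_derive1.
apply: le_trans (ler_normD _ _) _.
have H1 : `|derive1n n (fun y => f y * derive1 g y) x| <= 2 ^+ n * (A * (B * r)) * r ^+ n.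
  apply: IH => //; first exact: smooth_derive1.
    by move=> k kn; apply: Hf; exact: leqW.
  by move=> k kn; rewrite -derive1Sn -mulrA -exprS; exact: Hg.
have H2 : `|derive1n n (fun y => derive1 f y * g y) x| <= 2 ^+ n * (A * r * B) * r ^+ n.
  apply: IH => //; first exact: smooth_derive1.
    by move=> k kn; rewrite -derive1Sn -mulrA -exprS; exact: Hf.
  by move=> k kn; apply: Hg; exact: leqW.
apply: le_trans (lerD H1 H2) _.
by rewrite [X in _ <= X](_ : _ = 2 ^+ n * (A * (B * r)) * r ^+ n + 2 ^+ n * (A * r * B) * r ^+ n)// !exprS; ring.
Qed.

(* Second-order Taylor bound, with a constant twice the optimal one. *)
Lemma taylor2 (f f1 f2 : R -> R) (x e B : R) :
  (forall y, `|y - x| < e -> is_derive y 1 f (f1 y)) ->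
  (forall y, `|y - x| < e -> is_derive y 1 f1 (f2 y)) ->
  (forall y, `|y - x| < e -> `|f2 y| <= B) ->
  forall h, `|h| < e -> `|f (x + h) - f x - h * f1 x| <= B * h ^+ 2.
Proof.
move=> d1 d2 b2.
have mv (g dg : R -> R) (C : R) h : `|h| < e ->
    (forall y, `|y - x| <= `|h| -> is_derive y 1 g (dg y)) ->
    (forall y, `|y - x| <= `|h| -> `|dg y| <= C) ->
    `|g (x + h) - g x| <= C * `|h|.
  move=> he dgd bg.
  have [h0|h0] := leP 0 h.
    have [] := @MVT_segment _ g dg x (x + h); first by rewrite lerDl.
    - move=> y; rewrite in_itv /= => /andP[y1 y2]; apply: dgd.
      by rewrite !ger0_norm//; lra.
    - apply: derivable_within_continuous => y; rewrite in_itv /= => /andP[y1 y2].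
      have [] : is_derive y 1 g (dg y) by apply: dgd; rewrite !ger0_norm//; lra.
      by [].
    move=> c; rewrite in_itv /= => /andP[c1 c2] ->.
    rewrite normrM addrAC subrr add0r ler_wpM2r// bg//.
    by rewrite !ger0_norm//; lra.
  have [] := @MVT_segment _ g dg (x + h) x; first by lra.
  - move=> y; rewrite in_itv /= => /andP[y1 y2]; apply: dgd.
    by rewrite !ler0_norm//; lra.
  - apply: derivable_within_continuous => y; rewrite in_itv /= => /andP[y1 y2].
    have [] : is_derive y 1 g (dg y) by apply: dgd; rewrite !ler0_norm//; lra.
    by [].
  move=> c; rewrite in_itv /= => /andP[c1 c2] E.
  rewrite distrC E normrM opprD addrA subrr add0r normrN ler_wpM2r// bg//.
  by rewrite !ler0_norm//; lra.
move=> h he.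
(* The mean value inequality is applied to f minus its tangent at x, whose derivative [f1 y - f1 x]
   is bounded by the same inequality for f1. *)
have -> : f (x + h) - f x - h * f1 x =
   (fun y => f y - (y - x) * f1 x) (x + h) - (fun y => f y - (y - x) * f1 x) x.
  by rewrite /=; ring.
have B0 : 0 <= B by apply: le_trans (b2 x _) => //; rewrite subrr normr0 (le_lt_trans _ he).
rewrite -[h ^+ 2](@real_normK _ h) ?num_real// expr2 mulrA.
apply: (mv (fun y => f y - (y - x) * f1 x) (fun y => f1 y - f1 x) _ _ he) => y yh.
  have a := d1 y (le_lt_trans yh he).
  have i : is_derive y 1 (fun z => z - x) 1.
    by rewrite -[X in is_derive _ _ _ X]subr0; apply: is_deriveBr.
  apply: (is_derive_eq (is_deriveBr a (is_deriveMr i (is_derive_cstr (f1 x) y)))).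
  by rewrite mulr0 add0r mulr1.
have -> : y = x + (y - x) by rewrite addrC subrK.
apply: le_trans (_ : B * `|y - x| <= _); last by rewrite ler_wpM2l.
apply: (mv f1 f2 _ _ (le_lt_trans yh he)) => z zy.
  by apply: d2; exact: le_lt_trans (le_trans zy yh) he.
by apply: b2; exact: le_lt_trans (le_trans zy yh) he.
Qed.

End Smooth.

Arguments smooth_cst {R} c.
Arguments smooth_id {R}.
Arguments smooth_lin {R} c [f g] _ _.
Arguments smoothZ {R} c [f] _.
Arguments smooth_affine {R} [f] c t _.
Arguments smooth_derive1n {R} n [f] _.
Arguments smooth_is_derive {R} n [f] x _.
Arguments smooth_is_derive0 {R} [f] x _.
Arguments is_deriveZr {R} c [f x a] _.

(** * Smooth step and plateau functions *)

Section Step.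
Context {R : realType}.
Implicit Types (f g : R -> R) (x y t h : R).

Lemma is_derive_near_eq f g x l : (\forall y \near x, f y = g y) ->
  is_derive x 1 f l -> is_derive x 1 g l.
Proof. by move=> fg; apply: near_eq_is_derive => //; exact: oner_neq0. Qed.

Lemma is_derive_exprn n x : is_derive x 1 (fun y : R => y ^+ n) (n%:R * x ^+ n.-1).
Proof.
case: n => [|n] /=.
  by rewrite mul0r; under eq_fun do rewrite expr0; exact: is_derive_cstr.
apply: DeriveDef; first exact: exprn_derivable.
by rewrite exp_derive -[_ *: 1]/(_ * 1) mulr1.
Qed.

(** The derivative of each member is a linear combination of later members of the family, so
    smoothness of exp(- 1 / x), extended by 0, is an induction over all n at once. *)
Definition pexp n x : R := if 0 < x then x^-1 ^+ n * expR (- x^-1) else 0.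

Lemma pexp_ge0 n x : 0 <= pexp n x.
Proof.
rewrite /pexp; case: ifP => // x0.
by rewrite mulr_ge0// ?expR_ge0// exprn_ge0// invr_ge0 ltW.
Qed.

Lemma is_derive_pexp n x : is_derive x 1 (pexp n) (pexp n.+2 x - n%:R * pexp n.+1 x).
Proof.
have [x0|x0|x0] := ltgtP 0 x.
- apply: (@is_derive_near_eq (fun y => y^-1 ^+ n * expR (- y^-1))).
    by near=> y; rewrite /pexp ifT//; near: y; exact: lt_nbhsr.
  have d1 : is_derive x 1 (fun y => y^-1) (- x ^- 2).
    have a := is_deriveV (lt0r_neq0 x0) (is_derive_idr x).
    by apply: (is_derive_eq a); rewrite -[LHS]/(_ * 1) mulr1.
  have d2 : is_derive x^-1 1 (fun z => z ^+ n * expR (- z))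
      (x^-1 ^+ n * (expR (- x^-1) * - 1) + expR (- x^-1) * (n%:R * x^-1 ^+ n.-1)).
    have b := is_derive_expR (- x^-1).
    have c := @is_derive1_comp _ expR (fun z => - z) _ _ _ b (is_deriveNr (is_derive_idr x^-1)).
    exact: is_deriveMr (is_derive_exprn n x^-1) c.
  have a := @is_derive1_comp _ _ (fun y => y^-1) x _ _ d2 d1.
  apply: (is_derive_eq a).
  rewrite /pexp x0 -exprVn.
  by case: n {d2 a} => [|n] /=; rewrite ?exprS; ring.
- have -> : pexp n.+2 x - n%:R * pexp n.+1 x = 0.
    by rewrite /pexp ltNge (ltW x0) /= mulr0 subr0.
  apply: (is_derive_near_eq _ (is_derive_cstr 0 x)).
  near=> y; rewrite /pexp ifF//; apply/negbTE; rewrite -leNgt ltW//.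
  by near: y; exact: lt_nbhsl.
- have -> : pexp n.+2 x - n%:R * pexp n.+1 x = 0.
    by rewrite /pexp -x0 ltxx mulr0 subr0.
  have cB : 0 <= (n.+2)`!%:R :> R by [].
  apply: (@is_derive_quad _ _ _ _ (n.+2)`!%:R 1) => // h _.
  rewrite mulr0 subr0 -x0 add0r {2}/pexp ltxx subr0 ger0_norm ?pexp_ge0//.
  rewrite /pexp; case: ifPn => h0; last by rewrite mulr_ge0// sqr_ge0.
  (* At the origin the exponential dominates one term of its series: exp(1 / h) >= h ^ (- n - 2) /
     (n + 2)!, so [pexp n h] is at most (n + 2)! h ^ 2. *)
  have := @expR_ge1Dxn _ h^-1 n.+1; rewrite invr_ge0 (ltW h0) => /(_ isT) H.
  rewrite expRN ler_pdivrMr ?expR_gt0//.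
  have -> : h^-1 ^+ n = h^-1 ^+ n.+2 * h ^+ 2.
    by rewrite -addn2 exprD -mulrA -exprMn mulVf ?gt_eqF// expr1n mulr1.
  rewrite [X in _ <= X]mulrAC ler_wpM2r ?sqr_ge0// mulrC -ler_pdivrMr ?ltr0n ?fact_gt0//.
  by apply: le_trans H; rewrite lerDr.
Unshelve. all: end_near. Qed.

Lemma smooth_pexp n : Cinf (pexp n).
Proof.
apply/ndiffP => N; elim: N n => [|N IH] n.
  by split => // x; have [] := is_derive_pexp n x.
apply: (@is_derive_ndiff _ _ _ (fun x => - n%:R * pexp n.+1 x + pexp n.+2 x)) => [x|].
  by apply: (is_derive_eq (is_derive_pexp n x)); rewrite mulNr addrC.
exact: ndiff_lin.
Qed.

Definition step_fun x : R := pexp 0 x / (pexp 0 x + pexp 0 (1 - x)).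

Let pexp0_gt0 x : 0 < x -> 0 < pexp 0 x.
Proof. by move=> x0; rewrite /pexp x0 mul1r expR_gt0. Qed.

Let step_den x : 0 < pexp 0 x + pexp 0 (1 - x).
Proof.
have [x0|x0] := ltP 0 x; first by rewrite ltr_wpDr ?pexp_ge0// pexp0_gt0.
by rewrite ltr_wpDl ?pexp_ge0// pexp0_gt0// subr_gt0 (le_lt_trans x0).
Qed.

Lemma step_exists : exists S : R -> R, [/\ Cinf S, forall x, 0 <= S x,
  forall x, S x <= 1, forall x, x <= 0 -> S x = 0 & forall x, 1 <= x -> S x = 1].
Proof.
exists step_fun; split.
- apply: smoothM; first exact: smooth_pexp.
  apply: smoothV; first by move=> x; rewrite gt_eqF.
  apply: smoothD; first exact: smooth_pexp.
  apply: smooth_comp; first exact: smooth_pexp.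
  by apply: smoothB; [exact: smooth_cst|exact: smooth_id].
- by move=> x; rewrite divr_ge0 ?pexp_ge0// ltW.
- by move=> x; rewrite ler_pdivrMr// mul1r lerDl pexp_ge0.
- by move=> x x0; rewrite /step_fun {1}/pexp ltNge x0 mul0r.
- move=> x x1; rewrite /step_fun [pexp 0 (1 - x)]/pexp subr_gt0 ltNge x1 /= addr0 divff//.
  by rewrite gt_eqF// pexp0_gt0// (lt_le_trans _ x1).
Qed.

(* Choosing a witness keeps conversion from unfolding the explicit formula. *)
Definition step : R -> R := sval (cid step_exists).

Lemma smooth_step : Cinf step.
Proof. by have [] := svalP (cid step_exists). Qed.

Lemma step_ge0 x : 0 <= step x.
Proof. by have [_ H _ _ _] := svalP (cid step_exists); exact: H. Qed.

Lemma step_le1 x : step x <= 1.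
Proof. by have [_ _ H _ _] := svalP (cid step_exists); exact: H. Qed.

Lemma step0 x : x <= 0 -> step x = 0.
Proof. by have [_ _ _ H _] := svalP (cid step_exists); exact: H. Qed.

Lemma step1 x : 1 <= x -> step x = 1.
Proof. by have [_ _ _ _ H] := svalP (cid step_exists); exact: H. Qed.

Lemma plateau_exists : exists P : R -> R, [/\ Cinf P, forall x, 0 <= P x,
  forall x, P x <= 1, forall x, `|x| <= 1 -> P x = 1 & forall x, 2 <= `|x| -> P x = 0].
Proof.
exists (fun x => step (x + 2) * step (2 - x)); split.
- apply: smoothM; apply: smooth_comp; try exact: smooth_step.
    by apply: smoothD; [exact: smooth_id|exact: smooth_cst].
  by apply: smoothB; [exact: smooth_cst|exact: smooth_id].
- by move=> x; rewrite mulr_ge0 ?step_ge0.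
- by move=> x; rewrite mulr_ile1 ?step_ge0 ?step_le1.
- by move=> x; rewrite ler_norml => /andP[? ?]; rewrite !step1 ?mulr1//; lra.
- move=> x; rewrite ler_normr => /orP[] H.
    by rewrite [step (2 - x)]step0 ?mulr0//; lra.
  by rewrite step0 ?mul0r//; lra.
Qed.

Definition plateau : R -> R := sval (cid plateau_exists).

Lemma smooth_plateau : Cinf plateau.
Proof. by have [] := svalP (cid plateau_exists). Qed.

Lemma plateau_ge0 x : 0 <= plateau x.
Proof. by have [_ H _ _ _] := svalP (cid plateau_exists); exact: H. Qed.

Lemma plateau_le1 x : plateau x <= 1.
Proof. by have [_ _ H _ _] := svalP (cid plateau_exists); exact: H. Qed.

Lemma plateau1 x : `|x| <= 1 -> plateau x = 1.
Proof. by have [_ _ _ H _] := svalP (cid plateau_exists); exact: H. Qed.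

Lemma plateau0 x : 2 <= `|x| -> plateau x = 0.
Proof. by have [_ _ _ _ H] := svalP (cid plateau_exists); exact: H. Qed.

End Step.

(** * Functionals of compact support *)

Section Supports.
Context {R : realType}.
Implicit Types (f g : R -> R) (x y t h : R) (p : (R -> R) -> R).

Lemma near_norm_gt x (M : R) : M < `|x| -> \forall y \near x, M < `|y|.
Proof. by have H := @norm_continuous R R x; exact: (@cvgr_gt R R (nbhs x) _ (fun z => `|z|) _ H). Qed.

Lemma near_norm_lt x (M : R) : `|x| < M -> \forall y \near x, `|y| < M.
Proof. by have H := @norm_continuous R R x; exact: (@cvgr_lt R R (nbhs x) _ (fun z => `|z|) _ H). Qed.

Lemma derive1n_near0 n f x : (\forall y \near x, f y = 0) -> derive1n n f x = 0.
Proof.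
by move=> /(@derive1n_eq_nearx _ f (fun=> 0)) ->; case: n => // n; rewrite derive1n_cst.
Qed.

Lemma derive1n_far0 n f (M : R) : (forall x, M < `|x| -> f x = 0) ->
  forall x, M < `|x| -> derive1n n f x = 0.
Proof.
move=> H x Mx; apply: derive1n_near0; near=> y; apply: H.
by near: y; exact: near_norm_gt.
Unshelve. all: end_near. Qed.

Lemma smooth_bounded f (M : R) (N : nat) : Cinf f ->
  exists2 B, 0 <= B & forall k x, (k <= N)%N -> `|x| <= M -> `|derive1n k f x| <= B.
Proof.
move=> sf; have [M0|M0] := ltP M 0.
  by exists 0 => // k x _ /(le_lt_trans) => /(_ _ M0); rewrite normr_lt0.
elim: N => [|N [B B0 HB]].
  have [||c _ Hc] := @EVT_max R (fun x => `|derive1n 0 f x|) (- M) M.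
    - by lra.
    - apply: continuous_subspaceT => x.
    by apply: continuous_comp; [exact: (smooth_continuous sf)|exact: norm_continuous].
  exists `|derive1n 0 f c| => // k x; rewrite leqn0 => /eqP -> xM.
  by apply: Hc; rewrite in_itv /= -ler_norml.
have [||c _ Hc] := @EVT_max R (fun x => `|derive1n N.+1 f x|) (- M) M.
- by lra.
- apply: continuous_subspaceT => x.
  have cN := smooth_continuous (smooth_derive1n N.+1 sf) (x := x).
  exact: (continuous_comp cN (@norm_continuous R R _)).
exists (Num.max B `|derive1n N.+1 f c|) => [|k x]; first by rewrite le_max B0.
rewrite leq_eqVlt => /orP[/eqP -> xM|kN xM].
  by rewrite le_max; apply/orP; right; apply: Hc; rewrite in_itv /= -ler_norml.
by rewrite le_max HB.
Qed.

Lemma smooth_bounded_supp f (M : R) (N : nat) : Cinf f ->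
  (forall x, M < `|x| -> f x = 0) ->
  exists2 B, 0 <= B & forall k x, (k <= N)%N -> `|derive1n k f x| <= B.
Proof.
move=> sf f0; have [B B0 HB] := @smooth_bounded f M N sf.
exists B => // k x kN; have [xM|xM] := leP `|x| M; first exact: HB.
by rewrite (derive1n_far0 _ f0)// normr0.
Qed.

Lemma test_functionI f (M : R) : Cinf f -> (forall x, M < `|x| -> f x = 0) ->
  test_function f.
Proof.
move=> [sf] H; split => //; apply: (@subclosed_compact _ _ `[- M, M]%classic).
- exact: closed_closure.
- exact: segment_compact.
- have cM : closed (`[- M, M]%classic : set R) by exact: (@interval_closed R (BLeft (- M)) (BRight M)).
  apply: (@subset_trans _ (closure (`[- M, M]%classic : set R))); last first.
    by rewrite -((closure_id _).1 cM).
  apply: closureS => x /= fx.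
  by rewrite in_itv /= -ler_norml leNgt; apply: contra_neqN fx => /H.
Qed.

Lemma test_functionE f : test_function f ->
  Cinf f /\ exists2 M, 0 <= M & forall x, M <= `|x| -> f x = 0.
Proof.
move=> [sf cf]; split; first by split.
have [M [_ HM]] := compact_bounded cf.
exists (`|M| + 1) => [|x Mx]; first by rewrite addr_ge0.
apply/eqP; apply: contraT => fx.
have Mlt : M < `|M| + 1/2 by rewrite (le_lt_trans (ler_norm _))// ltrDl.
have /(_ x) := HM _ Mlt.
have : supp f x by apply: subset_closure.
move=> /[swap] /[apply] H; suff : `|M| + 1 <= `|M| + 1/2 by rewrite lerD2l; lra.
exact: le_trans Mx H.
Qed.

Definition clinear p := forall (c : R) f g, Cinf f -> Cinf g ->
  p (fun x => c * f x + g x) = c * p f + p g.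

Definition cbounded p (M C : R) (N : nat) := forall f A, Cinf f ->
  (forall k x, (k <= N)%N -> `|x| <= M -> `|derive1n k f x| <= A) -> `|p f| <= C * A.

(* Elements of E'(R) as plain functionals; [cbounded] replaces the seminorms. *)
Definition cdist p := clinear p /\
  exists (M C : R) (N : nat), [/\ 0 <= M, 0 <= C & cbounded p M C N].

Lemma cdist_of (u : compact_distribution R) : cdist u.
Proof.
split; first by move=> c f g [sf] [sg]; exact: cdist_linear.
have [K [C [N [cK HC]]]] := cdist_continuous u.
have [M0 [_ HM]] := compact_bounded cK.
have [M M1 MM0] : exists2 M, 0 <= M & M0 < M.
  by exists (`|M0| + 1); rewrite ?addr_ge0// (le_lt_trans (ler_norm _))// ltrDl.
exists M, (`|C| * N.+1%:R), N; split => //.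
move=> f A sf HA; apply: (le_trans (HC _ (CinfE sf))).
have A0 : 0 <= A by apply: le_trans (HA 0%N 0 isT _) => //; rewrite normr0.
apply: le_trans (_ : `|C| * seminorm N K f <= _).
  apply: ler_wpM2r (ler_norm _).
  apply: sumr_ge0 => i _.
  (* The supremum of the empty set is 0 by convention, so an empty K is harmless. *)
  have [->|/set0P[x Kx]] := eqVneq K set0; first by rewrite image_set0 sup0.
  apply: le_trans (normr_ge0 (derive1n i f x)) _.
  apply: ub_le_sup; last by exists x.
  exists A => _ [y Ky <-]; apply: HA; first by rewrite -ltnS.
  exact: (HM _ MM0).
rewrite -mulrA ler_wpM2l// mulr_natl -[N.+1 in X in _ <= X]card_ord -sumr_const.
apply: ler_sum => i _.
have [->|/set0P[x Kx]] := eqVneq K set0; first by rewrite image_set0 sup0.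
apply: ge_sup; first by exists `|derive1n i f x|, x.
move=> _ [y Ky <-]; apply: HA; first by rewrite -ltnS.
exact: (HM _ MM0).
Qed.

Section CdistTheory.
Variables (p : (R -> R) -> R).
Hypothesis linp : clinear p.

Lemma clinear0 : p (fun=> 0) = 0.
Proof.
have := linp 1 (smooth_cst (0:R)) (smooth_cst 0).
have -> : (fun=> 1 * 0 + 0) = (fun=> 0) :> (R -> R).
  by apply/funext => x; rewrite mulr0 addr0.
by rewrite mul1r -[LHS]addr0 => /addrI.
Qed.

Lemma clinearZ c f : Cinf f -> p (fun x => c * f x) = c * p f.
Proof.
move=> sf; have := linp c sf (smooth_cst 0).
rewrite clinear0 addr0 => <-; congr p.
by apply/funext => x; rewrite addr0.
Qed.

Lemma clinearD f g : Cinf f -> Cinf g -> p (fun x => f x + g x) = p f + p g.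
Proof.
move=> sf sg; have := linp 1 sf sg.
rewrite mul1r => <-; congr p.
by apply/funext => x; rewrite mul1r.
Qed.

Lemma clinearN f : Cinf f -> p (fun x => - f x) = - p f.
Proof.
move=> sf; have := clinearZ (-1) sf.
rewrite mulN1r => <-; congr p.
by apply/funext => x; rewrite mulN1r.
Qed.

Lemma clinearB f g : Cinf f -> Cinf g -> p (fun x => f x - g x) = p f - p g.
Proof.
move=> sf sg; have := linp (-1) sg sf.
rewrite mulN1r addrC => <-; congr p.
by apply/funext => x; rewrite mulN1r addrC.
Qed.

End CdistTheory.

Lemma cboundedW p M C N M' C' N' : 0 <= M -> 0 <= C -> M <= M' -> C <= C' -> (N <= N')%N ->
  cbounded p M C N -> cbounded p M' C' N'.
Proof.
move=> M0 C0 MM CC NN H f A sf HA.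
have A0 : 0 <= A.
  have := HA 0%N 0 isT; rewrite normr0 => /(_ (le_trans M0 MM)).
  exact: le_trans.
apply: (le_trans (H f A sf _)); last by rewrite ler_wpM2r.
by move=> k x kN xM; apply: HA; [exact: leq_trans kN NN|exact: le_trans xM MM].
Qed.

Lemma cdistD p q : cdist p -> cdist q -> cdist (fun f => p f + q f).
Proof.
move=> [lp [M [C [N [M0 C0 H]]]]] [lq [M' [C' [N' [M0' C0' H']]]]]; split.
  by move=> c f g sf sg; rewrite lp// lq//; ring.
exists (Num.max M M'), (C + C'), (maxn N N'); split.
- by rewrite le_max M0.
- exact: addr_ge0.
move=> f A sf HA; rewrite mulrDl (le_trans (ler_normD _ _))// lerD//.
  apply: H => // k x kN xM; apply: HA; first by rewrite leq_max kN.
  by rewrite le_max xM.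
apply: H' => // k x kN xM; apply: HA; first by rewrite leq_max kN orbT.
by rewrite le_max xM orbT.
Qed.

Lemma cdistZ c p : cdist p -> cdist (fun f => c * p f).
Proof.
move=> [lp [M [C [N [M0 C0 H]]]]]; split.
  by move=> d f g sf sg; rewrite lp//; ring.
exists M, (`|c| * C), N; split => //; first exact: mulr_ge0.
by move=> f A sf HA; rewrite normrM -mulrA ler_wpM2l// H.
Qed.

Lemma cdistB p q : cdist p -> cdist q -> cdist (fun f => p f - q f).
Proof.
move=> cp cq; have -> : (fun f => p f - q f) = (fun f => p f + -1 * q f).
  by apply/funext => f; rewrite mulN1r.
by apply: cdistD => //; exact: cdistZ.
Qed.

(* A functional with compact support only sees a neighbourhood of its support. *)
Lemma cdist_ge0_supp p : cdist p ->
  (forall M f, Cinf f -> (forall x, 0 <= f x) -> (forall x, M < `|x| -> f x = 0) -> 0 <= p f) ->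
  forall f, Cinf f -> (forall x, 0 <= f x) -> 0 <= p f.
Proof.
move=> [lp [M [C [N [M0 C0 H]]]]] Hp f sf f0.
pose chi x := plateau ((x - 0) / (M + 1)).
have M1 : 0 < M + 1 by rewrite ltr_wpDl.
have schi : Cinf chi by apply: smooth_affine; exact: smooth_plateau.
have E x : `|x| < M + 1 -> chi x = 1.
  move=> xM; rewrite /chi plateau1// subr0 normrM normfV [`|M + 1|]gtr0_norm//.
  by rewrite ler_pdivrMr// mul1r ltW.
have -> : p f = p (fun x => f x * chi x).
  apply/eqP; rewrite -subr_eq0 -(clinearB lp)//; last exact: smoothM.
  (* The difference vanishes near [- M, M], so the continuity estimate applies with bound 0. *)
  rewrite -normr_le0 -(mulr0 C); apply: H => [|k x _ xM].
    by apply: smoothB => //; exact: smoothM.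
  rewrite derive1n_near0 ?normr0//; near=> y.
  rewrite E ?mulr1 ?subrr//; near: y.
  by apply: near_norm_lt; rewrite (le_lt_trans xM)// ltrDl.
apply: (Hp (2 * (M + 1))) => [|x|x xM]; first exact: smoothM.
  by rewrite mulr_ge0// plateau_ge0.
rewrite /chi plateau0 ?mulr0// subr0 normrM normfV [`|M + 1|]gtr0_norm//.
by rewrite ler_pdivlMr// ltW.
Unshelve. all: end_near. Qed.

End Supports.

(** * Powers of 1 / (z + i t) and their kernels *)

Section CPow.
Context {R : realType}.
Implicit Types (x y z t r : R) (b : bool).

(* (z + i t) ^ (- k), as the pair of its real and imaginary parts. *)
Fixpoint cpow k z t : R * R :=
  if k is k'.+1 then
    ((z * (cpow k' z t).1 + t * (cpow k' z t).2) / (z ^+ 2 + t ^+ 2),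
     (z * (cpow k' z t).2 - t * (cpow k' z t).1) / (z ^+ 2 + t ^+ 2))
  else (1, 0).

Definition cpart b k z t := if b then (cpow k z t).2 else (cpow k z t).1.

Lemma den_gt0 z t : 0 < t -> 0 < z ^+ 2 + t ^+ 2.
Proof. by move=> t0; rewrite ltr_wpDl ?sqr_ge0// exprn_gt0. Qed.

Lemma den_neq0 z t : 0 < t -> z ^+ 2 + t ^+ 2 != 0.
Proof. by move=> t0; rewrite gt_eqF// den_gt0. Qed.

Lemma cpow_re k z t : (cpow k.+1 z t).1 =
  (z * (cpow k z t).1 + t * (cpow k z t).2) / (z ^+ 2 + t ^+ 2).
Proof. by []. Qed.

Lemma cpow_im k z t : (cpow k.+1 z t).2 =
  (z * (cpow k z t).2 - t * (cpow k z t).1) / (z ^+ 2 + t ^+ 2).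
Proof. by []. Qed.

Lemma cpow_prev k z t : 0 < t ->
  (cpow k z t).1 = z * (cpow k.+1 z t).1 - t * (cpow k.+1 z t).2 /\
  (cpow k z t).2 = z * (cpow k.+1 z t).2 + t * (cpow k.+1 z t).1.
Proof. by move=> t0; have d0 := den_neq0 z t0; rewrite /=; split; field. Qed.

Lemma is_derive_den1 z t : is_derive z 1 (fun z => z ^+ 2 + t ^+ 2) (2 * z).
Proof.
have a := is_deriveDr (is_derive_exprn 2 z) (is_derive_cstr (t ^+ 2) z).
by apply: (is_derive_eq a); rewrite /= addr0 expr1.
Qed.

Lemma is_derive_den2 z t : is_derive t 1 (fun t => z ^+ 2 + t ^+ 2) (2 * t).
Proof.
have a := is_deriveDr (is_derive_cstr (z ^+ 2) t) (is_derive_exprn 2 t).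
by apply: (is_derive_eq a); rewrite /= add0r expr1.
Qed.

Lemma is_derive_quotr (f g : R -> R) x a c : g x != 0 -> is_derive x 1 f a -> is_derive x 1 g c ->
  is_derive x 1 (fun y => f y / g y) ((a - f x / g x * c) / g x).
Proof.
move=> g0 df dg; have d := is_deriveV g0 dg.
apply: (is_derive_eq (is_deriveMr df d)).
by rewrite -[_ *: _]/(_ * _); field.
Qed.

(** The complex power rule: w ^ (- k) has derivative - k w ^ (- k - 1), here split into real and
    imaginary parts. Differentiating in t brings a factor i, which exchanges the two parts. *)
Lemma is_derive_cpow_z k z t : 0 < t ->
  is_derive z 1 (fun z => (cpow k z t).1) (- k%:R * (cpow k.+1 z t).1) /\
  is_derive z 1 (fun z => (cpow k z t).2) (- k%:R * (cpow k.+1 z t).2).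
Proof.
move=> t0; have d0 := den_neq0 z t0; elim: k => [|k [IH1 IH2]].
  by split; rewrite oppr0 mul0r; exact: is_derive_cstr.
have [E1 E2] := cpow_prev k z t0.
have [E3 E4] := cpow_prev k.+1 z t0.
have n1 := is_deriveMr (is_derive_idr z) IH1.
have n2 := is_deriveZr t IH2.
have n3 := is_deriveMr (is_derive_idr z) IH2.
have n4 := is_deriveZr t IH1.
have D1 := @is_derive_quotr _ (fun z => z ^+ 2 + t ^+ 2) z _ _ d0 (is_deriveDr n1 n2) (is_derive_den1 z t).
have D2 := @is_derive_quotr _ (fun z => z ^+ 2 + t ^+ 2) z _ _ d0 (is_deriveBr n3 n4) (is_derive_den1 z t).
split.
  apply: (is_derive_eq D1).
  have G : (z * (cpow k z t).1 + t * (cpow k z t).2) / (z ^+ 2 + t ^+ 2) = (cpow k.+1 z t).1 by [].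
  rewrite (cpow_re k.+1) -natr1; move: E1 G; set a := (cpow k z t).1; set c := (cpow k z t).2.
  set u := (cpow k.+1 z t).1; set v := (cpow k.+1 z t).2 => E1 G.
  by rewrite /= G E1; field.
apply: (is_derive_eq D2).
have G : (z * (cpow k z t).2 - t * (cpow k z t).1) / (z ^+ 2 + t ^+ 2) = (cpow k.+1 z t).2 by [].
rewrite (cpow_im k.+1) -natr1; move: E2 G; set a := (cpow k z t).1; set c := (cpow k z t).2.
set u := (cpow k.+1 z t).1; set v := (cpow k.+1 z t).2 => E2 G.
by rewrite /= G E2; field.
Qed.

Lemma is_derive_cpow_t k z t : 0 < t ->
  is_derive t 1 (fun t => (cpow k z t).1) (k%:R * (cpow k.+1 z t).2) /\
  is_derive t 1 (fun t => (cpow k z t).2) (- k%:R * (cpow k.+1 z t).1).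
Proof.
move=> t0; have d0 := den_neq0 z t0; elim: k => [|k [IH1 IH2]].
  by split; rewrite ?oppr0 mul0r; exact: is_derive_cstr.
have [E1 E2] := cpow_prev k z t0.
have n1 := is_deriveZr z IH1.
have n2 := is_deriveMr (is_derive_idr t) IH2.
have n3 := is_deriveZr z IH2.
have n4 := is_deriveMr (is_derive_idr t) IH1.
have D1 := @is_derive_quotr _ (fun t => z ^+ 2 + t ^+ 2) t _ _ d0 (is_deriveDr n1 n2) (is_derive_den2 z t).
have D2 := @is_derive_quotr _ (fun t => z ^+ 2 + t ^+ 2) t _ _ d0 (is_deriveBr n3 n4) (is_derive_den2 z t).
split.
  apply: (is_derive_eq D1).
  have G : (z * (cpow k z t).1 + t * (cpow k z t).2) / (z ^+ 2 + t ^+ 2) = (cpow k.+1 z t).1 by [].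
  rewrite (cpow_im k.+1) -natr1; move: E2 G; set a := (cpow k z t).1; set c := (cpow k z t).2.
  set u := (cpow k.+1 z t).1; set v := (cpow k.+1 z t).2 => E2 G.
  by rewrite /= G E2; field.
apply: (is_derive_eq D2).
have G : (z * (cpow k z t).2 - t * (cpow k z t).1) / (z ^+ 2 + t ^+ 2) = (cpow k.+1 z t).2 by [].
rewrite (cpow_re k.+1) -natr1; move: E1 G; set a := (cpow k z t).1; set c := (cpow k z t).2.
set u := (cpow k.+1 z t).1; set v := (cpow k.+1 z t).2 => E1 G.
by rewrite /= G E1; field.
Qed.

Lemma is_derive_cpart_z b k z t : 0 < t ->
  is_derive z 1 (fun z => cpart b k z t) (- k%:R * cpart b k.+1 z t).
Proof. by move=> /(is_derive_cpow_z k z)[]; case: b. Qed.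

Definition csign b : R := if b then - 1 else 1.

Lemma is_derive_cpart_t b k z t : 0 < t ->
  is_derive t 1 (fun t => cpart b k z t) (csign b * k%:R * cpart (~~ b) k.+1 z t).
Proof. by move=> /(is_derive_cpow_t k z)[]; case: b; rewrite /csign ?mul1r// mulN1r. Qed.

Lemma cpow_norm k z t : 0 < t ->
  (cpow k z t).1 ^+ 2 + (cpow k z t).2 ^+ 2 = (z ^+ 2 + t ^+ 2)^-1 ^+ k.
Proof.
move=> t0; have d0 := den_neq0 z t0; elim: k => [|k IH].
  by rewrite /= expr1n expr0n addr0.
rewrite [RHS]exprSr -IH /=.
by set u := (cpow k z t).1; set v := (cpow k z t).2; field.
Qed.

Lemma cpart_le b k z t r : 0 < t -> 0 < r -> r ^+ 2 <= z ^+ 2 + t ^+ 2 ->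
  `|cpart b k z t| <= r^-1 ^+ k.
Proof.
move=> t0 r0 H.
rewrite -(@ler_pXn2r _ 2) ?nnegrE ?exprn_ge0 ?invr_ge0 ?(ltW r0)//.
rewrite real_normK ?num_real//.
apply: le_trans (_ : (z ^+ 2 + t ^+ 2)^-1 ^+ k <= _).
  rewrite -cpow_norm//; case: b; [rewrite lerDr|rewrite lerDl]; exact: sqr_ge0.
rewrite -exprM mulnC exprM lerXn2r ?nnegrE ?invr_ge0 ?(ltW (den_gt0 _ _))//.
  by rewrite exprn_ge0// invr_ge0 ltW.
by rewrite exprVn lef_pV2 ?posrE ?exprn_gt0 ?den_gt0.
Qed.

(** The imaginary part vanishes on the real axis, and the induction extracts the corresponding
    factor t. This is why the Poisson kernel and its derivatives are O(t) away from their pole. *)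
Lemma cpart_im_le k z t r : 0 < t -> 0 < r -> r ^+ 2 <= z ^+ 2 + t ^+ 2 ->
  `|cpart true k z t| <= k%:R * t * r^-1 ^+ k.+1.
Proof.
move=> t0 r0 H; elim: k => [|k IH]; first by rewrite /= normr0 !mul0r.
have d0 := den_gt0 z t0.
have zr : `|z| / (z ^+ 2 + t ^+ 2) <= r^-1.
  rewrite ler_pdivrMr// mulrC ler_pdivlMr//.
  rewrite -(@ler_pXn2r _ 2) ?nnegrE ?mulr_ge0 ?(ltW r0) ?(ltW d0)//.
  rewrite exprMn real_normK ?num_real// [X in _ <= X]expr2.
  by apply: ler_pM; rewrite ?sqr_ge0// lerDl sqr_ge0.
have ir : (z ^+ 2 + t ^+ 2)^-1 <= r^-1 ^+ 2.
  by rewrite exprVn lef_pV2 ?posrE ?exprn_gt0.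
have Ak := @cpart_le false k z t r t0 r0 H.
rewrite /= normrM normfV [`|z ^+ 2 + _|]gtr0_norm//.
apply: le_trans (_ : (`|z| * `|(cpow k z t).2| + t * `|(cpow k z t).1|) / (z ^+ 2 + t ^+ 2) <= _).
  rewrite ler_pM2r ?invr_gt0// (le_trans (ler_normB _ _))// !normrM.
  by rewrite [`|t|]gtr0_norm.
have -> : k.+1%:R * t * r^-1 ^+ k.+2 = r^-1 * (k%:R * t * r^-1 ^+ k.+1) + t * r^-1 ^+ k * r^-1 ^+ 2.
  by rewrite -natr1 !exprS expr0; ring.
rewrite mulrDl lerD//.
  by rewrite mulrAC; apply: ler_pM => //; rewrite mulr_ge0// invr_ge0 ltW.
apply: ler_pM => //; first by rewrite mulr_ge0// ltW.
  by rewrite invr_ge0 ltW.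
by rewrite ler_pM2l.
Qed.

(* The coefficient of the k-th derivative of (z + i t) ^ (- m). *)
Definition cfact m k : R := \prod_(i < k) (m + i)%:R.

Lemma cfact_ge0 m k : 0 <= cfact m k.
Proof. by apply: prodr_ge0. Qed.

Lemma cfactS m k : cfact m k.+1 = cfact m k * (m + k)%:R.
Proof. exact: big_ord_recr. Qed.

Definition cfactN m N : R := \sum_(k < N.+1) cfact m k.

Lemma cfact_le m N k : (k <= N)%N -> cfact m k <= cfactN m N.
Proof.
move=> kN; rewrite /cfactN (bigD1 (Ordinal (kN : (k < N.+1)%N)))//= lerDl.
by apply: sumr_ge0 => i _; exact: cfact_ge0.
Qed.

Lemma cfactN_ge0 m N : 0 <= cfactN m N.
Proof. by apply: sumr_ge0 => i _; exact: cfact_ge0. Qed.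

(** The family contains the Poisson kernel (b true, m = 1, up to sign) and, up to constants, all its
    derivatives in x, y and t. *)
Definition ckern b m x t : R -> R := fun y => cpart b m (y - x) t.

Lemma derive1n_ckern b m x t : 0 < t -> Cinf (ckern b m x t) /\
  forall k, derive1n k (ckern b m x t) =
    fun y => (-1) ^+ k * cfact m k * cpart b (m + k) (y - x) t.
Proof.
move=> t0; pose F k y := (-1) ^+ k * cfact m k * cpart b (m + k) (y - x) t.
have H k y : is_derive y 1 (F k) (F k.+1 y).
  have a := is_derive_cpart_z b (m + k) (y - x) t0.
  have c : is_derive y 1 (fun y => y - x) 1.
    by have d := is_deriveBr (is_derive_idr y) (is_derive_cstr x y); apply: (is_derive_eq d); rewrite subr0.
  have d := @is_derive1_comp _ (fun z => cpart b (m + k) z t) (fun y => y - x) y _ _ a c.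
  apply: (is_derive_eq (is_deriveZr _ d)).
  by rewrite /F cfactS addnS exprS; ring.
have [] := smooth_family H.
have -> : F 0%N = ckern b m x t.
  by apply/funext => y; rewrite /F /cfact big_ord0 !mul1r addn0.
by [].
Qed.

Lemma smooth_ckern b m x t : 0 < t -> Cinf (ckern b m x t).
Proof. by move=> /(derive1n_ckern b m x)[]. Qed.

Lemma derive1n_ckernE b m x t k y : 0 < t -> derive1n k (ckern b m x t) y =
  (-1) ^+ k * cfact m k * cpart b (m + k) (y - x) t.
Proof. by move=> /(derive1n_ckern b m x)[_ ->]. Qed.

Lemma derive1n_ckern_le b m x t k y r : 0 < t -> 0 < r -> r ^+ 2 <= (y - x) ^+ 2 + t ^+ 2 ->
  `|derive1n k (ckern b m x t) y| <= cfact m k * r^-1 ^+ (m + k).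
Proof.
move=> t0 r0 H; rewrite derive1n_ckernE// !normrM normrX normrN1 expr1n mul1r.
by rewrite ger0_norm ?cfact_ge0// ler_wpM2l ?cfact_ge0// cpart_le.
Qed.

Lemma derive1n_ckern_im_le m x t k y r : 0 < t -> 0 < r -> r ^+ 2 <= (y - x) ^+ 2 + t ^+ 2 ->
  `|derive1n k (ckern true m x t) y| <= cfact m k * ((m + k)%:R * t * r^-1 ^+ (m + k).+1).
Proof.
move=> t0 r0 H; rewrite derive1n_ckernE// !normrM normrX normrN1 expr1n mul1r.
by rewrite ger0_norm ?cfact_ge0// ler_wpM2l ?cfact_ge0// cpart_im_le.
Qed.

End CPow.

(** * Differentiation under a functional and the extended functions *)

Section ParamDerive.
Context {R : realType}.
Implicit Types (p : (R -> R) -> R) (x y s t e : R).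

(** Taylor's formula in the parameter, applied to each y-derivative of order at most N uniformly for
    [|y| <= M], bounds the second-order remainder in the norm that controls p. *)
Lemma param_derive p (G G1 G2 : R -> R -> R) s e : cdist p -> 0 < e ->
  (forall s', `|s' - s| < e -> Cinf (G s')) ->
  (forall s', `|s' - s| < e -> Cinf (G1 s')) ->
  (forall k y s', `|s' - s| < e ->
     is_derive s' 1 (fun s => derive1n k (G s) y) (derive1n k (G1 s') y)) ->
  (forall k y s', `|s' - s| < e ->
     is_derive s' 1 (fun s => derive1n k (G1 s) y) (derive1n k (G2 s') y)) ->
  (forall N M, exists B, forall k y s', (k <= N)%N -> `|y| <= M -> `|s' - s| < e ->
     `|derive1n k (G2 s') y| <= B) ->
  is_derive s 1 (fun s => p (G s)) (p (G1 s)).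
Proof.
move=> [lp [M [C [N [M0 C0 H]]]]] e0 sG sG1 dG dG1 bG2.
have [B HB] := bG2 N M.
have ss : `|s - s| < e by rewrite subrr normr0.
apply: (@is_derive_quad _ _ _ _ (C * B) e) => // h he.
have sh : `|s + h - s| < e by rewrite addrAC subrr add0r.
have s1 : Cinf (fun y => G (s + h) y - G s y) by apply: smoothB; exact: sG.
have s2 : Cinf (fun y => h * G1 s y) by apply: smoothZ; exact: sG1.
rewrite -(clinearZ lp)//; last exact: sG1.
rewrite -(clinearB lp)//; [|exact: sG..].
rewrite -(clinearB lp)// -mulrA.
apply: H; first exact: smoothB.
move=> k y kN yM.
rewrite derive1nB// derive1nB//; [|exact: sG..].
rewrite derive1nZ; last exact: sG1.
apply: (taylor2 (fun z => dG k y z) (fun z => dG1 k y z)) => // z ze.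
exact: HB.
Qed.

End ParamDerive.

Section Poisson.
Context {R : realType}.
Variable p : (R -> R) -> R.
Hypothesis cp : cdist p.
Implicit Types (x y s t e : R) (b : bool).

Definition cext b m x t := p (ckern b m x t).

Lemma is_derive_cext_x b m x t : 0 < t ->
  is_derive x 1 (fun x => cext b m x t) (m%:R * cext b m.+1 x t).
Proof.
move=> t0.
have dx n k y s : is_derive s 1 (fun s => derive1n k (ckern b n s t) y)
    (derive1n k (fun y => n%:R * ckern b n.+1 s t y) y).
  rewrite derive1nZ; last exact: smooth_ckern.
  under eq_fun do rewrite derive1n_ckernE//.
  rewrite derive1n_ckernE//.
  have a := is_derive_cpart_z b (n + k) (y - s) t0.
  have c : is_derive s 1 (fun s => y - s) (- 1).
    by have d := is_deriveBr (is_derive_cstr y s) (is_derive_idr s); apply: (is_derive_eq d); rewrite sub0r.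
  have d := @is_derive1_comp _ (fun z => cpart b (n + k) z t) (fun s => y - s) s _ _ a c.
  apply: (is_derive_eq (is_deriveZr _ d)).
  (* Both sides are the rising product n (n + 1) ... (n + k). *)
  suff E : n%:R * cfact n.+1 k = cfact n k * (n + k)%:R :> R.
    transitivity ((-1) ^+ k * (n%:R * cfact n.+1 k) * cpart b (n + k).+1 (y - s) t).
      by rewrite E; ring.
    by rewrite addSn; ring.
  rewrite -cfactS /cfact big_ord_recl addn0; congr (_ * _).
  by apply: eq_bigr => i _; rewrite addSnnS.
rewrite -(clinearZ cp.1); last exact: smooth_ckern.
pose G1 n s y := n%:R * ckern b n.+1 s t y.
apply: (@param_derive _ p (fun s => ckern b m s t) (G1 m) (fun s y => m%:R * (m.+1%:R * ckern b m.+2 s t y)) x 1) => //.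
- by move=> s _; exact: smooth_ckern.
- by move=> s _; apply: smoothZ; exact: smooth_ckern.
- move=> k y s _; rewrite derive1nZ; last by apply: smoothZ; exact: smooth_ckern.
  have -> : (fun s => derive1n k (G1 m s) y) =
      (fun s => m%:R * derive1n k (ckern b m.+1 s t) y).
    by apply/funext => s'; rewrite /G1 derive1nZ//; exact: smooth_ckern.
  exact: is_deriveZr.
- move=> N M; exists (m%:R * (m.+1%:R * (cfactN m.+2 N * (\sum_(k < N.+1) t^-1 ^+ (m.+2 + k))))).
  move=> k y s kN _ _.
  rewrite derive1nZ; last by apply: smoothZ; exact: smooth_ckern.
  rewrite derive1nZ; last exact: smooth_ckern.
  rewrite !normrM !normr_nat ler_wpM2l// ler_wpM2l//.
  apply: le_trans (derive1n_ckern_le (r := t) _ _ _ _ _ _) _ => //.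
    by rewrite lerDr sqr_ge0.
  apply: ler_pM; rewrite ?cfact_ge0 ?cfact_le ?exprn_ge0 ?invr_ge0 ?(ltW t0)//.
  rewrite (bigD1 (Ordinal (kN : (k < N.+1)%N)))//= lerDl.
  by apply: sumr_ge0 => i _; rewrite exprn_ge0// invr_ge0 ltW.
Qed.

Lemma is_derive_cext_t b m x t : 0 < t ->
  is_derive t 1 (fun t => cext b m x t) (csign b * m%:R * cext (~~ b) m.+1 x t).
Proof.
move=> t0; have th0 : 0 < t / 2 by rewrite divr_gt0.
have tp s : `|s - t| < t / 2 -> t / 2 < s by rewrite ltr_norml => /andP[? _]; lra.
have tp0 s : `|s - t| < t / 2 -> 0 < s by move=> /tp; apply: lt_trans.
have dx c n k y s : `|s - t| < t / 2 -> is_derive s 1 (fun s => derive1n k (ckern c n x s) y)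
    (derive1n k (fun y => csign c * n%:R * ckern (~~ c) n.+1 x s y) y).
  move=> /[dup] /tp0 s0 st.
  rewrite derive1nZ; last exact: smooth_ckern.
  rewrite derive1n_ckernE//.
  have a := is_derive_cpart_t c (n + k) (y - x) s0.
  have d := is_deriveZr ((-1) ^+ k * cfact n k) a.
  apply: is_derive_near_eq; last first.
    apply: (is_derive_eq d).
    suff E : n%:R * cfact n.+1 k = cfact n k * (n + k)%:R :> R.
      transitivity ((-1) ^+ k * (n%:R * cfact n.+1 k) * (csign c * cpart (~~ c) (n + k).+1 (y - x) s)).
        by rewrite E; ring.
      by rewrite addSn; ring.
    rewrite -cfactS /cfact big_ord_recl addn0; congr (_ * _).
    by apply: eq_bigr => i _; rewrite addSnnS.
  by near=> s'; rewrite derive1n_ckernE//; near: s'; exact: lt_nbhsr.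
rewrite -(clinearZ cp.1); last exact: smooth_ckern.
apply: (@param_derive _ p (fun s => ckern b m x s) (fun s y => csign b * m%:R * ckern (~~ b) m.+1 x s y)
  (fun s y => csign b * m%:R * (csign (~~ b) * m.+1%:R * ckern (~~ ~~ b) m.+2 x s y)) t (t / 2)) => //.
- by move=> s /tp0 s0; exact: smooth_ckern.
- by move=> s /tp0 s0; apply: smoothZ; exact: smooth_ckern.
- move=> k y s st; rewrite derive1nZ; last by apply: smoothZ; apply: smooth_ckern; exact: tp0.
  have d := is_deriveZr (csign b * m%:R) (dx (~~ b) m.+1 k y s st).
  apply: (is_derive_near_eq _ d).
  near=> s'; rewrite derive1nZ//; apply: smooth_ckern.
  by near: s'; apply: lt_nbhsr; exact: tp0.
- move=> N M; exists (m%:R * (m.+1%:R * (cfactN m.+2 N * (\sum_(k < N.+1) (t / 2)^-1 ^+ (m.+2 + k))))).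
  move=> k y s kN _ st; have s0 := tp0 _ st.
  rewrite derive1nZ; last by apply: smoothZ; exact: smooth_ckern.
  rewrite derive1nZ; last exact: smooth_ckern.
  have cs c : `|csign c : R| = 1 by case: c; rewrite /csign ?normrN normr1.
  rewrite !normrM !cs !mul1r !normr_nat ler_wpM2l// ler_wpM2l//.
  apply: le_trans (derive1n_ckern_le (r := t / 2) _ _ _ _ _ _) _ => //.
    apply: le_trans (_ : s ^+ 2 <= _); last by rewrite lerDr sqr_ge0.
    by rewrite lerXn2r ?nnegrE ?(ltW s0) ?(ltW th0)// ltW// tp.
  apply: ler_pM; rewrite ?cfact_ge0 ?cfact_le ?exprn_ge0 ?invr_ge0 ?(ltW th0)//.
  rewrite (bigD1 (Ordinal (kN : (k < N.+1)%N)))//= lerDl.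
  by apply: sumr_ge0 => i _; rewrite exprn_ge0// invr_ge0 ltW.
Unshelve. all: end_near. Qed.

Lemma cext_bounded b m t0 : 0 < t0 -> exists2 B, 0 <= B &
  forall x t, t0 <= t -> `|cext b m x t| <= B.
Proof.
move=> t00; case: cp => lp [M [C [N [M0 C0 H]]]].
exists (C * (cfactN m N * (\sum_(k < N.+1) t0^-1 ^+ (m + k)))).
  rewrite !mulr_ge0 ?cfactN_ge0//; apply: sumr_ge0 => i _.
  by rewrite exprn_ge0// invr_ge0 ltW.
move=> x t t0t; have tgt0 := lt_le_trans t00 t0t.
apply: H => [|k y kN _]; first exact: smooth_ckern.
apply: le_trans (derive1n_ckern_le (r := t0) _ _ _ _ _ _) _ => //.
  apply: le_trans (_ : t ^+ 2 <= _); last by rewrite lerDr sqr_ge0.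
  by rewrite lerXn2r ?nnegrE ?(ltW t00) ?(ltW tgt0).
apply: ler_pM; rewrite ?cfact_ge0 ?cfact_le ?exprn_ge0 ?invr_ge0 ?(ltW t00)//.
rewrite (bigD1 (Ordinal (kN : (k < N.+1)%N)))//= lerDl.
by apply: sumr_ge0 => i _; rewrite exprn_ge0// invr_ge0 ltW.
Qed.

End Poisson.

(** * Uniform boundedness of dilations at a point *)

Section GlidingHump.
Context {R : realType}.
Implicit Types (f psi : R -> R) (x y c e A C : R).

Lemma third_pow_small (c e : R) : 0 < e -> exists m0, forall m, (m0 <= m)%N -> c * 3^-1 ^+ m <= e.
Proof.
move=> e0.
have H : c * 3^-1 ^+ m @[m --> \oo] --> c * 0.
  apply: cvgM; first exact: cvg_cst.
  by apply: cvg_expr; rewrite ger0_norm// invf_lt1// ltr1n.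
have : \forall m \near \oo, c * 3^-1 ^+ m < e.
  by apply: (cvgr_lt _ H); rewrite mulr0.
by move=> [m0 _ Hm]; exists m0 => m /Hm /ltW.
Qed.

Lemma le_third_pow (a b c : R) (n0 : nat) :
  (forall m, (n0 <= m)%N -> a <= b + c * 3^-1 ^+ m) -> a <= b.
Proof.
move=> H; apply/ler_addgt0Pr => e e0; have [m0 Hm] := third_pow_small c e0.
apply: le_trans (H (maxn n0 m0) _) _; first exact: leq_maxl.
by rewrite lerD2l Hm// leq_maxr.
Qed.

Section SmoothLimit.
Variables (N0 : nat) (x_ : nat -> R -> R).
Hypothesis x_smooth : forall n, Cinf (x_ n).
Hypothesis x_supp : forall n y, 4 <= `|y| -> x_ n y = 0.
Hypothesis x_close : forall n k y, (k <= n + N0)%N ->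
  `|derive1n k (x_ n.+1) y - derive1n k (x_ n) y| <= 3^-1 ^+ n.

Let x_dist k n j y : (k <= n + N0)%N ->
  `|derive1n k (x_ (n + j)) y - derive1n k (x_ n) y| <= 3/2 * 3^-1 ^+ n.
Proof.
move=> kn; suff : `|derive1n k (x_ (n + j)) y - derive1n k (x_ n) y| <=
    3/2 * (3^-1 ^+ n - 3^-1 ^+ (n + j)).
  move=> /le_trans; apply; rewrite ler_wpM2l// gerBl exprn_ge0//.
elim: j => [|j IH]; first by rewrite addn0 !subrr normr0 mulr0.
rewrite addnS.
have -> : derive1n k (x_ (n + j).+1) y - derive1n k (x_ n) y =
  (derive1n k (x_ (n + j).+1) y - derive1n k (x_ (n + j)) y) +
  (derive1n k (x_ (n + j)) y - derive1n k (x_ n) y) by ring.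
apply: le_trans (ler_normD _ _) _.
have H := @x_close (n + j) k y (leq_trans kn (leq_add (leq_addr j n) (leqnn N0))).
apply: le_trans (lerD H IH) _.
by rewrite exprS; lra.
Qed.

Definition dlim k y := lim (derive1n k (x_ n) y @[n --> \oo]).

Let dlim_cvg k y : derive1n k (x_ n) y @[n --> \oo] --> dlim k y.
Proof.
suff : cvgn (fun n => derive1n k (x_ n) y) by [].
(* The added term is the sum of all remaining geometric increments, so w is nonincreasing and
   bounded below. *)
pose w n := derive1n k (x_ (n + k)) y + 3/2 * 3^-1 ^+ (n + k).
have cw : cvgn w.
  apply: nonincreasing_is_cvgn.
    apply/nonincreasing_seqP => n; rewrite /w addSn.
    have := @x_close (n + k) k y (leq_trans (leq_addl n k) (leq_addr N0 _)).
    rewrite exprS ler_norml => /andP[_]; set q := 3^-1 ^+ (n + k); lra.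
  exists (derive1n k (x_ k) y - 3/2 * 3^-1 ^+ k) => _ [n _ <-].
  have := @x_dist k k n y (leq_addr _ _); rewrite /w (addnC n k) ler_norml => /andP[H _].
  have : 0 <= 3/2 * 3^-1 ^+ (k + n) :> R by rewrite mulr_ge0// exprn_ge0.
  lra.
have c3 : 3/2 * 3^-1 ^+ n @[n --> \oo] --> (3/2 * 0 : R).
  apply: cvgM; first exact: cvg_cst.
  by apply: cvg_expr; rewrite ger0_norm// invf_lt1// ltr1n.
suff H : cvgn (fun n => derive1n k (x_ (n + k)) y).
  apply/cvg_ex; exists (lim (derive1n k (x_ (n + k)) y @[n --> \oo])).
  by rewrite -(cvg_shiftn k).
have -> : (fun n => derive1n k (x_ (n + k)) y) = (fun n => w n - 3/2 * 3^-1 ^+ (n + k)).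
  by apply/funext => n; rewrite /w addrK.
apply: is_cvgB => //; apply/cvg_ex; exists (3/2 * 0).
by rewrite (cvg_shiftn k (fun n => 3/2 * 3^-1 ^+ n : R)).
Qed.

Let dlim_dist k n y : (k <= n + N0)%N -> `|dlim k y - derive1n k (x_ n) y| <= 3/2 * 3^-1 ^+ n.
Proof.
move=> kn; have H : `|derive1n k (x_ m) y - derive1n k (x_ n) y| @[m --> \oo] -->
    `|dlim k y - derive1n k (x_ n) y|.
  by apply: cvg_norm; apply: cvgB; [exact: dlim_cvg|exact: cvg_cst].
rewrite -(cvg_lim _ H)//; apply: limr_le; first by apply/cvg_ex; eexists; exact: H.
near=> m; have nm : (n <= m)%N by near: m; exact: nbhs_infty_ge.
by rewrite -(subnKC nm); exact: x_dist.
Unshelve. all: end_near. Qed.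

Let dlim_derive k y : is_derive y 1 (dlim k) (dlim k.+1 y).
Proof.
have [B0 B00 HB0] : exists2 B, 0 <= B & forall y, `|derive1n k.+2 (x_ k.+2) y| <= B.
  have [|B B0 HB] := @smooth_bounded_supp R (x_ k.+2) 4 k.+2 (@x_smooth _).
    by move=> z /ltW /x_supp.
  by exists B => // z; exact: HB.
(* B0 bounds the derivative of order [k.+2] of the approximant of index [k.+2]; later approximants
   differ from it by at most 3/2. *)
apply: (@is_derive_quad _ _ _ _ (B0 + 3/2) 1) => // h _.
apply: (@le_third_pow _ _ ((2 + `|h|) * (3/2)) k.+2) => m km.
have b2 z : `|derive1n k.+2 (x_ m) z| <= B0 + 3/2.
  have := @x_dist k.+2 k.+2 (m - k.+2) z (leq_addr _ _); rewrite subnKC// => H.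
  rewrite -[X in `|X|](subrK (derive1n k.+2 (x_ k.+2) z)).
  apply: le_trans (ler_normD _ _) _; rewrite addrC; apply: lerD (HB0 _) _.
  apply: le_trans H _; rewrite ler_piMr//; apply: exprn_ile1 => //.
  by rewrite invf_le1// ler1n.
have km' j : (j <= 2)%N -> (k + j <= m + N0)%N.
  by move=> j2; rewrite (leq_trans _ (leq_addr _ _))// (leq_trans _ km)// -addn2 leq_add2l.
have T := @taylor2 R (derive1n k (x_ m)) (derive1n k.+1 (x_ m)) (derive1n k.+2 (x_ m))
  y (`|h| + 1) (B0 + 3/2) (fun z _ => smooth_is_derive k z (@x_smooth m))
  (fun z _ => smooth_is_derive k.+1 z (@x_smooth m)) (fun z _ => b2 z) h.
have {}T : `|derive1n k (x_ m) (y + h) - derive1n k (x_ m) y - h * derive1n k.+1 (x_ m) y|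
    <= (B0 + 3/2) * h ^+ 2 by apply: T; rewrite ltrDl.
have h1 := @dlim_dist k m (y + h) (leq_trans (leq_addr _ _) (km' 2 isT)).
have h2 := @dlim_dist k m y (leq_trans (leq_addr _ _) (km' 2 isT)).
have h3 := @dlim_dist k.+1 m y; rewrite -addn1 in h3; move: h3 => /(_ (km' 1%N isT)) h3.
rewrite addn1 in h3.
have -> : dlim k (y + h) - dlim k y - h * dlim k.+1 y =
  (derive1n k (x_ m) (y + h) - derive1n k (x_ m) y - h * derive1n k.+1 (x_ m) y) +
  ((dlim k (y + h) - derive1n k (x_ m) (y + h)) - (dlim k y - derive1n k (x_ m) y)
   - h * (dlim k.+1 y - derive1n k.+1 (x_ m) y)) by ring.
apply: le_trans (ler_normD _ _) _; apply: lerD => //.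
apply: le_trans (ler_normB _ _) _.
have -> : (2 + `|h|) * (3 / 2) * 3^-1 ^+ m = (3 / 2 * 3^-1 ^+ m + 3 / 2 * 3^-1 ^+ m)
   + `|h| * (3 / 2 * 3^-1 ^+ m) by ring.
apply: lerD; last by rewrite normrM ler_wpM2l.
by apply: le_trans (ler_normB _ _) _; exact: lerD.
Qed.

(** From stage n on, the derivatives of order at most [n + N0] move by geometrically small amounts.
    Hence each fixed derivative converges uniformly, and its limit is the derivative of the limit of
    the preceding one. *)
Lemma smooth_limit : [/\ Cinf (dlim 0%N), (forall y, 4 <= `|y| -> dlim 0%N y = 0) &
  forall k n y, (k <= n + N0)%N ->
    `|derive1n k (fun y => dlim 0%N y - x_ n y) y| <= 3/2 * 3^-1 ^+ n].
Proof.
have [s E] := smooth_family dlim_derive; split => //.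
  move=> y y4; rewrite /dlim; apply: cvg_lim => //.
  have -> : (fun n => derive1n 0 (x_ n) y) = (fun=> 0).
    by apply/funext => n; rewrite /= x_supp.
  exact: cvg_cst.
by move=> k n y kn; rewrite derive1nB// E; exact: dlim_dist.
Qed.

End SmoothLimit.

Section UniformBound.
Variables (p : (R -> R) -> R) (c : R).
Hypothesis cp : cdist p.

Definition dilation e psi := p (fun y => psi ((y - c) / e)).

(** The trace left on p = U' by a point value of U at c: integrating by parts, the dilation of p on
    psi is minus the dilated pairing of U with psi', whose limit is a multiple of the integral of
    psi', that is, 0. *)
Definition dil_vanishing := forall psi, test_function psi ->
  dilation e psi @[e --> 0^'+] --> 0.

Definition dil_bounded := exists (C : R) (N : nat) (e0 : R), [/\ 0 <= C, 0 < e0 &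
  forall e psi A, 0 < e < e0 -> Cinf psi -> (forall y, 4 <= `|y| -> psi y = 0) ->
    (forall k y, (k <= N)%N -> `|derive1n k psi y| <= A) -> `|dilation e psi| <= C * A].

Lemma dilation_lin e a f g : Cinf f -> Cinf g ->
  dilation e (fun y => a * f y + g y) = a * dilation e f + dilation e g.
Proof. by move=> sf sg; rewrite /dilation cp.1//; exact: smooth_affine. Qed.

Lemma dilationZ e a f : Cinf f -> dilation e (fun y => a * f y) = a * dilation e f.
Proof. by move=> sf; rewrite /dilation (clinearZ cp.1)//; exact: smooth_affine. Qed.

Lemma dilationD e f g : Cinf f -> Cinf g ->
  dilation e (fun y => f y + g y) = dilation e f + dilation e g.
Proof. by move=> sf sg; rewrite /dilation (clinearD cp.1)//; exact: smooth_affine. Qed.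

Lemma dilationB e f g : Cinf f -> Cinf g ->
  dilation e (fun y => f y - g y) = dilation e f - dilation e g.
Proof. by move=> sf sg; rewrite /dilation (clinearB cp.1)//; exact: smooth_affine. Qed.

Let unit_ball n psi := [/\ Cinf psi, forall y, 4 <= `|y| -> psi y = 0 &
  forall k y, (k <= n)%N -> `|derive1n k psi y| <= 1].

(** At one fixed scale the dilation is merely continuous; this makes the suprema in the next proof
    finite. *)
Let crude_bound : exists N0, forall e, 0 < e -> exists2 C, 0 <= C &
  forall n psi, (N0 <= n)%N -> unit_ball n psi -> `|dilation e psi| <= C.
Proof.
case: cp => lp [M [C [N [M0 C0 H]]]]; exists N => e e0.
exists (C * \sum_(k < N.+1) e^-1 ^+ k).
  by rewrite mulr_ge0// sumr_ge0// => i _; rewrite exprn_ge0// invr_ge0 ltW.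
move=> n psi Nn [spsi _ bpsi]; apply: H; first exact: smooth_affine.
move=> k y kN _; rewrite derive1n_affine// normrM.
apply: le_trans (_ : e^-1 ^+ k * 1 <= _).
  rewrite ger0_norm; last by rewrite exprn_ge0// invr_ge0 ltW.
  by rewrite ler_wpM2l ?bpsi ?(leq_trans kN Nn)// exprn_ge0// invr_ge0 ltW.
rewrite mulr1 (bigD1 (Ordinal (kN : (k < N.+1)%N)))//= lerDl.
by apply: sumr_ge0 => i _; rewrite exprn_ge0// invr_ge0 ltW.
Qed.

(* Uniform boundedness by Sokal's argument: were the bound false, one could sum
   signed, geometrically small near-extremal functions into a test function on
   which the dilations blow up. *)
Lemma dil_vanishing_bounded : dil_vanishing -> dil_bounded.
Proof.
move=> van; apply: contrapT => nb.
have [N0 crude] := crude_bound.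
(* At stage n: a scale below 1/(n + 1) and an element of the unit ball of order [n + N0] whose
   dilation is within 9/10 of the supremum. The supremum exceeds 10/9 * 4 ^+ n, which leaves 4 ^+
   n. *)
have near_ext n : exists ep : R * (R -> R), [/\ 0 < ep.1 < n.+1%:R^-1, unit_ball (n + N0) ep.2,
    4 ^+ n < `|dilation ep.1 ep.2| &
    forall psi, unit_ball (n + N0) psi -> 9/10 * `|dilation ep.1 psi| <= `|dilation ep.1 ep.2|].
  have : ~ (forall e psi A, 0 < e < n.+1%:R^-1 -> Cinf psi -> (forall y, 4 <= `|y| -> psi y = 0) ->
    (forall k y, (k <= n + N0)%N -> `|derive1n k psi y| <= A) -> `|dilation e psi| <= 10/9 * 4 ^+ n * A).
    move=> H; apply: nb; exists (10/9 * 4 ^+ n), (n + N0)%N, n.+1%:R^-1; split; last exact: H.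
      by rewrite mulr_ge0// exprn_ge0.
    by rewrite invr_gt0.
  move=> /existsNP[e] /existsNP[psi] /existsNP[A] /not_implyP[e01] /not_implyP[spsi].
  move=> /not_implyP[psi0] /not_implyP[bpsi] /negP; rewrite -ltNge => big.
  have e0 : 0 < e by case/andP: e01.
  have A0 : 0 <= A by apply: le_trans (bpsi 0%N 0 isT); exact: normr_ge0.
  have Agt0 : 0 < A.
    rewrite lt0r A0 andbT; apply: contraTneq big => A00; rewrite -leNgt A00 mulr0.
    have psiE : psi = fun=> 0.
      apply/funext => y; apply/normr0_eq0/eqP; rewrite eq_le normr_ge0 andbT -A00.
      exact: (bpsi 0%N y isT).
    by rewrite psiE /dilation (clinear0 cp.1) normr0.
  have ub1 : unit_ball (n + N0) (fun y => A^-1 * psi y).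
    split; first exact: smoothZ.
      by move=> y /psi0 ->; rewrite mulr0.
    move=> k y kn; rewrite derive1nZ// normrM gtr0_norm ?invr_gt0//.
    by rewrite mulrC ler_pdivrMr// mul1r bpsi.
  have [C C0 HC] := crude e e0.
  pose S := [set `|dilation e psi| | psi in unit_ball (n + N0)].
  have hS : has_sup S.
    split; first by exists `|dilation e (fun y => A^-1 * psi y)|; exists (fun y => A^-1 * psi y).
    by exists C => _ [f uf <-]; apply: HC uf; exact: leq_addl.
  have S4 : 10/9 * 4 ^+ n < sup S.
    apply: (@lt_le_trans _ _ `|dilation e (fun y => A^-1 * psi y)|).
      by rewrite dilationZ// normrM gtr0_norm ?invr_gt0// [X in _ < X]mulrC ltr_pdivlMr.
    by apply: ub_le_sup; [exact: hS.2|exists (fun y => A^-1 * psi y)].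
  have Sgt0 : 0 < sup S by apply: le_lt_trans S4; rewrite mulr_ge0// exprn_ge0.
  have [|_ [f uf <-] Hf] := sup_adherent (_ : 0 < sup S / 10) hS; first by rewrite divr_gt0.
  exists (e, f); split => //=.
    by apply: le_lt_trans Hf; have := S4; lra.
  move=> g ug; have : `|dilation e g| <= sup S.
    by apply: ub_le_sup; [exact: hS.2|exists g].
  by move: Hf; lra.
have [F HF] := choice near_ext.
pose e_ n := (F n).1; pose phi_ n := (F n).2.
pose xi n := fun y => 3^-1 ^+ n * phi_ n y.
(* Of A + B and A - B one has absolute value at least |B|; the sign is chosen so that earlier terms
   cannot cancel the new hump at its own scale. *)
pose next n (x : R -> R) := if `|dilation (e_ n) (xi n)| <= `|dilation (e_ n) (fun y => x y + xi n y)|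
  then (fun y => x y + xi n y) else (fun y => x y - xi n y).
pose x_ := fix x n : R -> R := if n is m.+1 then next m (x m) else fun=> 0.
have ub n : unit_ball (n + N0) (phi_ n) by have [] := HF n.
have sxi n : Cinf (xi n) by apply: smoothZ; have [] := ub n.
have x_smooth n : Cinf (x_ n).
  elim: n => [|n IH] /=; first exact: smooth_cst.
  by rewrite /next; case: ifP => _; [exact: smoothD|exact: smoothB].
have x_supp n y : 4 <= `|y| -> x_ n y = 0.
  move=> y4; elim: n => [|n IH] //=.
  have xi0 : xi n y = 0 by rewrite /xi; have [_ -> //] := ub n; rewrite mulr0.
  by rewrite /next; case: ifP => _; rewrite IH xi0 ?addr0 ?subr0.
have xi_le n k y : (k <= n + N0)%N -> `|derive1n k (xi n) y| <= 3^-1 ^+ n.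
  move=> kn; have [s1 _ b1] := ub n; rewrite derive1nZ// normrM ger0_norm ?exprn_ge0//.
  by rewrite ler_piMr ?exprn_ge0// b1.
have x_close n k y : (k <= n + N0)%N -> `|derive1n k (x_ n.+1) y - derive1n k (x_ n) y| <= 3^-1 ^+ n.
  move=> kn; rewrite /= /next; case: ifP => _.
    by rewrite derive1nD// addrAC subrr add0r xi_le.
  by rewrite derive1nB// addrAC subrr add0r normrN xi_le.
have x_big n : 3^-1 ^+ n * `|dilation (e_ n) (phi_ n)| <= `|dilation (e_ n) (x_ n.+1)|.
  have -> : 3^-1 ^+ n * `|dilation (e_ n) (phi_ n)| = `|dilation (e_ n) (xi n)|.
    by have [sp _ _] := ub n; rewrite /xi dilationZ// normrM [`|3^-1 ^+ n|]ger0_norm ?exprn_ge0.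
  set A := dilation (e_ n) (x_ n); set B := dilation (e_ n) (xi n).
  have Dp : dilation (e_ n) (fun y => x_ n y + xi n y) = A + B by rewrite dilationD.
  have Dm : dilation (e_ n) (fun y => x_ n y - xi n y) = A - B by rewrite dilationB.
  have -> : x_ n.+1 = next n (x_ n) by [].
  rewrite /next Dp -/B; case: (leP `|B| `|A + B|) => H; rewrite ?Dp ?Dm//.
  have := ler_normB (A + B) (A - B); have -> : A + B - (A - B) = 2 * B by ring.
  by rewrite normrM normr_nat; lra.
have [sL L0 closeL] := smooth_limit x_smooth x_supp x_close.
set L := dlim x_ 0%N in sL L0 closeL.
have tL : test_function L.
  by apply: (test_functionI (M := 4)) => // y /ltW /L0.
(* The part of L beyond stage [n.+1] has size at most [3^-1 ^+ n / 2] in the norm of order [n + N0];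
   near-extremality bounds its dilation by 5/9 of the hump. At least 4/9 of (4/3) ^+ n survives. *)
have big n : 2/5 * (4/3) ^+ n <= `|dilation (e_ n) L|.
  have [e01 uf f4 fext] := HF n.
  pose g y := (2 * 3 ^+ n) * (L y - x_ n.+1 y).
  have p3 : 0 < 3 ^+ n :> R by rewrite exprn_gt0.
  have ug : unit_ball (n + N0) g.
    split.
    - by apply: smoothZ; exact: smoothB.
    - by move=> y y4; rewrite /g L0// x_supp// subrr mulr0.
    - move=> k y kn; rewrite /g derive1nZ; last exact: smoothB.
      rewrite normrM gtr0_norm ?mulr_gt0// mulrC -ler_pdivlMr ?mulr_gt0//.
      apply: le_trans (closeL k n.+1 y _) _; first by rewrite addSn leqW.
      by rewrite exprSr div1r invfM exprVn; lra.
  have := fext g ug; rewrite -/(e_ n) -/(phi_ n).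
  rewrite /g dilationZ; last exact: smoothB.
  rewrite dilationB// normrM gtr0_norm ?mulr_gt0// => H.
  have B := x_big n; move: H B f4; rewrite -/(e_ n) -/(phi_ n).
  set P := `|dilation (e_ n) (phi_ n)|.
  have tri := lerB_dist (dilation (e_ n) (x_ n.+1)) (dilation (e_ n) L).
  rewrite distrC in tri; move: tri.
  set X := `|dilation (e_ n) (x_ n.+1)|; set Y := `|dilation (e_ n) L|.
  set Z := `|dilation (e_ n) L - _| => tri H B f4.
  have -> : (4 / 3) ^+ n = 4 ^+ n / 3 ^+ n :> R by rewrite expr_div_n.
  rewrite exprVn mulrC ler_pdivrMr// in B.
  have {}H : Z * 3 ^+ n <= 5/9 * P by lra.
  rewrite mulrA ler_pdivrMr//.
  have : X * 3 ^+ n <= Y * 3 ^+ n + Z * 3 ^+ n by rewrite -mulrDl ler_pM2r//; lra.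
  have : 0 <= 4 ^+ n :> R by rewrite exprn_ge0.
  lra.
(* The threshold 1/2 is below 2/5 * 4/3, so one further stage already gives the contradiction. *)
have [d d0 Hd] : exists2 d, 0 < d & forall e, 0 < e < d -> `|dilation e L| < 1/2.
  have /cvgr0Pnorm_lt/(_ (1/2)) := van L tL; rewrite divr_gt0// => /(_ isT).
  move=> [d /= d0 H]; exists d => // e /andP[e0 ed]; apply: H => //=.
  by rewrite sub0r normrN gtr0_norm.
have [n nd] : exists n, n.+1%:R^-1 < d.
  by exists (Num.truncn d^-1); rewrite invf_plt ?posrE// truncnS_gt.
have dn m : (n <= m)%N -> `|dilation (e_ m) L| < 1/2.
  move=> nm; apply: Hd; have [/andP[-> em] _ _ _] := HF m.
  rewrite (lt_trans em)// (le_lt_trans _ nd)// lef_pV2 ?posrE// ler_nat.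
  by rewrite ltnS.
have := dn (n + 1)%N (leq_addr _ _); have := big (n + 1)%N.
have : 4/3 <= (4/3) ^+ (n + 1) :> R.
  by rewrite addn1 exprS ler_peMr// exprn_ege1//; lra.
lra.
Qed.

End UniformBound.

End GlidingHump.

(** * Dyadic estimates around a point *)

Section Dyadic.
Context {R : realType}.
Implicit Types (f psi kappa chi : R -> R) (x y z e A rho : R).
Variables (p : (R -> R) -> R) (c : R).
Hypothesis cp : cdist p.

(** The estimate at a single scale e: after rescaling to unit size, the cut-off function is
    supported in [- 4, 4] and its derivatives are all of size A / e. Bounds on kappa are required
    only where chi is not locally zero. *)
Let piece (N : nat) (C B e0 e A : R) kappa chi : 0 <= C ->
  (forall e psi A, 0 < e < e0 -> Cinf psi -> (forall y, 4 <= `|y| -> psi y = 0) ->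
    (forall k y, (k <= N)%N -> `|derive1n k psi y| <= A) -> `|dilation p c e psi| <= C * A) ->
  0 < e < e0 -> Cinf kappa -> Cinf chi -> (forall y, 4 <= `|y| -> chi y = 0) ->
  0 <= A -> (forall k y, (k <= N)%N -> `|derive1n k chi y| <= B) ->
  (forall z, (\forall w \near z, chi w = 0) \/
    forall k, (k <= N)%N -> `|derive1n k kappa (c + e * z)| <= A * e^-1 ^+ k.+1) ->
  `|p (fun y => kappa y * chi ((y - c) / e))| <= C * (2 ^+ N * B) * (A / e).
Proof.
move=> C0 H e01 sk sc c0 A0 cB kA; have e0' : 0 < e by case/andP: e01.
have e1 : e != 0 by rewrite gt_eqF.
pose f z := kappa ((z - - (c / e)) / e^-1).
have sf : Cinf f by exact: smooth_affine.
have B0 : 0 <= B by apply: le_trans (cB 0%N 0 isT); exact: normr_ge0.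
have -> : (fun y => kappa y * chi ((y - c) / e)) =
    (fun y => (fun z => f z * chi z) ((y - c) / e)).
  by apply/funext => y; rewrite /f; congr (kappa _ * _); field.
have -> : C * (2 ^+ N * B) * (A / e) = C * (2 ^+ N * (A / e * B)) by ring.
apply: (H e (fun z => f z * chi z) _ e01); first exact: smoothM.
  by move=> y /c0 ->; rewrite mulr0.
move=> k z kN; have [cz|Hz] := kA z.
  rewrite derive1n_near0; last by near=> w; rewrite (near cz w)// mulr0.
  by rewrite normr0 !mulr_ge0// ?exprn_ge0// invr_ge0 ltW.
have AB0 : 0 <= A / e * B by rewrite !mulr_ge0// invr_ge0 ltW.
apply: le_trans (_ : 2 ^+ k * (A / e * B) * 1 ^+ k <= _); last first.
  by rewrite expr1n mulr1 ler_wpM2r// ler_weXn2l// ler1n.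
apply: derive1nM_bound => // j jk; rewrite expr1n mulr1.
  rewrite derive1n_affine// normrM invrK.
  have -> : (z - - (c / e)) * e = c + e * z by field.
  rewrite ger0_norm ?exprn_ge0 ?(ltW e0')//.
  apply: le_trans (ler_wpM2l _ (Hz j (leq_trans jk kN))) _.
    by rewrite exprn_ge0 ?(ltW e0').
  have -> : e ^+ j * (A * e^-1 ^+ j.+1) = A / e * (e * e^-1) ^+ j.
    by rewrite exprMn exprS; ring.
  by rewrite mulfV// expr1n mulr1.
by apply: cB; exact: leq_trans jk kN.
Unshelve. all: end_near. Qed.

Lemma smooth_plateau_at e : Cinf (fun y => plateau ((y - c) / e)).
Proof. by apply: smooth_affine; exact: smooth_plateau. Qed.

(* Dyadic decomposition of [kappa] around c, each annulus being controlled by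
   [dil_bounded] at its own scale. *)
Lemma dyadic_bound : dil_bounded p c -> exists (C : R) (N : nat) (rho0 : R), [/\ 0 <= C, 0 < rho0 &
  forall rho kappa A, 0 < rho < rho0 -> Cinf kappa -> 0 <= A ->
    (forall k y, (k <= N)%N ->
       `|derive1n k kappa y| <= A * (Num.max rho `|y - c|)^-1 ^+ k.+1) ->
    `|p kappa| <= C * (A / rho)].
Proof.
move=> [C1 [N1 [e1 [C10 e10 H1]]]].
have [lp [M [C2 [N2 [M0 C20 H2]]]]] := cp.
pose N := maxn N1 N2.
have sP := @smooth_plateau R.
pose ann (z : R) := plateau ((z - 0) / 2) - plateau z.
have sann : Cinf ann by apply: smoothB; [exact: smooth_affine|exact: sP].
have P4 (y : R) : 4 <= `|y| -> plateau y = 0 by move=> y4; rewrite plateau0//; lra.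
have ann4 (y : R) : 4 <= `|y| -> ann y = 0.
  move=> y4; rewrite /ann (P4 y)// subr0 plateau0// subr0 normrM normfV normr_nat; lra.
have [B1 B10 HB1] := @smooth_bounded_supp R plateau 4 N sP (fun x h => P4 x (ltW h)).
have [B2 B20 HB2] := @smooth_bounded_supp R ann 4 N sann (fun x h => ann4 x (ltW h)).
pose B := Num.max B1 B2.
have B0 : 0 <= B by rewrite le_max B10.
have PB k y : (k <= N)%N -> `|derive1n k plateau y| <= B :> R.
  by move=> kN; rewrite le_max HB1.
have AB k y : (k <= N)%N -> `|derive1n k ann y| <= B.
  by move=> kN; rewrite le_max HB2// orbT.
have H1' e psi A : 0 < e < e1 -> Cinf psi -> (forall y, 4 <= `|y| -> psi y = 0) ->
    (forall k y, (k <= N)%N -> `|derive1n k psi y| <= A) -> `|dilation p c e psi| <= C1 * A.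
  move=> ? ? ? HA; apply: H1 => // k y kN; apply: HA.
  by rewrite (leq_trans kN)// leq_maxl.
pose C' := C1 * (2 ^+ N * B).
have C'0 : 0 <= C' by rewrite !mulr_ge0// exprn_ge0.
pose d := e1 / 2.
have d0 : 0 < d by rewrite divr_gt0.
pose D := \sum_(k < N.+1) d^-1 ^+ k.+1.
have D0 : 0 <= D by apply: sumr_ge0 => i _; rewrite exprn_ge0// invr_ge0 ltW.
exists (3 * C' + C2 * (2 ^+ N * ((1 + B) * D)) * e1), N, e1; split => //.
  by rewrite addr_ge0 ?mulr_ge0 ?exprn_ge0 ?addr_ge0// ltW.
move=> rho kappa A /andP[rho0 rhoe] sk A0 HA.
pose S j y := kappa y * plateau ((y - c) / (2 ^+ j * rho)).
have sS j : Cinf (S j) by apply: smoothM => //; exact: smooth_plateau_at.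
have scale_gt0 j : 0 < 2 ^+ j * rho by rewrite mulr_gt0// exprn_gt0.
have AR : 0 <= A / rho by rewrite divr_ge0// ltW.
(* The innermost piece costs 1 and the annulus at scale [2 ^+ j * rho] costs [2^-1 ^+ j], in units
   of C' A / rho; the partial sums are 3 - 2 * 2^-1 ^+ j. *)
have HS j : 2 ^+ j * rho < e1 -> `|p (S j)| <= C' * (A / rho) * (3 - 2 * 2^-1 ^+ j).
  elim: j => [|j IH] je.
    rewrite mul1r in je.
    have -> : 3 - 2 * 2^-1 ^+ 0 = 1 :> R by rewrite expr0; lra.
    rewrite mulr1 /S mul1r.
    apply: (piece C10 H1') => //; first by rewrite rho0.
    move=> z; right => k kN; apply: le_trans (HA k _ kN) _.
    rewrite ler_wpM2l// lerXn2r ?nnegrE ?invr_ge0 ?(ltW rho0) ?le_max ?(ltW rho0)//.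
    by rewrite lef_pV2 ?posrE ?lt_max ?rho0// le_max lexx.
  have je' : 2 ^+ j * rho < e1.
    by apply: lt_trans je; rewrite exprS -mulrA ltr_pMl// ltr1n.
  have -> : S j.+1 = (fun y => S j y + kappa y * ann ((y - c) / (2 ^+ j * rho))).
    apply/funext => y; rewrite /S /ann subr0.
    have -> : (y - c) / (2 ^+ j * rho) / 2 = (y - c) / (2 ^+ j.+1 * rho).
      by rewrite exprS; field; rewrite !gt_eqF// exprn_gt0.
    by ring.
  rewrite (clinearD lp)//; last by apply: smoothM => //; exact: smooth_affine.
  apply: le_trans (ler_normD _ _) _.
  have : `|p (fun y => kappa y * ann ((y - c) / (2 ^+ j * rho)))| <= C' * (A / (2 ^+ j * rho)).
    apply: (piece C10 H1') => //; first by rewrite scale_gt0.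
    move=> z; have [z1|z1] := ltP `|z| 1.
      left; near=> w; have w1 : `|w| < 1 by near: w; exact: near_norm_lt.
      by rewrite /ann !plateau1 ?subrr ?ltW// subr0 normrM normfV normr_nat; lra.
    right => k kN; apply: le_trans (HA k _ kN) _.
    have zr : 2 ^+ j * rho <= `|c + 2 ^+ j * rho * z - c|.
      rewrite addrAC subrr add0r normrM gtr0_norm// ler_peMr//; exact: ltW.
    rewrite ler_wpM2l// lerXn2r ?nnegrE ?invr_ge0 ?(ltW (scale_gt0 j)) ?le_max ?(ltW rho0)//.
    by rewrite lef_pV2 ?posrE ?lt_max ?rho0// le_max zr orbT.
  move=> /(lerD (IH je')) /le_trans; apply.
  have -> : A / (2 ^+ j * rho) = A / rho * 2^-1 ^+ j.
    by rewrite exprVn; field; rewrite !gt_eqF// exprn_gt0.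
  by rewrite exprS; lra.
(* J is the last dyadic scale below e1. What remains lives at distance at least e1 / 2 from c, where
   continuity of p alone suffices. *)
have [J [Je Jd]] : exists J, 2 ^+ J * rho < e1 /\ d <= 2 ^+ J * rho.
  have ex : exists n, e1 <= 2 ^+ n * rho.
    exists (Num.truncn (e1 / rho)).+1; rewrite -ler_pdivrMr//.
    apply: le_trans (ltW (truncnS_gt _)) _.
    by rewrite -natrX ler_nat ltnW// ltn_expl.
  have [n Hn nmin] := ex_minnP ex.
  case: n Hn nmin => [|n] Hn nmin; first by move: Hn; rewrite mul1r leNgt rhoe.
  exists n; split.
    by rewrite ltNge; apply/negP => /nmin; rewrite ltnn.
  by rewrite /d ler_pdivrMr// mulrC mulrA -exprS.
pose e := 2 ^+ J * rho; have e0 : 0 < e := scale_gt0 J.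
pose T y := kappa y * (1 - plateau ((y - c) / e)).
have sQ : Cinf (fun y : R => 1 - plateau ((y - c) / e)).
  by apply: smoothB; [exact: smooth_cst|exact: smooth_plateau_at].
have -> : kappa = (fun y => S J y + T y).
  by apply/funext => y; rewrite /S /T -/e; ring.
rewrite (clinearD lp)//; last exact: smoothM.
apply: le_trans (ler_normD _ _) _; rewrite mulrDl; apply: lerD.
  apply: le_trans (HS J Je) _.
  have v0 : 0 <= 2^-1 ^+ J :> R by rewrite exprn_ge0.
  have -> : 3 * C' * (A / rho) = C' * (A / rho) * 3 by ring.
  apply: ler_wpM2l; first exact: mulr_ge0.
  by rewrite gerBl mulr_ge0.
apply: le_trans (_ : C2 * (2 ^+ N * (A * (1 + B) * D)) <= _); last first.
  have -> : C2 * (2 ^+ N * ((1 + B) * D)) * e1 * (A / rho) =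
     (C2 * (2 ^+ N * (A * (1 + B) * D))) * (e1 / rho) by field; rewrite gt_eqF.
  rewrite ler_peMr//; last by rewrite ler_pdivlMr// mul1r ltW.
  by rewrite !mulr_ge0// ?exprn_ge0// addr_ge0.
apply: H2 => [|k y kN2 _]; first exact: smoothM.
have kN : (k <= N)%N by rewrite (leq_trans kN2)// leq_maxr.
have B1' : 0 <= 1 + B by rewrite addr_ge0.
have [y1|y1] := ltP `|(y - c) / e| 1.
  rewrite derive1n_near0 ?normr0; first by rewrite !mulr_ge0// ?exprn_ge0.
  have cont : (fun y : R => `|(y - c) / e|) @ y --> `|(y - c) / e|.
    apply: cvg_norm; apply: cvgM; last exact: cvg_cst.
    by apply: cvgB; [exact: cvg_id|exact: cvg_cst].
  near=> w; have w1 : `|(w - c) / e| < 1 by near: w; exact: (cvgr_lt _ cont).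
  by rewrite /T plateau1 ?subrr ?mulr0// ltW.
have ye : d <= `|y - c|.
  by move: y1; rewrite normrM normfV (gtr0_norm e0) ler_pdivlMr// mul1r; exact: le_trans.
apply: le_trans (_ : 2 ^+ k * (A * d^-1 * (1 + B)) * d^-1 ^+ k <= _); last first.
  rewrite -mulrA; apply: ler_pM; rewrite ?exprn_ge0// ?mulr_ge0 ?invr_ge0 ?(ltW d0)//.
  - by rewrite exprn_ge0// invr_ge0 ltW.
  - by rewrite ler_weXn2l// ler1n.
  - have -> : A * d^-1 * (1 + B) * d^-1 ^+ k = A * (1 + B) * d^-1 ^+ k.+1 by rewrite exprS; ring.
    rewrite ler_wpM2l ?mulr_ge0//.
    rewrite /D (bigD1 (Ordinal (kN : (k < N.+1)%N)))//= lerDl.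
    by apply: sumr_ge0 => i _; rewrite exprn_ge0// invr_ge0 ltW.
have di0 : 0 <= d^-1 by rewrite invr_ge0 ltW.
apply: derive1nM_bound => // j jk.
  apply: le_trans (HA j y (leq_trans jk kN)) _.
  rewrite -mulrA -exprS ler_wpM2l// lerXn2r ?nnegrE ?invr_ge0 ?le_max ?(ltW rho0) ?(ltW d0)//.
  by rewrite lef_pV2 ?posrE ?lt_max ?rho0// le_max ye orbT.
case: j jk => [|j] jk.
  rewrite /= mulr1; apply: le_trans (_ : 1 <= _); last by rewrite lerDl.
  by rewrite ger0_norm ?subr_ge0 ?plateau_le1// gerBl plateau_ge0.
rewrite derive1nB; [|exact: smooth_cst|exact: smooth_plateau_at].
rewrite derive1n_cst sub0r normrN derive1n_affine// normrM mulrC.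
apply: ler_pM => //; first by rewrite (le_trans (PB _ _ (leq_trans jk kN)))// lerDr.
rewrite ger0_norm; last by rewrite exprn_ge0// invr_ge0 ltW.
by rewrite lerXn2r ?nnegrE ?invr_ge0 ?(ltW e0) ?(ltW d0)// lef_pV2 ?posrE.
Unshelve. all: end_near. Qed.

End Dyadic.

(** * Boundary behaviour of the Poisson extension *)

Section Extension.
Context {R : realType}.
Implicit Types (f psi kappa chi : R -> R) (x y z s t e A rho l r : R).

(* [pkern x t] is pi times the Poisson kernel of the upper half-plane at (x, t),
   so [pext p] is pi times the harmonic extension of [p]. *)
Definition pkern x t : R -> R := fun y => t / ((y - x) ^+ 2 + t ^+ 2).

Definition pext p x t : R := p (pkern x t).

Let iexp_ge0 s n : 0 < s -> 0 <= s^-1 ^+ n.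
Proof. by move=> s0; rewrite exprn_ge0// invr_ge0 ltW. Qed.

Lemma pkernE x t : pkern x t = fun y => - ckern true 1 x t y.
Proof. by apply/funext => y; rewrite /pkern /ckern /=; ring. Qed.

Lemma smooth_pkern x t : 0 < t -> Cinf (pkern x t).
Proof.
move=> t0; rewrite pkernE.
have -> : (fun y => - ckern true 1 x t y) = (fun y => -1 * ckern true 1 x t y).
  by apply/funext => y; rewrite mulN1r.
by apply: smoothZ; exact: smooth_ckern.
Qed.

Lemma pkern_gt0 x t y : 0 < t -> 0 < pkern x t y.
Proof. by move=> t0; rewrite divr_gt0// den_gt0. Qed.

Lemma norm_derive1n_pkern k x t y : 0 < t ->
  `|derive1n k (pkern x t) y| = `|derive1n k (ckern true 1 x t) y|.
Proof.
move=> t0; rewrite pkernE.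
have -> : (fun y => - ckern true 1 x t y) = (fun y => -1 * ckern true 1 x t y).
  by apply/funext => z; rewrite mulN1r.
by rewrite derive1nZ ?mulN1r ?normrN//; exact: smooth_ckern.
Qed.

Lemma derive1n_pkern_le N k x t y s : (k <= N)%N -> 0 < t -> 0 < s -> s <= `|y - x| ->
  `|derive1n k (pkern x t) y| <= cfactN 1 N * N.+1%:R * t * s^-1 ^+ k.+2.
Proof.
move=> kN t0 s0 sy; rewrite norm_derive1n_pkern//.
apply: le_trans (derive1n_ckern_im_le (r := s) _ _ _ _ _) _ => //.
  apply: le_trans (_ : (y - x) ^+ 2 <= _); last by rewrite lerDl sqr_ge0.
  by rewrite -[X in _ <= X](@real_normK _ (y - x)) ?num_real// lerXn2r ?nnegrE ?(ltW s0).
rewrite add1n -!mulrA; apply: ler_pM => //; first exact: cfact_ge0.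
- by apply: mulr_ge0 => //; apply: mulr_ge0 (ltW t0) (iexp_ge0 _ s0).
- exact: cfact_le.
- by apply: ler_wpM2r; [apply: mulr_ge0 (ltW t0) (iexp_ge0 _ s0)|rewrite ler_nat].
Qed.

Section OneFunctional.
Variable p : (R -> R) -> R.
Hypothesis cp : cdist p.

Lemma pext_cext x t : 0 < t -> pext p x t = - cext p true 1 x t.
Proof.
move=> t0; rewrite /pext pkernE (clinearN cp.1)//; exact: smooth_ckern.
Qed.

(* Positivity of [p] on the closed interval [l, r]. *)
Definition pos_on l r := forall psi, Cinf psi -> (forall x, 0 <= psi x) ->
  (forall x, ~~ (l <= x <= r) -> psi x = 0) -> 0 <= p psi.

Lemma pos_onW l r l' r' : l <= l' -> r' <= r -> pos_on l r -> pos_on l' r'.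
Proof.
move=> ll rr H psi s p0 ps; apply: H => // x; apply: contraNeq => px.
have : l' <= x <= r' by apply: contraNT px => /ps ->.
by move=> /andP[? ?]; rewrite (le_trans ll)// (le_trans _ rr).
Qed.

(** A plateau splits the kernel in two. The part near x0 is nonnegative and supported where p is
    positive; the far part and its derivatives are O(t), since x stays within rho / 2 of x0. *)
Lemma pext_pos_bottom x0 rho : 0 < rho -> pos_on (x0 - 2 * rho) (x0 + 2 * rho) ->
  exists2 C, 0 <= C & forall x t, `|x - x0| <= rho / 2 -> 0 < t -> - (C * t) <= pext p x t.
Proof.
move=> rho0 pos; have [lp [M [C [N [M0 C0 H]]]]] := cp.
pose chi y := plateau ((y - x0) / rho).
have schi : Cinf chi by apply: smooth_affine; exact: smooth_plateau.
have s1 : Cinf (fun y => 1 - chi y) by apply: smoothB => //; exact: smooth_cst.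
have dd0 n (u v : R) : 0 <= u -> 0 <= v -> 0 <= 2 ^+ n * (u * v).
  by move=> u0 v0; apply: mulr_ge0; [rewrite exprn_ge0|exact: mulr_ge0].
have [B B0 HB] : exists2 B, 0 <= B & forall k y, (k <= N)%N -> `|derive1n k (fun y => 1 - chi y) y| <= B.
  have [|B B0 HB] := @smooth_bounded_supp R chi (`|x0| + 2 * rho) N schi.
    move=> y yx; rewrite /chi plateau0// normrM normfV (gtr0_norm rho0) ler_pdivlMr//.
    by have := lerB_dist y x0; lra.
  exists (1 + B) => [|k y kN]; first by rewrite addr_ge0.
  rewrite derive1nB//; last exact: smooth_cst.
  apply: le_trans (ler_normB _ _) _; apply: lerD; last exact: HB.
  by case: k kN => [|k] _; rewrite ?derive1n_cst ?normr0//= normr1.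
pose D := cfactN 1 N * N.+1%:R * \sum_(k < N.+1) (rho / 2)^-1 ^+ k.+2.
have rh0 : 0 < rho / 2 by rewrite divr_gt0.
have D0 : 0 <= D.
  rewrite !mulr_ge0 ?cfactN_ge0//; apply: sumr_ge0 => i _.
  by rewrite exprn_ge0// invr_ge0 ltW.
exists (C * (2 ^+ N * (D * B))) => [|x t xx t0]; first exact: mulr_ge0 C0 (dd0 _ _ _ D0 B0).
have sk := smooth_pkern x t0.
have -> : pext p x t = p (fun y => pkern x t y * chi y) + p (fun y => pkern x t y * (1 - chi y)).
  rewrite -(clinearD lp); [|exact: smoothM|exact: smoothM].
  by congr p; apply/funext => y; ring.
have pp : 0 <= p (fun y => pkern x t y * chi y).
  apply: pos; first exact: smoothM.
    by move=> y; rewrite mulr_ge0 ?plateau_ge0// ltW// pkern_gt0.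
  move=> y yx; rewrite /chi plateau0 ?mulr0// normrM normfV (gtr0_norm rho0) ler_pdivlMr//.
  by rewrite leNgt; apply: contra yx; rewrite ltr_norml => /andP[? ?]; apply/andP; split; lra.
suff : `|p (fun y => pkern x t y * (1 - chi y))| <= C * (2 ^+ N * (D * B)) * t.
  by rewrite ler_norml => /andP[? _]; lra.
rewrite -mulrA; apply: H; first exact: smoothM.
move=> k y kN _; have [yx|yx] := ltP `|y - x0| rho.
  rewrite derive1n_near0 ?normr0.
    exact: mulr_ge0 (dd0 _ _ _ D0 B0) (ltW t0).
  have cont : (fun y : R => `|y - x0|) @ y --> `|y - x0|.
    by apply: cvg_norm; apply: cvgB; [exact: cvg_id|exact: cvg_cst].
  near=> w; have w1 : `|w - x0| < rho by near: w; exact: (cvgr_lt _ cont).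
  rewrite /chi plateau1 ?subrr ?mulr0//.
  by rewrite normrM normfV (gtr0_norm rho0) ler_pdivrMr// mul1r ltW.
have yx2 : rho / 2 <= `|y - x|.
  have -> : y - x = (y - x0) - (x - x0) by ring.
  apply: le_trans (lerB_dist _ _); lra.
apply: le_trans (_ : 2 ^+ k * ((D * t) * B) * 1 ^+ k <= _).
  apply: derive1nM_bound => // j jk; rewrite expr1n mulr1.
    have jN := leq_trans jk kN.
    apply: le_trans (derive1n_pkern_le jN t0 rh0 yx2) _.
    rewrite [X in _ <= X]mulrAC ler_wpM2l//.
      by rewrite !mulr_ge0 ?cfactN_ge0// ltW.
    rewrite (bigD1 (Ordinal (jN : (j < N.+1)%N)))//= lerDl.
    by apply: sumr_ge0 => i _; rewrite exprn_ge0// invr_ge0 ltW.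
  by apply: HB; exact: leq_trans jk kN.
rewrite expr1n mulr1; have -> : 2 ^+ N * (D * B) * t = 2 ^+ N * (D * t * B) by ring.
apply: ler_wpM2r; first exact: mulr_ge0 (mulr_ge0 D0 (ltW t0)) B0.
by rewrite ler_weXn2l// ler1n.
Unshelve. all: end_near. Qed.

(* Corner estimate: near (c, 0) and to the right of c, where [p] is positive, a
   negative part of the extension is dominated by the harmonic barrier
   Im (- 1 / z ^ 2) / 2.  If x - c <= t, compare with the vertical line; if
   t <= x - c, remove from the kernel the part near x, which [p] maps to a
   nonnegative number. *)
Lemma pext_corner (c d eta m : R) : dil_bounded p c -> c < d -> 0 < eta -> 0 <= m ->
  (forall l r, c < l -> r < d -> pos_on l r) ->
  exists2 delta, 0 < delta & forall x t, c <= x -> x - c < delta -> 0 < t -> t < delta ->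
    - (m * t) <= pext p c t ->
    - (m * t) <= pext p x t + eta * ((x - c) * t / ((x - c) ^+ 2 + t ^+ 2) ^+ 2).
Proof.
move=> db cd eta0 m0 pos.
have [C [N [rho0 [C0 rho00 H]]]] := dyadic_bound cp db.
have [lp _] := cp.
pose c1 : R := cfactN 1 N * N.+1%:R.
have c10 : 0 <= c1 by rewrite mulr_ge0// cfactN_ge0.
have [B B0 HB] := @smooth_bounded_supp R plateau 2 N smooth_plateau (fun x h => plateau0 (ltW h)).
pose KA : R := C * (cfactN 2 N * 2 ^+ N.+2).
have p2 n : 0 <= 2 ^+ n :> R by rewrite exprn_ge0.
have KA0 : 0 <= KA by exact: mulr_ge0 C0 (mulr_ge0 (cfactN_ge0 _ _) (p2 _)).
pose K : R := c1 * 3 ^+ N.+2 + 2 ^+ N * c1 * (1 + B) * (4 * 6 ^+ N.+1).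
have B1' : 0 <= 1 + B by rewrite addr_ge0.
have p36 n m' : 0 <= n%:R ^+ m' :> R by rewrite exprn_ge0.
have K1' : 0 <= c1 * 3 ^+ N.+2 by exact: mulr_ge0 c10 (p36 3%N _).
have K2' : 0 <= 2 ^+ N * c1 * (1 + B) * (4 * 6 ^+ N.+1).
  apply: mulr_ge0; first exact: mulr_ge0 (mulr_ge0 (p2 _) c10) B1'.
  by apply: mulr_ge0 => //; exact: (p36 6%N).
have K0 : 0 <= K by exact: addr_ge0.
pose KB := C * K.
have KB0 : 0 <= KB by rewrite mulr_ge0.
(* KA and KB are the constants of the two regions; delta makes [4 * KA * t] and [4 * KB * (x - c)]
   at most eta. *)
pose delta := Num.min rho0 (Num.min ((d - c) / 2) (eta / (4 * (KA + KB + 1)))).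
have KK : 0 < 4 * (KA + KB + 1) by rewrite mulr_gt0// ltr_wpDl// addr_ge0.
exists delta; first by rewrite !lt_min rho00 !divr_gt0// subr_gt0.
move=> x t cx + t0 + Fc; rewrite !lt_min => /and3P[Xr Xd Xe] /and3P[tr td te].
have barr (u : R) : 0 <= u -> u < eta / (4 * (KA + KB + 1)) -> 4 * KA * u <= eta /\ 4 * KB * u <= eta.
  move=> u0; rewrite ltr_pdivlMr// => Hu.
  by split; apply: le_trans (ltW Hu); nra.
have F' s : is_derive s 1 (fun s => pext p s t) (- cext p true 2 s t).
  have E : (fun s => pext p s t) = (fun s => - cext p true 1 s t).
    by apply/funext => s'; exact: pext_cext.
  rewrite E -[cext p true 2 s t]mul1r; apply: is_deriveNr.
  exact: is_derive_cext_x.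
(* For x - c <= t the x-derivative of the extension is at most KA / t ^ 2, so moving from the line
   over c costs KA (x - c) / t ^ 2. The barrier is at least eta (x - c) / (4 t ^ 3) there. *)
have [Xt|tX] := leP (x - c) t.
  have F'b s : c <= s -> s <= x -> `|cext p true 2 s t| <= KA / t ^+ 2.
    move=> cs sx.
    have -> : KA / t ^+ 2 = C * (cfactN 2 N * 2 ^+ N.+2 / t / t).
      by rewrite /KA; field; rewrite gt_eqF.
    have A0 : 0 <= cfactN 2 N * 2 ^+ N.+2 / t.
      by apply: divr_ge0 (ltW t0); exact: mulr_ge0 (cfactN_ge0 _ _) (p2 _).
    apply: (H t) => //; [by rewrite t0|exact: smooth_ckern|].
    move=> k y kN; set mx := Num.max t `|y - c|.
    have mx0 : 0 < mx by rewrite lt_max t0.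
    apply: le_trans (derive1n_ckern_le (r := mx / 2) _ _ _ _ _ _) _ => //.
      by rewrite divr_gt0.
      have yc : `|y - c| <= `|y - s| + t.
        have -> : y - c = (y - s) + (s - c) by ring.
        by apply: le_trans (ler_normD _ _) _; rewrite lerD2l ger0_norm; lra.
      have mle : mx <= `|y - s| + t by rewrite ge_max yc lerDr normr_ge0.
      have n0 := normr_ge0 (y - s).
      have sq : mx ^+ 2 <= (`|y - s| + t) ^+ 2.
        by rewrite lerXn2r ?nnegrE ?(ltW mx0)// addr_ge0// ltW.
      have am : 0 <= (`|y - s| - t) ^+ 2 by exact: sqr_ge0.
      rewrite -(@real_normK _ (y - s)) ?num_real// expr_div_n.
      by rewrite ler_pdivrMr//; move: sq am; rewrite !sqrrD sqrrN; nra.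
    have kN2 : (2 : R) ^+ k.+2 <= 2 ^+ N.+2 by rewrite ler_weXn2l// ?ler1n.
    have mt : mx^-1 <= t^-1 by rewrite lef_pV2 ?posrE// le_max lexx.
    have mi0 n : 0 <= mx^-1 ^+ n by exact: iexp_ge0.
    have -> : (mx / 2)^-1 = 2 * mx^-1 by rewrite invf_div.
    rewrite add2n exprMn.
    have -> : cfactN 2 N * 2 ^+ N.+2 / t * mx^-1 ^+ k.+1 =
        cfactN 2 N * (2 ^+ N.+2 * (mx^-1 ^+ k.+1 * t^-1)) by ring.
    apply: ler_pM; [exact: cfact_ge0|exact: mulr_ge0|exact: cfact_le|].
    apply: ler_pM => //; rewrite exprSr; exact: ler_wpM2l.
  have cF : {within `[c, x], continuous (fun s => pext p s t)}.
    by apply: derivable_within_continuous => s _; have [] := F' s.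
  have [s + E] := MVT_segment cx (fun s _ => F' s) cF.
  rewrite in_itv /= => /andP[cs sx].
  have b := F'b s cs sx; rewrite ler_norml in b; case/andP: b => b1 b2.
  have X0 : 0 <= x - c by rewrite subr_ge0.
  have [_ _] := barr t (ltW t0) te.
  have [hA _] := barr t (ltW t0) te.
  suff : KA / t ^+ 2 * (x - c) <= eta * ((x - c) * t / ((x - c) ^+ 2 + t ^+ 2) ^+ 2).
    have : cext p true 2 s t * (x - c) <= KA / t ^+ 2 * (x - c) by rewrite ler_wpM2r.
    move: E; rewrite mulNr; lra.
  have den : ((x - c) ^+ 2 + t ^+ 2) ^+ 2 <= 4 * t ^+ 4.
    have -> : 4 * t ^+ 4 = (t ^+ 2 + t ^+ 2) ^+ 2 by ring.
    by rewrite lerXn2r ?nnegrE ?addr_ge0 ?sqr_ge0// lerD2r lerXn2r ?nnegrE ?(ltW t0).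
  apply: le_trans (_ : eta * ((x - c) * t / (4 * t ^+ 4)) <= _); last first.
    rewrite ler_wpM2l ?(ltW eta0)// ler_wpM2l ?mulr_ge0 ?(ltW t0)//.
    by rewrite lef_pV2 ?posrE ?exprn_gt0 ?den_gt0// mulr_gt0// exprn_gt0.
  have -> : eta * ((x - c) * t / (4 * t ^+ 4)) = eta * ((4 * t)^-1 * (x - c) / t ^+ 2).
    by field; rewrite gt_eqF.
  rewrite mulrAC -mulrA !mulrA ler_wpM2r ?invr_ge0 ?exprn_ge0 ?(ltW t0)//.
  by rewrite ler_wpM2r// ler_pdivlMr ?mulr_gt0//; lra.
set X := x - c; have X0 : 0 < X := lt_trans t0 tX.
have X4 : 0 < X / 4 by rewrite divr_gt0.
pose chi y := plateau ((y - x) / (X / 4)).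
have schi : Cinf chi by apply: smooth_affine; exact: smooth_plateau.
have s1 : Cinf (fun y => 1 - chi y) by apply: smoothB => //; exact: smooth_cst.
have sk := smooth_pkern x t0.
have -> : pext p x t = p (fun y => pkern x t y * chi y) + p (fun y => pkern x t y * (1 - chi y)).
  rewrite -(clinearD lp); [|exact: smoothM|exact: smoothM].
  by congr p; apply/funext => y; ring.
have pp : 0 <= p (fun y => pkern x t y * chi y).
  apply: (pos (x - X / 2) (x + X / 2)); [by rewrite /X; lra|by move: Xd; rewrite /X; lra|exact: smoothM| |].
    by move=> y; rewrite mulr_ge0 ?plateau_ge0// ltW// pkern_gt0.
  move=> y yx; rewrite /chi plateau0 ?mulr0// normrM normfV (gtr0_norm X4) ler_pdivlMr//.
  by rewrite leNgt; apply: contra yx; rewrite ltr_norml => /andP[? ?]; apply/andP; split; lra.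
(* [dyadic_bound] is used at radius X. The kernel with the neighbourhood of x removed vanishes for
   |y - x| < X / 4 and is the bare kernel for |y - x| > X / 2; in between, derivatives of the cutoff
   cost powers of 4 / X. *)
have bd : `|p (fun y => pkern x t y * (1 - chi y))| <= KB * t / X ^+ 2.
  have -> : KB * t / X ^+ 2 = C * (K * t / X / X) by rewrite /KB; field; rewrite gt_eqF.
  have KX : 0 <= K * t / X by rewrite !mulr_ge0 ?invr_ge0 ?(ltW t0) ?(ltW X0).
  apply: (H X) => //; [by rewrite X0|exact: smoothM|].
  move=> k y kN; set mx := Num.max X `|y - c|.
  have mx0 : 0 < mx by rewrite lt_max X0.
  have mi0 : 0 <= mx^-1 by rewrite invr_ge0 ltW.
  have mxn n : 0 <= mx^-1 ^+ n by exact: iexp_ge0.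
  have mX : mx^-1 <= X^-1 by rewrite lef_pV2 ?posrE// le_max lexx.
  have mle : mx <= `|y - x| + X.
    rewrite ge_max lerDr normr_ge0 /=.
    have -> : y - c = (y - x) + X by rewrite /X; ring.
    by apply: le_trans (ler_normD _ _) _; rewrite (gtr0_norm X0).
  have cont : (fun y : R => `|y - x|) @ y --> `|y - x|.
    by apply: cvg_norm; apply: cvgB; [exact: cvg_id|exact: cvg_cst].
  have [yx|yx] := ltP `|y - x| (X / 4).
    rewrite derive1n_near0 ?normr0; first by rewrite mulr_ge0// ?exprn_ge0.
    near=> w; have w1 : `|w - x| < X / 4 by near: w; exact: (cvgr_lt _ cont).
    rewrite /chi plateau1 ?subrr ?mulr0//.
    by rewrite normrM normfV (gtr0_norm X4) ler_pdivrMr// mul1r ltW.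
  have [yx2|yx2] := ltP (X / 2) `|y - x|.
    rewrite (@derive1n_eq_nearx _ _ (pkern x t)); last first.
      near=> w; have w1 : X / 2 < `|w - x| by near: w; exact: (cvgr_gt _ cont).
      rewrite /chi plateau0 ?subr0 ?mulr1//.
      by rewrite normrM normfV (gtr0_norm X4) ler_pdivlMr//; lra.
    have y0 : 0 < `|y - x| by apply: lt_trans yx2; rewrite divr_gt0.
    apply: le_trans (derive1n_pkern_le kN t0 y0 (lexx _)) _; rewrite -/c1.
    have i1 : `|y - x|^-1 <= 3 * mx^-1.
      rewrite ler_pdivlMr// mulrC ler_pdivrMr//; lra.
    have y10 : 0 <= `|y - x|^-1 by rewrite invr_ge0.
    have m3 : 0 <= 3 * mx^-1 by rewrite mulr_ge0.
    apply: le_trans (_ : c1 * t * (3 ^+ N.+2 * (mx^-1 ^+ k.+1 * X^-1)) <= _).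
      apply: ler_wpM2l (mulr_ge0 c10 (ltW t0)) _ _ _.
      apply: le_trans (_ : (3 * mx^-1) ^+ k.+2 <= _); first exact: lerXn2r.
      rewrite exprMn; apply: ler_pM; [exact: (p36 3%N)|exact: mxn| |].
        by rewrite ler_weXn2l// ?ler1n.
      by rewrite exprSr; exact: ler_wpM2l.
    rewrite [X in X <= _](_ : _ = c1 * 3 ^+ N.+2 * t / X * mx^-1 ^+ k.+1); last by ring.
    apply: ler_wpM2r => //; apply: ler_wpM2r; first by rewrite invr_ge0 ltW.
    by apply: ler_wpM2r; [exact: ltW|rewrite lerDl].
  have r0 : 0 <= (X / 4)^-1 by rewrite invr_ge0 ltW.
  apply: le_trans (_ : 2 ^+ k * ((c1 * t * (X / 4)^-1 ^+ 2) * (1 + B)) * (X / 4)^-1 ^+ k <= _).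
    apply: derive1nM_bound => // j jk.
      apply: le_trans (derive1n_pkern_le (leq_trans jk kN) t0 X4 yx) _.
      suff -> : c1 * t * (X / 4)^-1 ^+ 2 * (X / 4)^-1 ^+ j = c1 * t * (X / 4)^-1 ^+ j.+2 by [].
      by rewrite !exprS; ring.
    case: j jk => [|j] jk.
      rewrite /= mulr1; apply: le_trans (_ : 1 <= _); last by rewrite lerDl.
      by rewrite ger0_norm ?subr_ge0 ?plateau_le1// gerBl plateau_ge0.
    rewrite derive1nB//; last exact: smooth_cst.
    rewrite derive1n_cst sub0r normrN derive1n_affine; last exact: smooth_plateau.
    rewrite normrM mulrC; apply: ler_pM => //.
      by rewrite (le_trans (HB _ _ (leq_trans jk kN)))// lerDr.
    by rewrite ger0_norm// ?exprn_ge0.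
  have i2 : (X / 4)^-1 <= 6 * mx^-1.
    by rewrite invf_div ler_pdivrMr// mulrAC ler_pdivlMr//; lra.
  have -> : 2 ^+ k * (c1 * t * (X / 4)^-1 ^+ 2 * (1 + B)) * (X / 4)^-1 ^+ k =
      2 ^+ k * (c1 * (1 + B) * t * ((X / 4)^-1 * (X / 4)^-1 ^+ k.+1)).
    by rewrite exprS expr1 exprS; ring.
  have X40 n : 0 <= (X / 4)^-1 ^+ n by exact: iexp_ge0.
  have m6 : 0 <= 6 * mx^-1 by rewrite mulr_ge0.
  apply: le_trans (_ : 2 ^+ N * (c1 * (1 + B) * t * (4 / X * (6 ^+ N.+1 * mx^-1 ^+ k.+1))) <= _).
    have cB : 0 <= c1 * (1 + B) * t by exact: mulr_ge0 (mulr_ge0 c10 B1') (ltW t0).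
    apply: ler_pM => //.
    - by apply: mulr_ge0 => //; exact: mulr_ge0.
    - by rewrite ler_weXn2l// ?ler1n.
    - apply: ler_wpM2l => //; rewrite -[4 / X]invf_div; apply: ler_wpM2l => //.
      apply: le_trans (_ : (6 * mx^-1) ^+ k.+1 <= _); first exact: lerXn2r.
      by rewrite exprMn; apply: ler_wpM2r => //; rewrite ler_weXn2l// ?ler1n.
  rewrite [X in X <= _](_ : _ = 2 ^+ N * c1 * (1 + B) * (4 * 6 ^+ N.+1) * t / X * mx^-1 ^+ k.+1); last by ring.
  apply: ler_wpM2r => //; apply: ler_wpM2r; first by rewrite invr_ge0 ltW.
  by apply: ler_wpM2r; [exact: ltW|rewrite lerDr].
move: bd; rewrite ler_norml => /andP[bd _].
have [_ hB] := barr X (ltW X0) Xe.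
suff : KB * t / X ^+ 2 <= eta * (X * t / (X ^+ 2 + t ^+ 2) ^+ 2).
  have : 0 <= m * t by rewrite mulr_ge0// ltW.
  lra.
have den : (X ^+ 2 + t ^+ 2) ^+ 2 <= 4 * X ^+ 4.
  have -> : 4 * X ^+ 4 = (X ^+ 2 + X ^+ 2) ^+ 2 by ring.
  by rewrite lerXn2r ?nnegrE ?addr_ge0 ?sqr_ge0// lerD2l lerXn2r ?nnegrE ?(ltW t0) ?(ltW X0)// ltW.
apply: le_trans (_ : eta * (X * t / (4 * X ^+ 4)) <= _); last first.
  rewrite ler_wpM2l ?(ltW eta0)// ler_wpM2l ?mulr_ge0 ?(ltW t0) ?(ltW X0)//.
  by rewrite lef_pV2 ?posrE ?exprn_gt0 ?den_gt0// mulr_gt0// exprn_gt0.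
have -> : eta * (X * t / (4 * X ^+ 4)) = eta / (4 * X) * t / X ^+ 2.
  by field; rewrite gt_eqF.
rewrite ler_wpM2r ?invr_ge0 ?exprn_ge0 ?(ltW X0)// ler_wpM2r ?(ltW t0)//.
by rewrite ler_pdivlMr ?mulr_gt0//; lra.
Unshelve. all: end_near. Qed.

End OneFunctional.
End Extension.

(** * Minimum principle for strictly superharmonic functions *)

Section MinimumPrinciple.
Context {R : realType}.
Implicit Types (x y z s t e : R).

(** Were l negative, f1 would decrease strictly through x. The mean value theorem, to the right of x
    if f1 x <= 0 and to the left otherwise, would then give a value of f below the minimum. *)
Lemma second_derive_min (f f1 : R -> R) x (l e : R) : 0 < e ->
  (forall y, `|y - x| < e -> is_derive y 1 f (f1 y)) -> is_derive x 1 f1 l ->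
  (forall y, `|y - x| < e -> f x <= f y) -> 0 <= l.
Proof.
move=> e0 df df1 fmin; rewrite leNgt; apply/negP => l0.
have [r r0 Hr] : exists2 r, 0 < r & forall h, 0 < `|h| < r -> (f1 (x + h) - f1 x) / h < 0.
  have [df1' l1] := df1.
  have cv : h^-1 *: (f1 (h *: 1 + x) - f1 x) @[h --> 0^'] --> l by rewrite -l1; exact: df1'.
  have : \forall h \near 0^', h^-1 *: (f1 (h *: 1 + x) - f1 x) < 0.
    by apply: (cvgr_lt _ cv).
  move=> [r /= r0 H]; exists r => // h /andP[h0 hr].
  have := H h; rewrite /= sub0r normrN => /(_ hr); rewrite -normr_gt0 => /(_ h0).
  by rewrite -[_ *: 1]/(h * 1) mulr1 (addrC h) -[_ *: _]/(h^-1 * _) mulrC.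
pose q := Num.min e r / 2.
have q0 : 0 < q by rewrite divr_gt0// lt_min e0.
have qe : q < e by rewrite /q ltr_pdivrMr// (@le_lt_trans _ _ e)// ?ge_min ?lexx//; lra.
have qr : q < r by rewrite /q ltr_pdivrMr// (@le_lt_trans _ _ r)// ?ge_min ?lexx ?orbT//; lra.
have cf a b : x - q <= a -> a <= b -> b <= x + q -> {within `[a, b], continuous f}.
  move=> xa ab bx; apply: derivable_within_continuous => y; rewrite in_itv /= => /andP[ay yb].
  by have [] // := df y _; rewrite (le_lt_trans _ qe)// ler_norml; apply/andP; split; lra.
have dq a b y : x - q <= a -> b <= x + q -> y \in `]a, b[%R -> is_derive y 1 f (f1 y).
  move=> xa bx; rewrite in_itv /= => /andP[ay yb]; apply: df.
  by rewrite (le_lt_trans _ qe)// ler_norml; apply/andP; split; lra.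
have [f10|f10] := leP (f1 x) 0.
  have xq : x < x + q by rewrite ltrDl.
  have c1 : {within `[x, x + q], continuous f} by apply: cf; lra.
  have d1 y : y \in `]x, x + q[%R -> is_derive y 1 f (f1 y) by apply: dq; lra.
  have [y + E] := MVT xq d1 c1.
  rewrite in_itv /= => /andP[xy yq].
  have yr : 0 < `|y - x| < r by rewrite gtr0_norm ?subr_gt0// xy /=; lra.
  have := Hr (y - x) yr.
  rewrite [x + _]addrC subrK pmulr_llt0 ?invr_gt0 ?subr_gt0// => H.
  have : f (x + q) - f x < 0.
    by rewrite E addrAC subrr add0r pmulr_llt0//; lra.
  have := fmin (x + q); rewrite addrAC subrr add0r gtr0_norm// => /(_ qe); lra.
have xq : x - q < x by lra.
have c1 : {within `[x - q, x], continuous f} by apply: cf; lra.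
have d1 y : y \in `]x - q, x[%R -> is_derive y 1 f (f1 y) by apply: dq; lra.
have [y + E] := MVT xq d1 c1.
rewrite in_itv /= => /andP[xy yq].
have yr : 0 < `|y - x| < r by rewrite ltr0_norm ?subr_lt0//; apply/andP; split; lra.
have := Hr (y - x) yr.
rewrite [x + _]addrC subrK nmulr_llt0 ?invr_lt0 ?subr_lt0// => H.
have : f (x - q) - f x < 0.
  by rewrite -opprB E opprB oppr_lt0 mulr_gt0//; lra.
have := fmin (x - q); rewrite addrAC subrr add0r normrN gtr0_norm// => /(_ qe); lra.
Qed.

Lemma nbhs_box (x t e : R) : 0 < e ->
  \forall w \near (x, t), `|w.1 - x| < e /\ `|w.2 - t| < e.
Proof.
move=> e0; exists ([set y | `|y - x| < e], [set y | `|y - t| < e]) => [|[y s] //].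
split; apply/nbhs_ballP; exists e => //= y.
  by rewrite /ball /= distrC.
by rewrite /ball /= distrC.
Qed.

(** The boundary condition keeps the set where W <= m away from the boundary, so it is compact; at a
    minimum of W on it both second derivatives are nonnegative. The condition is a local one at each
    boundary point because W need not extend continuously to t = 0. *)
Lemma superharmonic_min (W Wx Wxx Wt Wtt : R -> R -> R) (c d delta m : R) :
  (forall x t, 0 < t -> is_derive x 1 (fun x => W x t) (Wx x t)) ->
  (forall x t, 0 < t -> is_derive x 1 (fun x => Wx x t) (Wxx x t)) ->
  (forall x t, 0 < t -> is_derive t 1 (fun t => W x t) (Wt x t)) ->
  (forall x t, 0 < t -> is_derive t 1 (fun t => Wt x t) (Wtt x t)) ->
  (forall x t, 0 < t -> Wxx x t + Wtt x t < 0) ->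
  (forall x t, 0 < t -> (fun w : R * R => W w.1 w.2) @ (x, t) --> W x t) ->
  (forall x t, c <= x <= d -> 0 <= t <= delta -> [\/ x = c, x = d, t = 0 | t = delta] ->
     exists2 e, 0 < e & forall x' t', `|x' - x| < e -> `|t' - t| < e ->
       c < x' < d -> 0 < t' < delta -> m < W x' t') ->
  forall x t, c < x < d -> 0 < t < delta -> m < W x t.
Proof.
move=> dx dxx dt dtt neg cW bd x0 t0 x0cd t0d; rewrite ltNge; apply/negP => Wm.
pose S := [set w : R * R | [/\ c < w.1 < d, 0 < w.2 < delta & W w.1 w.2 <= m]].
have SR : S `<=` `[c, d]%classic `*` `[0, delta]%classic.
  by move=> [x t] [/= /andP[? ?] /andP[? ?] _]; split => /=; rewrite in_itv /= !ltW.
have clS : closed S.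
  move=> [x t] clxt; apply: contrapT => nS.
  suff [w [Sw nSw]] : S `&` ~` S !=set0 by [].
  apply: clxt.
  have [xcd|xcd] := boolP (c <= x <= d); last first.
    have [q q0 Hq] : exists2 q, 0 < q & forall y, `|y - x| < q -> ~~ (c <= y <= d).
      move: xcd; rewrite negb_and -!ltNge => /orP[H|H].
        exists (c - x); rewrite ?subr_gt0// => y; rewrite ltr_norml => /andP[_ ?].
        by rewrite negb_and -!ltNge; apply/orP; left; lra.
      exists (x - d); rewrite ?subr_gt0// => y; rewrite ltr_norml => /andP[? _].
      by rewrite negb_and -!ltNge; apply/orP; right; lra.
    near=> w; have [w1 _] : `|w.1 - x| < q /\ `|w.2 - t| < q by near: w; exact: nbhs_box.
    by case=> /andP[/ltW ? /ltW ?] _ _; have := Hq _ w1; rewrite negb_and => /orP[] /negP.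
  have [td|td] := boolP (0 <= t <= delta); last first.
    have [q q0 Hq] : exists2 q, 0 < q & forall y, `|y - t| < q -> ~~ (0 <= y <= delta).
      move: td; rewrite negb_and -!ltNge => /orP[H|H].
        exists (- t); rewrite ?oppr_gt0// => y; rewrite ltr_norml => /andP[_ ?].
        by rewrite negb_and -!ltNge; apply/orP; left; lra.
      exists (t - delta); rewrite ?subr_gt0// => y; rewrite ltr_norml => /andP[? _].
      by rewrite negb_and -!ltNge; apply/orP; right; lra.
    near=> w; have [_ w2] : `|w.1 - x| < q /\ `|w.2 - t| < q by near: w; exact: nbhs_box.
    by case=> _ /andP[/ltW ? /ltW ?] _; have := Hq _ w2; rewrite negb_and => /orP[] /negP.
  have [bdy|nbdy] := pselect [\/ x = c, x = d, t = 0 | t = delta].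
    have [q q0 Hq] := bd x t xcd td bdy.
    near=> w; have [w1 w2] : `|w.1 - x| < q /\ `|w.2 - t| < q by near: w; exact: nbhs_box.
    by case=> wcd wd; rewrite leNgt => /negP; apply; exact: Hq.
  have xi : c < x < d.
    by rewrite !lt_neqAle; case/andP: xcd => -> ->; rewrite !andbT; apply/andP; split;
      apply/eqP => E; apply: nbdy; rewrite E; [constructor 1|constructor 2].
  have ti : 0 < t < delta.
    by rewrite !lt_neqAle; case/andP: td => -> ->; rewrite !andbT; apply/andP; split;
      apply/eqP => E; apply: nbdy; rewrite E; [constructor 3|constructor 4].
  have Wxt : m < W x t by rewrite ltNge; apply/negP => H; apply: nS.
  have tp : 0 < t by case/andP: ti.
  near=> w => -[_ _]; rewrite leNgt => /negP; apply.
  by near: w; apply: (cvgr_gt _ (cW x t tp)).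
have cS : compact S.
  apply: (subclosed_compact clS _ SR); apply: compact_setX; exact: segment_compact.
have S0 : S !=set0 by exists (x0, t0).
have cWS : {within S, continuous (fun w : R * R => W w.1 w.2)}.
  apply: continuous_in_subspaceT => -[x t]; rewrite inE => -[_ /= /andP[tp _] _].
  exact: cW.
have [[x t] + Hmin] := compact_EVT_min S0 cS cWS.
rewrite inE => -[/= xcd td Wxt].
have tp : 0 < t by case/andP: td.
have gmin x' t' : c < x' < d -> 0 < t' < delta -> W x t <= W x' t'.
  move=> x'cd t'd; have [H|/ltW H] := leP (W x' t') m; last exact: le_trans Wxt H.
  by apply: (Hmin (x', t')); rewrite inE.
have /andP[cx xd] := xcd; have /andP[_ tD] := td.
have h1 : 0 <= Wxx x t.
  apply: (@second_derive_min (fun x => W x t) (fun x => Wx x t) x _ (Num.min (x - c) (d - x))).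
  - by rewrite lt_min !subr_gt0 cx.
  - by move=> y _; exact: dx.
  - exact: dxx.
  - move=> y; rewrite lt_min !ltr_norml => /andP[/andP[? ?] /andP[? ?]].
    by apply: gmin => //; apply/andP; split; lra.
have h2 : 0 <= Wtt x t.
  apply: (@second_derive_min (fun t => W x t) (fun t => Wt x t) t _ (Num.min t (delta - t))).
  - by rewrite lt_min tp subr_gt0.
  - move=> y; rewrite lt_min !ltr_norml => /andP[/andP[? ?] _].
    by apply: dt; lra.
  - exact: dtt.
  - move=> y; rewrite lt_min !ltr_norml => /andP[/andP[? ?] /andP[? ?]].
    by apply: gmin => //; apply/andP; split; lra.
have := neg x t tp; lra.
Unshelve. all: end_near. Qed.

End MinimumPrinciple.

(** * Lower bounds for the extension on a rectangle *)

Section Strip.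
Context {R : realType}.
Implicit Types (x y z s t e : R) (p q : (R -> R) -> R).

Lemma mvt_le (f df : R -> R) (B a b : R) : a <= b ->
  (forall y, a <= y <= b -> is_derive y 1 f (df y)) ->
  (forall y, a <= y <= b -> `|df y| <= B) -> `|f b - f a| <= B * (b - a).
Proof.
move=> ab d1 bd.
have cf : {within `[a, b], continuous f}.
  by apply: derivable_within_continuous => y; rewrite in_itv /= => yab; have [] := d1 y yab.
have d1' y : y \in `]a, b[%R -> is_derive y 1 f (df y).
  by rewrite in_itv /= => /andP[? ?]; apply: d1; rewrite !ltW.
have [y + ->] := MVT_segment ab d1' cf; rewrite in_itv /= => yab.
by rewrite normrM [`|b - a|]ger0_norm ?subr_ge0// ler_wpM2r ?subr_ge0// bd.
Qed.

Lemma cext_lipschitz p b m t0 : cdist p -> 0 < t0 -> exists2 L, 0 <= L &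
  forall x t x' t', t0 <= t -> t0 <= t' ->
    `|cext p b m x' t' - cext p b m x t| <= L * (`|x' - x| + `|t' - t|).
Proof.
move=> cp t00.
have [B1 B10 HB1] := cext_bounded cp b m.+1 t00.
have [B2 B20 HB2] := cext_bounded cp (~~ b) m.+1 t00.
pose L := m%:R * (B1 + B2); exists L => [|x t x' t' tt tt']; first by rewrite mulr_ge0// addr_ge0.
have Hx s a c : t0 <= s -> `|cext p b m a s - cext p b m c s| <= L * `|a - c|.
  move=> ts; have s0 : 0 < s := lt_le_trans t00 ts.
  wlog ca : a c / c <= a => [W|].
    by have [/W//|/ltW/W] := leP c a; rewrite distrC [`|c - a|]distrC.
  rewrite [`|a - c|]ger0_norm ?subr_ge0//.
  apply: (mvt_le ca (fun y _ => is_derive_cext_x cp b m y s0)) => y _.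
  by rewrite normrM normr_nat ler_wpM2l// (le_trans (HB1 _ _ ts))// lerDl.
have Ht y a c : t0 <= a -> t0 <= c -> `|cext p b m y a - cext p b m y c| <= L * `|a - c|.
  move=> ta tc.
  wlog ca : a c ta tc / c <= a => [W|].
    by have [/W|/ltW/W] := leP c a; [exact|rewrite distrC [`|c - a|]distrC; exact].
  rewrite [`|a - c|]ger0_norm ?subr_ge0//.
  have ds s : c <= s <= a -> is_derive s 1 (fun s => cext p b m y s)
      (csign b * m%:R * cext p (~~ b) m.+1 y s).
    by move=> /andP[cs _]; exact: is_derive_cext_t (lt_le_trans t00 (le_trans tc cs)).
  apply: (mvt_le ca ds) => s /andP[cs _].
  have -> : `|csign b * m%:R * cext p (~~ b) m.+1 y s| = m%:R * `|cext p (~~ b) m.+1 y s|.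
    by rewrite !normrM normr_nat; case: (b); rewrite /csign ?normrN normr1 mul1r.
  by rewrite ler_wpM2l// (le_trans (HB2 _ _ (le_trans tc cs)))// lerDr.
have -> : cext p b m x' t' - cext p b m x t =
  (cext p b m x' t' - cext p b m x t') + (cext p b m x t' - cext p b m x t) by ring.
by rewrite mulrDr (le_trans (ler_normD _ _))// lerD ?Hx ?Ht.
Qed.

Lemma cext_continuous p b m x t : cdist p -> 0 < t ->
  (fun w : R * R => cext p b m w.1 w.2) @ (x, t) --> cext p b m x t.
Proof.
move=> cp t0; have th : 0 < t / 2 by rewrite divr_gt0.
have [L L0 HL] := cext_lipschitz b m cp th.
apply/cvgrPdist_le => e e0.
pose r := Num.min (t / 2) (e / (2 * (L + 1))).
have L1 : 0 < 2 * (L + 1) by rewrite mulr_gt0// ltr_wpDl.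
have r0 : 0 < r by rewrite lt_min th divr_gt0.
near=> w; have [w1 w2] : `|w.1 - x| < r /\ `|w.2 - t| < r by near: w; exact: nbhs_box.
move: w1 w2; rewrite !lt_min => /andP[_ w1] /andP[w2 w3].
have tt : t / 2 <= t by lra.
have tw : t / 2 <= w.2 by move: w2; rewrite ltr_norml => /andP[? _]; lra.
rewrite distrC; apply: le_trans (HL _ _ _ _ tt tw) _.
move: w1 w3; rewrite !ltr_pdivlMr// => w1 w3.
have := normr_ge0 (w.1 - x); have := normr_ge0 (w.2 - t); nra.
Unshelve. all: end_near. Qed.

Lemma cdist_dirac (c : R) : cdist (fun f : R -> R => f c).
Proof.
split=> //; exists `|c|, 1, 0%N; split => // f A sf H.
by rewrite mul1r (H 0%N).
Qed.

Lemma cdist_reflect p : cdist p -> cdist (fun f => p (fun y => f (- y))).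
Proof.
move=> [lp [M [C [N [M0 C0 H]]]]].
have E (f : R -> R) : (fun y => f (- y)) = (fun y => f ((y - 0) / -1)).
  by apply/funext => y; rewrite subr0 invrN invr1 mulrN1.
split.
  move=> a f g sf sg; rewrite (lp a (fun y => f (- y)) (fun y => g (- y)))//.
    by rewrite E; exact: smooth_affine.
  by rewrite E; exact: smooth_affine.
exists M, C, N; split => // f A sf HA; apply: H.
  by rewrite E; exact: smooth_affine.
move=> k x kN xM; rewrite E derive1n_affine// normrM normrX normfV normrN1 invr1 expr1n mul1r.
by apply: HA => //; rewrite subr0 invrN invr1 mulrN1 normrN.
Qed.

Lemma pext_reflect p x t : pext (fun f => p (fun y => f (- y))) x t = pext p (- x) t.
Proof.
rewrite /pext; congr p; apply/funext => y; rewrite /pkern; congr (_ / (_ + _)); ring.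
Qed.

Lemma pos_on_reflect p l r : pos_on p (- r) (- l) -> pos_on (fun f => p (fun y => f (- y))) l r.
Proof.
move=> H psi sp p0 ps; apply: H.
- have -> : (fun y => psi (- y)) = (fun y => psi ((y - 0) / -1)).
    by apply/funext => y; rewrite subr0 invrN invr1 mulrN1.
  exact: smooth_affine.
- by move=> y; exact: p0.
- by move=> y yr; apply: ps; apply: contra yr => /andP[? ?]; apply/andP; split; lra.
Qed.

Lemma dil_bounded_reflect p c : dil_bounded p c ->
  dil_bounded (fun f => p (fun y => f (- y))) (- c).
Proof.
move=> [C [N [e0 [C0 e00 H]]]]; exists C, N, e0; split => // e psi A e01 sp ps bp.
have E : (fun y => psi (- y)) = (fun y => psi ((y - 0) / -1)).
  by apply/funext => y; rewrite subr0 invrN invr1 mulrN1.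
have -> : dilation (fun f => p (fun y => f (- y))) (- c) e psi = dilation p c e (fun y => psi (- y)).
  by rewrite /dilation; congr p; apply/funext => y; congr psi; ring.
apply: H => //; first by rewrite E; exact: smooth_affine.
  by move=> y y4; apply: ps; rewrite normrN.
move=> k y kN; rewrite E derive1n_affine// normrM normrX normfV normrN1 invr1 expr1n mul1r.
exact: bp.
Qed.

(* Minimum principle in (c, d) x (0, delta) for the harmonic function [pext p],
   with barriers at the corners (c, 0) and (d, 0). *)
Lemma pext_strip p (c d delta M : R) : cdist p -> c < d -> 0 < delta -> 0 <= M ->
  dil_bounded p c -> dil_bounded p d ->
  (forall l r, c < l -> r < d -> pos_on p l r) ->
  (forall t, 0 < t <= delta -> - (M * t) <= pext p c t) ->
  (forall t, 0 < t <= delta -> - (M * t) <= pext p d t) ->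
  (forall x, c <= x <= d -> - (M * delta) <= pext p x delta) ->
  forall x t, c < x < d -> 0 < t < delta -> - (M * t) <= pext p x t.
Proof.
move=> cp cd delta0 M0 dbc dbd pos sc sd top x0 t0 x0cd t0d.
have t00 : 0 < t0 by case/andP: t0d.
pose qc (f : R -> R) := f c; pose qd (f : R -> R) := f d.
have cqc : cdist qc := cdist_dirac c; have cqd : cdist qd := cdist_dirac d.
(* The barriers are extensions of Dirac functionals at c and d, so their derivatives come from the
   general formulas for [cext]. *)
pose Bc x t := cext qc true 2 x t; pose Bd x t := - cext qd true 2 x t.
have cp2 z t : cpart true 2 z t = - 2 * (z * t / (z ^+ 2 + t ^+ 2) ^+ 2).
  have [->|tn] := eqVneq t 0; first by rewrite /=; ring.
  have nz : z ^+ 2 + t ^+ 2 != 0.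
    by rewrite gt_eqF// ltr_wpDl ?sqr_ge0// lt0r expf_neq0// sqr_ge0.
  by rewrite /=; field.
have BcE x t : Bc x t = 2 * ((x - c) * t / ((x - c) ^+ 2 + t ^+ 2) ^+ 2).
  by rewrite /Bc /cext /qc /ckern cp2 -(opprB x c) sqrrN; ring.
have BdE x t : Bd x t = 2 * ((d - x) * t / ((d - x) ^+ 2 + t ^+ 2) ^+ 2).
  by rewrite /Bd /cext /qd /ckern cp2; ring.
have Bc0 x t : c <= x -> 0 < t -> 0 <= Bc x t.
  by move=> cx t1; rewrite BcE !mulr_ge0 ?subr_ge0 ?invr_ge0 ?(ltW t1)// sqr_ge0.
have Bd0 x t : x <= d -> 0 < t -> 0 <= Bd x t.
  by move=> cx t1; rewrite BdE !mulr_ge0 ?subr_ge0 ?invr_ge0 ?(ltW t1)// sqr_ge0.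
(* At the fixed point (x0, t0) the barriers are finite, so eta may tend to 0. *)
suff H (eta : R) : 0 < eta -> - eta <= pext p x0 t0 + M * t0 + eta * (Bc x0 t0 + Bd x0 t0).
  rewrite -subr_ge0 opprK; apply/ler_addgt0Pr => e e0.
  have b0 : 0 < Bc x0 t0 + Bd x0 t0 + 1.
    by case/andP: x0cd => ? ?; rewrite ltr_wpDl// addr_ge0 ?Bc0 ?Bd0// ltW.
  have := H (e / (Bc x0 t0 + Bd x0 t0 + 1)) (divr_gt0 e0 b0).
  have : e / (Bc x0 t0 + Bd x0 t0 + 1) * (Bc x0 t0 + Bd x0 t0 + 1) = e by rewrite divfK// gt_eqF.
  set v := e / _; set u := Bc x0 t0 + Bd x0 t0; lra.
move=> eta0.
(* All other terms of W below are harmonic; the concave term - ka (x - c) ^ 2 makes W strictly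
   superharmonic and costs at most eta / 2. *)
pose ka := eta / (2 * (d - c) ^+ 2).
have dc0 : 0 < d - c by rewrite subr_gt0.
have ka0 : 0 < ka by rewrite divr_gt0// mulr_gt0// exprn_gt0.
have kab x : c <= x -> x <= d -> ka * (x - c) ^+ 2 <= eta / 2.
  move=> cx xd; have -> : eta / 2 = ka * (d - c) ^+ 2 by rewrite /ka; field; rewrite gt_eqF.
  by rewrite ler_pM2l// lerXn2r ?nnegrE ?subr_ge0 ?(ltW cd)// lerD2r.
pose W x t := (M * t - cext p true 1 x t) + (eta * Bc x t + eta * Bd x t) + - ka * (x - c) ^+ 2.
have pc x t : 0 < t -> pext p x t = - cext p true 1 x t by exact: pext_cext.
suff : - eta < W x0 t0.
  rewrite /W -mulrDr => /ltW; rewrite pc//.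
  have : 0 <= ka * (x0 - c) ^+ 2 by rewrite mulr_ge0 ?sqr_ge0// ltW.
  lra.
have dsq x : is_derive x 1 (fun x => - ka * (x - c) ^+ 2) (- ka * (2 * (x - c))).
  have i : is_derive x 1 (fun z => z - c) 1.
    by apply: (is_derive_eq (is_deriveBr (is_derive_idr x) (is_derive_cstr c x))); rewrite subr0.
  have := is_deriveZr (- ka) (is_deriveMr i i).
  have -> : (fun y => - ka * ((y - c) * (y - c))) = (fun x => - ka * (x - c) ^+ 2).
    by apply/funext => y; rewrite expr2.
  by move=> D; apply: (is_derive_eq D); ring.
have dsq2 x : is_derive x 1 (fun x => - ka * (2 * (x - c))) (- ka * 2).
  have i : is_derive x 1 (fun z => z - c) 1.
    by apply: (is_derive_eq (is_deriveBr (is_derive_idr x) (is_derive_cstr c x))); rewrite subr0.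
  by apply: (is_derive_eq (is_deriveZr (- ka) (is_deriveZr 2 i))); ring.
apply: (@superharmonic_min _ W
  (fun x t => - cext p true 2 x t + (eta * (2 * cext qc true 3 x t) + eta * - (2 * cext qd true 3 x t)) + - ka * (2 * (x - c)))
  (fun x t => - (2 * cext p true 3 x t) + (eta * (2 * (3 * cext qc true 4 x t)) + eta * - (2 * (3 * cext qd true 4 x t))) + - ka * 2)
  (fun x t => M + cext p false 2 x t + (eta * (- 2 * cext qc false 3 x t) + eta * - (- 2 * cext qd false 3 x t)))
  (fun x t => 2 * cext p true 3 x t + (eta * (- 2 * (3 * cext qc true 4 x t)) + eta * - (- 2 * (3 * cext qd true 4 x t))))
  c d delta (- eta) _ _ _ _ _ _ _ x0 t0 x0cd t0d).
- move=> x t t1.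
  have D := is_deriveDr (is_deriveDr (is_deriveBr (is_derive_cstr (M * t) x) (is_derive_cext_x cp true 1 x t1))
    (is_deriveDr (is_deriveZr eta (is_derive_cext_x cqc true 2 x t1))
       (is_deriveZr eta (is_deriveNr (is_derive_cext_x cqd true 2 x t1))))) (dsq x).
  by apply: (is_derive_eq D); rewrite sub0r mul1r.
- move=> x t t1.
  have D := is_deriveDr (is_deriveDr (is_deriveNr (is_derive_cext_x cp true 2 x t1))
    (is_deriveDr (is_deriveZr eta (is_deriveZr 2 (is_derive_cext_x cqc true 3 x t1)))
       (is_deriveZr eta (is_deriveNr (is_deriveZr 2 (is_derive_cext_x cqd true 3 x t1)))))) (dsq2 x).
  exact: (is_derive_eq D).
- move=> x t t1.
  have D := is_deriveDr (is_deriveDr (is_deriveBr (is_deriveZr M (is_derive_idr t)) (is_derive_cext_t cp true 1 x t1))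
    (is_deriveDr (is_deriveZr eta (is_derive_cext_t cqc true 2 x t1))
       (is_deriveZr eta (is_deriveNr (is_derive_cext_t cqd true 2 x t1))))) (is_derive_cstr (- ka * (x - c) ^+ 2) t).
  by apply: (is_derive_eq D); rewrite /csign /=; ring.
- move=> x t t1.
  have D := is_deriveDr (is_deriveDr (is_derive_cstr M t) (is_derive_cext_t cp false 2 x t1))
    (is_deriveDr (is_deriveZr eta (is_deriveZr (- 2) (is_derive_cext_t cqc false 3 x t1)))
       (is_deriveZr eta (is_deriveNr (is_deriveZr (- 2) (is_derive_cext_t cqd false 3 x t1))))).
  by apply: (is_derive_eq D); rewrite /csign /=; ring.
- by move=> x t t1; rewrite /=; lra.
- move=> x t t1.
  apply: cvgD; last first.
    apply: cvgM; first exact: cvg_cst.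
    apply: cvgM; (apply: cvgB; [exact: cvg_fst|exact: cvg_cst]).
  apply: cvgD.
    by apply: cvgB; [apply: cvgM; [exact: cvg_cst|exact: cvg_snd]|exact: cext_continuous].
  apply: cvgD; apply: cvgM; try exact: cvg_cst; first exact: cext_continuous.
  by apply: cvgN; exact: cext_continuous.
have Fcont x t : 0 < t -> - (M * t) <= pext p x t -> exists2 e, 0 < e &
    forall x' t', `|x' - x| < e -> `|t' - t| < e -> 0 < t' -> - (eta / 4) <= pext p x' t' + M * t'.
  move=> t1 Fxt; have th : 0 < t / 2 by rewrite divr_gt0.
  have [L L0 HL] := cext_lipschitz true 1 cp th.
  have L1 : 0 < 4 * (2 * L + M + 1) by rewrite mulr_gt0// ltr_wpDl// addr_ge0// mulr_ge0.
  exists (Num.min (t / 2) (eta / (4 * (2 * L + M + 1)))).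
    by rewrite lt_min th divr_gt0.
  move=> x' t'; rewrite !lt_min => /andP[_ h1] /andP[h2 h3] t'0.
  have tt' : t / 2 <= t' by move: h2; rewrite ltr_norml => /andP[? _]; lra.
  have tt : t / 2 <= t by lra.
  have := HL x t x' t' tt tt'; rewrite ler_norml => /andP[_ hL]; rewrite pc//; rewrite pc// in Fxt.
  move: h1 h3; rewrite !ltr_pdivlMr// => h1 h3.
  have := normr_ge0 (x' - x); have := normr_ge0 (t' - t).
  have : - `|t' - t| <= t' - t by rewrite lerNl -normrN ler_norm.
  move: hL h1 h3; set u := `|x' - x|; set v := `|t' - t| => hL h1 h3 hv v0 u0.
  have hM : - (M * v) <= M * (t' - t) by rewrite -mulrN ler_wpM2l.
  nra.
have fin x t : c <= x <= d -> 0 < t -> - (eta / 4) <= pext p x t + M * t + eta * (Bc x t + Bd x t) -> - eta < W x t.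
  move=> /andP[cx xd] t1; rewrite /W pc// -mulrDr => H; have := kab x cx xd.
  by move: H eta0; rewrite mulNr; lra.
(* On the sides and the top, the assumed bounds spread by continuity; the two lower corners use the
   barriers, and the open bottom uses positivity of p inside (c, d). *)
move=> x t /andP[cx xd] /andP[t1 td] bdy.
have [t1'|t10] := ltP 0 t.
  have Fxt : - (M * t) <= pext p x t.
    case: bdy => E.
    - by rewrite E; apply: sc; rewrite t1'.
    - by rewrite E; apply: sd; rewrite t1'.
    - by rewrite E ltxx in t1'.
    - by rewrite E; apply: top; rewrite cx.
  have [e e0 He] := Fcont x t t1' Fxt.
  exists e => // x' t' hx ht /andP[cx' xd'] /andP[t'0 _].
  apply: fin => //; first by rewrite !ltW.
  rewrite -[X in X <= _]addr0; apply: lerD; first exact: He.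
  by rewrite mulr_ge0 ?(ltW eta0)// addr_ge0 ?Bc0 ?Bd0// ltW.
have {t10 t1 td bdy}-> : t = 0 by apply/eqP; rewrite eq_le t10.
have [xc|cx'] := leP x c.
  have {xc}-> : x = c by apply/eqP; rewrite eq_le xc.
  have e20 : 0 < 2 * eta by rewrite mulr_gt0.
  have [e e0 He] := pext_corner cp dbc cd e20 M0 pos.
  exists (Num.min e delta); first by rewrite lt_min e0.
  move=> x' t'; rewrite subr0 !lt_min => /andP[hx _] /andP[ht htd] /andP[cx' xd'] /andP[t'0 td'].
  apply: fin => //; first by rewrite !ltW.
  have t't : 0 < t' <= delta by rewrite t'0 ltW.
  have xe : x' - c < e by move: hx; rewrite ltr_norml => /andP[].
  have te : t' < e by move: ht; rewrite gtr0_norm.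
  have := He x' t' (ltW cx') xe t'0 te (sc t' t't).
  have -> : 2 * eta * ((x' - c) * t' / ((x' - c) ^+ 2 + t' ^+ 2) ^+ 2) = eta * Bc x' t'.
    by rewrite BcE; ring.
  have : 0 <= eta * Bd x' t' by rewrite mulr_ge0 ?(ltW eta0)// Bd0// ltW.
  lra.
have [dx|xd'] := leP d x.
  have {dx}-> : x = d by apply/eqP; rewrite eq_le xd.
  (* The reflection y -> - y turns the corner at d into a left corner. *)
  pose q f := p (fun y => f (- y)).
  have e20 : 0 < 2 * eta by rewrite mulr_gt0.
  have ndc : - d < - c by rewrite ltrN2.
  have qpos l r : - d < l -> r < - c -> pos_on q l r.
    by move=> dl rc; apply: pos_on_reflect; apply: pos; rewrite 1?ltrNr// ltrNl.
  have [e e0 He] := pext_corner (cdist_reflect cp) (dil_bounded_reflect dbd) ndc e20 M0 qpos.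
  exists (Num.min e delta); first by rewrite lt_min e0.
  move=> x' t'; rewrite subr0 !lt_min => /andP[hx _] /andP[ht htd] /andP[cx'' xd''] /andP[t'0 td'].
  apply: fin => //; first by rewrite !ltW.
  have t't : 0 < t' <= delta by rewrite t'0 ltW.
  have xe : d - x' < e by move: hx; rewrite ltr_norml => /andP[? _]; lra.
  have te : t' < e by move: ht; rewrite gtr0_norm.
  have := He (- x') t'; rewrite !pext_reflect !opprK lerN2 => /(_ (ltW xd'')).
  have -> : - x' + d = d - x' by ring.
  move=> /(_ xe t'0 te (sd t' t't)).
  have -> : 2 * eta * ((d - x') * t' / ((d - x') ^+ 2 + t' ^+ 2) ^+ 2) = eta * Bd x' t'.
    by rewrite BdE; ring.
  have : 0 <= eta * Bc x' t' by rewrite mulr_ge0 ?(ltW eta0)// Bc0// ltW.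
  lra.
pose rho := Num.min (x - c) (d - x) / 3.
have rho0 : 0 < rho by rewrite divr_gt0// lt_min !subr_gt0 cx'.
have rc : 3 * rho <= x - c by rewrite /rho mulrC divfK// ge_min lexx.
have rd : 3 * rho <= d - x by rewrite /rho mulrC divfK// ge_min lexx orbT.
have [|C C0 HC] := @pext_pos_bottom _ p cp x rho rho0.
  by apply: pos; lra.
have C1 : 0 < 4 * (C + 1) by rewrite mulr_gt0// ltr_wpDl.
exists (Num.min (rho / 2) (eta / (4 * (C + 1)))); first by rewrite lt_min (divr_gt0 rho0)// (divr_gt0 eta0).
move=> x' t'; rewrite subr0 !lt_min => /andP[hx _] /andP[_ ht] /andP[cx'' xd''] /andP[t'0 td'].
apply: fin => //; first by rewrite !ltW.
have := HC x' t' (ltW hx) t'0.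
have : 0 <= eta * (Bc x' t' + Bd x' t').
  by rewrite mulr_ge0 ?(ltW eta0)// addr_ge0 ?Bc0 ?Bd0// ltW.
have : 0 <= M * t' by rewrite mulr_ge0// ltW.
move: ht; rewrite gtr0_norm// ltr_pdivlMr//; nra.
Qed.

End Strip.

(** * Integrals over segments *)

Section Segments.
Context {R : realType}.
Local Notation mu := (@lebesgue_measure R).
Implicit Types (f g F G psi : R -> R) (x y z s t e l r a b : R).

(* The integral of a continuous function over a segment. *)
Definition sint a b f : R := (\int[mu]_(x in `[a, b]) f x)%R.

Lemma continuous_integrable a b f : continuous f ->
  mu.-integrable `[a, b]%classic (EFin \o f).
Proof.
move=> cf; apply: continuous_compact_integrable; first exact: segment_compact.
exact: continuous_subspaceT.
Qed.

Lemma is_derive_continuous f g : (forall x, is_derive x 1 f (g x)) -> continuous f.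
Proof.
by move=> H x; apply: differentiable_continuous; apply/derivable1_diffP; have [] := H x.
Qed.

Lemma FTC2_segment a b F f : a < b -> continuous f -> (forall x, is_derive x 1 F (f x)) ->
  (\int[mu]_(x in `[a, b]) (f x)%:E = (F b - F a)%:E)%E.
Proof.
move=> ab cf dF; rewrite (@continuous_FTC2 _ f F)//.
- exact: continuous_subspaceT.
- have cF := is_derive_continuous dF; split.
  + by move=> x _; have [] := dF x.
  + exact: cvg_at_right_filter (cF a).
  + exact: cvg_at_left_filter (cF b).
- by move=> x _; exact: is_derive_derive1.
Qed.

Lemma sint_FTC a b F f : a < b -> continuous f -> (forall x, is_derive x 1 F (f x)) ->
  sint a b f = F b - F a.
Proof. by move=> ab cf dF; rewrite /sint /Rintegral (FTC2_segment ab cf dF). Qed.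

Lemma is_derive_sint a s f : continuous f -> a < s ->
  is_derive s 1 (fun s => sint a s f) (f s).
Proof.
move=> cf lt_as.
have s1 : s < s + 1 by rewrite ltrDl.
have [|||d1 d2] := @continuous_FTC1 R f (BLeft a) s (s + 1) s1.
- exact: continuous_integrable.
- by rewrite /= lte_fin.
- exact: cf.
by rewrite -d2; exact: derivable_is_derive.
Qed.

Lemma sintB a b f g : continuous f -> continuous g ->
  sint a b (fun x => f x - g x) = sint a b f - sint a b g.
Proof. by move=> cf cg; apply: RintegralB => //; exact: continuous_integrable. Qed.

Lemma sintZ a b c f : continuous f -> sint a b (fun x => c * f x) = c * sint a b f.
Proof. by move=> cf; apply: RintegralZl => //; exact: continuous_integrable. Qed.

Lemma le_sint a b f g : continuous f -> continuous g ->
  (forall x, a <= x <= b -> f x <= g x) -> sint a b f <= sint a b g.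
Proof.
by move=> cf cg fg; apply: le_Rintegral => //; exact: continuous_integrable.
Qed.

Lemma sint_cst a b c : a <= b -> sint a b (fun=> c) = c * (b - a).
Proof.
move=> ab; rewrite /sint Rintegral_cst//= lebesgue_measure_itv /= lte_fin.
by case: ltP => // ba; congr (c * _); apply/esym/eqP; rewrite subr_eq0 eq_le ab ba.
Qed.

Lemma norm_sint_le a b f g : continuous f -> continuous g ->
  (forall x, a <= x <= b -> `|f x| <= g x) -> `|sint a b f| <= sint a b g.
Proof.
move=> cf cg fg; rewrite ler_norml; apply/andP; split.
  have -> : - sint a b g = sint a b (fun x => -1 * g x) by rewrite sintZ// mulN1r.
  apply: le_sint => // [x|x /fg]; first by apply: cvgM; [exact: cvg_cst|exact: cg].
  by rewrite ler_norml mulN1r => /andP[].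
by apply: le_sint => // x /fg; rewrite ler_norml => /andP[].
Qed.

Lemma sint_eq0 a b f : (forall x, a <= x <= b -> f x = 0) -> sint a b f = 0.
Proof.
move=> f0; rewrite /sint (@eq_Rintegral _ _ _ _ _ (fun=> 0)).
  by rewrite Rintegral_cst// mul0r.
by move=> x; rewrite inE /= in_itv /=; exact: f0.
Qed.

(* Differentiation under the integral sign, with a quadratic error bound. *)
Lemma is_derive_sint_param a b (K K1 : R -> R -> R) y (B : R) : a <= b ->
  (forall y, continuous (fun x => K x y)) -> (forall y, continuous (fun x => K1 x y)) ->
  (forall x h, a <= x <= b -> `|K x (y + h) - K x y - h * K1 x y| <= B * h ^+ 2) ->
  is_derive y 1 (fun y => sint a b (fun x => K x y)) (sint a b (fun x => K1 x y)).
Proof.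
move=> ab cK cK1 HB.
apply: (@is_derive_quad _ _ _ _ (B * (b - a)) 1) => // h _.
have cB : continuous (fun x => K x (y + h) - K x y).
  by move=> x; apply: cvgB; exact: cK.
have cZ : continuous (fun x => h * K1 x y).
  by move=> x; apply: cvgM; [exact: cvg_cst|exact: cK1].
rewrite -sintZ// -sintB// -sintB//.
have -> : B * (b - a) * h ^+ 2 = sint a b (fun=> B * h ^+ 2) by rewrite sint_cst//; ring.
apply: norm_sint_le.
- by move=> x; apply: cvgB; [exact: cB|exact: cZ].
- by move=> x; exact: cvg_cst.
- by move=> x; exact: HB.
Qed.

End Segments.

(** * Poisson integrals of a test function *)

Section Convolution.
Context {R : realType}.
Implicit Types (f g psi : R -> R) (x y z s t e l r a b : R) (p : (R -> R) -> R).

Lemma is_derive_atan_kernel x y t : 0 < t ->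
  is_derive x 1 (fun x => atan ((x - y) / t)) (pkern x t y).
Proof.
move=> t0; have a := is_derive_affine (is_derive1_atan ((x - y) / t)).
apply: (is_derive_eq a); rewrite /pkern.
have n0 : (y - x) ^+ 2 + t ^+ 2 != 0 by exact: den_neq0.
have n1 : 1 + ((x - y) / t) ^+ 2 != 0.
  by rewrite gt_eqF// ltr_pwDl// sqr_ge0.
have tn : t != 0 by rewrite gt_eqF.
rewrite -(opprB x y) sqrrN in n0 *.
have -> : 1 + ((x - y) / t) ^+ 2 = ((x - y) ^+ 2 + t ^+ 2) / t ^+ 2 by field.
by field; rewrite n0 tn.
Qed.

(* The k-th y-derivative of [pkern x t y]; also minus its x-derivatives. *)
Let K k x t y : R := - ((-1) ^+ k * cfact 1 k * cpart true (1 + k) (y - x) t).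

Let K0 x t y : K 0 x t y = pkern x t y.
Proof. by rewrite pkernE /K /ckern /cfact big_ord0 !mul1r. Qed.

Let dKy k x t y : 0 < t -> is_derive y 1 (fun y => K k x t y) (K k.+1 x t y).
Proof.
move=> t0; have [sc E] := derive1n_ckern true 1 x t0.
have d := smooth_is_derive k y sc; rewrite !E in d.
exact: is_deriveNr.
Qed.

Let dKx k x t y : 0 < t -> is_derive x 1 (fun x => K k x t y) (- K k.+1 x t y).
Proof.
move=> t0; have d := dKy k 0 (y - x) t0.
have i : is_derive x 1 (fun x => y - x) (- 1).
  by apply: (is_derive_eq (is_deriveBr (is_derive_cstr y x) (is_derive_idr x))); rewrite sub0r.
have c := @is_derive1_comp _ (fun z => K k 0 t z) (fun x => y - x) x _ _ d i.
have -> : (fun x => K k x t y) = (fun z => K k 0 t z) \o (fun x => y - x).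
  by apply/funext => z; rewrite /K /= subr0.
by apply: (is_derive_eq c); rewrite /K subr0; ring.
Qed.

Let K_bound k t : 0 < t -> exists2 B, 0 <= B & forall x y, `|K k x t y| <= B.
Proof.
move=> t0; exists (cfact 1 k * t^-1 ^+ (1 + k)).
  by rewrite mulr_ge0 ?cfact_ge0// exprn_ge0// invr_ge0 ltW.
move=> x y; rewrite /K normrN -derive1n_ckernE//.
by apply: derive1n_ckern_le => //; rewrite lerDr sqr_ge0.
Qed.

Let K_cont k t y : 0 < t -> continuous (fun x => K k x t y).
Proof. by move=> t0; exact: is_derive_continuous (fun x => dKx k x y t0). Qed.

Let PK_cont psi k t y : Cinf psi -> 0 < t -> continuous (fun x => psi x * K k x t y).
Proof.
move=> sp t0 x; apply: cvgM; first exact: (smooth_continuous sp).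
exact: K_cont.
Qed.

Variables (psi : R -> R) (al be : R).
Hypothesis spsi : Cinf psi.
Hypothesis psi0 : forall x, ~~ (al <= x <= be) -> psi x = 0.
Hypothesis albe : al <= be.

Let dpsi0 k x : x < al \/ be < x -> derive1n k psi x = 0.
Proof.
move=> [xa|xb]; apply: derive1n_near0; near=> z; apply: psi0; rewrite negb_and -!ltNge.
  by apply/orP; left; near: z; exact: lt_nbhsl.
by apply/orP; right; near: z; exact: lt_nbhsr.
Unshelve. all: end_near. Qed.

Let M0 := `|al| + `|be|.

Let dpsi_bound N : exists2 S, 0 <= S & forall k x, (k <= N)%N -> `|derive1n k psi x| <= S.
Proof.
apply: (@smooth_bounded_supp _ _ M0) => // x; rewrite /M0 => xM; apply: psi0.
apply/negP => /andP[ax xb]; move: xM; apply/negP; rewrite -leNgt ler_norml.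
have := ler_norm be; have := normr_ge0 be; have := normr_ge0 al.
by have := lerNnormlW (lexx `|al|); move=> *; apply/andP; split; lra.
Qed.

Variable t : R.
Hypothesis t0 : 0 < t.

(** The upper limit s is kept variable so that [p (pconv s)] can be differentiated in s, which takes
    the place of exchanging p with the integral. The lower limit lies strictly left of the support
    of psi. *)
Definition pconv s y : R := sint (al - 1) s (fun x => psi x * pkern x t y).

Let pconv_family s : al - 1 <= s -> Cinf (pconv s) /\
  forall k y, derive1n k (pconv s) y = sint (al - 1) s (fun x => psi x * K k x t y).
Proof.
move=> als; pose F k y := sint (al - 1) s (fun x => psi x * K k x t y).
have dF k y : is_derive y 1 (F k) (F k.+1 y).
  have [B B0 HB] := K_bound k.+2 t0; have [S S0 HS] := dpsi_bound 0.
  apply: (@is_derive_sint_param _ _ _ (fun x y => psi x * K k x t y) (fun x y => psi x * K k.+1 x t y) y (S * B)) => //.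
  - by move=> z; exact: PK_cont.
  - by move=> z; exact: PK_cont.
  - move=> x h _.
    have -> : psi x * K k x t (y + h) - psi x * K k x t y - h * (psi x * K k.+1 x t y) =
      psi x * (K k x t (y + h) - K k x t y - h * K k.+1 x t y) by ring.
    rewrite normrM -mulrA; apply: ler_pM => //; first exact: (HS 0%N).
    apply: (@taylor2 _ (fun y => K k x t y) (fun y => K k.+1 x t y) (fun y => K k.+2 x t y) y (`|h| + 1)).
    + by move=> z _; exact: dKy.
    + by move=> z _; exact: dKy.
    + by move=> z _; exact: HB.
    + by rewrite ltrDl.
have [] := smooth_family dF.
have -> : F 0%N = pconv s by apply/funext => y; rewrite /F /pconv; congr sint; apply/funext => x; rewrite K0.
by move=> sF E; split => // k y; rewrite E.
Qed.

Lemma smooth_pconv s : al - 1 <= s -> Cinf (pconv s).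
Proof. by move=> /pconv_family[]. Qed.

Lemma is_derive_pconv p s : cdist p -> al - 1 < s ->
  is_derive s 1 (fun s => p (pconv s)) (psi s * pext p s t).
Proof.
move=> cp als.
have sk z : Cinf (pkern z t) by exact: smooth_pkern.
have DK k z y : derive1n k (pkern z t) y = K k z t y.
  have [sc E] := derive1n_ckern true 1 z t0.
  have -> : pkern z t = (fun y => -1 * ckern true 1 z t y).
    by rewrite pkernE; apply/funext => w; rewrite mulN1r.
  by rewrite derive1nZ// E /K; ring.
have sc z : Cinf (ckern true 2 z t) by exact: smooth_ckern.
have DC k z y : derive1n k (fun y => - K 1 z t y) y = - K k.+1 z t y.
  pose F k (y : R) : R := - K k.+1 z t y.
  have dF j (w : R) : is_derive w 1 (F j) (F j.+1 w) by exact: is_deriveNr (dKy j.+1 z w t0).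
  by have [_ E] := smooth_family dF; rewrite (_ : (fun y => _) = F 0%N)// E.
have sC z : Cinf (fun y => - K 1 z t y).
  pose F k (y : R) : R := - K k.+1 z t y.
  have dF j (w : R) : is_derive w 1 (F j) (F j.+1 w) by exact: is_deriveNr (dKy j.+1 z w t0).
  by have [sF _] := smooth_family dF.
have als' s' : `|s' - s| < s - (al - 1) -> al - 1 < s'.
  by rewrite ltr_norml => /andP[? _]; lra.
rewrite /pext -(clinearZ cp.1)//.
apply: (@param_derive _ p pconv (fun s y => psi s * pkern s t y)
  (fun s y => psi s * (- K 1 s t y) + derive1 psi s * pkern s t y) s (s - (al - 1)) cp).
- by rewrite subr_gt0.
- by move=> s' /als' /ltW; exact: smooth_pconv.
- by move=> s' _; exact: smoothZ.
- move=> k y s' ss'; rewrite derive1nZ// DK.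
  have d := is_derive_sint (@PK_cont psi k t y spsi t0) (als' _ ss').
  apply: (is_derive_near_eq _ d).
  near=> s2; have h : al - 1 <= s2 by near: s2; apply: lt_le_nbhsr; exact: als'.
  by have [_ ->] := pconv_family h.
- move=> k y s' _.
  have -> : derive1n k (fun y => psi s' * - K 1 s' t y + derive1 psi s' * pkern s' t y) y =
      psi s' * - K k.+1 s' t y + K k s' t y * derive1 psi s'.
    rewrite (@derive1n_lin R k _ _ _ (sC s') (smoothZ (derive1 psi s') (sk s'))).
    by rewrite derive1nZ// DC DK [derive1 psi s' * _]mulrC.
  have -> : (fun s => derive1n k (fun y => psi s * pkern s t y) y) = (fun s => psi s * K k s t y).
    by apply/funext => s2; rewrite derive1nZ// DK.
  exact: is_deriveMr (smooth_is_derive0 s' spsi) (dKx k s' y t0).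
- move=> N M; have [S S0 HS] := dpsi_bound 1.
  have [D HD] : exists D : R, forall k x y, (k <= N.+1)%N -> `|K k x t y| <= D.
    elim: N.+1 => [|n [D HD]].
      by have [B _ HB] := K_bound 0 t0; exists B => k x y; rewrite leqn0 => /eqP ->.
    have [B _ HB] := K_bound n.+1 t0; exists (Num.max B D) => k x y.
    rewrite leq_eqVlt => /orP[/eqP ->|kn]; first by rewrite le_max HB.
    by rewrite le_max HD ?orbT.
  exists (S * D + S * D) => k y s' kN _ _.
  rewrite (@derive1n_lin R k _ _ _ (sC s') (smoothZ (derive1 psi s') (sk s'))).
  rewrite derive1nZ// DC DK.
  apply: le_trans (ler_normD _ _) _; rewrite !normrM normrN.
  apply: lerD; apply: ler_pM => //.
  + exact: (HS 0%N).
  + exact: HD.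
  + exact: (HS 1%N).
  + by apply: HD; exact: leqW.
Unshelve. all: end_near. Qed.

(* Integration by parts moves all derivatives to [psi]. *)
Let pconv_ibp k y : sint (al - 1) (be + 1) (fun x => psi x * K k x t y) =
  sint (al - 1) (be + 1) (fun x => derive1n k psi x * pkern x t y).
Proof.
have ab : al - 1 < be + 1 by move: albe; lra.
suff H j i : (i + j)%N = k -> sint (al - 1) (be + 1) (fun x => psi x * K k x t y) =
    sint (al - 1) (be + 1) (fun x => derive1n i psi x * K j x t y).
  rewrite (H 0%N k) ?addn0//; congr sint; apply/funext => x; congr (_ * _); exact: K0.
elim: i j => [|i IH] j ijk; first by rewrite -ijk add0n.
rewrite (IH j.+1); last by rewrite -ijk addSnnS.
have c1 := @PK_cont _ j.+1 t y (smooth_derive1n i spsi) t0.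
have c2 := @PK_cont _ j t y (smooth_derive1n i.+1 spsi) t0.
apply/eqP; rewrite eq_sym -subr_eq0 -sintB//; apply/eqP.
have cd : continuous (fun x => derive1n i.+1 psi x * K j x t y - derive1n i psi x * K j.+1 x t y).
  by move=> x; apply: cvgB; [exact: c2|exact: c1].
have dd x : is_derive x 1 (fun x => derive1n i psi x * K j x t y)
    (derive1n i.+1 psi x * K j x t y - derive1n i psi x * K j.+1 x t y).
  have d := is_deriveMr (smooth_is_derive i x spsi) (dKx j x y t0).
  by apply: (is_derive_eq d); ring.
rewrite (sint_FTC ab cd dd) !dpsi0 ?mul0r ?subr0//; [left|right]; lra.
Qed.

(** The approximate identity estimate. For |x - y| <= de the Lipschitz bound contributes L de pi;
    beyond de, |x - y| times the kernel is at most t / de. The last term is the missing mass of the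
    kernel: for y in [al, be] both ends of the integration interval are at distance at least 1. *)
Let pi_defect g (L S : R) y (de : R) : continuous g -> 0 < de -> 0 <= L ->
  (forall x y, `|g x - g y| <= L * `|x - y|) -> (forall x, `|g x| <= S) ->
  (forall x, x < al \/ be < x -> g x = 0) ->
  `|sint (al - 1) (be + 1) (fun x => g x * pkern x t y) - pi * g y| <=
  L * (de * pi + t / de * (be - al + 2)) + S * (pi - 2 * atan t^-1).
Proof.
move=> cg de0 L0 gL gS g0.
have ab : al - 1 < be + 1 by move: albe; lra.
have ck : continuous (fun x => pkern x t y).
  have -> : (fun x => pkern x t y) = (fun x => K 0 x t y) by apply/funext => x; rewrite K0.
  exact: K_cont.
pose th := atan ((be + 1 - y) / t) - atan ((al - 1 - y) / t).
have thE : sint (al - 1) (be + 1) (fun x => pkern x t y) = th.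
  exact: (sint_FTC ab ck (fun x => is_derive_atan_kernel x y t0)).
have th_pi : th <= pi.
  have := atan_ltpi2 ((be + 1 - y) / t); have := atan_gtNpi2 ((al - 1 - y) / t).
  by rewrite /th; lra.
have cgk : continuous (fun x => g x * pkern x t y).
  by move=> x; apply: cvgM; [exact: cg|exact: ck].
have cgyk : continuous (fun x => g y * pkern x t y).
  by move=> x; apply: cvgM; [exact: cvg_cst|exact: ck].
have -> : sint (al - 1) (be + 1) (fun x => g x * pkern x t y) - pi * g y =
   sint (al - 1) (be + 1) (fun x => g x * pkern x t y - g y * pkern x t y) - g y * (pi - th).
  by rewrite sintB// sintZ// thE; ring.
apply: le_trans (ler_normB _ _) _; apply: lerD.
  pose w x := L * de * pkern x t y + L * (t / de).
  have cw : continuous w.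
    by move=> x; apply: cvgD; [apply: cvgM; [exact: cvg_cst|exact: ck]|exact: cvg_cst].
  apply: le_trans (norm_sint_le _ cw _) _.
  - by move=> x; apply: cvgB; [exact: cgk|exact: cgyk].
  - move=> x _; rewrite -mulrBl normrM [`|pkern _ _ _|]gtr0_norm ?pkern_gt0//.
    apply: le_trans (_ : L * `|x - y| * pkern x t y <= _).
      by rewrite ler_wpM2r// ltW// pkern_gt0.
    rewrite /w -!mulrA -mulrDr ler_wpM2l//.
    have k0 := pkern_gt0 x y t0.
    have [xd|xd] := leP `|x - y| de.
      apply: le_trans (_ : de * pkern x t y <= _); first by rewrite ler_wpM2r// ltW.
      by rewrite lerDl divr_ge0// ltW.
    apply: le_trans (_ : t / de <= _); last by rewrite lerDr mulr_ge0// ltW.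
    rewrite /pkern mulrCA ler_pM2l// ler_pdivrMr ?den_gt0// mulrC ler_pdivlMr//.
    have a0 : 0 <= `|x - y| by [].
    have -> : (y - x) ^+ 2 = `|x - y| ^+ 2 by rewrite real_normK ?num_real// -(opprB x y) sqrrN.
    by have := sqr_ge0 t; nra.
  - have -> : sint (al - 1) (be + 1) w = L * de * th + L * (t / de) * (be + 1 - (al - 1)).
      rewrite /w -thE -sintZ// -sint_cst ?(ltW ab)//.
      apply: RintegralD => //; apply: continuous_integrable.
        by move=> x; apply: cvgM; [exact: cvg_cst|exact: ck].
      by move=> x; exact: cvg_cst.
    have -> : L * (de * pi + t / de * (be - al + 2)) = L * de * pi + L * (t / de) * (be + 1 - (al - 1)) by ring.
    by rewrite lerD2r ler_wpM2l// mulr_ge0// ltW.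
rewrite normrM [`|pi - th|]ger0_norm ?subr_ge0//.
have S0 : 0 <= S by exact: le_trans (normr_ge0 _) (gS 0).
have at0 : 0 <= pi - 2 * atan t^-1 :> R by have := atan_ltpi2 t^-1; lra.
have [yab|] := boolP (al <= y <= be); last first.
  rewrite negb_and -!ltNge => yab; rewrite g0 ?normr0 ?mul0r ?mulr_ge0//.
  by move: yab => /orP[]; [left|right].
apply: ler_pM; rewrite ?subr_ge0//.
rewrite lerD2l lerN2 /th; move: yab => /andP[ya yb].
have h1 : atan t^-1 <= atan ((be + 1 - y) / t).
  by apply: le_atan; rewrite -[X in X <= _]mul1r ler_pM2r ?invr_gt0//; lra.
have h2 : atan ((al - 1 - y) / t) <= - atan t^-1.
  rewrite -atanN; apply: le_atan; rewrite -[X in _ <= - X]mul1r -mulNr ler_pM2r ?invr_gt0//; lra.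
lra.
Qed.

Lemma pconv_approx N S de k y : 0 <= S ->
  (forall k x, (k <= N.+1)%N -> `|derive1n k psi x| <= S) -> (k <= N)%N -> 0 < de ->
  `|derive1n k (fun y => pconv (be + 1) y - pi * psi y) y| <=
  S * ((de * pi + t / de * (be - al + 2)) + (pi - 2 * atan t^-1)).
Proof.
move=> S0 HS kN de0.
have abe : al - 1 <= be + 1 by move: albe; lra.
have [sc E] := pconv_family abe.
rewrite derive1nB//; last exact: smoothZ.
rewrite derive1nZ// E pconv_ibp mulrDr; apply: pi_defect => //.
- exact: smooth_continuous (smooth_derive1n k spsi).
- move=> x z; wlog zx : x z / z <= x => [W|].
    by have [/W//|/ltW/W] := leP z x; rewrite distrC [`|z - x|]distrC.
  rewrite [`|x - z|]ger0_norm ?subr_ge0//.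
  by apply: (mvt_le zx (fun w _ => smooth_is_derive k w spsi)) => w _; exact: HS.
- by move=> x; apply: HS; exact: leqW.
- by move=> x; exact: dpsi0.
Qed.

End Convolution.

(** * Positivity recovered from the extension *)

Section PositivityFromExtension.
Context {R : realType}.
Implicit Types (x y z s t e l r a b : R) (p : (R -> R) -> R).

(* Approximation by Poisson integrals.  The approximants are built through the
   function s |-> p (int_(al - 1)^s psi(x) P_t(. - x) dx), whose derivative is
   psi(s) times the extension of p at (s, t). *)
Lemma pos_on_of_pext p (al be M d : R) : cdist p -> 0 <= M -> 0 < d ->
  (forall x t, al <= x <= be -> 0 < t < d -> - (M * t) <= pext p x t) -> pos_on p al be.
Proof.
move=> cp M0 d0 HF psi sp p0 ps.
have [albe|beal] := leP al be; last first.
  have -> : psi = fun=> 0.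
    apply/funext => x; apply: ps; apply/negP => /andP[? ?]; lra.
  by rewrite (clinear0 cp.1).
have [lp [Mp [C [N [Mp0 C0 H]]]]] := cp.
have [S0 [S0p HS0]] : exists S, 0 <= S /\ forall x, psi x <= S.
  have [|S S0 HS] := @smooth_bounded_supp R psi (`|al| + `|be|) 0 sp.
    move=> x xM; apply: ps; apply/negP => /andP[ax xb]; move: xM; apply/negP; rewrite -leNgt ler_norml.
    have := ler_norm be; have := normr_ge0 be; have := normr_ge0 al.
    by have := lerNnormlW (lexx `|al|); move=> *; apply/andP; split; lra.
  by exists S; split => // x; apply: le_trans (ler_norm _) (HS 0%N x isT).
have lower t : 0 < t < d -> - (M * t * S0 * (be - al + 2)) <= p (pconv psi al t (be + 1)).
  move=> /andP[t0 td].
  (* The point a lies to the left of the support, so the partial integral vanishes there, and to the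
     right of al - 1, where the derivative formula holds. *)
  pose a := al - 1/2.
  have base : p (pconv psi al t a) = 0.
    have -> : pconv psi al t a = fun=> 0.
      apply/funext => y; apply: sint_eq0 => x /andP[_ xa].
      by rewrite ps ?mul0r//; apply/negP => /andP[? _]; move: xa; rewrite /a; lra.
    exact: clinear0.
  have der s : al - 1 < s -> is_derive s 1 (fun s => p (pconv psi al t s)) (psi s * pext p s t).
    by move=> als; apply: (@is_derive_pconv _ psi al be sp ps).
  have ab : a <= be + 1 by rewrite /a; lra.
  have [s + E] : exists2 s, s \in `[a, be + 1]%R & p (pconv psi al t (be + 1)) - p (pconv psi al t a) = (psi s * pext p s t) * (be + 1 - a).
    apply: (@MVT_segment _ (fun s => p (pconv psi al t s)) (fun s => psi s * pext p s t)) => //.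
      by move=> s; rewrite in_itv /= => /andP[as_ _]; apply: der; move: as_; rewrite /a; lra.
    apply: derivable_within_continuous => s; rewrite in_itv /= => /andP[as_ _].
    by have [] : is_derive s 1 (fun s => p (pconv psi al t s)) (psi s * pext p s t) by apply: der; move: as_; rewrite /a; lra.
  rewrite in_itv /= => /andP[as_ sb].
  move: E; rewrite base subr0 => ->.
  have Mt0 : 0 <= M * t by rewrite mulr_ge0// ltW.
  have h1 : - (M * t * S0) <= psi s * pext p s t.
    have [sab|sab] := boolP (al <= s <= be); last by rewrite ps// mul0r oppr_le0 mulr_ge0.
    have := HF s t sab; rewrite t0 td => /(_ isT) Fs.
    apply: le_trans (_ : psi s * - (M * t) <= _); last by rewrite ler_wpM2l.
    by rewrite mulrN lerN2 [X in X <= _]mulrC ler_wpM2l.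
  have w0 : 0 <= be + 1 - a by rewrite subr_ge0.
  apply: le_trans (_ : - (M * t * S0) * (be + 1 - a) <= _); last by rewrite ler_wpM2r.
  by rewrite mulNr lerN2 ler_wpM2l ?mulr_ge0// /a; lra.
suff : 0 <= pi * p psi by rewrite pmulr_rge0// pi_gt0.
rewrite -(clinearZ lp)//.
rewrite -oppr_le0; apply/ler_addgt0Pr => e e0; rewrite add0r.
have [Ca [Ca0 HCa]] : exists Ca, 0 <= Ca /\ forall t de k y, 0 < t -> (k <= N)%N -> 0 < de ->
    `|derive1n k (fun y => pconv psi al t (be + 1) y - pi * psi y) y| <=
    Ca * ((de * pi + t / de * (be - al + 2)) + (pi - 2 * atan t^-1)).
  have [S S1 HS] : exists2 S, 0 <= S & forall k x, (k <= N.+1)%N -> `|derive1n k psi x| <= S.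
    apply: (@smooth_bounded_supp _ _ (`|al| + `|be|)) => // x xM; apply: ps.
    apply/negP => /andP[ax xb]; move: xM; apply/negP; rewrite -leNgt ler_norml.
    have := ler_norm be; have := normr_ge0 be; have := normr_ge0 al.
    by have := lerNnormlW (lexx `|al|); move=> *; apply/andP; split; lra.
  exists S; split => // t de k y t0 kN de0.
  exact: (@pconv_approx R psi al be sp ps albe t t0 N S de k y S1 HS kN de0).
pose err de t := C * (Ca * ((de * pi + t / de * (be - al + 2)) + (pi - 2 * atan t^-1))) + M * t * S0 * (be - al + 2).
have main de t : 0 < de -> 0 < t < d -> - p (fun x => pi * psi x) <= err de t.
  move=> de0 td; have t0 : 0 < t by case/andP: td.
  have sc : Cinf (pconv psi al t (be + 1)).
    by apply: (@smooth_pconv _ psi al be) => //; lra.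
  have B : `|p (fun y => pconv psi al t (be + 1) y - pi * psi y)| <=
      C * (Ca * ((de * pi + t / de * (be - al + 2)) + (pi - 2 * atan t^-1))).
    apply: H => [|k y kN _]; last exact: HCa.
    by apply: smoothB => //; exact: smoothZ.
  rewrite (clinearB lp) in B => //; last exact: smoothZ.
  have := lower t td; move: B; rewrite ler_norml => /andP[_]; rewrite /err.
  lra.
have W0 : 0 <= be - al + 2 by lra.
have CC0 : 0 <= C * Ca by rewrite mulr_ge0.
(* First de is fixed so that the Lipschitz term is at most e / 2; the remaining terms tend to 0 with
   t. *)
pose de := e / (2 * (C * Ca * pi + 1)).
have pi0 := @pi_gt0 R.
have de0 : 0 < de by rewrite divr_gt0// mulr_gt0// ltr_wpDl// mulr_ge0// ltW.
have hde : C * Ca * (de * pi) <= e / 2.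
  have : de * (2 * (C * Ca * pi + 1)) = e by rewrite divfK// gt_eqF// mulr_gt0// ltr_wpDl// mulr_ge0// ltW.
  by move: de0; nra.
have cvg : (C * Ca * (t / de * (be - al + 2) + (pi - 2 * atan t^-1)) + M * t * S0 * (be - al + 2)) @[t --> 0^'+] -->
   (C * Ca * (0 / de * (be - al + 2) + (pi - 2 * (pi / 2))) + M * 0 * S0 * (be - al + 2) : R).
  have ct : t @[t --> (0:R)^'+] --> (0:R) by exact: cvg_at_right_filter cvg_id.
  have cy : t^-1 @[t --> (0:R)^'+] --> +oo.
    by apply/(cvgrVy _).2; [exact: nbhs_right_gt|exact: ct].
  have ca : atan t^-1 @[t --> (0:R)^'+] --> (pi / 2 : R) := cvg_comp _ _ cy (@cvgy_atan R).
  apply: cvgD; last first.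
    apply: cvgM; last exact: cvg_cst.
    by apply: cvgM; [apply: cvgM; [exact: cvg_cst|exact: ct]|exact: cvg_cst].
  apply: cvgM; first exact: cvg_cst.
  apply: cvgD.
    by apply: cvgM; [apply: cvgM; [exact: ct|exact: cvg_cst]|exact: cvg_cst].
  by apply: cvgB; [exact: cvg_cst|apply: cvgM; [exact: cvg_cst|exact: ca]].
have near1 : \forall t \near 0^'+, C * Ca * (t / de * (be - al + 2) + (pi - 2 * atan t^-1)) + M * t * S0 * (be - al + 2) < e / 2.
  apply: (cvgr_lt _ cvg).
  have -> : pi - 2 * (pi / 2) = 0 :> R by rewrite mulrC divfK// subrr.
  by rewrite !(mul0r, mulr0, addr0) divr_gt0.
near (0 : R)^'+ => t.
have td : 0 < t < d by apply/andP; split; near: t; [exact: nbhs_right_gt|exact: nbhs_right_lt].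
apply: le_trans (main de t de0 td) _.
have : C * Ca * (t / de * (be - al + 2) + (pi - 2 * atan t^-1)) + M * t * S0 * (be - al + 2) < e / 2.
  by near: t.
rewrite /err; lra.
Unshelve. all: end_near. Qed.

End PositivityFromExtension.

(** * Localising positivity *)

Section LocalPositivity.
Context {R : realType}.
Implicit Types (x y z s t e l r a b : R) (p : (R -> R) -> R).

(** A smooth step rising from m1 to m2 splits a nonnegative psi into two nonnegative pieces, one
    supported in each interval. *)
Lemma pos_on_glue p l m1 m2 r : cdist p -> m1 < m2 -> pos_on p l m2 -> pos_on p m1 r ->
  pos_on p l r.
Proof.
move=> [lp _] m12 pl pr psi spsi psi0 psis.
pose s y := step ((y - m1) / (m2 - m1)).
have m0 : 0 < m2 - m1 by rewrite subr_gt0.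
have ss : Cinf s by exact: (smooth_affine m1 (m2 - m1) smooth_step).
have s1 y : m2 <= y -> s y = 1.
  by move=> my; apply: step1; rewrite ler_pdivlMr// mul1r lerB.
have s0 y : y <= m1 -> s y = 0.
  by move=> my; apply: step0; rewrite ler_pdivrMr// mul0r subr_le0.
have sm1 : Cinf (fun y => psi y * s y) by exact: smoothM.
have sm2 : Cinf (fun y => psi y - psi y * s y) by exact: smoothB.
have -> : psi = fun y => (psi y - psi y * s y) + psi y * s y.
  by apply/funext => y; rewrite subrK.
rewrite (clinearD lp)// addr_ge0//.
  apply: pl => // y.
    by rewrite -[X in X - _]mulr1 -mulrBr mulr_ge0// subr_ge0 step_le1.
  move=> yl; have [ly|ly] := leP l y; last by rewrite psis ?mul0r ?subrr// leNgt ly.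
  by rewrite s1 ?mulr1 ?subrr//; move: yl; rewrite ly/= -ltNge => /ltW.
apply: pr => // y; first by rewrite mulr_ge0// step_ge0.
move=> yl; have [yr|yr] := leP y r; last by rewrite psis ?mul0r// [y <= r]leNgt yr andbF.
by rewrite s0 ?mulr0//; move: yl; rewrite yr andbT -ltNge => /ltW.
Qed.

Definition locally_pos p x := exists2 d, 0 < d & pos_on p (x - d) (x + d).

Lemma locally_pos_open p x : locally_pos p x ->
  exists2 d, 0 < d & forall y, `|y - x| < d -> locally_pos p y.
Proof.
move=> [d d0 pd]; exists (d / 2); first by rewrite divr_gt0.
move=> y yx; exists (d / 2); first by rewrite divr_gt0.
by move: yx; rewrite ltr_norml => /andP[? ?]; apply: (pos_onW _ _ pd); lra.
Qed.

Lemma pos_on_empty p l r : cdist p -> r < l -> pos_on p l r.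
Proof.
move=> [lp _] rl psi _ _ ps; have -> : psi = fun=> 0.
  by apply/funext => x; apply: ps; apply/negP => /andP[? ?]; lra.
by rewrite (clinear0 lp).
Qed.

(** The supremum of the s with p positive on [l, s] cannot lie strictly inside: gluing with a
    neighbourhood of it goes further. *)
Lemma pos_on_locally p l r : cdist p -> (forall x, l <= x <= r -> locally_pos p x) ->
  pos_on p l r.
Proof.
move=> cp H; have [lr|rl] := leP l r; last exact: pos_on_empty.
pose S := [set s | l <= s <= r /\ pos_on p l s].
have Sl : S l.
  split; first by rewrite lexx.
  by have [|d d0 pd] := H l; [rewrite lexx|apply: (pos_onW _ _ pd); lra].
have Sub : has_ubound S by exists r => s [/andP[]].
have Ssup : has_sup S by split=> //; exists l.
have ls : l <= sup S by exact: ub_le_sup.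
have sr : sup S <= r by apply: ge_sup; [exists l|move=> s [/andP[]]].
have [|d d0 pd] := H (sup S); first by rewrite ls.
have [s [_ ps] sd] := sup_adherent d0 Ssup.
have pl : pos_on p l (sup S + d) by exact: (pos_on_glue cp sd ps pd).
have [rd|rd] := leP r (sup S + d); first by apply: (pos_onW _ _ pl).
have : S (sup S + d) by split=> //; apply/andP; split; lra.
by move=> /(ub_le_sup Sub); lra.
Qed.

Lemma left_gap (K : set R) al x : al <= x -> K al -> ~ K x ->
  (forall y, ~ K y -> exists2 d, 0 < d & forall z, `|z - y| < d -> ~ K z) ->
  exists c, [/\ K c, al <= c, c < x & forall y, c < y -> y <= x -> ~ K y].
Proof.
move=> alx Kal Kx oK.
pose S := [set y | K y /\ y <= x].
have Sub : has_ubound S by exists x => s [].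
have S0 : S !=set0 by exists al.
have als : al <= sup S by exact: ub_le_sup.
have sx : sup S <= x by apply: ge_sup => // s [].
have Ks : K (sup S).
  apply: contrapT => nK; have [d d0 Hd] := oK _ nK.
  have [s Ss sd] := sup_adherent d0 (conj S0 Sub).
  have ss : s <= sup S by exact: ub_le_sup.
  have [Kk _] := Ss.
  by apply: (Hd s) Kk; rewrite ltr_norml; apply/andP; split; lra.
exists (sup S); split=> //.
  by rewrite lt_neqAle sx andbT; apply/eqP => E; apply: Kx; rewrite -E.
by move=> y sy yx Ky; have /(ub_le_sup Sub) := conj Ky yx : S y; lra.
Qed.

(** The points c and d bound the component of x in the complement of K. The right end comes from
    [left_gap] applied to the reflected set. *)
Lemma gap (K : set R) al be x : al <= x <= be -> K al -> K be -> ~ K x ->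
  (forall y, ~ K y -> exists2 d, 0 < d & forall z, `|z - y| < d -> ~ K z) ->
  exists c d, [/\ K c, K d, al <= c & d <= be] /\
    [/\ c < x, x < d & forall y, c < y -> y < d -> ~ K y].
Proof.
move=> /andP[alx xbe] Ka Kb Kx oK.
have [c [Kc alc cx cK]] := left_gap alx Ka Kx oK.
have [| | | |d [Kd ald dx dK]] := @left_gap [set y | K (- y)] (- be) (- x).
- by rewrite lerN2.
- by rewrite /= opprK.
- by rewrite /= opprK.
- move=> y /oK[d d0 Hd]; exists d => // z zy; apply: Hd.
  by rewrite -opprD normrN.
exists c, (- d); split; first by split=> //; lra.
split=> //; first lra.
move=> y cy yd; have [yx|xy] := leP y x; first exact: cK.
by rewrite -[y]opprK; apply: dK; lra.
Qed.

End LocalPositivity.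

(** * From pointwise boundary bounds to positivity *)

Section PointwiseMinimum.
Context {R : realType}.
Implicit Types (x y z s t e l r a b : R).
Variable p : (R -> R) -> R.
Hypothesis cp : cdist p.
Hypothesis bp : forall c, dil_bounded p c.
Hypothesis hp : forall x, exists C d, 0 < d /\ forall t, 0 < t < d -> - (C * t) <= pext p x t.

Let bad x := ~ locally_pos p x.

Let cont_pext x t e : 0 < t -> 0 < e ->
  exists2 d, 0 < d & forall y, `|y - x| <= d -> `|pext p y t - pext p x t| < e.
Proof.
move=> t0 e0; have [L L0 HL] := cext_lipschitz true 1 cp t0.
exists (e / (2 * (L + 1))); first by rewrite divr_gt0// mulr_gt0// ltr_wpDl.
move=> y yx; rewrite !pext_cext// -opprD normrN.
apply: le_lt_trans (HL x t y t _ _) _ => //.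
rewrite subrr normr0 addr0; apply: le_lt_trans (_ : (L + 1) * (e / (2 * (L + 1))) < _).
  by apply: ler_pM => //; rewrite lerDl.
suff -> : (L + 1) * (e / (2 * (L + 1))) = e / 2 by lra.
by field; apply/eqP; lra.
Qed.

(** Baire's argument with nested intervals. If it failed, each interval meeting the bad set would
    contain a smaller such interval over which the extension is below - (n + 1) t at some height t <
    1/(n + 1). A point common to all of them contradicts the bound assumed there once n + 1 exceeds
    C and 1 / d. *)
Let baire x0 : bad x0 -> exists l r (n : nat), (exists x, bad x /\ l < x < r) /\
  forall x t, bad x -> l < x < r -> 0 < t < n.+1%:R^-1 -> - (n.+1%:R * t) <= pext p x t.
Proof.
move=> bx0; apply: contrapT => nH.
pose P (I : R * R) := exists x, bad x /\ I.1 < x < I.2.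
pose Q (n : nat) (I J : R * R) := [/\ P J, I.1 <= J.1, J.2 <= I.2 &
  exists2 t, 0 < t < n.+1%:R^-1 & forall y, J.1 <= y <= J.2 -> pext p y t < - (n.+1%:R * t)].
have next n I : P I -> exists J, Q n I J.
  move=> PI; apply: contrapT => nJ; apply: nH; exists I.1, I.2, n; split=> // x t bx xI t0n.
  rewrite leNgt; apply/negP => xt; apply: nJ.
  have /andP[t0 tn] := t0n; have /andP[xl xr] := xI.
  have e0 : 0 < - (n.+1%:R * t) - pext p x t by rewrite subr_gt0.
  have [d d0 Hd] := cont_pext x t0 e0.
  exists (Num.max I.1 (x - d), Num.min I.2 (x + d)); split=> /=.
  - by exists x; split=> //=; rewrite gt_max lt_min xl xr; apply/andP; split; lra.
  - by rewrite le_max lexx.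
  - by rewrite ge_min lexx.
  exists t => // y; rewrite ge_max le_min => /andP[/andP[_ y1] /andP[_ y2]].
  have /Hd : `|y - x| <= d by rewrite ler_norml; apply/andP; split; lra.
  by rewrite ltr_norml => /andP[]; lra.
have /choice[F HF] : forall nI : nat * (R * R), exists J, P nI.2 -> Q nI.1 nI.2 J.
  move=> [n I]; have [PI|nPI] := pselect (P I); last by exists I.
  by have [J QJ] := next n I PI; exists J.
pose I := fix I n := if n is n'.+1 then F (n', I n') else (x0 - 1, x0 + 1).
have PI n : P (I n).
  elim: n => [|n IHn]; last by have [] := HF (n, I n) IHn.
  by exists x0; split=> //=; apply/andP; split; lra.
have QI n : Q n (I n) (I n.+1) by apply: (HF (n, I n)); exact: PI.
have lr n : (I n).1 < (I n).2 by have [x [_ /andP[? ?]]] := PI n; lra.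
have mono m n : (m <= n)%N -> (I m).1 <= (I n).1 /\ (I n).2 <= (I m).2.
  move=> /subnK <-; elim: (n - m)%N => [//|k [IH1 IH2]]; rewrite addSn.
  by have [_ q1 q2 _] := QI (k + m)%N; split; [exact: le_trans q1|exact: le_trans IH2].
pose z : R := sup (range (fun n => (I n).1)).
have zI n : (I n).1 <= z <= (I n).2.
  have ub m k : (I m).1 <= (I k).2.
    have [m1 _] := mono m (maxn m k) (leq_maxl _ _).
    have [_ k2] := mono k (maxn m k) (leq_maxr _ _).
    by apply: le_trans m1 (le_trans (ltW (lr _)) k2).
  apply/andP; split.
    apply: ub_le_sup; last by exists n.
    by exists (I 0%N).2 => _ [m _ <-].
  by apply: ge_sup; [exists (I 0%N).1, 0%N|move=> _ [m _ <-]].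
have [C [d [d0 Hz]]] := hp z.
pose n := Num.truncn (Num.max C d^-1).
have nC : Num.max C d^-1 < n.+1%:R by exact: truncnS_gt.
have [_ _ _ [t /andP[t0 tn] Ht]] := QI n.
have := Ht z (zI n.+1); rewrite ltNge => /negP; apply.
move: nC; rewrite gt_max => /andP[nC nd].
apply: le_trans (Hz t _); last first.
  by rewrite t0/= (lt_trans tn)// invf_plt ?posrE.
by rewrite lerN2 ler_wpM2r// ltW.
Qed.

(* On the closed set of bad points the hypothesis is uniform in some interval, by
   Baire; the minimum principle on the complementary components then makes it
   uniform near a bad point, which is absurd. *)
Lemma locally_pos_everywhere x : locally_pos p x.
Proof.
apply: contrapT => /baire [l [r [n [[x1 [bx1 /andP[lx1 x1r]]] Hn]]]].
pose al : R := (l + x1) / 2; pose be : R := (x1 + r) / 2.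
have lal : l < al by rewrite /al; lra.
have alx1 : al < x1 by rewrite /al; lra.
have x1be : x1 < be by rewrite /be; lra.
have ber : be < r by rewrite /be; lra.
have [Ca [da [da0 Ha]]] := hp al; have [Cb [db [db0 Hb]]] := hp be.
pose N : R := n.+1%:R; have N0 : 0 < N by rewrite /N.
pose m : R := Num.min N^-1 (Num.min da db).
have m0 : 0 < m by rewrite !lt_min invr_gt0 N0 da0 db0.
have mN : m <= N^-1 by rewrite ge_min lexx.
have ma : m <= da by rewrite !ge_min lexx orbT.
have mb : m <= db by rewrite !ge_min lexx !orbT.
pose de : R := m / 2.
have de0 : 0 < de by rewrite divr_gt0.
have dem : de < m by rewrite /de; lra.
have [L L0 HL] := cext_lipschitz true 1 cp de0.
pose B : R := `|pext p al de| + L * (be - al).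
have B0 : 0 <= B by apply: addr_ge0 => //; apply: mulr_ge0 => //; lra.
have Bd : 0 <= B / de by apply: divr_ge0 => //; exact: ltW.
(* M dominates the Baire bound on bad points, the bounds over al and be, and the bound on the top
   side at height de. *)
pose M : R := N + `|Ca| + `|Cb| + B / de.
have M0 : 0 <= M.
  by apply: addr_ge0 => //; apply: addr_ge0 => //; apply: addr_ge0 => //; exact: ltW.
have Ma : Ca <= M by rewrite /M; have := ler_norm Ca; have := normr_ge0 Cb; lra.
have Mb : Cb <= M by rewrite /M; have := ler_norm Cb; have := normr_ge0 Ca; lra.
have MN : N <= M by rewrite /M; have := normr_ge0 Cb; have := normr_ge0 Ca; lra.
have MB : B / de <= M by rewrite /M; have := normr_ge0 Cb; have := normr_ge0 Ca; lra.
have weaken C t y : 0 < t -> C <= M -> - (C * t) <= pext p y t -> - (M * t) <= pext p y t.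
  by move=> t0 CM; apply: le_trans; rewrite lerN2 ler_wpM2r// ltW.
(* Adding al and be to the bad set ensures that each other point of [al, be] lies in a gap whose two
   ends carry a bound. *)
pose K := [set y | bad y \/ y = al \/ y = be].
have side y t : K y -> al <= y <= be -> 0 < t <= de -> - (M * t) <= pext p y t.
  move=> Ky /andP[aly ybe] /andP[t0 td]; have tm : t < m by exact: le_lt_trans td dem.
  case: Ky => [by_|[->|->]].
  - apply: (weaken N) => //; apply: Hn => //; first by apply/andP; split; lra.
    by rewrite t0 (lt_le_trans tm).
  - by apply: (weaken Ca) => //; apply: Ha; rewrite t0 (lt_le_trans tm).
  - by apply: (weaken Cb) => //; apply: Hb; rewrite t0 (lt_le_trans tm).
have top y : al <= y <= be -> - (M * de) <= pext p y de.
  move=> /andP[aly ybe]; apply: (weaken (B / de)) => //.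
  rewrite divfK ?gt_eqF//.
  have := HL al de y de (lexx _) (lexx _); rewrite subrr normr0 addr0.
  have -> : cext p true 1 y de = - pext p y de by rewrite pext_cext// opprK.
  have -> : cext p true 1 al de = - pext p al de by rewrite pext_cext// opprK.
  rewrite [`|y - al|]ger0_norm ?subr_ge0// => H.
  have : L * (y - al) <= L * (be - al) by rewrite ler_wpM2l// lerB.
  move: H; rewrite ler_norml => /andP[H1 H2].
  by rewrite /B; have := ler_norm (- pext p al de); rewrite normrN; lra.
have oK y : ~ K y -> exists2 d, 0 < d & forall z, `|z - y| < d -> ~ K z.
  move=> nK; have [gy [na nb]] : locally_pos p y /\ y != al /\ y != be.
    split; first by apply: contrapT => ?; apply: nK; left.
    by split; apply/eqP => ?; apply: nK; right; [left|right].
  have [d d0 Hd] := locally_pos_open gy.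
  pose d' : R := Num.min d (Num.min `|y - al| `|y - be|).
  exists d'; first by rewrite !lt_min d0 !normr_gt0 !subr_eq0 na nb.
  move=> z; rewrite !lt_min => /andP[zd /andP[za zb]] [bz|[E|E]].
  - exact: bz (Hd _ zd).
  - by move: za; rewrite E distrC ltxx.
  - by move: zb; rewrite E distrC ltxx.
apply: bx1; pose e : R := Num.min (x1 - al) (be - x1).
have e0 : 0 < e by rewrite lt_min !subr_gt0 alx1 x1be.
have ea : e <= x1 - al by rewrite ge_min lexx.
have eb : e <= be - x1 by rewrite ge_min lexx orbT.
exists e => //; apply: (@pos_onW _ _ al be); [lra|lra|].
apply: (pos_on_of_pext cp M0 de0) => y t yab tde.
have [Ky|nKy] := pselect (K y).
  by apply: side => //; have /andP[-> /ltW ->] := tde.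
have Ka : K al by right; left.
have Kb : K be by right; right.
have [c [d [[Kc Kd alc dbe] [cy yd cK]]]] := gap yab Ka Kb nKy oK.
have cab : al <= c <= be by apply/andP; split; lra.
have dab : al <= d <= be by apply/andP; split; lra.
apply: (@pext_strip _ p c d de M) => //; first exact: lt_trans yd.
- move=> l' r' cl rd; apply: pos_on_locally => // z /andP[lz zr].
  by apply: contrapT => bz; have := cK z; case; [lra|lra|left].
- by move=> s; exact: side.
- by move=> s; exact: side.
- by move=> z /andP[cz zd]; apply: top; apply/andP; split; lra.
- by rewrite cy.
Qed.

Lemma pos_on_everywhere l r : pos_on p l r.
Proof. by apply: pos_on_locally => // x _; exact: locally_pos_everywhere. Qed.

End PointwiseMinimum.

(** * A measure charging the exceptional sets *)

Section CoveringMeasure.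
Context {R : realType}.
Local Notation mu := (@lebesgue_measure R).
Local Notation cball x t := (`[(x - t)%R, (x + t)%R]%classic : set R).
Implicit Types (x y z s t e l r a b : R) (E Z : set R).

Lemma countable_enum E : countable E -> exists x : nat -> R, E `<=` range x.
Proof.
move=> /pcard_injP[f injf]; exists (fun n => xget 0 [set x | E x /\ f x = n]).
move=> x Ex; exists (f x) => //; apply: xget_unique => // y [Ey fyx].
by apply: injf => //; rewrite inE.
Qed.

Lemma open_cover_negligible Z e : mu.-negligible Z -> 0 < e ->
  exists V : set R, [/\ open V, Z `<=` V & (mu V <= e%:E)%E].
Proof.
move=> [A [mA A0 ZA]] e0.
have Aoo : (mu A < +oo)%E by rewrite [mu A]A0.
have [V [oV AV VA]] := lebesgue_regularity_outer mA Aoo e0.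
exists V; split=> //; first exact: subset_trans AV.
have mV : measurable V by exact: open_measurable.
apply: (@le_trans _ _ (mu (V `\` A) + mu A)%E).
  rewrite -{1}(setDUK AV) setUC; apply: measureU2 => //; exact: measurableD.
by rewrite (_ : mu A = 0%E)// adde0 ltW.
Qed.

(* Its upper density is infinite on Z, and it has atoms at the points of E. *)
Lemma covering_measure E Z : countable E -> mu.-negligible Z ->
  exists m : {measure set (measurableTypeR R) -> \bar R},
  [/\ forall a b, (m `[a, b]%classic < +oo)%E,
      forall x t, 0 < t -> ((2 * t)%:E <= m (cball x t))%E,
      forall x (n : nat), Z x -> exists2 d, 0 < d & forall t, 0 < t < d ->
        ((n%:R * t)%:E <= m (cball x t))%E &
      forall x, E x -> exists2 c, 0 < c & forall t, 0 < t ->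
        (c%:E <= m (cball x t))%E].
Proof.
move=> /countable_enum[q Eq] nZ.
pose w (k : nat) : R := 1 / (2 ^ k.+1)%:R.
have w0 k : 0 < w k by rewrite divr_gt0// ltr0n expn_gt0.
have /choice[V HV] := fun k => open_cover_negligible nZ (w0 k).
have mV k : measurable (V k) by have [/open_measurable] := HV k.
pose c k : {nonneg R} := NngNum (ltW (w0 k)).
pose q' : nat -> measurableTypeR R := q.
(* The k-th term is Lebesgue measure on an open set V k containing Z, of measure at most w k, plus a
   mass w k at the k-th point of an enumeration of E. The total mass of the series is finite because
   the w k are summable. *)
pose M k : {measure set (measurableTypeR R) -> \bar R} :=
  measure_add (mrestr mu (mV k)) (mscale (c k) (dirac (q' k))).
have ME k A : M k A = (mu (A `&` V k) + (w k * (q k \in A)%:R)%:E)%E.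
  by rewrite EFinM; exact: measure_addE.
pose S : {measure set (measurableTypeR R) -> \bar R} := mseries M 0.
have SE A : S A = (\sum_(0 <= k <oo) M k A)%E by [].
have muI x t : 0 < t -> mu (cball x t) = (2 * t)%:E.
  move=> t0; rewrite lebesgue_measure_itv/= lte_fin ifT; last by lra.
  by rewrite -EFinD; congr EFin; ring.
pose T : {measure set (measurableTypeR R) -> \bar R} := measure_add mu S.
have TE A : T A = (mu A + S A)%E by exact: measure_addE.
exists T; split.
- move=> a b; rewrite TE lte_add_pinfty//.
    by rewrite /= lebesgue_measure_itv/=; case: ifP => // _; rewrite -EFinD ltry.
  rewrite SE; apply: (@le_lt_trans _ _ (\sum_(0 <= k <oo) (2 / (2 ^ k.+1)%:R)%:E)%E).
    apply: lee_nneseries => [k _ _|k _]; first exact: measure_ge0.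
    rewrite ME; have -> : 2 / (2 ^ k.+1)%:R = w k + w k :> R by rewrite /w -mulrDl.
    rewrite EFinD; apply: leeD.
      have [_ _] := HV k; apply: le_trans; apply: le_measure; rewrite ?inE//.
        by apply: measurableI; [exact: measurable_itv|exact: mV].
      exact: mV.
    rewrite lee_fin; case: (_ \in _); rewrite ?mulr1// mulr0 ltW//.
  by apply: le_lt_trans (epsilon_trick0 _ _) _; rewrite ?ltry.
- by move=> x t t0; rewrite TE -(muI x t t0) leeDl// measure_ge0.
(* For small t the interval around x lies in the first n open sets, and each of them contributes 2
   t. *)
- move=> x n Zx.
  have [d d0 Hd] : exists2 d, 0 < d & forall k y, (k < n)%N -> `|x - y| < d -> V k y.
    elim: n => [|n [d d0 Hd]]; first by exists 1.
    have [oV ZV _] := HV n; have /nbhs_ballP[d' d'0 Hd'] := oV x (ZV x Zx).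
    exists (Num.min d d'); first by rewrite lt_min d0.
    move=> k y; rewrite ltnS leq_eqVlt lt_min => /orP[/eqP ->|kn] /andP[yd yd'].
      exact: Hd'.
    exact: Hd yd.
  exists d => // t /andP[t0 td]; rewrite TE.
  apply: (@le_trans _ _ (S (cball x t))); last by rewrite leeDr// measure_ge0.
  rewrite SE; apply: (@le_trans _ _ (\sum_(0 <= k < n) M k (cball x t))%E).
    apply: (@le_trans _ _ (\sum_(0 <= k < n) (2 * t)%:E)%E).
      rewrite sumEFin lee_fin big_const_nat subn0 iter_addr_0 -[leRHS]mulr_natl.
      by apply: ler_wpM2l => //; lra.
    rewrite big_nat [leRHS]big_nat; apply: lee_sum => k /andP[_ kn]; rewrite ME.
    have -> : (cball x t) `&` V k = (cball x t).
      apply/setIidl => y /=; rewrite in_itv/= => /andP[y1 y2]; apply: (Hd k) => //.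
      by rewrite ltr_norml; apply/andP; split; lra.
    by rewrite muI// leeDl// lee_fin mulr_ge0// ltW.
  by apply: nneseries_lim_ge => k _ _; exact: measure_ge0.
- move=> x /Eq[k _ <-]; exists (w k) => // t t0; rewrite TE.
  set I := `[_, _]%classic.
  apply: (@le_trans _ _ (S I)); last by rewrite leeDr// measure_ge0.
  rewrite SE; apply: (@le_trans _ _ (\sum_(0 <= j < k.+1) M j I)%E).
    rewrite big_nat_recr//=; apply: (@le_trans _ _ (M k I)).
      rewrite ME mem_set ?mulr1 ?leeDr ?measure_ge0//.
      by rewrite /I/= in_itv/=; apply/andP; split; lra.
    by rewrite leeDr// sume_ge0// => j _; exact: measure_ge0.
  by apply: nneseries_lim_ge => j _ _; exact: measure_ge0.
Qed.

End CoveringMeasure.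

(** * Integration against a measure as a functional *)

Section IntegralFunctional.
Context {R : realType}.
Variable m : {measure set (measurableTypeR R) -> \bar R}.
Variables (a b : R).
Hypothesis finm : (m `[a, b]%classic < +oo)%E.
Local Notation cball x t := (`[(x - t)%R, (x + t)%R]%classic : set R).
Implicit Types (x y z s t e : R) (f : R -> R).

Definition mint f : R := (\int[m]_(x in `[a, b]) f x)%R.

Lemma continuous_mintegrable f : continuous f -> m.-integrable `[a, b]%classic (EFin \o f).
Proof.
move=> cf; apply: measurable_bounded_integrable => //.
  by apply: measurable_funTS; exact: continuous_measurable_fun.
have cK : compact (f @` `[a, b]%classic).
  by apply: continuous_compact; [exact: continuous_subspaceT|exact: segment_compact].
have [M [Mr HM]] := compact_bounded cK.
by exists M; split=> // y My z az; apply: (HM y My); exists z.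
Qed.

Lemma mintE f : continuous f -> (mint f)%:E = (\int[m]_(x in `[a, b]) (f x)%:E)%E.
Proof.
move=> cf; rewrite /mint /Rintegral fineK//.
by apply: integrable_fin_num => //; exact: continuous_mintegrable.
Qed.

Lemma mint_ge0 f : (forall x, 0 <= f x) -> 0 <= mint f.
Proof. by move=> f0; apply: Rintegral_ge0. Qed.

Lemma mint_le f A : continuous f -> (forall x, a <= x <= b -> `|f x| <= A) ->
  `|mint f| <= fine (m `[a, b]%classic) * A.
Proof.
move=> cf fA; apply: le_trans (_ : (\int[m]_(x in `[a, b]) `|f x|)%R <= _).
  by apply: le_normr_Rintegral => //; exact: continuous_mintegrable.
have icn : m.-integrable `[a, b]%classic (EFin \o (fun x => `|f x|)).
  by apply: continuous_mintegrable => x; apply: cvg_norm; exact: cf.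
have icA : m.-integrable `[a, b]%classic (EFin \o cst A).
  by apply: continuous_mintegrable; exact: cst_continuous.
rewrite mulrC -Rintegral_cst//.
by apply: (le_Rintegral _ icn icA) => // x /=; rewrite in_itv/=; exact: fA.
Qed.

Lemma cdist_mint : cdist mint.
Proof.
split.
  have I f : Cinf f -> m.-integrable `[a, b]%classic (EFin \o f).
    by move=> sf; apply: continuous_mintegrable; exact: smooth_continuous.
  move=> c f g sf sg; have icf := I _ (smoothM (smooth_cst c) sf).
  by rewrite /mint (RintegralD _ icf (I _ sg))// RintegralZl//; exact: I.
exists (`|a| + `|b|), (fine (m `[a, b]%classic)), 0%N; split.
- exact: addr_ge0.
- by rewrite fine_ge0.
move=> f A sf H; apply: mint_le; first exact: smooth_continuous.
move=> x /andP[ax xb]; apply: (H 0%N) => //; rewrite ler_norml.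
have := ler_norm b; have := ler_norm (- a); rewrite normrN => ? ?.
have := normr_ge0 b; have := normr_ge0 a => ? ?.
by apply/andP; split; lra.
Qed.

Lemma dil_bounded_mint c : dil_bounded mint c.
Proof.
exists (fine (m `[a, b]%classic)), 0%N, 1; split=> //.
move=> e psi A _ sp _ H; rewrite /dilation; apply: mint_le.
  by apply: smooth_continuous; exact: smooth_affine.
by move=> x _; exact: (H 0%N).
Qed.

(** Within distance t of x the kernel is at least 1 / (2 t). *)
Lemma pext_mint_ge x t r : 0 < t -> a <= x - t -> x + t <= b ->
  (r%:E <= m (cball x t))%E -> r / (2 * t) <= pext mint x t.
Proof.
move=> t0 ax xb rm.
have cp : continuous (pkern x t) by apply: smooth_continuous; exact: smooth_pkern.
rewrite -lee_fin /pext mintE//.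
have sub : cball x t `<=` `[a, b]%classic.
  by move=> y /=; rewrite !in_itv/= => /andP[? ?]; apply/andP; split; lra.
apply: (@le_trans _ _ (\int[m]_(x in cball x t) ((2 * t)^-1)%:E)%E).
  rewrite integral_cst//= muleC EFinM; apply: lee_wpmul2r => //.
  by rewrite lee_fin invr_ge0 mulr_ge0// ltW.
apply: (@le_trans _ _ (\int[m]_(y in cball x t) (pkern x t y)%:E)%E).
  apply: ge0_le_integral => //.
  - by move=> y _; rewrite lee_fin invr_ge0 mulr_ge0// ltW.
  - by apply/measurable_EFinP; apply: measurable_funTS; exact: continuous_measurable_fun.
  move=> y /=; rewrite in_itv/= => /andP[y1 y2]; rewrite lee_fin /pkern.
  have d0 : 0 < (y - x) ^+ 2 + t ^+ 2 by rewrite ltr_wpDl ?sqr_ge0// exprn_gt0.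
  rewrite ler_pdivlMr// mulrC ler_pdivrMr ?mulr_gt0//; nra.
apply: ge0_subset_integral => //.
  apply/measurable_EFinP; apply: measurable_funTS; exact: continuous_measurable_fun.
by move=> y _; rewrite lee_fin ltW// pkern_gt0.
Qed.

End IntegralFunctional.

(** * Growth of the extension at a point of vanishing dilations *)

Section PointVanishing.
Context {R : realType}.
Implicit Types (x y z s t e A rho : R) (p : (R -> R) -> R).

Lemma derive1n_plateauC N : exists2 G : R, 0 <= G & forall k z, (k <= N)%N -> 1 <= `|z| ->
  `|derive1n k (fun z => 1 - plateau z) z| <= G * `|z|^-1 ^+ k.
Proof.
have p0 x : (2 : R) < `|x| -> plateau x = 0 by move=> /ltW; exact: plateau0.
have [B B0 HB] := smooth_bounded_supp N smooth_plateau p0.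
exists ((1 + B) * 2 ^+ N) => [|k z kN z1].
  by apply: mulr_ge0; [exact: addr_ge0|exact: exprn_ge0].
have z0 : 0 < `|z| by exact: lt_le_trans z1.
have c1 : `|derive1n k (fun=> 1 : R) z| <= 1.
  by case: k {kN} => [|k]; rewrite ?derive1n_cst ?normr0//= normr1.
rewrite derive1nB//; [|exact: smooth_cst|exact: smooth_plateau].
have [z2|z2] := leP `|z| 2.
  apply: le_trans (_ : 1 + B <= _).
    by apply: le_trans (ler_normB _ _) _; apply: lerD => //; exact: HB.
  rewrite -mulrA ler_peMr ?addr_ge0// exprVn -[_ ^+ N]invrK -invfM.
  rewrite invf_ge1 ?mulr_gt0 ?invr_gt0 ?exprn_gt0// mulrC ler_pdivrMr ?exprn_gt0// mul1r.
  apply: le_trans (_ : 2 ^+ k <= _); first by rewrite lerXn2r// nnegrE.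
  by rewrite ler_weXn2l// ler1n.
rewrite (derive1n_far0 _ p0)// subr0; case: k kN {c1} => [|k] kN.
  rewrite expr0 mulr1 /= normr1; apply: mulr_ege1; first by rewrite lerDl.
  by apply: exprn_ege1; rewrite ler1n.
rewrite derive1n_cst normr0; apply: mulr_ge0; last by rewrite exprn_ge0// invr_ge0.
by apply: mulr_ge0; [exact: addr_ge0|exact: exprn_ge0].
Qed.

(** The function [t * pkern c t] is [pkern 0 1] dilated about c by t. Truncated at radius r it is a
    test function, on which dilations tend to 0; the remainder is small uniformly in t for large r,
    by the dyadic bound at radius t r. *)
Lemma pext_dil_vanishing p c e : cdist p -> dil_vanishing p c -> 0 < e ->
  exists2 d, 0 < d & forall t, 0 < t < d -> `|t * pext p c t| <= e.
Proof.
move=> cp van e0; have lp := cp.1.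
have [C [N [rho0 [C0 rho00 HC]]]] := dyadic_bound cp (dil_vanishing_bounded cp van).
have [G G0 HG] := derive1n_plateauC N.
pose D : R := cfactN 1 N * N.+1%:R.
have D0 : 0 <= D by rewrite /D mulr_ge0// cfactN_ge0.
pose K : R := 2 ^+ N * (D * G).
have K0 : 0 <= K by apply: mulr_ge0; [exact: exprn_ge0|exact: mulr_ge0].
(* The choice of r makes the contribution [C * K / r] of the remainder at most e / 2. *)
pose r : R := 1 + 2 * (C * K) / e.
have r1 : 1 <= r.
  rewrite lerDl; apply: divr_ge0; last exact: ltW.
  by apply: mulr_ge0 => //; exact: mulr_ge0.
have r0 : 0 < r by exact: lt_le_trans r1.
have rK : C * K / r <= e / 2.
  rewrite ler_pdivrMr//; have -> : e / 2 * r = e / 2 + C * K.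
    by rewrite /r; field; rewrite gt_eqF.
  by rewrite lerDr; apply: divr_ge0; [exact: ltW|].
pose psi z := pkern 0 1 z * plateau ((z - 0) / r).
have sk : Cinf (pkern 0 (1 : R)) by exact: smooth_pkern.
have sr : Cinf (fun z => plateau ((z - 0) / r)) by apply: smooth_affine; exact: smooth_plateau.
have spsi : Cinf psi by exact: smoothM.
have tpsi : test_function psi.
  apply: (@test_functionI _ _ (2 * r)) => // x xr; rewrite /psi plateau0 ?mulr0//.
  by rewrite subr0 normrM normfV (gtr0_norm r0) ler_pdivlMr// ltW.
have /cvgrPdist_le/(_ _ (divr_gt0 e0 (ltr0Sn _ 1))) := van _ tpsi.
move=> [/= d1 d10 H1]; exists (Num.min d1 (rho0 / r)).
  by rewrite lt_min d10 divr_gt0.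
move=> t /andP[t0]; rewrite lt_min => /andP[td1 trho].
have {}trho : t * r < rho0 by rewrite -ltr_pdivlMr.
have tr0 : 0 < t * r by exact: mulr_gt0.
have {}H1 : `|dilation p c t psi| <= e / 2.
  have := H1 t; rewrite /= sub0r normrN (gtr0_norm t0) sub0r normrN; exact.
pose g y := 1 - plateau ((y - c) / (t * r)).
pose kappa y := (t * pkern c t y) * g y.
have skt : Cinf (fun y => t * pkern c t y).
  by apply: smoothM; [exact: smooth_cst|exact: smooth_pkern].
have sg : Cinf g.
  apply: smoothB; first exact: smooth_cst.
  by apply: smooth_affine; exact: smooth_plateau.
have skap : Cinf kappa by exact: smoothM.
have -> : t * pext p c t = dilation p c t psi + p kappa.
  rewrite /pext -(clinearZ lp); last exact: smooth_pkern.
  rewrite /dilation -(clinearD lp)//; last exact: smooth_affine.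
  congr p; apply/funext => y; rewrite /psi /kappa /g subr0.
  have -> : (y - c) / t / r = (y - c) / (t * r) by rewrite invfM mulrA.
  have -> : pkern 0 1 ((y - c) / t) = t * pkern c t y.
    have u0 := sqr_ge0 (y - c); have v0 : 0 < t ^+ 2 by rewrite exprn_gt0.
    rewrite /pkern; field; rewrite !gt_eqF//= -?expr2 ?subr0; lra.
  by ring.
suff : `|p kappa| <= e / 2.
  by move=> H2; apply: le_trans (ler_normD _ _) _; lra.
apply: le_trans (_ : C * ((K * t / r) / (t * r)) <= _); last first.
  have -> : K * t / r / (t * r) = K / r / r by field; rewrite !gt_eqF.
  apply: le_trans rK; rewrite -[leRHS]mulrA ler_wpM2l//.
  rewrite ler_pdivrMr// ler_peMr//; apply: divr_ge0 => //; exact: ltW.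
have A0 : 0 <= K * t / r.
  apply: divr_ge0; last exact: ltW.
  by apply: mulr_ge0 => //; exact: ltW.
apply: HC => //; first by rewrite tr0.
move=> k y kN; set s := `|y - c|; have [str|str] := ltP s (t * r).
  rewrite derive1n_near0 ?normr0.
    by apply: mulr_ge0 => //; apply: exprn_ge0; rewrite invr_ge0 ltW.
  have cont : (fun y : R => `|y - c|) @ y --> `|y - c|.
    by apply: cvg_norm; apply: cvgB; [exact: cvg_id|exact: cvg_cst].
  near=> w; have w1 : `|w - c| < t * r by near: w; exact: (cvgr_lt _ cont).
  rewrite /kappa /g plateau1 ?subrr ?mulr0//.
  by rewrite normrM normfV (gtr0_norm tr0) ler_pdivrMr// mul1r ltW.
have s0 : 0 < s by exact: lt_le_trans str.
have si0 : 0 <= s^-1 by rewrite invr_ge0 ltW.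
have tN0 : 0 <= D * t ^+ 2 * s^-1 ^+ 2.
  by apply: mulr_ge0; [apply: mulr_ge0 => //; exact: sqr_ge0|exact: exprn_ge0].
apply: le_trans (_ : 2 ^+ k * ((D * t ^+ 2 * s^-1 ^+ 2) * G) * s^-1 ^+ k <= _).
  apply: derive1nM_bound => // j jk.
    rewrite derive1nZ; last exact: smooth_pkern.
    rewrite normrM (gtr0_norm t0).
    apply: le_trans (ler_wpM2l (ltW t0) (derive1n_pkern_le (leq_trans jk kN) t0 s0 (lexx _))) _.
    by rewrite /D !exprS le_eqVlt; apply/orP; left; apply/eqP; ring.
  have s1 : Cinf (fun z : R => 1 - plateau z).
    by apply: smoothB; [exact: smooth_cst|exact: smooth_plateau].
  have -> : derive1n j g y =
      (t * r)^-1 ^+ j * derive1n j (fun z => 1 - plateau z) ((y - c) / (t * r)).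
    by have /(congr1 (fun h => h y)) := derive1n_affine j c (t * r) s1.
  rewrite normrM normrX normfV (gtr0_norm tr0).
  have z1 : 1 <= `|(y - c) / (t * r)|.
    by rewrite normrM normfV (gtr0_norm tr0) ler_pdivlMr// mul1r.
  apply: le_trans (ler_wpM2l _ (HG j _ (leq_trans jk kN) z1)) _.
    by rewrite exprn_ge0// invr_ge0 ltW.
  rewrite mulrCA ler_wpM2l// normrM normfV (gtr0_norm tr0) -/s -exprMn.
  by have -> : (t * r)^-1 * (s / (t * r))^-1 = s^-1 by field; rewrite !gt_eqF.
rewrite [s^-1 ^+ k.+1]exprS [leRHS]mulrA; apply: ler_wpM2r; first exact: exprn_ge0.
have -> : K * t / r * s^-1 = 2 ^+ N * (D * G * (t / r * s^-1)) by rewrite /K; ring.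
apply: ler_pM => //.
- exact: mulr_ge0.
- by rewrite ler_weXn2l// ler1n.
have -> : D * t ^+ 2 * s^-1 ^+ 2 * G = D * G * (t ^+ 2 * s^-1 ^+ 2) by ring.
apply: ler_wpM2l; first exact: mulr_ge0.
have -> : t / r * s^-1 = t * s^-1 * r^-1 by ring.
rewrite -exprMn expr2; apply: ler_wpM2l; first by rewrite mulr_ge0// ltW.
by rewrite ler_pdivrMr// mulrC ler_pdivlMr.
Unshelve. all: end_near. Qed.

End PointVanishing.

(** * Nonnegativity up to exceptional sets *)

Section Positivity.
Context {R : realType}.
Local Notation mu := (@lebesgue_measure R).
Implicit Types (x y z s t e A rho : R) (p q : (R -> R) -> R).

Lemma dil_boundedD p q c : dil_bounded p c -> dil_bounded q c ->
  dil_bounded (fun f => p f + q f) c.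
Proof.
move=> [C [N [e0 [C0 e00 H]]]] [C' [N' [e0' [C0' e00' H']]]].
exists (C + C'), (maxn N N'), (Num.min e0 e0'); split.
- exact: addr_ge0.
- by rewrite lt_min e00.
move=> e psi A /andP[e1]; rewrite lt_min => /andP[e2 e3] sp p4 HA.
rewrite mulrDl; apply: le_trans (ler_normD _ _) _; apply: lerD.
  by apply: H => // [|k y kN]; [rewrite e1|apply: HA; rewrite leq_max kN].
by apply: H' => // [|k y kN]; [rewrite e1|apply: HA; rewrite leq_max kN orbT].
Qed.

Lemma dil_boundedZ a p c : dil_bounded p c -> dil_bounded (fun f => a * p f) c.
Proof.
move=> [C [N [e0 [C0 e00 H]]]]; exists (`|a| * C), N, e0; split=> //.
  exact: mulr_ge0.
move=> e psi A e1 sp p4 HA; rewrite /dilation normrM -mulrA.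
by apply: ler_wpM2l => //; exact: H.
Qed.

(* The exceptional sets are absorbed by a small multiple of the covering measure. *)
Lemma nonneg_of_extension p a b (E Z : set R) : cdist p -> (forall c, dil_vanishing p c) ->
  (forall psi d, Cinf psi -> 0 < d -> (forall y, a - d <= y <= b + d -> psi y = 0) -> p psi = 0) ->
  countable E -> mu.-negligible Z ->
  (forall x e, a <= x <= b -> ~ Z x -> 0 < e ->
     exists2 d, 0 < d & forall t, 0 < t < d -> - e <= pext p x t) ->
  (forall x, a <= x <= b -> ~ E x ->
     exists C d, 0 < d /\ forall t, 0 < t < d -> - C <= pext p x t) ->
  forall psi, Cinf psi -> (forall x, 0 <= psi x) -> 0 <= p psi.
Proof.
move=> cp van supp cE nZ hZ hE; apply: cdist_ge0_supp => // M psi spsi psi0 psis.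
have [m [mfin mt mZ mE]] := covering_measure cE nZ.
pose nu := mint m (a - 1) (b + 1).
have cnu : cdist nu by apply: cdist_mint; exact: mfin.
have nu0 x t : 0 < t -> 0 <= pext nu x t by move=> t0; apply: mint_ge0 => y; rewrite ltW// pkern_gt0.
have nupsi : 0 <= nu psi by exact: mint_ge0.
rewrite leNgt; apply/negP => ppsi.
(* With this eta the perturbed functional satisfies q psi <= p psi / 2 < 0, against its
   positivity. *)
pose eta : R := - p psi / (2 * (nu psi + 1)).
have eta0 : 0 < eta by rewrite divr_gt0 ?oppr_gt0// mulr_gt0// ltr_wpDl.
pose q f := p f + eta * nu f.
have cq : cdist q by apply: cdistD => //; exact: cdistZ.
have bq c : dil_bounded q c.
  apply: dil_boundedD; first exact: dil_vanishing_bounded.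
  by apply: dil_boundedZ; apply: dil_bounded_mint; exact: mfin.
have qE x t : pext q x t = pext p x t + eta * pext nu x t by [].
have etanu x t : 0 < t -> 0 <= eta * pext nu x t.
  by move=> t0; apply: mulr_ge0; [exact: ltW|exact: nu0].
have outside x rho : 0 < rho ->
    (forall y, a - rho <= y <= b + rho -> ~~ (x - 2 * rho <= y <= x + 2 * rho)) ->
    exists C d, 0 < d /\ forall t, 0 < t < d -> - (C * t) <= pext q x t.
  move=> rho0 far; have pos : pos_on p (x - 2 * rho) (x + 2 * rho).
    by move=> f sf f0 fs; rewrite (supp f rho)// => y /far /fs.
  have [C _ HC] := pext_pos_bottom cp rho0 pos; exists C, 1; split=> // t /andP[t0 _].
  rewrite qE; apply: ler_wpDr; first exact: etanu.
  by apply: HC => //; rewrite subrr normr0 divr_ge0// ltW.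
have nuge x t r : a <= x <= b -> 0 < t < 1 -> (r%:E <= m `[(x - t)%R, (x + t)%R]%classic)%E ->
    eta * (r / (2 * t)) <= eta * pext nu x t.
  move=> /andP[ax xb] /andP[t0 t1] rm; apply: ler_wpM2l; first exact: ltW.
  by apply: (pext_mint_ge (mfin _ _)) => //; lra.
(* Outside [a, b] the functional p vanishes locally. Off Z the Lebesgue part of nu contributes at
   least eta, which covers the loss of eta. On Z but off E the density of nu outweighs the constant
   C. On E the atom contributes a multiple of 1 / t, while the extension of p is o(1 / t). *)
have hq x : exists C d, 0 < d /\ forall t, 0 < t < d -> - (C * t) <= pext q x t.
  have [xa|ax] := ltP x a.
    apply: (outside x ((a - x) / 4)) => [|y /andP[y1 y2]]; first by lra.
    by apply/negP => /andP[? ?]; lra.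
  have [bx|xb] := ltP b x.
    apply: (outside x ((x - b) / 4)) => [|y /andP[y1 y2]]; first by lra.
    by apply/negP => /andP[? ?]; lra.
  have xab : a <= x <= b by rewrite ax.
  have [Zx|nZx] := pselect (Z x); last first.
    have [d d0 Hd] := hZ x eta xab nZx eta0.
    exists 0, (Num.min d 1); split; first by rewrite lt_min d0/=.
    move=> t /andP[t0]; rewrite lt_min => /andP[td t1]; rewrite mul0r oppr0 qE.
    have t01 : 0 < t < 1 by rewrite t0.
    have := nuge x t (2 * t) xab t01 (mt x t t0).
    rewrite divff ?mulr1 ?mulf_neq0 ?gt_eqF//.
    by have := Hd t; rewrite t0 td => /(_ isT); lra.
  have [Ex|nEx] := pselect (E x); last first.
    have [C [d [d0 Hd]]] := hE x xab nEx.
    pose n := (Num.truncn (2 * C / eta)).+1.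
    have [d' d'0 Hd'] := mZ x n Zx.
    exists 0, (Num.min d (Num.min d' 1)); split; first by rewrite !lt_min d0 d'0/=.
    move=> t /andP[t0]; rewrite !lt_min => /andP[td /andP[td' t1]]; rewrite mul0r oppr0 qE.
    have t01 : 0 < t < 1 by rewrite t0.
    have := Hd' t; rewrite t0 td' => /(_ isT) /(nuge x t _ xab t01).
    have -> : n%:R * t / (2 * t) = n%:R / 2 by field; rewrite gt_eqF.
    have : 2 * C / eta < n%:R by exact: truncnS_gt.
    rewrite ltr_pdivrMr// => nC.
    by have := Hd t; rewrite t0 td => /(_ isT); lra.
  have [c c0 Hc] := mE x Ex.
  have e0 : 0 < eta * c / 2 by rewrite divr_gt0// mulr_gt0.
  have [d d0 Hd] := pext_dil_vanishing cp (van x) e0.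
  exists 0, (Num.min d 1); split; first by rewrite lt_min d0/=.
  move=> t /andP[t0]; rewrite lt_min => /andP[td t1]; rewrite mul0r oppr0 qE.
  have t01 : 0 < t < 1 by rewrite t0.
  have := nuge x t c xab t01 (Hc t t0).
  have -> : eta * (c / (2 * t)) = eta * c / 2 / t by field; rewrite gt_eqF.
  have := Hd t; rewrite t0 td => /(_ isT); rewrite ler_norml => /andP[H _].
  have : - (eta * c / 2 / t) <= pext p x t by rewrite -mulNr ler_pdivrMr// [leRHS]mulrC.
  lra.
have : 0 <= q psi.
  apply: (pos_on_everywhere cq bq hq (l := - M) (r := M)) => // x xM; apply: psis.
  by rewrite ltNge ler_norml.
rewrite /q /eta; have -> : - p psi / (2 * (nu psi + 1)) * nu psi =
   - p psi / 2 * (nu psi / (nu psi + 1)) by field; apply/eqP; lra.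
have n1 : nu psi / (nu psi + 1) <= 1 by rewrite ler_pdivrMr ?mul1r ?lerDl// ltr_wpDl.
have : - p psi / 2 * (nu psi / (nu psi + 1)) <= - p psi / 2 * 1.
  by apply: ler_wpM2l => //; lra.
lra.
Qed.

End Positivity.

(** * Lower and upper values in terms of small dilations *)

Section OneSidedLimits.
Context {R : realType}.
Implicit Types (f : R -> R) (y e B : R).

Lemma near_at_right0 (V : set R) :
  (\forall t \near 0^'+, V t) <-> exists2 d : R, 0 < d & forall t, 0 < t < d -> V t.
Proof.
split=> [[d /= d0 Hd]|[d d0 Hd]].
  by exists d => // t /andP[t0 td]; apply: Hd => //=; rewrite sub0r normrN gtr0_norm.
by exists d => //= t + t0; rewrite /= sub0r normrN gtr0_norm// => td; apply: Hd; rewrite t0.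
Qed.

Lemma einf_ge f y e : 0 < e -> (y%:E <= limf_einf (EFin \o f) 0^'+)%E ->
  exists2 d, 0 < d & forall t, 0 < t < d -> y - e <= f t.
Proof.
move=> e0; rewrite limf_einfE => H.
have : ((y - e)%:E < ereal_sup [set ereal_inf ((EFin \o f) @` V) | V in 0^'+])%E.
  by apply: lt_le_trans H; rewrite lte_fin; lra.
move=> /ereal_sup_gt[_ [V /near_at_right0[d d0 Hd] <-] lt]; exists d => // t /Hd Vt.
rewrite -lee_fin; apply: le_trans (ltW lt) _; apply: ereal_inf_lbound.
by exists t.
Qed.

Lemma ge_einf f B d : 0 < d -> (forall t, 0 < t < d -> B <= f t) ->
  (B%:E <= limf_einf (EFin \o f) 0^'+)%E.
Proof.
move=> d0 H; rewrite limf_einfE; apply: le_ereal_sup_tmp => /=.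
exists (ereal_inf ((EFin \o f) @` [set t | 0 < t < d])).
  by exists [set t | 0 < t < d] => //; apply/near_at_right0; exists d.
by apply: le_ereal_inf_tmp => _ [t /H ? <-]; rewrite lee_fin.
Qed.

Lemma einf_gtNy f : (-oo < limf_einf (EFin \o f) 0^'+)%E ->
  exists B d, 0 < d /\ forall t, 0 < t < d -> B <= f t.
Proof.
move=> H; have [y ylow] : exists y : R, (y%:E <= limf_einf (EFin \o f) 0^'+)%E.
  case: (limf_einf _ _) H => [r _|_|//]; first by exists r.
  by exists 0; rewrite leey.
by have [d d0 Hd] := einf_ge ltr01 ylow; exists (y - 1), d.
Qed.

Lemma esup_einf f : limf_esup (EFin \o f) 0^'+ = (- limf_einf (EFin \o (fun t => - f t)%R) 0^'+)%E.
Proof.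
have -> : EFin \o f = (\- (EFin \o (fun t => - f t)%R))%E.
  by apply/funext => t /=; rewrite opprK.
by rewrite limf_esupN.
Qed.

End OneSidedLimits.

Section Values.
Context {R : realType}.
Implicit Types (u v : compact_distribution R) (phi psi : R -> R) (x y e B t : R).

Lemma lower_value_ge u phi x y e : 0 < e -> (y%:E <= lower_value u phi x)%E ->
  exists2 d, 0 < d & forall t, 0 < t < d -> y - e <= dilated_pairing u x t phi.
Proof. exact: einf_ge. Qed.

Lemma ge_lower_value u phi x B d : 0 < d ->
  (forall t, 0 < t < d -> B <= dilated_pairing u x t phi) -> (B%:E <= lower_value u phi x)%E.
Proof. exact: ge_einf. Qed.

Lemma lower_value_gtNy u phi x : (-oo < lower_value u phi x)%E ->
  exists B d, 0 < d /\ forall t, 0 < t < d -> B <= dilated_pairing u x t phi.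
Proof. exact: einf_gtNy. Qed.

Lemma upper_value_le u phi x y e : 0 < e -> (upper_value u phi x <= y%:E)%E ->
  exists2 d, 0 < d & forall t, 0 < t < d -> dilated_pairing u x t phi <= y + e.
Proof.
move=> e0; rewrite /upper_value (esup_einf (dilated_pairing u x ^~ phi)) leeNl -EFinN.
by move=> /(einf_ge e0)[d d0 Hd]; exists d => // t /Hd; lra.
Qed.

Lemma le_upper_value u phi x B d : 0 < d ->
  (forall t, 0 < t < d -> dilated_pairing u x t phi <= B) -> (upper_value u phi x <= B%:E)%E.
Proof.
move=> d0 H; rewrite /upper_value (esup_einf (dilated_pairing u x ^~ phi)) leeNl -EFinN.
by apply: (ge_einf d0) => t /H; rewrite lerN2.
Qed.

Lemma upper_value_lty u phi x : (upper_value u phi x < +oo)%E ->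
  exists B d, 0 < d /\ forall t, 0 < t < d -> dilated_pairing u x t phi <= B.
Proof.
rewrite /upper_value (esup_einf (dilated_pairing u x ^~ phi)) lteNl.
move=> /einf_gtNy[B [d [d0 Hd]]]; exists (- B), d; split=> // t /Hd; lra.
Qed.

End Values.

(** * The Poisson kernel as a test function *)

Section PoissonKernel.
Context {R : realType}.
Local Notation mu := (@lebesgue_measure R).

Definition poisson (y : R) : R := pi^-1 * pkern 0 1 y.

(** This is the passage from the values in the definition of the pairs to the boundary behaviour of
    the harmonic extension. *)
Lemma dilated_pairing_poisson (u : compact_distribution R) x t : 0 < t ->
  dilated_pairing u x t poisson = pext u x t / pi.
Proof.
move=> t0; have lp := (cdist_of u).1; rewrite /dilated_pairing (gtr0_norm t0).
have sk : Cinf (fun y => pkern 0 1 ((y - x) / t)) by apply: smooth_affine; exact: smooth_pkern.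
rewrite -(clinearZ lp); last by apply: smoothM; [exact: smooth_cst|].
rewrite /pext mulrC -(clinearZ lp); last exact: smooth_pkern.
congr (cdist_fun u); apply/funext => y; rewrite /poisson mulrCA; congr (_ * _).
have u0 := sqr_ge0 (y - x); have v0 : 0 < t ^+ 2 by rewrite exprn_gt0.
by rewrite /pkern; field; rewrite !gt_eqF//= -?expr2 ?subr0; lra.
Qed.

Lemma integral_pkern01 : (\int[mu]_y (pkern 0 1 y)%:E = pi%:E)%E.
Proof.
have cE : continuous (pkern 0 (1 : R)) by apply: smooth_continuous; exact: smooth_pkern.
have ev : pkern 0 (1 : R) =1 pkern 0 1 \o -%R by move=> y; rewrite /pkern /= !subr0 sqrrN.
rewrite (ge0_symfun_integralT (fun y => ltW (pkern_gt0 0 y ltr01)) cE ev).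
have -> : [set x | (0 <= x)%R] = `[0%R, +oo[%classic :> set R.
  by apply/seteqP; split => x/=; rewrite in_itv/= andbT.
under eq_integral do rewrite /pkern subr0 div1r expr1n addrC.
by rewrite integral0y_oneDsqr -EFinM mulrCA divff// mulr1.
Qed.

Lemma smooth_poisson : Cinf poisson.
Proof. by apply: smoothM; [exact: smooth_cst|exact: smooth_pkern]. Qed.

(** The kernel decays with exponent alpha = - 2, each derivative gaining one power, and it is even
    and decreasing in |x|. *)
Lemma T1_poisson : T1 poisson.
Proof.
have pi0 : 0 < pi^-1 :> R by rewrite invr_gt0 pi_gt0.
have sk : Cinf (pkern 0 (1 : R)) by exact: smooth_pkern.
split; first split.
- exact: CinfE smooth_poisson.
- by move=> y; rewrite mulr_ge0 ?ltW// pkern_gt0.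
- under eq_integral do rewrite EFinM.
  have mk : measurable_fun setT (fun y => (pkern 0 1 y)%:E : \bar R).
    by apply/measurable_EFinP; apply: continuous_measurable_fun; exact: smooth_continuous.
  have k0 (y : R) : setT y -> (0 <= (pkern 0 1 y)%:E)%E.
    by move=> _; rewrite lee_fin ltW// pkern_gt0.
  rewrite (ge0_integralZl mu measurableT mk k0) ?lee_fin ?ltW//.
  by rewrite integral_pkern01 -EFinM mulVf// gt_eqF// pi_gt0.
- exists (-2); first by lra.
  move=> m; exists (pi^-1 * (cfactN 1 m * m.+1%:R)), 0 => y y0.
  rewrite /poisson derive1nZ// normrM (gtr0_norm pi0) -mulrA.
  apply: ler_wpM2l; first exact: ltW.
  have := @derive1n_pkern_le R m m 0 1 y `|y| (leqnn _) ltr01 y0; rewrite subr0 lexx => /(_ isT).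
  rewrite mulr1 => /le_trans; apply; apply: ler_wpM2l; first by rewrite mulr_ge0// cfactN_ge0.
  have -> : -2 - m%:R = - m.+2%:R :> R.
    by rewrite (natrD R 2 m : m.+2%:R = 2 + m%:R); ring.
  rewrite powRN powR_mulrn ?normr_ge0// exprVn.
  by [].
move=> x; have d1 : is_derive x 1 (fun y : R => y ^+ 2 + 1) (2 * x).
  by apply: (is_derive_eq (is_deriveDr (is_derive_exprn 2 x) (is_derive_cstr 1 x))); rewrite addr0 expr1.
have d0 : x ^+ 2 + 1 != 0 by rewrite gt_eqF// ltr_wpDl// sqr_ge0.
have -> : poisson = fun y => pi^-1 * (y ^+ 2 + 1)^-1.
  by apply/funext => y; rewrite /poisson /pkern subr0 div1r expr1n.
have d2 := is_deriveZr pi^-1 (@is_deriveV R (fun y => y ^+ 2 + 1) x (2 * x) 1 d0 d1).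
rewrite (is_derive_derive1 d2).
set w := (x ^+ 2 + 1) ^- 2.
have w0 : 0 <= w by rewrite invr_ge0 exprn_ge0// addr_ge0// sqr_ge0.
have -> : x * (pi^-1 * (- w *: (2 * x))) = - (pi^-1 * (w * (2 * x ^+ 2))).
  by rewrite /GRing.scale/=; ring.
rewrite oppr_le0; apply: mulr_ge0; first exact: ltW.
by apply: mulr_ge0 => //; apply: mulr_ge0 => //; exact: sqr_ge0.
Qed.


End PoissonKernel.

(** * Primitives, point values and total mass *)

Section Pairs.
Context {R : realType}.
Local Notation mu := (@lebesgue_measure R).
Implicit Types (u v : compact_distribution R) (U V : schwartz_distribution R).
Implicit Types (phi psi f : R -> R) (p q : R -> \bar R) (a b x y e t d : R).

(** The support condition only concerns test functions. A plateau equal to 1 near the interval that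
    controls u makes psi compactly supported without changing [u psi]. *)
Lemma supported_in0 u a b psi d : supported_in u `[a, b] -> Cinf psi -> 0 < d ->
  (forall y, a - d <= y <= b + d -> psi y = 0) -> u psi = 0.
Proof.
move=> su spsi d0 psi0; have [lp [M [C [N [M0 C0 H]]]]] := cdist_of u.
pose chi y := plateau ((y - 0) / (M + 1)).
have M1 : 0 < M + 1 by rewrite ltr_wpDl.
have schi : Cinf chi by apply: smooth_affine; exact: smooth_plateau.
have s1 : Cinf (fun y => psi y * chi y) by exact: smoothM.
have s2 : Cinf (fun y => psi y - psi y * chi y) by exact: smoothB.
have -> : psi = fun y => (psi y - psi y * chi y) + psi y * chi y.
  by apply/funext => y; rewrite subrK.
rewrite (clinearD lp)//.
have -> : u (fun y => psi y - psi y * chi y) = 0.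
  apply/eqP; rewrite -normr_le0 -(mulr0 C); apply: H => // k y _ yM.
  rewrite derive1n_near0 ?normr0//.
  have yM1 : `|y| < M + 1 by lra.
  near=> w; rewrite /chi plateau1 ?mulr1 ?subrr//.
  rewrite subr0 normrM normfV (gtr0_norm M1) ler_pdivrMr// mul1r ltW//.
  by near: w; exact: near_norm_lt.
rewrite add0r; apply: su.
  apply: (@test_functionI _ _ (2 * (M + 1))) => // y yM.
  rewrite /chi plateau0 ?mulr0//.
  by rewrite subr0 normrM normfV (gtr0_norm M1) ler_pdivlMr// ltW.
apply/seteqP; split=> // y [cy /=]; rewrite in_itv/= => /andP[ay yb].
have [] := cy (ball y d); first exact: nbhsx_ballx.
move=> z [/= nz]; rewrite /ball/= ltr_norml => /andP[z1 z2].
by move: nz; rewrite psi0 ?mul0r ?eqxx//; apply/andP; split; lra.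
Unshelve. all: end_near. Qed.

Lemma dist_scale (T : schwartz_distribution R) c f : test_function f ->
  T (fun x => c * f x) = c * T f.
Proof.
move=> tf; have t0 : test_function (fun=> 0 : R).
  by apply: (@test_functionI _ _ 0) => //; exact: smooth_cst.
have T0 : T (fun=> 0) = 0.
  have := dist_linear T 1 t0 t0; rewrite !mul1r addr0 => /eqP.
  by rewrite -subr_eq0 opprD addNKr oppr_eq0 => /eqP.
have := dist_linear T c tf t0; rewrite T0 addr0 => <-.
by congr (dist_fun T); apply/funext => x; rewrite addr0.
Qed.

Lemma Rintegral_supp f a b : (forall x, ~~ (a <= x <= b) -> f x = 0) ->
  (\int[mu]_x f x)%R = sint a b f.
Proof.
move=> f0; rewrite /sint /Rintegral [in RHS]integral_mkcond; congr fine.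
apply: eq_integral => x _; rewrite patchE; case: ifPn => // xab; rewrite f0//.
by apply: contra xab => xab; rewrite inE/= in_itv.
Qed.

Lemma Rintegral_derive1 F a b : a < b -> Cinf F ->
  (forall x, ~~ (a <= x <= b) -> derive1 F x = 0) -> (\int[mu]_x derive1 F x)%R = F b - F a.
Proof.
move=> ab sF dF; rewrite (Rintegral_supp dF); apply: sint_FTC => //.
  by apply: smooth_continuous; exact: smooth_derive1.
by move=> x; exact: (smooth_is_derive 0 x sF).
Qed.

Lemma test_function_affine f c e : 0 < e -> test_function f ->
  test_function (fun x => f ((x - c) / e)).
Proof.
move=> e0 /test_functionE[sf [M M0 f0]].
apply: (@test_functionI _ _ (`|c| + M * e)); first exact: smooth_affine.
move=> x xM; rewrite f0// normrM normfV (gtr0_norm e0) ler_pdivlMr//.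
by have := lerB_dist x c; lra.
Qed.

Lemma test_function_derive1 f : test_function f -> test_function (derive1 f).
Proof.
move=> /test_functionE[sf [M M0 f0]]; apply: (@test_functionI _ _ M); first exact: smooth_derive1.
by apply: (@derive1n_far0 _ 1) => x /ltW; exact: f0.
Qed.

Lemma derive1_affine f c e : Cinf f ->
  derive1 (fun x => f ((x - c) / e)) = fun x => e^-1 * derive1 f ((x - c) / e).
Proof. by move=> /(derive1n_affine 1 c e); rewrite expr1. Qed.

(* Differentiating the primitive turns its point values into vanishing dilations. *)
Lemma dil_vanishing_of u U c : Lojasiewicz U -> has_derivative U u -> dil_vanishing u c.
Proof.
move=> lU dU psi tpsi; have [spsi [M M0 psi0]] := test_functionE tpsi.
have tdpsi := test_function_derive1 tpsi.
have [gam Hg] := lU c.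
have I0 : (\int[mu]_y derive1 psi y)%R = 0.
  have out x : ~~ (- (M + 1) <= x <= M + 1) -> derive1 psi x = 0.
    move=> xM; apply: (@derive1n_far0 _ 1 psi M); first by move=> y /ltW; exact: psi0.
    by rewrite ltNge; apply: contra xM; rewrite ler_norml => /andP[? ?]; apply/andP; split; lra.
  rewrite (Rintegral_derive1 _ spsi out); last by lra.
  by rewrite !psi0 ?subrr// ?normrN ger0_norm; lra.
have := cvg_dnbhs_at_right (Hg _ tdpsi); rewrite I0 mulr0 => /(@cvgN _ R^o).
rewrite oppr0; apply: cvg_trans; apply: near_eq_cvg; near=> e.
have e0 : 0 < e by near: e; exact: nbhs_right_gt.
rewrite /dilation dU; last exact: test_function_affine.
rewrite (derive1_affine c e spsi) dist_scale; last exact: test_function_affine.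
by rewrite -[LHS]/(- (`|e|^-1 * _)) (gtr0_norm e0).
Unshelve. all: end_near. Qed.

(** The constant 1 may be replaced by a cutoff chi that rises just left of a and falls just right of
    b. Its derivative consists of two dilated bumps of integral 1, so - U(chi') tends to U(b) - U(a)
    = y. *)
Lemma point_value_total u U a b y : a < b -> supported_in u `[a, b] -> has_derivative U u ->
  has_point_value U a 0 -> has_point_value U b y -> u (fun=> 1) = y.
Proof.
move=> ab su dU Ua Ub.
pose s c (z : R) := step ((z - c) / 1).
have ss c : Cinf (s c) by apply: smooth_affine; exact: smooth_step.
have s0 c z : z <= c -> s c z = 0 by move=> zc; apply: step0; rewrite divr1 subr_le0.
have s1 c z : c + 1 <= z -> s c z = 1 by move=> zc; apply: step1; rewrite divr1; lra.
have ds c z : ~~ (c <= z <= c + 1) -> derive1 (s c) z = 0.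
  rewrite negb_and -!ltNge => /orP[zc|cz].
    apply: (etrans (@derive1n_eq_nearx _ (s c) (fun=> 0) z 1 _)); last by rewrite derive1n_cst.
    by near=> w; apply: s0; rewrite ltW//; near: w; exact: lt_nbhsl.
  apply: (etrans (@derive1n_eq_nearx _ (s c) (fun=> 1) z 1 _)); last by rewrite derive1n_cst.
  by near=> w; apply: s1; rewrite ltW//; near: w; exact: lt_nbhsr.
have I1 c : (\int[mu]_z derive1 (s c) z)%R = 1.
  rewrite (@Rintegral_derive1 _ c (c + 1))//; [by rewrite s1// s0// subr0|lra|exact: ds].
have ts c : test_function (derive1 (s c)).
  apply: (@test_functionI _ _ (`|c| + 1)); first exact: smooth_derive1.
  move=> z cz; apply: ds; apply/negP => /andP[z1 z2].
  have := ler_norm c; have := ler_norm (- c); rewrite normrN => ? ?.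
  by move: cz; rewrite ltNge => /negP; apply; rewrite ler_norml; apply/andP; split; lra.
have E e : 0 < e -> u (fun=> 1) =
    dilated_pairing U b e (derive1 (s 1)) - dilated_pairing U a e (derive1 (s (-2))).
  (* The shifts - 2 and 1 leave chi equal to 1 on the e-neighbourhood of [a, b]. *)
  move=> e0; pose chi y := s (-2) ((y - a) / e) - s 1 ((y - b) / e).
  have sa : Cinf (fun y => s (-2) ((y - a) / e)) by exact: smooth_affine.
  have sb : Cinf (fun y => s 1 ((y - b) / e)) by exact: smooth_affine.
  have schi : Cinf chi by exact: smoothB.
  have tchi : test_function chi.
    apply: (@test_functionI _ _ (`|a| + `|b| + 2 * e)) => // z zM.
    have := ler_norm a; have := ler_norm (- b); have := ler_norm b; have := ler_norm (- a).
    rewrite !normrN => ? ? ? ?; move: zM; rewrite /chi ltr_normr => /orP[] zM.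
      by rewrite !s1 ?subrr//; rewrite ler_pdivlMr//; lra.
    by rewrite !s0 ?subrr//; rewrite ler_pdivrMr//; lra.
  have lu := (cdist_of u).1.
  have s1c : Cinf (fun y => 1 - chi y) by apply: smoothB => //; exact: smooth_cst.
  have : u (fun y => 1 - chi y) = 0.
    apply: (supported_in0 su s1c e0) => z /andP[z1 z2]; rewrite /chi s1 ?s0 ?subr0 ?subrr//.
      by rewrite ler_pdivrMr//; lra.
    by rewrite ler_pdivlMr//; lra.
  rewrite (clinearB lu)//; last exact: smooth_cst.
  move=> /eqP; rewrite subr_eq0 => /eqP ->; rewrite dU//.
  have ta := test_function_affine a e0 (ts (-2)).
  have tb := test_function_affine b e0 (ts 1).
  have ta' : test_function (fun y => e^-1 * derive1 (s (-2)) ((y - a) / e)).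
    have [sta [M M0 fM]] := test_functionE ta.
    apply: (@test_functionI _ _ M); first by apply: smoothM => //; exact: smooth_cst.
    by move=> x /ltW /fM ->; rewrite mulr0.
  have -> : derive1 chi = fun y => (- e^-1) * derive1 (s 1) ((y - b) / e)
                                  + e^-1 * derive1 (s (-2)) ((y - a) / e).
    apply/funext => z; have /(congr1 (fun h => h z)) := derive1nB 1 sa sb.
    rewrite /= (derive1_affine a e (ss (-2))) (derive1_affine b e (ss 1)) => ->.
    by rewrite mulNr addrC.
  rewrite dist_linear// dist_scale// /dilated_pairing (gtr0_norm e0); ring.
have Ha := cvg_dnbhs_at_right (Ua _ (ts (-2))); have Hb := cvg_dnbhs_at_right (Ub _ (ts 1)).
rewrite I1 mulr1 in Hb; rewrite I1 mulr1 in Ha.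
have : (dilated_pairing U b e (derive1 (s 1)) - dilated_pairing U a e (derive1 (s (-2))))
    @[e --> (0 : R)^'+] --> y - 0 by exact: cvgB.
rewrite subr0 => /cvgrPdist_le Hc.
apply/eqP; rewrite eq_sym -subr_eq0 -normr_le0; apply/ler_addgt0Pr => e e0; rewrite add0r.
have [d [t [t0 Ht]]] : exists d t : R, 0 < t /\ `|y - (dilated_pairing U b t (derive1 (s 1))
    - dilated_pairing U a t (derive1 (s (-2))))| <= e.
  have [d d0 Hd] := (near_at_right0 _).1 (Hc e e0).
  by exists d, (d / 2); split; [lra|apply: Hd; lra].
by move: Ht; rewrite -E.
Unshelve. all: end_near. Qed.

End Pairs.

(** * Comparison of pairs and the integral *)

Section Integrals.
Context {R : realType}.
Local Notation mu := (@lebesgue_measure R).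
Implicit Types (u v : compact_distribution R) (U V : schwartz_distribution R).
Implicit Types (psi : R -> R) (f p q : R -> \bar R) (a b x y e t d : R).

Lemma countable_negligible (E : set R) : countable E -> mu.-negligible E.
Proof.
move=> cE; apply/negligibleP; first by apply: countable_measurable => // t; exact: measurable_set1.
exact: countable_lebesgue_measure0.
Qed.

Lemma countableU (E E' : set R) : countable E -> countable E' -> countable (E `|` E').
Proof.
move=> cE cE'; have -> : E `|` E' = \bigcup_(i in [set: bool]) (if i then E else E').
  apply/seteqP; split=> [x [xE|xE]|x [[] _ xE]]; [by exists true|by exists false|by left|by right].
by apply: bigcup_countable => [|[]]//; exact: countableP.
Qed.

(** The value y may be infinite. Then one of the two values is infinite in the direction that helps,
    and finiteness of the other on the relevant side leaves room for a real r. *)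
Lemma ext_bounds u v x (y : \bar R) : (upper_value v poisson x <= y)%E ->
  (y <= lower_value u poisson x)%E -> (-oo < lower_value u poisson x)%E ->
  (upper_value v poisson x < +oo)%E ->
  exists r : R, (upper_value v poisson x <= r%:E)%E /\ (r%:E <= lower_value u poisson x)%E.
Proof.
case: y => [y vy uy _ _|_|+ _]; first by exists y.
- rewrite leye_eq => /eqP -> _; case: (upper_value v poisson x) => [r| |] // _.
    by exists r; split => //; exact: leey.
  by exists 0; split; [exact: leNye|exact: leey].
rewrite leeNy_eq => /eqP ->; case: (lower_value u poisson x) => [r| |] // _ _.
  by exists r; split => //; exact: leNye.
by exists 0; split; [exact: leNye|exact: leey].
Qed.

Lemma lower_pext u x y e : 0 < e -> (y%:E <= lower_value u poisson x)%E ->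
  exists2 d, 0 < d & forall t, 0 < t < d -> y - e <= pext u x t / pi.
Proof.
move=> e0 /(lower_value_ge e0)[d d0 Hd]; exists d => // t t0d.
by have /andP[t0 _] := t0d; rewrite -dilated_pairing_poisson//; exact: Hd.
Qed.

Lemma upper_pext u x y e : 0 < e -> (upper_value u poisson x <= y%:E)%E ->
  exists2 d, 0 < d & forall t, 0 < t < d -> pext u x t / pi <= y + e.
Proof.
move=> e0 /(upper_value_le e0)[d d0 Hd]; exists d => // t t0d.
by have /andP[t0 _] := t0d; rewrite -dilated_pairing_poisson//; exact: Hd.
Qed.

Lemma lower_upper_pext u v x y z e : 0 < e -> (y%:E <= lower_value u poisson x)%E ->
  (upper_value v poisson x <= z%:E)%E ->
  exists2 d, 0 < d & forall t, 0 < t < d -> y - z - e <= (pext u x t - pext v x t) / pi.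
Proof.
move=> e0 yu vz; have e2 : 0 < e / 2 by lra.
have [d1 d10 H1] := lower_pext e2 yu; have [d2 d20 H2] := upper_pext e2 vz.
exists (Num.min d1 d2); first by rewrite lt_min d10.
move=> t /andP[t0]; rewrite lt_min mulrBl => /andP[td1 td2].
by have := H1 t; have := H2 t; rewrite t0 td1 td2 => /(_ isT) ? /(_ isT); lra.
Qed.

(** The functional w = u - v satisfies the hypotheses of [nonneg_of_extension]: the primitives give
    vanishing dilations, the T0 conditions give a lower limit at least 0 almost everywhere, and the
    T1 conditions give lower bounds off a countable set. *)
Lemma pair_le a b p q u U v V : major_pair a b q u U -> minor_pair a b p v V ->
  {ae mu, forall x, x \in `[a, b] -> (p x <= q x)%E} ->
  forall psi, Cinf psi -> (forall x, 0 <= psi x) -> v psi <= u psi.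
Proof.
move=> [su lU dU _ [E1 [Z1 [cE1 nZ1 M1 N1]]]] [sv lV dV _ [E2 [Z2 [cE2 nZ2 M2 N2]]]] pq.
move=> psi spsi psi0; rewrite -subr_ge0.
have [T0P T1P] : T0 (@poisson R) /\ T1 (@poisson R) by have := @T1_poisson R; move=> H; split => //; case: H.
pose w g := u g - v g.
have cw : cdist w by apply: cdistB; exact: cdist_of.
have pi0 : 0 < pi :> R by exact: pi_gt0.
(* E1 and E2 are included in Z so that off Z the T1 conditions hold too, as [ext_bounds]
   requires. *)
pose Z := E1 `|` E2 `|` (Z1 `|` Z2 `|` ~` [set x | x \in `[a, b] -> (p x <= q x)%E]).
apply: (@nonneg_of_extension _ w a b (E1 `|` E2) Z) => //.
- move=> c g tg; have : dilation u c e g - dilation v c e g @[e --> (0 : R)^'+] --> (0 : R) - 0.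
    by apply: cvgB; [exact: (dil_vanishing_of c lU dU tg)|exact: (dil_vanishing_of c lV dV tg)].
  by rewrite subr0.
- move=> f d sf d0 f0.
  by rewrite /w (supported_in0 su sf d0 f0) (supported_in0 sv sf d0 f0) subr0.
- exact: countableU.
- apply: negligibleU; first by apply: negligibleU; exact: countable_negligible.
  by apply: negligibleU => //; exact: negligibleU.
- move=> x e xab nZ e0.
  have xI : x \in `[a, b] by rewrite inE/= in_itv.
  have [nE1 nE2 nZ1' nZ2' Hpq] : [/\ ~ E1 x, ~ E2 x, ~ Z1 x, ~ Z2 x & (p x <= q x)%E].
    split; try by move=> H; apply: nZ; rewrite /Z/=; tauto.
    by apply: contrapT => npq; apply: nZ; right; right => H; apply: npq; exact: H.
  have [r [vr ru]] := ext_bounds (M2 x _ xI nZ2' T0P) (le_trans Hpq (M1 x _ xI nZ1' T0P))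
    (N1 x _ xI nE1 T1P) (N2 x _ xI nE2 T1P).
  have [d d0 Hd] := lower_upper_pext (divr_gt0 e0 pi0) ru vr.
  exists d => // t /Hd; rewrite subrr sub0r -mulNr ler_pM2r ?invr_gt0//; exact.
- move=> x xab /not_orP[nE1 nE2]; have xI : x \in `[a, b] by rewrite inE/= in_itv.
  have [B1 [d1 [d10 H1]]] := lower_value_gtNy (N1 x _ xI nE1 T1P).
  have [B2 [d2 [d20 H2]]] := upper_value_lty (N2 x _ xI nE2 T1P).
  exists (- (pi * (B1 - B2))), (Num.min d1 d2); split; first by rewrite lt_min d10.
  move=> t /andP[t0]; rewrite lt_min opprK => /andP[td1 td2].
  have := H1 t; have := H2 t; rewrite t0 td1 td2 => /(_ isT) h2 /(_ isT) h1.
  have -> : pext w x t = pi * (pext u x t / pi - pext v x t / pi).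
    by rewrite -mulrBl mulrC divfK// gt_eqF.
  apply: ler_wpM2l; first exact: ltW.
  by move: h1 h2; rewrite !dilated_pairing_poisson//; lra.
Qed.

Lemma major_values_total a b f u U : a < b -> major_pair a b f u U ->
  major_values a b f (u (fun=> 1)).
Proof.
move=> ab M; have [su lU dU Ua _] := M; have [y Uy] := lU b.
by exists u, U; split => //; rewrite (point_value_total ab su dU Ua Uy).
Qed.

Lemma minor_values_total a b f v V : a < b -> minor_pair a b f v V ->
  minor_values a b f (v (fun=> 1)).
Proof.
move=> ab M; have [sv lV dV Va _] := M; have [y Vy] := lV b.
by exists v, V; split => //; rewrite (point_value_total ab sv dV Va Vy).
Qed.

Lemma major_valuesE a b f y : a < b -> major_values a b f y ->
  exists u U, major_pair a b f u U /\ y = u (fun=> 1).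
Proof.
move=> ab [u [U [M Uy]]]; exists u, U; split=> //.
by have [su lU dU Ua _] := M; rewrite (point_value_total ab su dU Ua Uy).
Qed.

Lemma minor_valuesE a b f y : a < b -> minor_values a b f y ->
  exists v V, minor_pair a b f v V /\ y = v (fun=> 1).
Proof.
move=> ab [v [V [M Vy]]]; exists v, V; split=> //.
by have [sv lV dV Va _] := M; rewrite (point_value_total ab sv dV Va Vy).
Qed.

Lemma pair_le1 a b f u U v V : major_pair a b f u U -> minor_pair a b f v V ->
  v (fun=> 1) <= u (fun=> 1).
Proof.
move=> M m; apply: (pair_le M m) => //; last exact: smooth_cst.
by apply: aeW => x _.
Qed.

(** The supremum and infimum in epsilon form, with end values U(b) and V(b) replaced by total masses
    u(1) and v(1), which are linear in the pair. *)
Definition approx_integral a b f (I e : R) :=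
  (exists u U, major_pair a b f u U /\ u (fun=> 1) <= I + e) /\
  (exists v V, minor_pair a b f v V /\ I - e <= v (fun=> 1)).

Lemma dist_integrableP a b f e : a < b -> dist_integrable a b f -> 0 < e ->
  approx_integral a b f (dist_integral a b f) e.
Proof.
move=> ab [[u [U M]] [v [V m]] E] e0.
rewrite /dist_integral; set s := ereal_sup _ in E *.
have sfin : s \is a fin_num.
  rewrite fin_numElt; apply/andP; split.
    apply: lt_le_trans (ltNyr (v (fun=> 1))) _; apply: ereal_sup_ubound.
    by exists (v (fun=> 1)) => //; exact: minor_values_total m.
  rewrite E; apply: le_lt_trans (ltry (u (fun=> 1))); apply: ereal_inf_lbound.
  by exists (u (fun=> 1)) => //; exact: major_values_total M.
have sE := fineK sfin; split.
  have : (ereal_inf [set y%:E | y in major_values a b f] < (fine s + e)%:E)%E.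
    by rewrite -E EFinD sE lteDl// lte_fin.
  move=> /ereal_inf_lt[_ [y /(major_valuesE ab)[u' [U' [M' ->]]] <-]].
  by rewrite lte_fin => /ltW ?; exists u', U'.
have : ((fine s - e)%:E < s)%E by rewrite -{2}sE lte_fin ltrBlDr ltrDl.
move=> /ereal_sup_gt[_ [y /(minor_valuesE ab)[v' [V' [m' ->]]] <-]].
by rewrite lte_fin => /ltW ?; exists v', V'.
Qed.

Lemma dist_integrableI a b f I : a < b -> (forall e, 0 < e -> approx_integral a b f I e) ->
  dist_integrable a b f /\ dist_integral a b f = I.
Proof.
move=> ab H.
have Esup : ereal_sup (EFin @` minor_values a b f) = I%:E.
  apply/eqP; rewrite eq_le; apply/andP; split.
    apply/lee_addgt0Pr => e e0; apply: ge_ereal_sup => _ [y /(minor_valuesE ab)[v [V [m ->]]] <-].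
    have [[u [U [M uI]]] _] := H e e0.
    by rewrite -EFinD lee_fin (le_trans _ uI)// (pair_le1 M m).
  apply/lee_subgt0Pr => e e0; have [_ [v [V [m vI]]]] := H e e0.
  apply: le_trans (_ : (v (fun=> 1))%:E <= _)%E; first by rewrite -EFinB lee_fin.
  by apply: ereal_sup_ubound; exists (v (fun=> 1)) => //; exact: minor_values_total m.
have Einf : ereal_inf (EFin @` major_values a b f) = I%:E.
  apply/eqP; rewrite eq_le; apply/andP; split.
    apply/lee_addgt0Pr => e e0; have [[u [U [M uI]]] _] := H e e0.
    apply: le_trans (_ : (u (fun=> 1))%:E <= _)%E; last by rewrite -EFinD lee_fin.
    by apply: ereal_inf_lbound; exists (u (fun=> 1)) => //; exact: major_values_total M.
  apply/lee_subgt0Pr => e e0; apply: le_ereal_inf_tmp => _ [y /(major_valuesE ab)[u [U [M ->]]] <-].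
  have [_ [v [V [m vI]]]] := H e e0.
  by rewrite -EFinB lee_fin (le_trans vI)// (pair_le1 M m).
split; last by rewrite /dist_integral Esup.
have [[u [U [M _]]] [v [V [m _]]]] := H 1 ltr01.
by split; [exists u, U|exists v, V|rewrite Esup Einf].
Qed.

End Integrals.

(** * Lower limits of real sequences *)

Section LowerLimits.
Context {R : realType}.
Implicit Types (u w : nat -> R) (c e y : R).

Lemma limn_einf_ge u y : (forall e, 0 < e -> exists N, forall n, (N <= n)%N -> y - e <= u n) ->
  (y%:E <= limn_einf (fun n => (u n)%:E))%E.
Proof.
have E : limn_einf (fun n => (u n)%:E) = limf_einf (fun n => (u n)%:E) \oo by [].
move=> H; rewrite E; apply/lee_subgt0Pr => e e0; have [N HN] := H e e0.
rewrite limf_einfE; apply: le_ereal_sup_tmp => /=.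
exists (ereal_inf ((fun n => (u n)%:E) @` [set n | (N <= n)%N])).
  by exists [set n | (N <= n)%N] => //; exact: nbhs_infty_ge.
by apply: le_ereal_inf_tmp => _ [n /HN ? <-]; rewrite -EFinB lee_fin.
Qed.

Lemma limn_einf_le u w c :
  (forall e, 0 < e -> exists N, forall n, (N <= n)%N -> u n <= w n + c + e) ->
  (limn_einf (fun n => (u n)%:E) <= limn_einf (fun n => (w n)%:E) + c%:E)%E.
Proof.
have E v : limn_einf (fun n : nat => (v n : R)%:E) = limf_einf (fun n => (v n)%:E) \oo by [].
move=> H; rewrite !E; apply/lee_addgt0Pr => e e0; have [N HN] := H e e0.
rewrite [leLHS]limf_einfE; apply: ge_ereal_sup => _ [V FV <-].
rewrite -addeA -EFinD -leeBlDr// limf_einfE; apply: le_ereal_sup_tmp => /=.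
exists (ereal_inf ((fun n => (w n)%:E) @` (V `&` [set n | (N <= n)%N]))).
  by exists (V `&` [set n | (N <= n)%N]) => //; apply: filterI => //; exact: nbhs_infty_ge.
apply: le_ereal_inf_tmp => _ [n [Vn /HN un] <-]; rewrite EFinN leeBlDr//.
apply: (@le_trans _ _ (u n)%:E); first by apply: ereal_inf_lbound; exists n.
by rewrite -EFinD lee_fin addrA.
Qed.

End LowerLimits.

(** * The density of a positive functional *)

Section Fatou.
Context {R : realType}.
Local Notation mu := (@lebesgue_measure R).
Implicit Types (x y z s t e a b : R) (f F : R -> R).

Lemma FTC2_on a b F f : a < b -> continuous f ->
  (forall x, a <= x <= b -> is_derive x 1 F (f x)) ->
  (\int[mu]_(x in `[a, b]) (f x)%:E = (F b - F a)%:E)%E.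
Proof.
move=> ab cf dF; rewrite (@continuous_FTC2 _ f F)//.
- exact: continuous_subspaceT.
- have cF x : a <= x <= b -> {for x, continuous F}.
    by move=> /dF[dx _]; apply: differentiable_continuous; apply/derivable1_diffP.
  split.
  + by move=> x; rewrite in_itv/= => /andP[ax xb]; have [] := dF x; rewrite ?ltW.
  + by apply: cvg_at_right_filter; apply: cF; rewrite lexx ltW.
  + by apply: cvg_at_left_filter; apply: cF; rewrite lexx ltW.
- move=> x; rewrite in_itv/= => /andP[ax xb].
  by apply: is_derive_derive1; apply: dF; rewrite !ltW.
Qed.

Variable p : (R -> R) -> R.
Hypothesis cp : cdist p.
Hypothesis p0 : forall psi, Cinf psi -> (forall x, 0 <= psi x) -> 0 <= p psi.

Lemma pext_ge0 x t : 0 < t -> 0 <= pext p x t.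
Proof. by move=> t0; apply: p0 => [|y]; [exact: smooth_pkern|rewrite ltW// pkern_gt0]. Qed.

Lemma continuous_pext t : 0 < t -> continuous (pext p ^~ t).
Proof.
move=> t0; have -> : pext p ^~ t = fun x => - cext p true 1 x t.
  by apply/funext => x; rewrite pext_cext.
move=> x; apply: cvgN; exact: (is_derive_continuous (fun x => is_derive_cext_x cp true 1 x t0)).
Qed.

(** With psi = 1 on [a, b], the integral of the extension is p applied to the function y |->
    integral over [a, b] of the kernel in x. That function is a difference of two arctangents, hence
    at most pi, and p is positive. *)
Lemma integral_pext_le a b t : a < b -> 0 < t ->
  (\int[mu]_(x in `[a, b]) (pext p x t)%:E <= (pi * p (fun=> 1%R))%:E)%E.
Proof.
move=> ab t0.
pose psi x := step ((x - (a - 1)) / 1) * step ((x - (b + 1)) / -1).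
have spsi : Cinf psi by apply: smoothM; apply: smooth_affine; exact: smooth_step.
have psi1 x : a <= x <= b -> psi x = 1.
  by move=> /andP[ax xb]; rewrite /psi !step1 ?mulr1// ?divr1 ?invrN1 ?mulrN1; lra.
have psi0 x : ~~ (a - 1 <= x <= b + 1) -> psi x = 0.
  rewrite negb_and -!ltNge /psi => /orP[xa|xb].
    by rewrite step0 ?mul0r// divr1; lra.
  by rewrite [step (_ / -1)]step0 ?mulr0// ?invrN1 mulrN1; lra.
have als s : a <= s -> a - 1 - 1 < s by lra.
have cpext := continuous_pext t0.
have dG s : a <= s <= b -> is_derive s 1 (fun s => p (pconv psi (a - 1) t s)) (pext p s t).
  move=> sab; have /andP[as_ _] := sab.
  by have := is_derive_pconv spsi psi0 t0 cp (als s as_); rewrite psi1// mul1r.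
rewrite (FTC2_on ab cpext dG) lee_fin.
have [lp _] := cp.
have sc s : a <= s -> Cinf (pconv psi (a - 1) t s).
  by move=> as_; apply: (smooth_pconv spsi psi0 t0); exact/ltW/als.
rewrite -(clinearB lp); [|exact: sc (ltW ab)|exact: sc].
rewrite -(clinearZ lp); last exact: smooth_cst.
have s1 : Cinf (fun=> pi * 1 : R) by exact: smooth_cst.
have s2 : Cinf (fun y => pconv psi (a - 1) t b y - pconv psi (a - 1) t a y).
  by apply: smoothB; [exact: sc (ltW ab)|exact: sc].
rewrite -subr_ge0 -(clinearB lp)//; apply: p0; first exact: smoothB.
move=> y; rewrite subr_ge0 mulr1.
have ck : continuous (fun x => pkern x t y).
  have -> : (fun x => pkern x t y) = pkern y t.
    by apply/funext => z; rewrite /pkern -sqrrN opprB.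
  exact: (smooth_continuous (smooth_pkern y t0)).
have cg : continuous (fun x => psi x * pkern x t y).
  by move=> x; apply: cvgM; [exact: (smooth_continuous spsi)|exact: ck].
have d1 s : a <= s <= b ->
    is_derive s 1 (fun s => pconv psi (a - 1) t s y) (psi s * pkern s t y).
  by move=> /andP[as_ _]; exact: (is_derive_sint cg (als s as_)).
have E1 := FTC2_on ab cg d1.
have E2 := FTC2_segment ab ck (fun x => is_derive_atan_kernel x y t0).
have E3 : (\int[mu]_(x in `[a, b]) (psi x * pkern x t y)%:E
         = \int[mu]_(x in `[a, b]) (pkern x t y)%:E)%E.
  by apply: eq_integral => x; rewrite inE/= in_itv/= => /psi1 ->; rewrite mul1r.
move: E3; rewrite E1 E2 => -[->].
have := atan_ltpi2 ((b - y) / t); have := atan_gtNpi2 ((a - y) / t); lra.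
Qed.

(** The lower boundary limit of the Poisson extension, taken along t = 1/(n + 1): a sequence is what
    measurability and Fatou's lemma ask for, and it can only increase the lower limit. *)
Definition pdensity x : \bar R := limn_einf (fun n : nat => (pext p x n.+1%:R^-1 / pi)%:E).

Lemma pdensity_ge0 x : (0 <= pdensity x)%E.
Proof.
apply: limn_einf_ge => e e0; exists 0%N => n _; apply: le_trans (_ : 0 <= _); first by lra.
by apply: divr_ge0; [exact: pext_ge0|exact: pi_ge0].
Qed.

Let mpext D n : measurable_fun D (fun x => (pext p x n.+1%:R^-1 / pi)%:E : \bar R).
Proof.
apply/measurable_EFinP; apply: measurable_funTS; apply: continuous_measurable_fun.
move=> x; apply: cvgM; last exact: cvg_cst.
by apply: continuous_pext; rewrite invr_gt0.
Qed.

Lemma measurable_pdensity D : measurable D -> measurable_fun D pdensity.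
Proof.
move=> mD; have -> : pdensity = fun x =>
    (- limn_esup (fun n => - (pext p x n.+1%:R^-1 / pi)%:E))%E by [].
apply: measurableT_comp => //; apply: measurable_fun_limn_esup => // n.
by apply: measurableT_comp => //; exact: mpext.
Qed.

Lemma integral_pdensity_le a b : a < b ->
  (\int[mu]_(x in `[a, b]) pdensity x <= (p (fun=> 1%R))%:E)%E.
Proof.
move=> ab; have mI : measurable (`[a, b]%classic : set R) by exact: measurable_itv.
have pi0 : 0 < pi :> R by exact: pi_gt0.
have F0 n x : `[a, b]%classic x -> (0 <= (pext p x n.+1%:R^-1 / pi)%:E)%E.
  by move=> _; rewrite lee_fin divr_ge0 ?pi_ge0// pext_ge0.
pose I n := (\int[mu]_(x in `[a, b]) (pext p x n.+1%:R^-1 / pi)%:E)%E.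
have F : (\int[mu]_(x in `[a, b]) pdensity x <= limn_einf I)%E.
  by apply: fatou => // n; exact: mpext.
apply: le_trans F _.
have HI n : (I n <= (p (fun=> 1%R))%:E)%E.
  rewrite /I; have t0 : 0 < n.+1%:R^-1 :> R by rewrite invr_gt0.
  have mk : measurable_fun `[a, b]%classic (fun x => (pext p x n.+1%:R^-1)%:E : \bar R).
    apply/measurable_EFinP; apply: measurable_funTS; apply: continuous_measurable_fun.
    exact: continuous_pext.
  have k0 x : `[a, b]%classic x -> (0 <= (pext p x n.+1%:R^-1)%:E)%E.
    by move=> _; rewrite lee_fin pext_ge0.
  have pin : (0 <= pi^-1%:E :> \bar R)%E by rewrite lee_fin invr_ge0 ltW.
  under eq_integral do rewrite mulrC EFinM.
  rewrite (ge0_integralZl mu mI mk k0 pin).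
  apply: le_trans (lee_wpmul2l pin (integral_pext_le ab t0)) _.
  by rewrite -EFinM mulKf// gt_eqF.
have -> : limn_einf I = limf_einf I \oo by [].
rewrite limf_einfE; apply: ge_ereal_sup => _ [V FV <-].
have [n Vn] := filter_ex FV.
by apply: le_trans (HI n); apply: ereal_inf_lbound; exists n.
Qed.

End Fatou.

(** * Lebesgue integrability of differences *)

Section Difference.
Context {R : realType}.
Local Notation mu := (@lebesgue_measure R).
Implicit Types (u v : compact_distribution R) (U V : schwartz_distribution R).
Implicit Types (f p q : R -> \bar R) (a b x y z e t d : R).

Lemma ae_imp3 (P Q S W : R -> Prop) : {ae mu, forall x, P x} -> {ae mu, forall x, Q x} ->
  {ae mu, forall x, S x} -> (forall x, P x -> Q x -> S x -> W x) -> {ae mu, forall x, W x}.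
Proof.
move=> nP nQ nS PQSW; apply: negligibleS (negligibleU (negligibleU nP nQ) nS) => x /= nW.
by apply: contrapT => /not_orP[/not_orP[/contrapT ? /contrapT ?] /contrapT ?]; apply/nW/PQSW.
Qed.

Lemma ae_and (P Q : R -> Prop) : {ae mu, forall x, P x} -> {ae mu, forall x, Q x} ->
  {ae mu, forall x, P x /\ Q x}.
Proof. by move=> nP nQ; apply: (ae_imp3 nP nQ nQ). Qed.

Lemma major_ae a b f u U : major_pair a b f u U -> {ae mu, forall x, x \in `[a, b] ->
  (f x <= lower_value u poisson x)%E /\ (-oo < lower_value u poisson x)%E}.
Proof.
move=> [_ _ _ _ [E [Z [cE nZ H1 H2]]]].
have T1P := @T1_poisson R; have [T0P _] := T1P.
apply: negligibleS (negligibleU (countable_negligible cE) nZ) => x /= nH.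
apply: contrapT => /not_orP[nE nZx]; apply: nH => xab.
by split; [exact: H1|exact: H2].
Qed.

Lemma minor_ae a b f v V : minor_pair a b f v V -> {ae mu, forall x, x \in `[a, b] ->
  (upper_value v poisson x <= f x)%E /\ (upper_value v poisson x < +oo)%E}.
Proof.
move=> [_ _ _ _ [E [Z [cE nZ H1 H2]]]].
have T1P := @T1_poisson R; have [T0P _] := T1P.
apply: negligibleS (negligibleU (countable_negligible cE) nZ) => x /= nH.
apply: contrapT => /not_orP[nE nZx]; apply: nH => xab.
by split; [exact: H1|exact: H2].
Qed.

Lemma seq_of_near (P : R -> Prop) d : 0 < d -> (forall t, 0 < t < d -> P t) ->
  exists N : nat, forall n, (N <= n)%N -> P n.+1%:R^-1.
Proof.
move=> d0 H; exists (Num.truncn d^-1) => n Nn; apply: H; rewrite invr_gt0 ltr0n/=.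
rewrite invf_plt ?posrE//; apply: lt_le_trans (truncnS_gt _) _.
by rewrite ler_nat ltnS.
Qed.

Lemma pdensity_sub_ge u v x y z : (y%:E <= lower_value u poisson x)%E ->
  (upper_value v poisson x <= z%:E)%E ->
  ((y - z)%:E <= pdensity (fun psi => (u psi - v psi)%R) x)%E.
Proof.
move=> yu vz; apply: limn_einf_ge => e e0.
have [d d0 Hd] := lower_upper_pext e0 yu vz.
exact: seq_of_near d0 Hd.
Qed.

Lemma major_minor_nonneg a b p q u U v V : major_pair a b q u U -> minor_pair a b p v V ->
  {ae mu, forall x, x \in `[a, b] -> (p x <= q x)%E} ->
  forall psi, Cinf psi -> (forall x, 0 <= psi x) -> 0 <= u psi - v psi.
Proof. by move=> M m pq psi spsi psi0; rewrite subr_ge0 (pair_le M m). Qed.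

Lemma ae_refl a b f : {ae mu, forall x, x \in `[a, b] -> (f x <= f x)%E}.
Proof. exact: aeW. Qed.

(** Where f is infinite, the lower value of u is +oo or the upper value of v is -oo, so the density
    of u - v is infinite. That density is integrable, hence finite almost everywhere. *)
Lemma dist_integrable_fin_ae a b f : a < b -> dist_integrable a b f ->
  {ae mu, forall x, x \in `[a, b] -> f x \is a fin_num}.
Proof.
move=> ab [[u [U M]] [v [V m]] _].
pose w psi := u psi - v psi.
have cw : cdist w by apply: cdistB; exact: cdist_of.
have w0 := major_minor_nonneg M m (ae_refl a b f).
have mI : measurable (`[a, b]%classic : set (measurableTypeR R)) by exact: measurable_itv.
have ip : mu.-integrable `[a, b]%classic (pdensity w).
  apply/integrableP; split; first exact: measurable_pdensity.
  apply: le_lt_trans (ltry (w (fun=> 1))).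
  under eq_integral do rewrite gee0_abs ?(pdensity_ge0 w0)//.
  exact: integral_pdensity_le.
have fin : {ae mu, forall x, x \in `[a, b] -> pdensity w x \is a fin_num}.
  have H : {ae mu, forall x, `[a, b]%classic x -> pdensity w x \is a fin_num}.
    by apply: integrable_ae ip; exact: measurable_itv.
  by apply: (ae_imp3 H H H) => x Hx _ _ xab; apply: Hx; move: xab; rewrite inE.
apply: (ae_imp3 (major_ae M) (minor_ae m) fin) => x H1 H2 H3 xab.
have [fu uNy] := H1 xab; have [vf vy] := H2 xab.
have /fineK E := H3 xab.
case: (f x) fu vf => [r//| |]; rewrite ?leye_eq ?leeNy_eq.
- move=> /eqP uy _; have [B vB] : exists B : R, (upper_value v poisson x <= B%:E)%E.
    by case: (upper_value v poisson x) vy => [r| |] // _; [exists r|exists 0; rewrite leNye].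
  have : ((fine (pdensity w x) + B + 1)%:E <= lower_value u poisson x)%E by rewrite uy leey.
  by move=> /pdensity_sub_ge/(_ vB); rewrite -/w -E lee_fin; lra.
move=> _ /eqP vNy; have [B uB] : exists B : R, (B%:E <= lower_value u poisson x)%E.
  by case: (lower_value u poisson x) uNy => [r| |] // _; [exists r|exists 0; rewrite leey].
have : (upper_value v poisson x <= (B - fine (pdensity w x) - 1)%:E)%E by rewrite vNy leNye.
by move=> /(pdensity_sub_ge uB); rewrite -/w -E lee_fin; lra.
Qed.

(** Take u, v' for q and u', v for p, each within e / 4 of the integral. F is the density of u - v,
    hence at least q - p. G is the density of (u - v') + (u' - v), of total mass at most e; it
    exceeds F by at least p - q because it adds the extension of u' - v'. *)
Lemma approx_density a b p q e : a < b -> dist_integrable a b p -> dist_integrable a b q ->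
  {ae mu, forall x, x \in `[a, b] -> (p x <= q x)%E} -> 0 < e ->
  exists F G : R -> \bar R, [/\ measurable_fun `[a, b]%classic F, measurable_fun `[a, b]%classic G,
    (forall x, 0 <= F x)%E /\ (forall x, 0 <= G x)%E,
    (\int[mu]_(x in `[a, b]) F x < +oo)%E /\ (\int[mu]_(x in `[a, b]) G x <= e%:E)%E &
    {ae mu, forall x, x \in `[a, b] -> ((fine (q x) - fine (p x))%:E <= F x)%E /\
       (F x <= G x + (fine (q x) - fine (p x))%:E)%E}].
Proof.
move=> ab ip iq pq e0; have e4 : 0 < e / 4 by lra.
have [[u [U [M Ml]]] [v' [V' [m' ml']]]] := dist_integrableP ab iq e4.
have [[u' [U' [M' Ml']]] [v [V [m ml]]]] := dist_integrableP ab ip e4.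
pose w1 psi := u psi - v psi; pose w2 psi := (u psi - v' psi) + (u' psi - v psi).
have c1 : cdist w1 by apply: cdistB; exact: cdist_of.
have c2 : cdist w2 by apply: cdistD; apply: cdistB; exact: cdist_of.
have p1 := major_minor_nonneg M m pq.
have p2 psi : Cinf psi -> (forall x, 0 <= psi x) -> 0 <= w2 psi.
  move=> sp pp; apply: addr_ge0; first exact: (major_minor_nonneg M m' (ae_refl a b q)).
  exact: (major_minor_nonneg M' m (ae_refl a b p)).
have mI : measurable (`[a, b]%classic : set (measurableTypeR R)) by exact: measurable_itv.
exists (pdensity w1), (pdensity w2); split.
- exact: measurable_pdensity.
- exact: measurable_pdensity.
- by split; [exact: pdensity_ge0|exact: pdensity_ge0].
- split; first exact: le_lt_trans (integral_pdensity_le c1 p1 ab) (ltry _).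
  by apply: le_trans (integral_pdensity_le c2 p2 ab) _; rewrite lee_fin /w2; lra.
apply: (ae_imp3 (ae_and (major_ae M) (minor_ae m)) (ae_and (major_ae M') (minor_ae m'))
  (ae_and (dist_integrable_fin_ae ab ip) (dist_integrable_fin_ae ab iq))).
move=> x [H1 H2] [H3 H4] [H5 H6] xab.
have [qu _] := H1 xab; have [vp _] := H2 xab; have [pu' _] := H3 xab; have [vq _] := H4 xab.
have Ep := fineK (H5 xab); have Eq := fineK (H6 xab).
move: qu vp pu' vq; rewrite -Ep -Eq /= => qu vp pu' vq.
split; first exact: pdensity_sub_ge.
apply: limn_einf_le => e' e'0; have [d d0 Hd] := lower_upper_pext e'0 pu' vq.
apply: (seq_of_near (P := fun t => pext w1 x t / pi <=
   pext w2 x t / pi + (fine (q x) - fine (p x)) + e') d0) => t /Hd.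
have -> : pext w2 x t = pext w1 x t + (pext u' x t - pext v' x t).
  by rewrite /pext /w1 /w2; ring.
rewrite mulrDl; lra.
Qed.

(** The squeeze of [approx_density] with errors 1/(n + 1): the infimum of the G n has integral 0 and
    so vanishes almost everywhere, whence the infimum of the F n equals q - p almost everywhere.
    Measurability of q - p is thus a conclusion. *)
Lemma dist_integrable_diff a b p q : a < b -> dist_integrable a b p -> dist_integrable a b q ->
  {ae mu, forall x, x \in `[a, b] -> (p x <= q x)%E} ->
  exists2 k : R -> R, mu.-integrable `[a, b]%classic (EFin \o k) &
    {ae mu, forall x, x \in `[a, b] -> [/\ q x = (p x + (k x)%:E)%E, p x \is a fin_num & 0 <= k x]}.
Proof.
move=> ab ip iq pq.
have e0 (n : nat) : 0 < n.+1%:R^-1 :> R by rewrite invr_gt0.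
have /choice[F /choice[G H]] := fun n => approx_density ab ip iq pq (e0 n).
have mI : measurable (`[a, b]%classic : set (measurableTypeR R)) by exact: measurable_itv.
have mF n : measurable_fun `[a, b]%classic (F n) by have [] := H n.
have mG n : measurable_fun `[a, b]%classic (G n) by have [] := H n.
have F0 n x : (0 <= F n x)%E by have [_ _ []] := H n.
have G0 n x : (0 <= G n x)%E by have [_ _ []] := H n.
(* [einfs] at index 0 is the infimum over the whole sequence. *)
pose f x := einfs (F ^~ x) 0; pose g x := einfs (G ^~ x) 0.
have mf : measurable_fun `[a, b]%classic f by exact: measurable_fun_einfs.
have mg : measurable_fun `[a, b]%classic g by exact: measurable_fun_einfs.
have f0 x : (0 <= f x)%E by apply: le_ereal_inf_tmp => _ [n _ <-]; exact: F0.
have g0 x : (0 <= g x)%E by apply: le_ereal_inf_tmp => _ [n _ <-]; exact: G0.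
have fF n x : (f x <= F n x)%E by apply: ereal_inf_lbound; exists n.
have gG n x : (g x <= G n x)%E by apply: ereal_inf_lbound; exists n.
have Ig : (\int[mu]_(x in `[a, b]) g x = 0)%E.
  apply/eqP; rewrite eq_le integral_ge0 ?andbT//; apply/lee_addgt0Pr => e ee0; rewrite add0e.
  have [|N HN] := seq_of_near (P := fun t => t <= e) ee0; first by move=> t /andP[_ /ltW].
  apply: le_trans (_ : (N.+1%:R^-1)%:E <= _)%E; last by rewrite lee_fin; exact: HN.
  have [_ _ _ [_ IG] _] := H N; apply: le_trans IG.
  by apply: ge0_le_integral => //; try exact: mG.
have gae : {ae mu, forall x, x \in `[a, b] -> g x = 0%E}.
  have : (\int[mu]_(x in `[a, b]) `|g x| = 0)%E.
    by under eq_integral do rewrite gee0_abs//.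
  move=> /(ae_eq_integral_abs _ mI mg) K; apply: (ae_imp3 K K K) => x Hx _ _ xab.
  by apply: Hx; move: xab; rewrite inE.
have Hae : {ae mu, forall x, forall n, x \in `[a, b] ->
    ((fine (q x) - fine (p x))%:E <= F n x)%E /\
       (F n x <= G n x + (fine (q x) - fine (p x))%:E)%E}.
  by apply/ae_foralln => n; have [] := H n.
have If : mu.-integrable `[a, b]%classic f.
  apply/integrableP; split=> //.
  under eq_integral do rewrite gee0_abs//.
  have [_ _ _ [IF _] _] := H 0%N; apply: le_lt_trans IF.
  by apply: ge0_le_integral => //; try exact: mF.
exists (fine \o f).
  apply: (le_integrable mI _ _ If).
    by apply/measurable_EFinP; apply: measurableT_comp mf.
  by move=> x _ /=; have := f0 x; case: (f x) => [r|_|] //=; rewrite leey.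
apply: (ae_imp3 (ae_and gae Hae) (dist_integrable_fin_ae ab ip) (dist_integrable_fin_ae ab iq)).
move=> x [H1 H2] H3 H4 xab; have Ep := fineK (H3 xab); have Eq := fineK (H4 xab).
have fE : f x = (fine (q x) - fine (p x))%:E.
  apply/eqP; rewrite eq_le; apply/andP; split.
    have : (f x - (fine (q x) - fine (p x))%:E <= g x)%E.
      apply: le_ereal_inf_tmp => _ [n _ <-]; rewrite leeBlDr//.
      by apply: le_trans (fF n x) _; have [] := H2 n xab.
    by rewrite H1// leeBlDr// add0e.
  by apply: le_ereal_inf_tmp => _ [n _ <-]; have [] := H2 n xab.
split; [|exact: H3|by rewrite /= fine_ge0].
rewrite /= fE /=; apply: etrans (esym Eq) _.
by rewrite -[X in (X + _)%E]Ep -EFinD; congr EFin; ring.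
Qed.

End Difference.

(** * Antiderivatives of test functions *)

Section Antiderivative.
Context {R : realType}.
Local Notation mu := (@lebesgue_measure R).
Implicit Types (phi psi : R -> R) (a b c d e s y z M A : R).

Definition antider phi s : R := (\int[mu]_(y in `]-oo, s]) phi y)%R.

(** The integral of phi over the half-line to the right of s. *)
Definition tail phi s : R := (\int[mu]_y phi y)%R - antider phi s.

Lemma antider_sint phi c s : (forall y, y <= c -> phi y = 0) -> antider phi s = sint c s phi.
Proof.
move=> phi0; rewrite /antider /sint /Rintegral integral_mkcond [in RHS]integral_mkcond.
congr fine; apply: eq_integral => y _; rewrite !patchE.
have E1 : (y \in `]-oo, s]%classic) = (y <= s) by apply/idP/idP; rewrite inE/= in_itv.
have E2 : (y \in `[c, s]%classic) = (c <= y <= s) by apply/idP/idP; rewrite inE/= in_itv.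
rewrite E1 E2; have [ys|] := leP y s; last by rewrite andbF.
by rewrite andbT; have [//|/ltW/phi0 ->] := leP c y.
Qed.

Lemma is_derive_antider phi c s : continuous phi -> (forall y, y <= c -> phi y = 0) ->
  is_derive s 1 (antider phi) (phi s).
Proof.
move=> cphi phi0; pose c' := Num.min c (s - 1).
have -> : antider phi = fun s => sint c' s phi.
  by apply/funext => z; apply: antider_sint => y; rewrite le_min => /andP[/phi0].
by apply: is_derive_sint => //; rewrite gt_min; apply/orP; right; lra.
Qed.

Lemma antider_left phi c s : (forall y, y <= c -> phi y = 0) -> s <= c -> antider phi s = 0.
Proof.
move=> phi0 sc; rewrite (antider_sint _ phi0); apply: sint_eq0 => y /andP[cy ys].
by apply: phi0; exact: le_trans sc.
Qed.

Lemma antider_right phi c d s : (forall y, y <= c -> phi y = 0) -> (forall y, d <= y -> phi y = 0) ->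
  d <= s -> antider phi s = (\int[mu]_y phi y)%R.
Proof.
move=> phic phid ds; rewrite (antider_sint _ phic); apply/esym/Rintegral_supp => y.
by rewrite negb_and -!ltNge => /orP[/ltW/phic|sy]//; apply: phid; exact/ltW/(le_lt_trans ds).
Qed.

Lemma norm_antider_le phi M A s : 0 <= M -> continuous phi -> (forall y, `|phi y| <= A) ->
  (forall y, M <= `|y| -> phi y = 0) -> `|antider phi s| <= 2 * M * A.
Proof.
move=> M0 cphi phiA phi0; have A0 : 0 <= A by exact: le_trans (normr_ge0 _) (phiA 0).
have phi1 y : y <= - M -> phi y = 0.
  by move=> yM; apply: phi0; rewrite ler0_norm; lra.
have phi2 y : M <= y -> phi y = 0 by move=> My; apply: phi0; rewrite ger0_norm; lra.
have bnd z : - M <= z <= M -> `|antider phi z| <= 2 * M * A.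
  move=> /andP[z1 z2]; rewrite (antider_sint _ phi1).
  apply: le_trans (norm_sint_le (g := fun=> A) cphi _ _) _ => //; first exact: cst_continuous.
  by rewrite sint_cst// mulrC ler_wpM2r//; lra.
have [sM|Ms] := leP s (- M).
  by rewrite (antider_left phi1 sM) normr0 mulr_ge0// mulr_ge0.
have [sM|sM] := leP M s; last by apply: bnd; lra.
rewrite (antider_right phi1 phi2 sM) -(antider_right phi1 phi2 (lexx M)); apply: bnd; lra.
Qed.

Lemma test_function_bounds phi : test_function phi -> exists M A, [/\ 0 < M, 0 <= A, continuous phi,
  forall y, `|phi y| <= A & forall y, M <= `|y| -> phi y = 0].
Proof.
move=> /test_functionE[sphi [M M0 phi0]].
have [|A A0 HA] := smooth_bounded_supp 0 sphi (M := M); first by move=> y /ltW; exact: phi0.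
exists (M + 1), A; split=> //; first by lra.
- exact: smooth_continuous.
- by move=> y; exact: (HA 0%N).
- by move=> y My; apply: phi0; lra.
Qed.

Lemma test_lr phi M : (forall y, M <= `|y| -> phi y = 0) ->
  (forall y, y <= - M -> phi y = 0) /\ (forall y, M <= y -> phi y = 0).
Proof.
move=> phi0; split=> y yM; apply: phi0.
  by rewrite ler_normr; apply/orP; right; lra.
exact: le_trans (ler_norm _).
Qed.

Lemma continuous_antider phi : test_function phi -> continuous (antider phi).
Proof.
move=> /test_function_bounds[M [A [M0 A0 cphi _ /test_lr[phi1 _]]]].
by apply: is_derive_continuous => s; exact: is_derive_antider cphi phi1.
Qed.

Lemma antider_affine phi c e s : 0 < e -> test_function phi ->
  antider (fun y => phi ((y - c) / e)) s = e * antider phi ((s - c) / e).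
Proof.
move=> e0 tphi; have [M [A [M0 A0 cphi _ /test_lr[phi1 _]]]] := test_function_bounds tphi.
have [M' [A' [M0' A0' cpsi _ /test_lr[psi1 _]]]] := test_function_bounds (test_function_affine c e0 tphi).
pose D z := antider (fun y => phi ((y - c) / e)) z - e * antider phi ((z - c) / e).
have dD z : is_derive z 1 D 0.
  have d1 := is_derive_antider z cpsi psi1.
  have d2 := is_derive_affine (is_derive_antider ((z - c) / e) cphi phi1).
  apply: (is_derive_eq (is_deriveBr d1 (is_deriveZr e d2))).
  by field; rewrite gt_eqF.
pose z0 := Num.min (- M') (c - M * e).
have : D s = D z0 by exact: is_derive_0_is_cst.
rewrite {2}/D (antider_left psi1) ?ge_min ?lexx// (antider_left phi1); last first.
  by rewrite ler_pdivrMr// mulNr lerBlDr addrC ge_min lexx orbT.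
by rewrite mulr0 subrr => /eqP; rewrite subr_eq0 => /eqP.
Qed.

Lemma Rintegral_affine phi c e : 0 < e -> test_function phi ->
  (\int[mu]_y phi ((y - c) / e))%R = e * (\int[mu]_y phi y)%R.
Proof.
move=> e0 tphi; have [M [A [M0 A0 cphi _ /test_lr[phi1 phi2]]]] := test_function_bounds tphi.
have [M' [A' [M0' A0' cpsi _ /test_lr[psi1 psi2]]]] := test_function_bounds (test_function_affine c e0 tphi).
pose s := Num.max M' (c + M * e).
rewrite -(antider_right psi1 psi2 (s := s)) ?le_max ?lexx// antider_affine//.
by rewrite (antider_right phi1 phi2)// ler_pdivlMr// lerBrDl le_max lexx orbT.
Qed.

Lemma tail_affine phi c e s : 0 < e -> test_function phi ->
  tail (fun y => phi ((y - c) / e)) s = e * tail phi ((s - c) / e).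
Proof. by move=> e0 tphi; rewrite /tail Rintegral_affine// antider_affine// mulrBr. Qed.

Lemma tail_lin a phi psi s : test_function phi -> test_function psi ->
  tail (fun y => a * phi y + psi y) s = a * tail phi s + tail psi s.
Proof.
move=> /test_function_bounds[M [A [M0 A0 cphi _ phi0]]] /test_function_bounds[M' [A' [M0' A0' cpsi _ psi0]]].
pose N := Num.max M M'.
have [phi1 phi2] : (forall y, y <= - N -> phi y = 0) /\ (forall y, N <= y -> phi y = 0).
  by apply: test_lr => y; rewrite ge_max => /andP[/phi0].
have [psi1 psi2] : (forall y, y <= - N -> psi y = 0) /\ (forall y, N <= y -> psi y = 0).
  by apply: test_lr => y; rewrite ge_max => /andP[_ /psi0].
pose f y := a * phi y + psi y.
have f1 y : y <= - N -> f y = 0 by move=> yN; rewrite /f phi1// psi1// mulr0 addr0.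
have f2 y : N <= y -> f y = 0 by move=> yN; rewrite /f phi2// psi2// mulr0 addr0.
have sf z : sint (- N) z f = a * sint (- N) z phi + sint (- N) z psi.
  have -> : f = fun y => a * phi y - (-1) * psi y by apply/funext => y; rewrite /f mulN1r opprK.
  rewrite sintB ?sintZ//; first by rewrite mulN1r opprK.
    by move=> y; apply: cvgM; [exact: cvg_cst|exact: cphi].
  by move=> y; apply: cvgM; [exact: cvg_cst|exact: cpsi].
rewrite /tail -/f -(antider_right f1 f2 (lexx N)) -(antider_right phi1 phi2 (lexx N)).
rewrite -(antider_right psi1 psi2 (lexx N)) !(antider_sint _ f1) !(antider_sint _ phi1).
by rewrite !(antider_sint _ psi1) !sf; ring.
Qed.

Lemma tail_derive1 phi s : test_function phi -> tail (derive1 phi) s = - phi s.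
Proof.
move=> tphi; have [sphi _] := test_functionE tphi.
have tdphi := test_function_derive1 tphi.
have [M [A [M0 A0 cphi _ /test_lr[phi1 phi2]]]] := test_function_bounds tphi.
have [M' [A' [M0' A0' cdphi _ /test_lr[dphi1 dphi2]]]] := test_function_bounds tdphi.
have E z : antider (derive1 phi) z = phi z.
  pose c := Num.min (z - 1) (Num.min (- M) (- M')).
  have cM' : c <= - M' by rewrite !ge_min lexx !orbT.
  rewrite (antider_sint (c := c)); last by move=> y yc; apply: dphi1; exact: le_trans cM'.
  have dp y : is_derive y 1 phi (derive1 phi y) by exact: (smooth_is_derive 0 y sphi).
  have cz : c < z by rewrite gt_min; apply/orP; left; lra.
  by rewrite (sint_FTC cz cdphi dp) (phi1 c) ?subr0// !ge_min lexx orbT.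
rewrite /tail E -(antider_right dphi1 dphi2 (s := Num.max M M')) ?le_max ?lexx ?orbT//.
by rewrite E phi2 ?sub0r// le_max lexx.
Qed.

Lemma norm_tail_le phi M A s : 0 <= M -> continuous phi -> (forall y, `|phi y| <= A) ->
  (forall y, M <= `|y| -> phi y = 0) -> `|tail phi s| <= 4 * M * A.
Proof.
move=> M0 cphi phiA phi0; have [phi1 phi2] := test_lr phi0.
rewrite /tail -(antider_right phi1 phi2 (lexx M)).
apply: le_trans (ler_normB _ _) _.
by have := norm_antider_le M M0 cphi phiA phi0; have := norm_antider_le s M0 cphi phiA phi0; lra.
Qed.

Lemma test_function_reflect phi : test_function phi -> test_function (fun y => phi (- y)).
Proof.
move=> /test_functionE[sphi [M M0 phi0]]; apply: (@test_functionI _ _ M).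
  have -> : (fun y => phi (- y)) = fun y => phi ((y - 0) / -1).
    by apply/funext => y; rewrite subr0 invrN1 mulrN1.
  exact: smooth_affine.
by move=> y /ltW yM; apply: phi0; rewrite normrN.
Qed.

Lemma Rintegral_reflect phi : test_function phi ->
  (\int[mu]_y phi (- y))%R = (\int[mu]_y phi y)%R.
Proof.
move=> tphi; have [M [A [M0 A0 cphi _ phi0]]] := test_function_bounds tphi.
have [phi1 phi2] := test_lr phi0.
have [M' [A' [M0' A0' cpsi _ _]]] := test_function_bounds (test_function_reflect tphi).
have out y : ~~ (- M <= y <= M) -> phi (- y) = 0.
  by rewrite negb_and -!ltNge => /orP[?|?]; [apply: phi2|apply: phi1]; lra.
have dG y : is_derive y 1 (fun y => - antider phi (- y)) (phi (- y)).
  have -> : (fun y => - antider phi (- y)) = fun y => -1 * antider phi ((y - 0) / -1).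
    by apply/funext => z; rewrite subr0 invrN1 mulrN1 mulN1r.
  have Ey : (y - 0) / -1 = - y by rewrite subr0 invrN1 mulrN1.
  have d : is_derive ((y - 0) / -1) 1 (antider phi) (phi (- y)).
    by rewrite Ey; exact: is_derive_antider cphi phi1.
  apply: (is_derive_eq (is_deriveZr (-1) (is_derive_affine d))).
  by rewrite invrN1 mulrA mulrNN !mulr1 mul1r.
have MM : - M < M by lra.
rewrite (Rintegral_supp out) (sint_FTC MM cpsi dG) !opprK (antider_left phi1 (lexx _)).
by rewrite oppr0 add0r (antider_right phi1 phi2 (lexx _)).
Qed.

End Antiderivative.

(** * Distributions with integrable density *)

Section Density.
Context {R : realType}.
Local Notation mu := (@lebesgue_measure R).
Implicit Types (phi psi : R -> R) (c e s x y A B M : R).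
Variables (a b : R) (w : R -> R).
Hypothesis iw : mu.-integrable setT (EFin \o w).

Definition dint phi : R := (\int[mu]_(x in `[a, b]) (w x * phi x))%R.

Let mI : measurable (`[a, b]%classic : set (measurableTypeR R)). Proof. exact: measurable_itv. Qed.

Let izl (D : set (measurableTypeR R)) r (f : R -> R) : measurable D -> mu.-integrable D (EFin \o f) ->
  mu.-integrable D (EFin \o (fun x => r * f x)).
Proof.
move=> mD jf; have -> : EFin \o (fun x => r * f x) = (fun x => r%:E * (f x)%:E)%E.
  by apply/funext => x; rewrite /= EFinM.
exact: integrableZl.
Qed.

Let iwI : mu.-integrable `[a, b]%classic (EFin \o w).
Proof. by apply: integrableS iw. Qed.

Lemma dint_integrable phi B : measurable_fun setT phi ->
  (forall x, a <= x <= b -> `|phi x| <= B) ->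
  mu.-integrable `[a, b]%classic (EFin \o (fun x => w x * phi x)).
Proof.
move=> mphi pB; have -> : EFin \o (fun x => w x * phi x) = ((EFin \o phi) \* (EFin \o w))%E.
  by apply/funext => x /=; rewrite mulrC EFinM.
apply: integrableMr => //; first exact: measurable_funTS.
exists B; split; first exact: num_real.
move=> M BM x /=; rewrite in_itv/= => /pB H; apply: le_trans H _; exact: ltW.
Qed.

Lemma continuous_segment_bounded phi : continuous phi ->
  exists2 B, 0 <= B & forall x, a <= x <= b -> `|phi x| <= B.
Proof.
move=> cphi; have cK : compact (phi @` `[a, b]%classic).
  by apply: continuous_compact; [exact: continuous_subspaceT|exact: segment_compact].
have [M [Mr HM]] := compact_bounded cK.
exists (`|M| + 1) => [|x xab]; first by rewrite addr_ge0.
apply: (HM (`|M| + 1)); first by apply: le_lt_trans (ler_norm _) _; rewrite ltrDl.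
by exists x => //=; rewrite in_itv.
Qed.

Let ci phi : continuous phi -> mu.-integrable `[a, b]%classic (EFin \o (fun x => w x * phi x)).
Proof.
move=> cphi; have [B B0 HB] := continuous_segment_bounded cphi.
by apply: dint_integrable HB; exact: continuous_measurable_fun.
Qed.

Lemma dint_lin r phi psi A B : measurable_fun setT phi -> measurable_fun setT psi ->
  (forall x, a <= x <= b -> `|phi x| <= A) -> (forall x, a <= x <= b -> `|psi x| <= B) ->
  dint (fun x => r * phi x + psi x) = r * dint phi + dint psi.
Proof.
move=> mphi mpsi pA pB; have i1 := dint_integrable mphi pA; have i2 := dint_integrable mpsi pB.
have i3 : mu.-integrable `[a, b]%classic (EFin \o (fun x => r * (w x * phi x))).
  exact: izl.
rewrite /dint -RintegralZl// -(RintegralD mI i3 i2).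
by apply: eq_Rintegral => x _; ring.
Qed.

Definition dmass : R := (\int[mu]_(x in `[a, b]) `|w x|)%R.

Lemma dmass_ge0 : 0 <= dmass.
Proof. by apply: Rintegral_ge0. Qed.

Let iabs : mu.-integrable `[a, b]%classic (EFin \o (fun x => `|w x|)).
Proof. exact: (integrable_norm iwI). Qed.

Lemma dint_le phi A : measurable_fun setT phi -> (forall x, a <= x <= b -> `|phi x| <= A) ->
  `|dint phi| <= dmass * A.
Proof.
move=> mphi pA; have i1 := dint_integrable mphi pA.
apply: le_trans (le_normr_Rintegral mI i1) _; rewrite mulrC -RintegralZl//.
have i2 : mu.-integrable `[a, b]%classic (EFin \o (fun x => A * `|w x|)) by exact: izl.
apply: (le_Rintegral mI (integrable_norm i1) i2) => x /=; rewrite in_itv/= => /pA H.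
by rewrite normrM mulrC ler_wpM2r.
Qed.

Lemma dint_local_le psi B (A : set (measurableTypeR R)) : measurable_fun setT psi -> measurable A ->
  (forall s, `|psi s| <= B) -> (forall s, ~ A s -> psi s = 0) ->
  `|dint psi| <= B * (\int[mu]_(x in A) `|w x|)%R.
Proof.
move=> mpsi mA pB pA; have i1 := dint_integrable mpsi (fun x _ => pB x).
apply: le_trans (le_normr_Rintegral mI i1) _.
have iA : mu.-integrable A (EFin \o (fun x => `|w x|)).
  by apply: integrable_norm; exact: integrableS iw.
have mw : measurable_fun setT w by case/integrableP : iw => /measurable_EFinP.
rewrite -RintegralZl// /Rintegral; apply: fine_le.
- by apply: integrable_fin_num => //; exact: integrable_norm.
- by apply: integrable_fin_num => //; exact: izl.
rewrite [leLHS]integral_mkcond [leRHS]integral_mkcond; apply: ge0_le_integral => //.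
- by move=> x _; rewrite patchE; case: ifP.
- apply/(measurable_restrictT _ _).1 => //; apply/measurable_EFinP; apply: measurable_funTS.
  by apply: measurableT_comp => //; exact: measurable_funM.
- apply/(measurable_restrictT _ _).1 => //; apply/measurable_EFinP; apply: measurable_funTS.
  by apply: measurable_funM => //; exact: measurableT_comp.
move=> x _; rewrite !patchE.
have B0 : 0 <= B by exact: le_trans (normr_ge0 _) (pB 0).
have [xA|/negP xA] := boolP (x \in A).
  case: ifP => _; last by rewrite lee_fin mulr_ge0.
  by rewrite lee_fin normrM mulrC ler_wpM2r.
case: ifP => // _; rewrite lee_fin pA ?mulr0 ?normr0//.
by move=> H; apply: xA; rewrite inE.
Qed.

Let cmeas phi : Cinf phi -> measurable_fun setT phi.
Proof. by move=> sp; apply: continuous_measurable_fun; exact: smooth_continuous. Qed.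

Lemma le_seminorm0 phi (K : set R) x : smooth phi -> compact K -> K x -> `|phi x| <= seminorm 0 K phi.
Proof.
move=> sphi cK Kx; rewrite /seminorm big_ord_recl big_ord0 addr0 /=.
have cphi : continuous phi by apply: smooth_continuous; split.
have cI : compact (phi @` K) by apply: continuous_compact => //; exact: continuous_subspaceT.
have [M [Mr HM]] := compact_bounded cI.
apply: ub_le_sup; last by exists x.
exists (`|M| + 1) => _ [y Ky <-]; apply: (HM (`|M| + 1)); last by exists y.
by apply: le_lt_trans (ler_norm _) _; rewrite ltrDl.
Qed.

Lemma dint_linear (c : R) phi psi : smooth phi -> smooth psi ->
  dint (fun x => c * phi x + psi x) = c * dint phi + dint psi.
Proof.
move=> sphi spsi; have sp : Cinf phi by split. have sq : Cinf psi by split.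
have [A _ HA] := continuous_segment_bounded (smooth_continuous sp).
have [B _ HB] := continuous_segment_bounded (smooth_continuous sq).
by apply: dint_lin HA HB; exact: cmeas.
Qed.

Lemma dint_continuous : exists K (C : R) (N : nat), compact K /\
  forall phi, smooth phi -> `|dint phi| <= C * seminorm N K phi.
Proof.
exists `[a, b]%classic, dmass, 0%N; split; first exact: segment_compact.
move=> phi sphi; apply: dint_le; first by apply: cmeas; split.
by move=> x xab; apply: (le_seminorm0 sphi (@segment_compact _ a b)); rewrite /= in_itv.
Qed.

Definition density_cdist := CompactDistribution dint_linear dint_continuous.

Lemma density_supported : supported_in density_cdist `[a, b].
Proof.
move=> phi tphi sK; rewrite /= /dint (@eq_Rintegral _ _ _ mu _ (fun=> 0)).
  by rewrite Rintegral_cst// mul0r.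
move=> x; rewrite inE => xab; have [->|nz] := eqVneq (phi x) 0; first by rewrite mulr0.
have : (supp phi `&` `[a, b]%classic) x by split => //; exact: subset_closure.
by rewrite sK.
Qed.

(** By Fubini this is the pairing of phi with the function x |-> integral of w over the part of
    [a, b] left of x; the exchanged form is taken as definition. *)
Definition dprim phi : R := dint (tail phi).

Lemma continuous_tail phi : test_function phi -> continuous (tail phi).
Proof.
move=> tphi x; apply: cvgB; first exact: cvg_cst.
exact: continuous_antider.
Qed.

Lemma dprim_linear (c : R) phi psi : test_function phi -> test_function psi ->
  dprim (fun x => c * phi x + psi x) = c * dprim phi + dprim psi.
Proof.
move=> tp tq; have cp := continuous_tail tp; have cq := continuous_tail tq.
have [A _ HA] := continuous_segment_bounded cp; have [B _ HB] := continuous_segment_bounded cq.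
rewrite /dprim -(dint_lin _ _ _ HA HB); try exact: continuous_measurable_fun.
by congr dint; apply/funext => s; exact: tail_lin.
Qed.

Lemma dprim_continuous (K : set R) : compact K -> exists (C : R) (N : nat),
  forall phi, test_function phi -> supp phi `<=` K -> `|dprim phi| <= C * seminorm N K phi.
Proof.
move=> cK; have [M0 [_ HM]] := compact_bounded cK; pose M : R := `|M0| + 2.
have M0' : 0 <= M by rewrite addr_ge0.
exists (dmass * (4 * M)), 0%N => phi tphi sK.
have [sphi _] := test_functionE tphi.
have phi0 y : ~ K y -> phi y = 0.
  by move=> nK; apply/eqP; apply: contra_notT nK => nz; apply: sK; exact: subset_closure.
have S0 : 0 <= seminorm 0 K phi.
  have [->|/set0P[y Ky]] := eqVneq K set0.
    by rewrite /seminorm big_ord_recl big_ord0 addr0 image_set0 sup0.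
  exact: le_trans (normr_ge0 _) (le_seminorm0 (CinfE sphi) cK Ky).
rewrite -mulrA; apply: dint_le.
  by apply: continuous_measurable_fun; exact: continuous_tail.
move=> x _; apply: norm_tail_le => //; first exact: smooth_continuous.
  move=> y; have [Ky|/phi0 ->] := pselect (K y); last by rewrite normr0.
  by apply: le_seminorm0 => //; exact: CinfE.
move=> y My; apply: phi0 => Ky; have := HM (`|M0| + 1) _ y Ky.
have -> : M0 < `|M0| + 1 by apply: le_lt_trans (ler_norm _) _; rewrite ltrDl.
move=> /(_ isT) H; have : `|M0| + 2 <= `|M0| + 1 by exact: le_trans My H.
lra.
Qed.

Definition density_dist := SchwartzDistribution dprim_linear dprim_continuous.

Let mcst (c : R) : measurable_fun setT (fun _ : R => c).
Proof. by apply: continuous_measurable_fun; exact: cst_continuous. Qed.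

Lemma density_derivative : has_derivative density_dist density_cdist.
Proof.
move=> phi tphi; rewrite /= /dprim.
have -> : tail (derive1 phi) = fun s => - phi s by apply/funext => s; exact: tail_derive1.
have [A _ HA] := continuous_segment_bounded (smooth_continuous (test_functionE tphi).1).
have mphi := cmeas (test_functionE tphi).1.
have := @dint_lin (-1) phi (fun=> 0) A 0 mphi (mcst 0) HA (fun x _ => eq_ind_r (fun z => z <= 0) (lexx _) (normr0 R)).
rewrite [dint (fun=> 0)](_ : _ = 0); last first.
  by rewrite /dint; under eq_Rintegral do rewrite mulr0; rewrite Rintegral_cst// mul0r.
rewrite addr0 mulN1r => E; rewrite [X in - X](_ : _ = - dint phi) ?opprK//.
by rewrite -E; congr dint; apply/funext => x; rewrite addr0 mulN1r.
Qed.

Definition below c x : R := if x < c then 1 else 0.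

(* The primitive of w which vanishes at a. *)
Definition cumul c : R := dint (below c).

Let mlt c : measurable_fun setT (below c).
Proof.
have -> : below c = \1_(`]-oo, c[%classic).
  apply/funext => x; rewrite indicE /below.
  have -> : (x \in `]-oo, c[%classic) = (x < c) by apply/idP/idP; rewrite inE/= in_itv.
  by case: (x < c).
exact: measurable_indic.
Qed.

Lemma cumul_left : cumul a = 0.
Proof.
rewrite /cumul /dint (@eq_Rintegral _ _ _ mu _ (fun=> 0)); first by rewrite Rintegral_cst// mul0r.
by move=> x; rewrite inE/= in_itv/= => /andP[ax _]; rewrite /below ltNge ax mulr0.
Qed.

(** The function [tail phi ((s - c) / t)] agrees with the integral of phi times the indicator of s <
    c except within M t of c. On that short interval the integral of |w| is small by absolute
    continuity. *)
Lemma density_point_right c phi e : test_function phi -> 0 < e ->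
  exists2 d, 0 < d & forall t, 0 < t < d ->
    `|cumul c * (\int[mu]_y phi y)%R - dilated_pairing density_dist c t phi| <= e.
Proof.
move=> tphi e0; have [M [A [M0 A0 cphi phiA phi0]]] := test_function_bounds tphi.
have [phi1 phi2] := test_lr phi0.
set I := (\int[mu]_y phi y)%R; pose B : R := 4 * M * A + `|I|.
have B0 : 0 <= B by apply: addr_ge0 => //; apply: mulr_ge0 => //; apply: mulr_ge0 => //; exact: ltW.
have eB : 0 < e / (B + 1) by rewrite divr_gt0// ltr_wpDl.
have [d [d0 Hd]] := integral_normr_continuous iw eB.
exists (d / (4 * M)); first by rewrite divr_gt0// mulr_gt0.
move=> t /andP[t0 td]; have tM : t * (4 * M) < d by rewrite -ltr_pdivlMr// mulr_gt0.
pose psi s := - I * below c s + tail phi ((s - c) / t).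
have ctail : continuous (fun s => tail phi ((s - c) / t)).
  move=> s; apply: (@continuous_comp _ _ _ (fun s => (s - c) / t) (tail phi)).
    by apply: cvgM; [apply: cvgB; [exact: cvg_id|exact: cvg_cst]|exact: cvg_cst].
  exact: continuous_tail.
have mtail : measurable_fun setT (fun s => tail phi ((s - c) / t)) by exact: continuous_measurable_fun.
have tB s : `|tail phi ((s - c) / t)| <= 4 * M * A by apply: norm_tail_le => //; exact: ltW.
have lt1 s : `|below c s| <= 1 by rewrite /below; case: ifP; rewrite ?normr1 ?normr0.
have -> : cumul c * I - dilated_pairing density_dist c t phi = - dint psi.
  rewrite /psi (dint_lin _ (mlt c) mtail (fun s _ => lt1 s) (fun s _ => tB s)) -/(cumul c).
  rewrite /dilated_pairing /= /dprim (gtr0_norm t0).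
  have -> : tail (fun y => phi ((y - c) / t)) = fun s => t * tail phi ((s - c) / t) + 0.
    by apply/funext => s; rewrite tail_affine// addr0.
  have z0 (s : R) : a <= s <= b -> `|0 : R| <= 0 by rewrite normr0.
  rewrite (dint_lin t mtail (mcst 0) (fun s _ => tB s) z0).
  rewrite [dint (fun=> 0)](_ : _ = 0); last first.
    by rewrite /dint; under eq_Rintegral do rewrite mulr0; rewrite Rintegral_cst// mul0r.
  by rewrite addr0 mulKf ?gt_eqF//; ring.
rewrite normrN; pose K := `[(c - M * t)%R, (c + M * t)%R]%classic : set (measurableTypeR R).
have mK : measurable K by exact: measurable_itv.
apply: le_trans (_ : B * (\int[mu]_(x in K) `|w x|)%R <= _).
  apply: dint_local_le => //.
  - by apply: measurable_funD => //; apply: measurable_funM => //; exact: mcst.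
  - move=> s; apply: le_trans (ler_normD _ _) _; rewrite /B addrC lerD//.
    by rewrite normrM normrN ler_piMr.
  move=> s /= nK; rewrite /psi /below; have [sc|cs] := ltP s c.
    rewrite mulr1 /tail (antider_left phi1) ?subr0 ?addNr//.
    rewrite ler_pdivrMr//; rewrite leNgt; apply/negP => H; apply: nK.
    by rewrite /K/= in_itv/=; apply/andP; split; lra.
  rewrite mulr0 add0r /tail (antider_right phi1 phi2) ?subrr//.
  rewrite ler_pdivlMr// leNgt; apply/negP => H; apply: nK.
  by rewrite /K/= in_itv/=; apply/andP; split; lra.
have KM : c - M * t < c + M * t by have : 0 < M * t by [exact: mulr_gt0]; lra.
have muK := lebesgue_measure_itv (`[c - M * t, c + M * t]%R : interval R).
rewrite /= lte_fin KM -EFinD in muK.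
have : (\int[mu]_(x in K) `|w x| < e / (B + 1))%R.
  apply: Hd => //; apply: (@eq_ind_r _ _ (fun z => (z < d%:E)%E) _ _ muK).
  by rewrite lte_fin; have : 0 < M * t by [exact: mulr_gt0]; lra.
move=> /ltW H; apply: le_trans (ler_wpM2l B0 H) _.
rewrite mulrA ler_pdivrMr ?ltr_wpDl// mulrC ler_wpM2l ?lerDl//; exact: ltW.
Qed.

Lemma density_point_value c : has_point_value density_dist c (cumul c).
Proof.
move=> phi tphi; apply/cvgrPdist_le => e e0.
have [d1 d10 H1] := density_point_right c tphi e0.
have [d2 d20 H2] := density_point_right c (test_function_reflect tphi) e0.
exists (Num.min d1 d2); first by rewrite /= lt_min d10.
move=> t /=; rewrite sub0r normrN lt_min => /andP[td1 td2] t0.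
have [tpos|tneg] := ltP 0 t; first by apply: H1; move: td1; rewrite gtr0_norm// tpos.
have tn : t < 0 by rewrite lt_neqAle t0.
(* Negative dilations are positive dilations of the reflected test function. *)
have E : dilated_pairing density_dist c t phi =
    dilated_pairing density_dist c (- t) (fun y => phi (- y)).
  rewrite /dilated_pairing normrN.
  have -> // : (fun y => phi ((y - c) / t)) = fun y => phi (- ((y - c) / - t)).
  by apply/funext => y; rewrite invrN mulrN opprK.
rewrite E -(Rintegral_reflect tphi); apply: H2.
by rewrite oppr_gt0 tn -(ltr0_norm tn).
Qed.

Lemma density_Lojasiewicz : Lojasiewicz density_dist.
Proof. by move=> c; exists (cumul c); exact: density_point_value. Qed.

Lemma density_point_left : has_point_value density_dist a 0.
Proof. by rewrite -cumul_left; exact: density_point_value. Qed.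

End Density.

(** * Lower values of densities *)

Section DensityLowerValue.
Context {R : realType}.
Local Notation mu := (@lebesgue_measure R).
Implicit Types (phi g : R -> R) (c d e s t x y : R).

Lemma powR_small be e : 0 < be -> 0 < e -> exists2 d : R, 0 < d & forall z, 0 < z < d -> z `^ be <= e.
Proof.
move=> be0 e0; exists (e `^ be^-1); first by rewrite powR_gt0.
move=> z /andP[z0 ze]; have -> : e = (e `^ be^-1) `^ be.
  by rewrite -powRrM mulVf ?gt_eqF// powRr1// ltW.
apply: ge0_ler_powR; rewrite ?nnegrE ?ltW//; exact: powR_gt0.
Qed.

Section Kernel.
Variable phi : R -> R.
Hypothesis tphi : T0 phi.

Let sphi : Cinf phi. Proof. by have [s _ _ _] := tphi; split. Qed.
Let phi0 y : 0 <= phi y. Proof. by have [_ H _ _] := tphi; exact: H. Qed.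
Let cphi : continuous phi. Proof. exact: smooth_continuous. Qed.

(** Since alpha < -1, phi(s / t) is at most t / |s| times a positive power of t / |s|, and the extra
    power tends to 0 uniformly for |s| >= d. *)
Lemma T0_tail d e : 0 < d -> 0 < e -> exists2 t0 : R, 0 < t0 &
  forall t s, 0 < t < t0 -> d <= `|s| -> phi (s / t) <= e * t.
Proof.
move=> d0 e0; have [_ _ _ [al al1 /(_ 0%N)[C [M HM]]]] := tphi.
have be0 : 0 < - 1 - al by lra.
have C1 : 0 < `|C| + 1 by rewrite ltr_wpDl.
have ed : 0 < e * d / (`|C| + 1) by rewrite divr_gt0// mulr_gt0.
have [d1 d10 H1] := powR_small be0 ed.
have M1 : 0 < `|M| + 1 by rewrite ltr_wpDl.
exists (Num.min (d1 * d) (d / (`|M| + 1))); first by rewrite lt_min mulr_gt0// divr_gt0.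
move=> t s /andP[t0]; rewrite lt_min => /andP[td1 tM] ds.
have s0 : 0 < `|s| by exact: lt_le_trans ds.
have zE : `|s / t| = `|s| / t by rewrite normrM normfV (gtr0_norm t0).
have Ms : M < `|s / t|.
  rewrite zE ltr_pdivlMr//; move: tM; rewrite ltr_pdivlMr// mulrC => tM.
  apply: le_lt_trans (_ : (`|M| + 1) * t < _); last exact: lt_le_trans ds.
  by apply: ler_wpM2r; [exact: ltW|have := ler_norm M; lra].
have := HM _ Ms; rewrite /= subr0 ger0_norm// => H; apply: le_trans H _.
have z0 : 0 < t / `|s| by rewrite divr_gt0.
have -> : `|s / t| `^ al = (t / `|s|) * (t / `|s|) `^ (- 1 - al).
  have -> : `|s / t| = (t / `|s|)^-1 by rewrite zE invf_div.
  rewrite -{2}[t / `|s|]powRr1 ?ltW// -powRD; last by apply/implyP => _; rewrite gt_eqF.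
  have -> : 1 + (- 1 - al) = - al by ring.
  by rewrite -powR_inv1 ?ltW// -powRrM mulN1r.
have zd1 : 0 < t / `|s| < d1.
  rewrite z0 ltr_pdivrMr//; apply: lt_le_trans td1 _.
  by apply: ler_wpM2l => //; exact: ltW.
have P := H1 _ zd1; have P0 := powR_ge0 (t / `|s|) (- 1 - al).
apply: le_trans (_ : (`|C| + 1) * (t / d * (e * d / (`|C| + 1))) <= _); last first.
  rewrite le_eqVlt; apply/orP; left; apply/eqP; by field; rewrite !gt_eqF.
have Z0 : 0 <= t / `|s| * (t / `|s|) `^ (- 1 - al) by apply: mulr_ge0 => //; exact: ltW.
apply: le_trans (_ : (`|C| + 1) * (t / `|s| * (t / `|s|) `^ (- 1 - al)) <= _).
  by apply: ler_wpM2r => //; have := ler_norm C; lra.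
apply: ler_wpM2l; first exact: ltW.
apply: ler_pM => //; first exact: ltW.
by rewrite ler_pM2l// lef_pV2 ?posrE.
Qed.

Lemma sint_le1 l r : sint l r phi <= 1.
Proof.
have [_ _ I1 _] := tphi.
have mphi : measurable_fun setT phi by exact: continuous_measurable_fun.
rewrite -lee_fin /sint /Rintegral fineK; last first.
  by apply: integrable_fin_num => //; exact: continuous_integrable.
rewrite -I1; apply: ge0_subset_integral => //.
  by apply/measurable_EFinP.
by move=> x _; rewrite lee_fin.
Qed.

Lemma sint_near1 e : 0 < e -> exists2 r : R, 0 < r & 1 - e <= sint (- r) r phi.
Proof.
move=> e0; have [_ _ I1 _] := tphi.
have mphi : measurable_fun setT phi by exact: continuous_measurable_fun.
pose F (n : nat) : set (measurableTypeR R) := `[- n%:R, n%:R]%classic.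
have FT : \bigcup_n F n = setT.
  apply/seteqP; split=> // x _; exists (Num.truncn `|x|).+1 => //=.
  by rewrite /F /= in_itv/= -ler_norml ltW// truncnS_gt.
have ndF : nondecreasing_seq F.
  move=> m n mn; apply/subsetPset => x; rewrite /F /= !in_itv/= -!ler_norml => /le_trans; apply.
  by rewrite ler_nat.
have mF n : measurable (F n) by exact: measurable_itv.
have mE n : measurable_fun (F n) (EFin \o phi).
  by apply/measurable_EFinP; apply: measurable_funTS.
have f0 n y : F n y -> (0 <= (EFin \o phi) y)%E by move=> _; rewrite lee_fin.
have := @ge0_nondecreasing_set_cvg_integral _ _ _ F (EFin \o phi) mu ndF mF mE f0.
rewrite FT (_ : integral mu setT (EFin \o phi) = 1%E)// => /fine_cvgP[_ /cvgrPdist_le/(_ _ e0)[N _ HN]].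
exists N.+1%:R => //; have := HN N.+1 (leqnSn _).
rewrite /= ler_norml => /andP[_]; rewrite /sint /Rintegral; lra.
Qed.

Lemma sint_dilate a b x t : a < b -> 0 < t ->
  sint a b (fun s => t^-1 * phi ((s - x) / t)) = sint ((a - x) / t) ((b - x) / t) phi.
Proof.
move=> ab t0; pose c : R := (a - x) / t - 1.
have ab' : (a - x) / t < (b - x) / t by rewrite ltr_pM2r ?invr_gt0// ltrD2r.
have dG z : (a - x) / t <= z -> is_derive z 1 (fun z => sint c z phi) (phi z).
  by move=> az; apply: is_derive_sint => //; rewrite /c; lra.
have c1 : continuous (fun s => t^-1 * phi ((s - x) / t)).
  apply: smooth_continuous; apply: smoothM; first exact: smooth_cst.
  exact: smooth_affine.
have d1 s : a <= s <= b -> is_derive s 1 (fun s => sint c ((s - x) / t) phi) (t^-1 * phi ((s - x) / t)).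
  move=> /andP[as_ _]; apply: (is_derive_affine (dG _ _)).
  by rewrite ler_pM2r ?invr_gt0// lerD2r.
have d2 z : (a - x) / t <= z <= (b - x) / t -> is_derive z 1 (fun z => sint c z phi) (phi z).
  by move=> /andP[+ _]; exact: dG.
by rewrite /sint /Rintegral (FTC2_on ab c1 d1) (FTC2_on ab' cphi d2).
Qed.

Lemma sint_mono l r l' r' : l' <= l -> r <= r' -> sint l r phi <= sint l' r' phi.
Proof.
move=> ll rr; rewrite -lee_fin /sint /Rintegral !fineK; try by
  apply: integrable_fin_num => //; exact: continuous_integrable.
apply: ge0_subset_integral => //.
- by apply/measurable_EFinP; apply: measurable_funTS; exact: continuous_measurable_fun.
- by move=> x _; rewrite lee_fin.
by move=> x /=; rewrite !in_itv/= => /andP[? ?]; apply/andP; split; lra.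
Qed.

(* Near x the dilated kernel has mass close to 1, and away from x it is o(1). *)
Lemma sint_approx a b g x e : a < x < b -> continuous g -> 0 < e ->
  exists2 d, 0 < d & forall t, 0 < t < d ->
    g x - e <= sint a b (fun s => g s * (t^-1 * phi ((s - x) / t))).
Proof.
move=> /andP[ax xb] cg e0; have ab : a < b by exact: lt_trans xb.
have [G G0 HG] := continuous_segment_bounded a b cg.
(* The error e is shared by the oscillation of g near x, the tail of the kernel (threshold e1 / K)
   and its missing mass (threshold e1 / Q). *)
pose e1 : R := e / 3; have e10 : 0 < e1 by rewrite /e1; lra.
have [d1 /= d10 H1] := (@cvgrPdist_le _ _ _ _ _ g (g x)).1 (cg x) e1 e10.
pose Q : R := `|g x| + e1; have Q0 : 0 < Q by rewrite /Q; have := normr_ge0 (g x); lra.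
have e2 : 0 < e1 / Q by rewrite divr_gt0.
have [r r0 Hr] := sint_near1 e2.
pose K : R := (G + Q) * (b - a) + 1.
have GQ0 : 0 <= G + Q by lra.
have K0 : 0 < K by have := mulr_ge0 GQ0 (ltW (_ : 0 < b - a)); rewrite /K subr_gt0 ab; move=> /(_ isT); lra.
have e3 : 0 < e1 / K by rewrite divr_gt0.
have [t0 t00 Ht0] := T0_tail d10 e3.
exists (Num.min t0 (Num.min ((x - a) / r) ((b - x) / r))).
  by rewrite !lt_min t00 !divr_gt0// subr_gt0.
move=> t /andP[tp]; rewrite !lt_min => /andP[tt0 /andP[txa tbx]].
pose k s := t^-1 * phi ((s - x) / t).
have ck : continuous k.
  apply: smooth_continuous; apply: smoothM; first exact: smooth_cst.
  exact: smooth_affine.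
have k0 s : 0 <= k s by rewrite mulr_ge0// invr_ge0 ltW.
pose L s := (g x - e1) * k s - (G + Q) * (e1 / K).
have cgk : continuous (fun s => (g x - e1) * k s).
  by move=> s; apply: cvgM; [exact: cvg_cst|exact: ck].
have cL : continuous L by move=> s; apply: cvgB; [exact: cgk|exact: cvg_cst].
have cc : continuous (fun _ : R => (G + Q) * (e1 / K)) by exact: cst_continuous.
have LE s : a <= s <= b -> L s <= g s * k s.
  move=> sab; rewrite /L; have [sd|sd] := ltP `|s - x| d1.
    have := H1 s; rewrite /= distrC => /(_ sd); rewrite ler_norml => /andP[_ h].
    have : (g x - e1) * k s <= g s * k s by apply: ler_wpM2r => //; lra.
    by have := mulr_ge0 GQ0 (ltW e3); lra.
  have ks : k s <= e1 / K.
    have := Ht0 t (s - x); rewrite tp tt0 => /(_ isT sd).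
    by rewrite /k [t^-1 * _]mulrC ler_pdivrMr.
  have h1 : g x - e1 - g s <= G + Q.
    have := HG s sab; rewrite ler_norml => /andP[h _]; have := ler_norm (g x); rewrite /Q; lra.
  have : (g x - e1 - g s) * k s <= (G + Q) * k s by exact: ler_wpM2r.
  have : (G + Q) * k s <= (G + Q) * (e1 / K) by apply: ler_wpM2l.
  lra.
have cgs : continuous (fun s => g s * k s) by move=> s; apply: cvgM; [exact: cg|exact: ck].
apply: le_trans (le_sint cL cgs LE).
rewrite sintB// sintZ// sint_cst; last exact: ltW.
rewrite sint_dilate//.
set m := sint _ _ _; have m1 : m <= 1 by exact: sint_le1.
have m2 : 1 - e1 / Q <= m.
  apply: le_trans Hr _; apply: sint_mono.
    by rewrite ler_pdivrMr// mulNr; move: txa; rewrite ltr_pdivlMr// mulrC; lra.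
  by rewrite ler_pdivlMr//; move: tbx; rewrite ltr_pdivlMr// mulrC; lra.
have h3 : (G + Q) * (e1 / K) * (b - a) <= e1.
  have -> : (G + Q) * (e1 / K) * (b - a) = e1 * (((G + Q) * (b - a)) / K) by field; rewrite gt_eqF.
  apply: ler_piMr; first exact: ltW.
  by rewrite ler_pdivrMr// mul1r /K lerDl.
have h4 : (g x - e1) * (1 - m) <= e1.
  apply: le_trans (_ : Q * (e1 / Q) <= _); last by rewrite mulrCA mulfV ?mulr1// gt_eqF.
  apply: le_trans (_ : Q * (1 - m) <= _); last by apply: ler_wpM2l; [exact: ltW|lra].
  by apply: ler_wpM2r; [lra|rewrite /Q; have := ler_norm (g x); lra].
have key (y P : R) : P <= e1 -> y * (1 - m) <= e1 -> y + e1 - (e1 + e1 + e1) <= y * m - P.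
  by move=> ? ?; have -> : y * m = y - y * (1 - m) by [ring]; lra.
have eE : e = e1 + e1 + e1 by rewrite /e1; field.
by rewrite eE; have := key _ _ h3 h4; rewrite subrK.
Qed.

End Kernel.

Lemma density_lower_value a b (w g : R -> R) (iw : mu.-integrable setT (EFin \o w)) phi x :
  a < x < b -> T0 phi -> continuous g ->
  {ae mu, forall s, s \in `[a, b] -> g s <= w s} ->
  ((g x)%:E <= lower_value (density_cdist a b iw) phi x)%E.
Proof.
move=> axb tphi cg gw; have [sphi phi0 _ _] := tphi.
apply/lee_subgt0Pr => e e0; have [d d0 Hd] := sint_approx tphi axb cg e0.
rewrite -EFinB; apply: (ge_lower_value d0) => t td.
apply: le_trans (Hd t td) _; have /andP[t0 _] := td.
have sp : Cinf phi by split.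
pose k s := t^-1 * phi ((s - x) / t).
have sk : Cinf k by apply: smoothM; [exact: smooth_cst|exact: smooth_affine].
have ck := smooth_continuous sk.
have -> : dilated_pairing (density_cdist a b iw) x t phi = dint a b w k.
  rewrite /dilated_pairing (gtr0_norm t0).
  by rewrite -(clinearZ (cdist_of (density_cdist a b iw)).1)//; exact: smooth_affine.
have cgk : continuous (fun s => g s * k s) by move=> s; apply: cvgM; [exact: cg|exact: ck].
have ig : mu.-integrable `[a, b]%classic (EFin \o (fun s => g s * k s)) by exact: continuous_integrable.
have [B _ HB] := continuous_segment_bounded a b ck.
have iwk := dint_integrable iw (continuous_measurable_fun ck) HB.
have mI : measurable (`[a, b]%classic : set (measurableTypeR R)) by exact: measurable_itv.
rewrite -subr_ge0 /sint /dint -(RintegralB mI iwk ig).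
have iwg := integrableB mI iwk ig.
rewrite /Rintegral.
have -> : (\int[mu]_(s in `[a, b]) (w s * k s - g s * k s)%:E =
   \int[mu]_(s in `[a, b]) `|(w s * k s - g s * k s)%:E|)%E.
  apply: ae_eq_integral => //.
  - exact: (measurable_int mu iwg).
  - by apply: measurableT_comp => //; exact: (measurable_int mu iwg).
  apply: (ae_imp3 gw gw gw) => s H _ _ sab.
  by rewrite gee0_abs// lee_fin subr_ge0 ler_wpM2r ?H ?inE// mulr_ge0// invr_ge0 ltW.
by apply: fine_ge0; exact: integral_ge0.
Qed.

End DensityLowerValue.

(** * Linear combinations and negation of pairs *)

Section LinearCombinations.
Context {R : realType}.
Local Notation mu := (@lebesgue_measure R).
Implicit Types (u v z : compact_distribution R) (U V W : schwartz_distribution R).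
Implicit Types (phi : R -> R) (K : set R) (a b c x y e : R) (p q : R -> \bar R).

Lemma le_sup_derive phi K k x : smooth phi -> compact K -> K x ->
  `|derive1n k phi x| <= sup [set `|derive1n k phi x| | x in K].
Proof.
move=> sphi cK Kx.
have ck : continuous (derive1n k phi).
  by apply: is_derive_continuous => y; apply: (smooth_is_derive k y); split.
have cI : compact (derive1n k phi @` K) by apply: continuous_compact => //; exact: continuous_subspaceT.
have [M [Mr HM]] := compact_bounded cI.
apply: ub_le_sup; last by exists x.
exists (`|M| + 1) => _ [y Ky <-]; apply: (HM (`|M| + 1)); last by exists y.
by apply: le_lt_trans (ler_norm _) _; rewrite ltrDl.
Qed.

Lemma sup_derive_ge0 phi K k : smooth phi -> compact K ->
  0 <= sup [set `|derive1n k phi x| | x in K].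
Proof.
move=> sphi cK; have [->|/set0P[y Ky]] := eqVneq K set0; first by rewrite image_set0 sup0.
exact: le_trans (normr_ge0 _) (le_sup_derive k sphi cK Ky).
Qed.

Lemma le_seminorm N phi K k x : smooth phi -> compact K -> (k <= N)%N -> K x ->
  `|derive1n k phi x| <= seminorm N K phi.
Proof.
move=> sphi cK kN Kx; apply: le_trans (le_sup_derive k sphi cK Kx) _.
rewrite /seminorm (bigD1 (Ordinal (kN : (k < N.+1)%N)))//= lerDl.
by apply: sumr_ge0 => i _; exact: sup_derive_ge0.
Qed.

Lemma seminorm_mono N N' phi K : smooth phi -> compact K -> (N <= N')%N ->
  seminorm N K phi <= seminorm N' K phi.
Proof.
move=> sphi cK NN; rewrite /seminorm.
rewrite -(big_mkord xpredT (fun k => sup [set `|derive1n k phi x| | x in K])).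
rewrite -(big_mkord xpredT (fun k => sup [set `|derive1n k phi x| | x in K])).
rewrite (big_cat_nat _ (n := N.+1) (p := N'.+1))//= lerDl.
by apply: sumr_ge0 => i _; exact: sup_derive_ge0.
Qed.

Lemma seminorm_ge0 N phi K : smooth phi -> compact K -> 0 <= seminorm N K phi.
Proof. by move=> sphi cK; apply: sumr_ge0 => i _; exact: sup_derive_ge0. Qed.

Lemma cdist_lin c u v : exists z, forall phi, z phi = c * u phi + v phi.
Proof.
pose w phi := c * u phi + v phi.
have [lw [M [C [N [M0 C0 HC]]]]] : cdist w by apply: cdistD; [apply: cdistZ|]; exact: cdist_of.
have wl (r : R) phi psi : smooth phi -> smooth psi ->
    w (fun x => r * phi x + psi x) = r * w phi + w psi.
  by move=> s1 s2; apply: lw; split.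
have wc : exists K (C : R) (N : nat), compact K /\
    forall phi, smooth phi -> `|w phi| <= C * seminorm N K phi.
  exists `[- M, M]%classic, C, N; split; first exact: segment_compact.
  move=> phi sphi; apply: HC; first by split.
  move=> k x kN xM; apply: le_seminorm => //; first exact: segment_compact.
  by rewrite /= in_itv/= -ler_norml.
by exists (CompactDistribution wl wc).
Qed.

Lemma dist_lin c U V : exists W, forall phi, W phi = c * U phi + V phi.
Proof.
pose w phi := c * U phi + V phi.
have wl (r : R) phi psi : test_function phi -> test_function psi ->
    w (fun x => r * phi x + psi x) = r * w phi + w psi.
  by move=> s1 s2; rewrite /w !dist_linear//; ring.
have wc K : compact K -> exists (C : R) (N : nat),
    forall phi, test_function phi -> supp phi `<=` K -> `|w phi| <= C * seminorm N K phi.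
  move=> cK; have [C1 [N1 H1]] := dist_continuous U cK; have [C2 [N2 H2]] := dist_continuous V cK.
  exists (`|c| * `|C1| + `|C2|), (maxn N1 N2) => phi tphi sK; have sphi := tphi.1.
  rewrite mulrDl; apply: le_trans (ler_normD _ _) _; apply: lerD.
    rewrite normrM -mulrA; apply: ler_wpM2l => //; apply: le_trans (H1 _ tphi sK) _.
    apply: le_trans (_ : `|C1| * seminorm N1 K phi <= _).
      by apply: ler_wpM2r; [exact: seminorm_ge0|exact: ler_norm].
    by apply: ler_wpM2l => //; apply: seminorm_mono => //; exact: leq_maxl.
  apply: le_trans (H2 _ tphi sK) _.
  apply: le_trans (_ : `|C2| * seminorm N2 K phi <= _).
    by apply: ler_wpM2r; [exact: seminorm_ge0|exact: ler_norm].
  by apply: ler_wpM2l => //; apply: seminorm_mono => //; exact: leq_maxr.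
by exists (SchwartzDistribution wl wc).
Qed.

Section Combination.
Variables (c : R) (u v z : compact_distribution R) (U V W : schwartz_distribution R).
Hypothesis zE : forall phi, z phi = c * u phi + v phi.
Hypothesis WE : forall phi, W phi = c * U phi + V phi.

Lemma supported_in_lin a b : supported_in u `[a, b] -> supported_in v `[a, b] -> supported_in z `[a, b].
Proof. by move=> su sv phi tphi sK; rewrite zE su// sv// mulr0 addr0. Qed.

Lemma has_derivative_lin : has_derivative U u -> has_derivative V v -> has_derivative W z.
Proof. by move=> dU dV phi tphi; rewrite zE WE dU// dV//; ring. Qed.

Lemma has_point_value_lin x y y' : has_point_value U x y -> has_point_value V x y' ->
  has_point_value W x (c * y + y').
Proof.
move=> Uy Vy phi tphi.
have -> : (fun e => dilated_pairing W x e phi) =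
    fun e => c * dilated_pairing U x e phi + dilated_pairing V x e phi.
  by apply/funext => e; rewrite /dilated_pairing WE; ring.
rewrite mulrDl -mulrA; apply: cvgD; last exact: Vy.
by apply: cvgM; [exact: cvg_cst|exact: Uy].
Qed.

Lemma Lojasiewicz_lin : Lojasiewicz U -> Lojasiewicz V -> Lojasiewicz W.
Proof.
move=> lU lV x; have [y Uy] := lU x; have [y' Vy] := lV x.
by exists (c * y + y'); exact: has_point_value_lin.
Qed.

Lemma dilated_pairing_lin x t phi :
  dilated_pairing z x t phi = c * dilated_pairing u x t phi + dilated_pairing v x t phi.
Proof. by rewrite /dilated_pairing zE; ring. Qed.

End Combination.

Lemma lower_value_add u v z phi x y y' : (forall psi, z psi = 1 * u psi + v psi) ->
  (y%:E <= lower_value u phi x)%E -> (y'%:E <= lower_value v phi x)%E ->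
  ((y + y')%:E <= lower_value z phi x)%E.
Proof.
move=> zE uy vy; apply/lee_subgt0Pr => e e0; have e2 : 0 < e / 2 by lra.
have [d d0 Hd] := lower_value_ge e2 uy; have [d' d'0 Hd'] := lower_value_ge e2 vy.
rewrite -EFinB; apply: (@ge_lower_value _ _ _ _ _ (Num.min d d')); first by rewrite lt_min d0.
move=> t /andP[t0]; rewrite lt_min => /andP[td td'].
rewrite (dilated_pairing_lin zE) mul1r.
by have := Hd t; have := Hd' t; rewrite t0 td td' => /(_ isT) ? /(_ isT) ?; lra.
Qed.

Lemma lower_value_opp v z phi x : (forall psi, z psi = - v psi) ->
  lower_value z phi x = (- upper_value v phi x)%E.
Proof.
move=> zE; rewrite /upper_value (esup_einf (dilated_pairing v x ^~ phi)) oppeK /lower_value.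
congr limf_einf; apply/funext => t /=; congr EFin.
by rewrite /dilated_pairing zE mulrN.
Qed.

Lemma cdist_opp v : exists z, forall phi, z phi = (- 2) * v phi + v phi.
Proof. exact: cdist_lin. Qed.

Lemma upper_value_opp v z phi x : (forall psi, z psi = - v psi) ->
  upper_value z phi x = (- lower_value v phi x)%E.
Proof.
move=> zE; rewrite (@lower_value_opp z v) ?oppeK// => psi.
by rewrite zE opprK.
Qed.

Lemma minor_opp a b p v V : minor_pair a b p v V -> exists z W,
  major_pair a b (fun x => - p x)%E z W /\ forall phi, z phi = - v phi.
Proof.
move=> [sv lV dV Va [E [Z [cE nZ H1 H2]]]].
(* The negative of v is obtained as - 2 v + v. *)
have [z zE] := cdist_lin (- 2) v v; have [W WE] := dist_lin (- 2) V V.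
have zN phi : z phi = - v phi by rewrite zE; ring.
exists z, W; split=> //; split.
- exact: (supported_in_lin zE sv sv).
- exact: (Lojasiewicz_lin WE lV lV).
- exact: (has_derivative_lin zE WE dV dV).
- by have := has_point_value_lin WE Va Va; rewrite mulr0 addr0.
exists E, Z; split=> // x phi xab nx Tphi; rewrite (lower_value_opp _ _ zN).
  by rewrite leeN2; exact: H1.
by rewrite lteNr /=; exact: H2.
Qed.

Lemma major_opp a b p u U : major_pair a b (fun x => - p x)%E u U -> exists z W,
  minor_pair a b p z W /\ forall phi, z phi = - u phi.
Proof.
move=> [sv lV dV Va [E [Z [cE nZ H1 H2]]]].
have [z zE] := cdist_lin (- 2) u u; have [W WE] := dist_lin (- 2) U U.
have zN phi : z phi = - u phi by rewrite zE; ring.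
exists z, W; split=> //; split.
- exact: (supported_in_lin zE sv sv).
- exact: (Lojasiewicz_lin WE lV lV).
- exact: (has_derivative_lin zE WE dV dV).
- by have := has_point_value_lin WE Va Va; rewrite mulr0 addr0.
exists E, Z; split=> // x phi xab nx Tphi; rewrite (upper_value_opp _ _ zN).
  by rewrite leeNl; exact: H1.
by rewrite lteNl /=; exact: H2.
Qed.

End LinearCombinations.

(** * Adding a Lebesgue integrable function *)

Section IntegrablePerturbation.
Context {R : realType}.
Local Notation mu := (@lebesgue_measure R).
Implicit Types (u v z : compact_distribution R) (U V W : schwartz_distribution R).
Implicit Types (phi k w g : R -> R) (a b c x y e : R) (p q : R -> \bar R).

Let mI a b : measurable (`[a, b]%classic : set (measurableTypeR R)).
Proof. exact: measurable_itv. Qed.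

Lemma approx_continuous a b k e : mu.-integrable `[a, b]%classic (EFin \o k) -> 0 < e ->
  exists g, [/\ continuous g, mu.-integrable `[a, b]%classic (EFin \o g) &
    (\int[mu]_(x in `[a, b]) `|(k x - g x)%:E| <= e%:E)%E].
Proof.
move=> ik e0.
have fI : (mu `[a, b]%classic < +oo)%E.
  by rewrite /= lebesgue_measure_itv/=; case: ifP => // _; rewrite -EFinD ltry.
have [g_ [cg ig]] := approximation_continuous_integrable (mI a b) fI ik.
move=> /fine_cvgP[[m _ fin] /cvgrPdist_le/(_ e e0)[n _ Hn]].
pose N := maxn m n; exists (g_ N); split=> //.
have := Hn N (leq_maxr _ _); rewrite /= sub0r normrN => H.
have fN := fin N (leq_maxl _ _); rewrite -(fineK fN) lee_fin.
exact: le_trans (ler_norm _) H.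
Qed.

(* A majorant of k with integral close to that of k, which dominates continuous
   functions converging to k: it plays the role of a lower semicontinuous majorant. *)
Lemma vitali_majorant a b k e : mu.-integrable `[a, b]%classic (EFin \o k) -> 0 < e ->
  exists w (g_ : nat -> R -> R), [/\ mu.-integrable setT (EFin \o w),
    (\int[mu]_(x in `[a, b]) w x)%R <= (\int[mu]_(x in `[a, b]) k x)%R + e,
    forall n, continuous (g_ n),
    forall n, {ae mu, forall x, x \in `[a, b] -> g_ n x <= w x} &
    {ae mu, forall x, x \in `[a, b] -> forall d, 0 < d -> exists n, k x - d <= g_ n x}].
Proof.
move=> ik e0.
have eps0 (n : nat) : 0 < e / (2 ^ n.+1)%:R by rewrite divr_gt0// ltr0n expn_gt0.
have /choice[g_ Hg] := fun n => approx_continuous ik (eps0 n).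
pose D n x : \bar R := `|(k x - g_ n x)%:E|%E.
have D0 n x : (0 <= D n x)%E by exact: abse_ge0.
have iD n : mu.-integrable `[a, b]%classic (EFin \o (fun x => k x - g_ n x)).
  by have [_ ig _] := Hg n; exact: (integrableB (mI a b) ik ig).
have mD n : measurable_fun `[a, b]%classic (D n).
  by apply: measurableT_comp => //; exact: (measurable_int mu (iD n)).
(* The majorant will be k + T. T dominates each |k - g_n|, its integral is at most the sum e of the
   errors, and where T is finite the terms cannot all stay above a fixed d. *)
pose T x : \bar R := (\sum_(0 <= n <oo) D n x)%E.
have T0 x : (0 <= T x)%E by apply: nneseries_ge0 => n _ _; exact: D0.
have mT : measurable_fun `[a, b]%classic T.
  by apply: ge0_emeasurable_sum => // n x _ _; exact: D0.
have IT : (\int[mu]_(x in `[a, b]) T x <= e%:E)%E.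
  rewrite integral_nneseries//.
  apply: le_trans (epsilon_trick0 xpredT (ltW e0)).
  apply: lee_nneseries => [n _ _|n _]; first by apply: integral_ge0 => x _; exact: D0.
  by have [] := Hg n.
have iT : mu.-integrable `[a, b]%classic T.
  apply/integrableP; split=> //; under eq_integral do rewrite gee0_abs//.
  exact: le_lt_trans IT (ltry _).
have ifT : mu.-integrable `[a, b]%classic (EFin \o (fine \o T)).
  apply: (le_integrable (mI a b) _ _ iT).
    by apply/measurable_EFinP; apply: measurableT_comp mT.
  by move=> x _ /=; have := T0 x; case: (T x) => [r|_|] //=; rewrite leey.
have Tfin : {ae mu, forall x, x \in `[a, b] -> T x \is a fin_num}.
  have H : {ae mu, forall x, `[a, b]%classic x -> T x \is a fin_num}.
    by apply: integrable_ae iT; exact: mI.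
  by apply: (ae_imp3 H H H) => x Hx _ _ xab; apply: Hx; move: xab; rewrite inE.
pose w0 x := k x + fine (T x).
have iw0 : mu.-integrable `[a, b]%classic (EFin \o w0) by exact: (integrableD (mI a b) ik ifT).
(* Cutting w0 to zero outside [a, b] makes w integrable on the whole line, as the density
   construction requires. *)
pose w := w0 \_ `[a, b]%classic.
have wE x : x \in `[a, b] -> w x = w0 x by move=> xab; rewrite /w patchE xab.
exists w, g_; split.
- have -> : EFin \o w = (EFin \o w0) \_ `[a, b]%classic.
    by apply/funext => x; rewrite /w /= !patchE; case: ifP.
  by apply/(integrable_mkcond _ (mI a b)).1.
- rewrite (@eq_Rintegral _ _ _ mu _ w0) => [|x xab]; last exact: wE.
  rewrite /w0 (RintegralD (mI a b) ik ifT) lerD2l /Rintegral.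
  rewrite -lee_fin fineK; last by apply: integrable_fin_num.
  apply: le_trans IT; apply: ge0_le_integral => //.
  + by move=> x _; rewrite lee_fin fine_ge0.
  + exact: (measurable_int mu ifT).
  + by move=> x _ /=; have := T0 x; case: (T x) => [r|_|] //= _; exact: leey.
- by move=> n; have [] := Hg n.
- move=> n; apply: (ae_imp3 Tfin Tfin Tfin) => x fx _ _ xab; rewrite wE// /w0.
  have DT : (D n x <= T x)%E.
    apply: (@le_trans _ _ (\sum_(0 <= j < n.+1) D j x)%E).
      by rewrite big_nat_recr//= leeDr// sume_ge0.
    by apply: nneseries_lim_ge => j _ _; exact: D0.
  move: DT; rewrite -(fineK (fx xab)) lee_fin ler_norml => /andP[? _]; lra.
apply: (ae_imp3 Tfin Tfin Tfin) => x fx _ _ xab d d0; apply: contrapT => nn.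
have Dd n : (d%:E <= D n x)%E.
  rewrite lee_fin leNgt; apply/negP => H; apply: nn; exists n.
  by move: H; rewrite ltr_norml => /andP[_ ?]; lra.
pose n := (Num.truncn (fine (T x) / d)).+1.
have : ((d *+ n)%:E <= T x)%E.
  apply: (@le_trans _ _ (\sum_(0 <= j < n) D j x)%E).
    apply: (@le_trans _ _ (\sum_(0 <= j < n) d%:E)%E).
      by rewrite sumEFin lee_fin big_const_nat subn0 iter_addr_0.
    by apply: lee_sum => j _; exact: Dd.
  by apply: nneseries_lim_ge => j _ _; exact: D0.
rewrite -(fineK (fx xab)) lee_fin -mulr_natl -ler_pdivlMr// leNgt => /negP; apply.
exact: truncnS_gt.
Qed.

(** The density of a majorant w of k is added to u. At interior points its lower values are at least
    every g_n(x), hence at least k(x) almost everywhere; g_0 alone keeps them above -oo at every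
    interior point. *)
Lemma major_add a b p q k u U e : a < b -> major_pair a b p u U ->
  mu.-integrable `[a, b]%classic (EFin \o k) -> 0 < e ->
  {ae mu, forall x, x \in `[a, b] -> q x = (p x + (k x)%:E)%E /\ p x \is a fin_num} ->
  exists z W, major_pair a b q z W /\
    z (fun=> 1) <= u (fun=> 1) + (\int[mu]_(x in `[a, b]) k x)%R + e.
Proof.
move=> ab [su lU dU Ua [E [Z [cE nZ H1 H2]]]] ik e0 qE.
have [w [g_ [iw Iw cg gw gk]]] := vitali_majorant ik e0.
pose v := density_cdist a b iw; pose V := density_dist a b iw.
have [z zE] := cdist_lin 1 u v; have [W WE] := dist_lin 1 U V.
exists z, W; split; last first.
  rewrite zE mul1r -addrA lerD2l; apply: le_trans Iw.
  rewrite le_eqVlt; apply/orP; left; apply/eqP.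
  by apply: eq_Rintegral => x _; rewrite mulr1.
split.
- exact: (supported_in_lin zE su (density_supported iw)).
- exact: (Lojasiewicz_lin WE lU (density_Lojasiewicz a b iw)).
- have dV : has_derivative V v by exact: density_derivative.
  exact: (has_derivative_lin zE WE dU dV).
- by have := has_point_value_lin WE Ua (density_point_left a b iw); rewrite mulr0 addr0.
(* The continuous minorants control lower values only inside ]a, b[; the endpoints join the
   exceptional sets. *)
pose S := [set a] `|` [set b].
have cS : countable S by apply: countableU; exact: countable1.
have inner x : x \in `[a, b] -> ~ S x -> a < x < b.
  rewrite inE/= in_itv/= => /andP[ax xb] /not_orP[/eqP xa /eqP xb'].
  by rewrite !lt_neqAle ax xb eq_sym xa xb'.
have low x phi n : a < x < b -> T0 phi -> ((g_ n x)%:E <= lower_value v phi x)%E.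
  by move=> axb tphi; exact: (density_lower_value iw axb tphi (cg n) (gw n)).
exists (E `|` S), (Z `|` S `|` (~` [set x | x \in `[a, b] -> q x = (p x + (k x)%:E)%E /\ p x \is a fin_num]
   `|` ~` [set x | x \in `[a, b] -> forall d, 0 < d -> exists n, k x - d <= g_ n x])).
split.
- exact: countableU.
- apply: negligibleU; first by apply: negligibleU => //; exact: countable_negligible.
  exact: negligibleU.
- move=> x phi xab /not_orP[/not_orP[nZx nS] /not_orP[/contrapT Hq /contrapT Hk]] tphi.
  have [-> fp] := Hq xab; rewrite -(fineK fp) -EFinD.
  apply: (lower_value_add zE); first by rewrite fineK//; exact: H1.
  apply/lee_subgt0Pr => d d0; have [n Hn] := Hk xab d d0.
  by apply: le_trans (low x phi n (inner _ xab nS) tphi); rewrite -EFinB lee_fin.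
move=> x phi xab /not_orP[nE nS] tphi.
have [B [d [d0 Hd]]] := lower_value_gtNy (H2 x phi xab nE tphi).
have := low x phi 0%N (inner _ xab nS) tphi.1.
move=> /(lower_value_ge ltr01)[d' d'0 Hd'].
apply: lt_le_trans (ltNyr (B + (g_ 0%N x - 1))) _.
apply: (@ge_lower_value _ _ _ _ _ (Num.min d d')); first by rewrite lt_min d0.
move=> t /andP[t0]; rewrite lt_min => /andP[td td'].
rewrite (dilated_pairing_lin zE) mul1r.
by have := Hd t; have := Hd' t; rewrite t0 td td' => /(_ isT) ? /(_ isT) ?; lra.
Qed.

Lemma dist_integrable_add a b p q k : a < b -> dist_integrable a b p ->
  mu.-integrable `[a, b]%classic (EFin \o k) ->
  {ae mu, forall x, x \in `[a, b] -> q x = (p x + (k x)%:E)%E /\ p x \is a fin_num} ->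
  dist_integrable a b q /\
  dist_integral a b q = dist_integral a b p + (\int[mu]_(x in `[a, b]) k x)%R.
Proof.
move=> ab ip ik qE; apply: dist_integrableI => // e e0; have e2 : 0 < e / 2 by lra.
have [[u [U [M Ml]]] [v [V [m ml]]]] := dist_integrableP ab ip e2; split.
  have [z [W [Mz zl]]] := major_add ab M ik e2 qE.
  by exists z, W; split=> //; lra.
(* The minor half is the major half for - p and - k. *)
have [z [W [Mz zN]]] := minor_opp m.
have ikN : mu.-integrable `[a, b]%classic (EFin \o (fun x => - k x)).
  have -> : EFin \o (fun x => - k x) = -%E \o (EFin \o k) by apply/funext => x.
  exact: integrableN.
have qEN : {ae mu, forall x, x \in `[a, b] ->
    (- q x)%E = (- p x + (- k x)%:E)%E /\ (- p x)%E \is a fin_num}.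
  apply: (ae_imp3 qE qE qE) => x H _ _ xab; have [-> fp] := H xab.
  by rewrite fin_numN fin_num_oppeD.
have [z' [W' [Mz' zl']]] := major_add ab Mz ikN e2 qEN.
have [z'' [W'' [m'' zN'']]] := major_opp Mz'.
exists z'', W''; split=> //; rewrite zN''; move: zl'; rewrite zN.
have -> : (\int[mu]_(x in `[a, b]) (- k x))%R = - (\int[mu]_(x in `[a, b]) k x)%R.
  have -> : (fun x => - k x) = fun x => -1 * k x by apply/funext => x; rewrite mulN1r.
  by rewrite RintegralZl// mulN1r.
lra.
Qed.

End IntegrablePerturbation.

(** * Dominated convergence *)

Unset Implicit Arguments.
Theorem theorem9p3 (R : realType) (a b : R) (hab : a < b)
  (f h g : R -> \bar R) (g_ : nat -> R -> \bar R)
  (hf : dist_integrable a b f) (hh : dist_integrable a b h)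
  (hg_ : forall n : nat, dist_integrable a b (g_ n))
  (hbound : forall n : nat, {ae (@lebesgue_measure R), forall x : R,
     x \in `[a, b] -> (h x <= g_ n x <= f x)%E})
  (hlim : {ae (@lebesgue_measure R), forall x : R,
     x \in `[a, b] -> g_ n x @[n --> \oo] --> g x}) :
  dist_integrable a b g /\
  dist_integral a b (g_ n) @[n --> \oo] --> dist_integral a b g.
Proof.
pose mu := @lebesgue_measure R.
have hbl n : {ae mu, forall x, x \in `[a, b] -> (h x <= g_ n x)%E}.
  by apply: (ae_imp3 (hbound n) (hbound n) (hbound n)) => x H _ _ xab; have /andP[] := H xab.
have hfl : {ae mu, forall x, x \in `[a, b] -> (h x <= f x)%E}.
  apply: (ae_imp3 (hbound 0%N) (hbound 0%N) (hbound 0%N)) => x H _ _ xab.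
  by have /andP[h1 h2] := H xab; exact: le_trans h2.
(* D = f - h almost everywhere on [a, b] is the dominating function for the differences k n = g_n -
   h. *)
have [D iD HD] := dist_integrable_diff hab hh hf hfl.
have /choice[k Hk] : forall n, exists k : R -> R, mu.-integrable `[a, b]%classic (EFin \o k) /\
    {ae mu, forall x, x \in `[a, b] -> [/\ g_ n x = (h x + (k x)%:E)%E, h x \is a fin_num & 0 <= k x]}.
  by move=> n; have [k ik Hk] := dist_integrable_diff hab hh (hg_ n) (hbl n); exists k.
(* An upper limit is defined and measurable everywhere; on the good points it is the true limit g -
   h. *)
pose K x := fine (limn_esup (fun n => (k n x)%:E)).
have hk : {ae mu, forall x, forall n, x \in `[a, b] ->
    [/\ g_ n x = (h x + (k n x)%:E)%E, h x \is a fin_num & 0 <= k n x]}.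
  by apply/ae_foralln => n; have [] := Hk n.
have hb : {ae mu, forall x, forall n, x \in `[a, b] -> (h x <= g_ n x <= f x)%E}.
  by apply/ae_foralln => n; exact: hbound.
have good : {ae mu, forall x, x \in `[a, b] -> [/\ forall n, 0 <= k n x <= D x,
    (k n x)%:E @[n --> \oo] --> (K x)%:E, g x = (h x + (K x)%:E)%E & h x \is a fin_num]}.
  apply: (ae_imp3 (ae_and hk hb) hlim HD) => x [H1 H2] H3 H4 xab.
  have [fE fh _] := H4 xab; pose r := fine (h x); have rE : h x = r%:E by rewrite /r fineK.
  have gE n : g_ n x = (r + k n x)%:E by have [-> _ _] := H1 n xab; rewrite rE -EFinD.
  have kD n : 0 <= k n x <= D x.
    have [_ _ ->] := H1 n xab; have /andP[_] := H2 n xab.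
    by rewrite gE fE rE -EFinD lee_fin lerD2l.
  have cv : (r + k n x)%:E @[n --> \oo] --> g x.
    have -> : (fun n => (r + k n x)%:E) = (fun n => g_ n x) by apply/funext => n; rewrite gE.
    exact: H3.
  have gl : (r%:E <= g x)%E.
    rewrite -(cvg_lim _ cv)//; apply: lime_ge; first by apply/cvg_ex; exists (g x).
    by near=> n; rewrite lee_fin lerDl; have /andP[] := kD n.
  have gu : (g x <= (r + D x)%:E)%E.
    rewrite -(cvg_lim _ cv)//; apply: lime_le; first by apply/cvg_ex; exists (g x).
    by near=> n; rewrite lee_fin lerD2l; have /andP[] := kD n.
  (* The limit is caught between the finite values of h and f, so subtracting h from it is
     legitimate. *)
  have gf : g x \is a fin_num.
    by rewrite fin_numElt (lt_le_trans (ltNyr r) gl) (le_lt_trans gu (ltry _)).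
  have ck : (k n x)%:E @[n --> \oo] --> (fine (g x) - r)%:E.
    apply: cvg_EFin; first by near=> n.
    have -> : fine \o (fun n => (k n x)%:E) = (fun n => (r + k n x) - r).
      by apply/funext => n /=; rewrite addrC addKr.
    apply: cvgB; last exact: cvg_cst.
    by move: cv; rewrite -(fineK gf) => /fine_cvg.
  have KE : K x = fine (g x) - r by rewrite /K (cvg_limn_einf_sup ck).2.
  by split=> //; rewrite KE // rE -EFinD addrC subrK fineK.
have mI : measurable (`[a, b]%classic : set (measurableTypeR R)) by exact: measurable_itv.
have mk n : measurable_fun `[a, b]%classic (EFin \o k n).
  by have [ik _] := Hk n; exact: (measurable_int mu ik).
have mK : measurable_fun `[a, b]%classic (EFin \o K).
  apply/measurable_EFinP; apply: measurableT_comp => //.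
  exact: measurable_fun_limn_esup.
have cvK : {ae mu, forall x, `[a, b]%classic x -> (EFin \o k n) x @[n --> \oo] --> (EFin \o K) x}.
  by apply: (ae_imp3 good good good) => x H _ _ xab; have [] := H (mem_set xab).
have bdK : {ae mu, forall x n, `[a, b]%classic x -> (`|(EFin \o k n) x| <= (EFin \o D) x)%E}.
  apply: (ae_imp3 good good good) => x H _ _ n xab; have [/(_ n)/andP[k0 kD] _ _ _] := H (mem_set xab).
  by rewrite /= lee_fin ger0_norm.
have [iK _ cI] := dominated_convergence mI mk mK cvK iD bdK.
have [ig Ig] : dist_integrable a b g /\
    dist_integral a b g = dist_integral a b h + (\int[mu]_(x in `[a, b]) K x)%R.
  apply: (dist_integrable_add hab hh iK).
  by apply: (ae_imp3 good good good) => x H _ _ xab; have [] := H xab.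
split=> //; rewrite Ig.
have -> : (fun n => dist_integral a b (g_ n)) =
    fun n => dist_integral a b h + (\int[mu]_(x in `[a, b]) k n x)%R.
  apply/funext => n; have [ik _] := Hk n; apply: (dist_integrable_add hab hh ik _).2.
  by apply: (ae_imp3 hk hk hk) => x H _ _ xab; have [] := H n xab.
apply: cvgD; first exact: cvg_cst.
have fK : (\int[mu]_(x in `[a, b]) (K x)%:E)%E \is a fin_num by exact: integrable_fin_num.
by move: cI; rewrite -(fineK fK) => /fine_cvg.
Unshelve. all: end_near. Qed.
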